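(* The group $\Delta=[3,5,3]^+$ has only the following normal subgroups $K$ with $\Delta/K\cong L_2(q)$, where $q$ is a power of a prime $p$ (so that for each prime $p$ the list below gives all such $K$, as $q$ ranges over all powers of $p$): (a) if $p=2$ there is one normal subgroup $K$ with $\Delta/K\cong L_2(2^4)$; (b) if $p=5$ there is one normal subgroup $K$ with $\Delta/K\cong L_2(5^2)$; (c) if $p=11$ there is one normal subgroup $K=K_0$ with $\Delta/K\cong L_2(11)$ and one normal subgroup $K$ with $\Delta/K\cong L_2(11^2)$; (d) if $p\equiv\pm1 \pmod 5$ with $p\equiv 1,3,4,5$ or $9\pmod{11}$, there are four normal subgroups $K$ with $\Delta/K\cong L_2(p)$ if $3+2\sqrt5$ and $3-2\sqrt5$ are both squares in $F_p$, or two normal subgroups $K$ with $\Delta/K\cong L_2(p^2)$ if $3+2\sqrt5$ and $3-2\sqrt5$ are both non-squares in $F_p$ (one of these two alternatives always holds); (e) if $p\equiv\pm1\pmod 5$ with $p\equiv 2,6,7,8$ or $10\pmod{11}$ there are two normal subgroups $K$ with $\Delta/K\cong L_2(p)$ and one with $\Delta/K\cong L_2(p^2)$; (f) if $2\neq p\equiv\pm2\pmod 5$ and $3+2\sqrt5$, $3-2\sqrt5$ are both squares in $F_{p^2}$ there are two normal subgroups $K$ with $\Delta/K\cong L_2(p^2)$; (g) if $2\neq p\equiv\pm2\pmod 5$ and $3+2\sqrt5$, $3-2\sqrt5$ are both non-squares in $F_{p^2}$ there is one normal subgroup $K$ with $\Delta/K\cong L_2(p^4)$.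
   Context: $F_q$ denotes the finite field of order $q$, and $L_2(q)=SL_2(q)/\{\pm I\}$, where $q=p^n\geq 4$ is a prime power. When $p\equiv\pm1\pmod 5$, $5$ is a square in $F_p$, and when $p\equiv\pm2\pmod5$, $p\ne2$, it is a square in $F_{p^2}$; $\sqrt5$ denotes a square root of $5$ in the field in question, so $3\pm2\sqrt5$ is well-defined as a pair of elements. $\Gamma=[3,5,3]$ is the Coxeter group $$\langle a,b,c,d\mid a^2=b^2=c^2=d^2=(ab)^3=(bc)^5=(cd)^3=(ac)^2=(ad)^2=(bd)^2=1\rangle,$$ realised as the discrete group of isometries of hyperbolic $3$-space $\mathcal H^3$ generated by the reflections $a,b,c,d$ in the faces opposite the vertices $A,B,C,D$ of a tetrahedron $ABCD$ with dihedral angles $\pi/2$ along $AC$, $BC$, $BD$, angles $\pi/3$ along $AB$, $CD$, and angle $\pi/5$ along $AD$. $\Delta=\Gamma^+=[3,5,3]^+$ is its even (orientation-preserving) subgroup of index $2$, with presentation $$\langle\alpha,\beta,\gamma\mid\alpha^3=\beta^5=\gamma^3=(\alpha\beta)^2=(\beta\gamma)^2=(\alpha\beta\gamma)^2=1\rangle,\quad \alpha=ab,\ \beta=bc,\ \gamma=cd.$$ $\Omega$ is the normaliser of $\Gamma$ in $\mathrm{Iso}\,\mathcal H^3$; it is the semidirect product $\Gamma\rtimes\langle r\rangle$ with $r^2=1$, where conjugation by $r$ transposes $a$ and $d$ and transposes $b$ and $c$. $K_0$ denotes the unique torsion-free normal subgroup of least index in $\Omega$; it has $\Omega/K_0\cong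 PGL_2(11)\times C_2$. *)

(* Defs.v *)
From HB Require Import structures.
From mathcomp Require Import all_boot all_order all_fingroup all_algebra.
From mathcomp Require Import boolp classical_sets functions cardinality.
From mathcomp Require Import generic_quotient.
Set Implicit Arguments.
Unset Strict Implicit.
Unset Printing Implicit Defensive.

Local Open Scope group_scope.
Local Open Scope quotient_scope.

Import GRing.Theory.

Definition group_iso (G H : groupType) : Prop :=
  exists f : {multiplicative G -> H}, bijective f.

Record normal_subgroup (G : groupType) := NormalSubgroup {
  nsub_set :> G -> Prop;
  nsub1 : nsub_set 1;
  nsubM : forall x y, nsub_set x -> nsub_set y -> nsub_set (x * y);
  nsubV : forall x, nsub_set x -> nsub_set x^-1;
  nsubJ : forall x y, nsub_set x -> nsub_set (x ^ y) }.

Lemma nsub_inj (G : groupType) (K L : normal_subgroup G) :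
  nsub_set K = nsub_set L -> K = L.
Proof.
case: K L => [K K1 KM KV KJ] [L L1 LM LV LJ] /= eKL; subst L.
by congr NormalSubgroup; apply: Prop_irrelevance.
Qed.

Section Quotient.
Variables (G : groupType) (K : normal_subgroup G).
Implicit Types x y : G.

Definition coset_rel : rel G := fun x y => `[< K (x^-1 * y) >].

Lemma coset_rel_refl : reflexive coset_rel.
Proof. by move=> x; apply/asboolP; rewrite mulVg; exact: nsub1. Qed.

Lemma coset_rel_sym : symmetric coset_rel.
Proof.
have h x y : coset_rel x y -> coset_rel y x.
  by move=> /asboolP /nsubV; rewrite invgM invgK => ?; apply/asboolP.
by move=> x y; apply/idP/idP; apply: h.
Qed.

Lemma coset_rel_trans : transitive coset_rel.
Proof.
move=> y x z /asboolP Kxy /asboolP Kyz; apply/asboolP.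
by have := nsubM Kxy Kyz; rewrite -mulgA mulKVg.
Qed.

Canonical coset_equiv :=
  EquivRel coset_rel coset_rel_refl coset_rel_sym coset_rel_trans.

Definition quot_group := {eq_quot coset_equiv}.
HB.instance Definition _ := EqQuotient.on quot_group.
HB.instance Definition _ := Choice.on quot_group.

Definition to_quot : G -> quot_group := \pi_quot_group.

Lemma to_quot_eq x y : (to_quot x = to_quot y) <-> K (x^-1 * y).
Proof.
split; first by move=> /eqmodP /asboolP.
by move=> Kxy; apply/eqmodP/asboolP.
Qed.

Lemma to_quot_surj (u : quot_group) : exists x, to_quot x = u.
Proof. by exists (repr u); rewrite /to_quot reprK. Qed.

Definition quot_one : quot_group := to_quot 1.
Definition quot_mul (u v : quot_group) : quot_group :=
  to_quot (repr u * repr v).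
Definition quot_inv (u : quot_group) : quot_group := to_quot (repr u)^-1.

Lemma repr_to_quot x : K ((repr (to_quot x))^-1 * x).
Proof. by apply/to_quot_eq; rewrite /to_quot reprK. Qed.

Lemma quot_mulE x y : quot_mul (to_quot x) (to_quot y) = to_quot (x * y).
Proof.
apply/to_quot_eq.
have Kx := repr_to_quot x; have Ky := repr_to_quot y.
set a := repr _ in Kx *; set b := repr _ in Ky *.
have -> : (a * b)^-1 * (x * y) = ((a^-1 * x) ^ b) * (b^-1 * y).
  by rewrite conjgE invgM !mulgA mulgK.
exact: nsubM (nsubJ _ Kx) Ky.
Qed.

Lemma quot_invE x : quot_inv (to_quot x) = to_quot x^-1.
Proof.
apply/to_quot_eq; rewrite invgK; have Kx := repr_to_quot x.
set a := repr _ in Kx *.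
have -> : a * x^-1 = ((a^-1 * x)^-1) ^ (a^-1).
  by rewrite conjgE invgM !invgK !mulgA mulgK.
exact/nsubJ/nsubV.
Qed.

Lemma quot_mulA : associative quot_mul.
Proof.
move=> u v w.
case: (to_quot_surj u) (to_quot_surj v) (to_quot_surj w) => x <- [y <-] [z <-].
by rewrite !quot_mulE mulgA.
Qed.
Lemma quot_mul1g : left_id quot_one quot_mul.
Proof. by move=> u; case: (to_quot_surj u) => x <-; rewrite quot_mulE mul1g. Qed.
Lemma quot_mulg1 : right_id quot_one quot_mul.
Proof. by move=> u; case: (to_quot_surj u) => x <-; rewrite quot_mulE mulg1. Qed.
Lemma quot_mulVg : left_inverse quot_one quot_inv quot_mul.
Proof.
by move=> u; case: (to_quot_surj u) => x <-; rewrite quot_invE quot_mulE mulVg.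
Qed.
Lemma quot_mulgV : right_inverse quot_one quot_inv quot_mul.
Proof.
by move=> u; case: (to_quot_surj u) => x <-; rewrite quot_invE quot_mulE mulgV.
Qed.

HB.instance Definition _ := isGroup.Build quot_group
  quot_mulA quot_mul1g quot_mulg1 quot_mulVg quot_mulgV.

Lemma to_quotM : {morph to_quot : x y / x * y}.
Proof. by move=> x y; rewrite -quot_mulE. Qed.
HB.instance Definition _ := isUMagmaMorphism.Build G quot_group to_quot
  (erefl, to_quotM).

Lemma to_quot_eq1 x : to_quot x = 1 <-> K x.
Proof.
have -> : (1 : quot_group) = to_quot 1 by [].
split; first by move/esym/to_quot_eq; rewrite invg1 mul1g.
by move=> Kx; apply/esym/to_quot_eq; rewrite invg1 mul1g.
Qed.

Variables (H : groupType) (f : G -> H).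
Hypotheses (fM : {morph f : x y / x * y}) (fK : forall x, K x -> f x = 1).

Definition quot_lift (u : quot_group) : H := f (repr u).

Lemma quot_liftE x : quot_lift (to_quot x) = f x.
Proof.
rewrite /quot_lift -[in RHS](mulKVg (repr (to_quot x)) x) fM.
by rewrite (fK (repr_to_quot x)) mulg1.
Qed.

Lemma quot_liftM : {morph quot_lift : u v / u * v}.
Proof.
move=> u v; case: (to_quot_surj u) (to_quot_surj v) => x <- [y <-].
by rewrite -to_quotM !quot_liftE fM.
Qed.

End Quotient.

Section NormalClosure.
Variables (G : groupType) (R : set G).

Definition normal_closure_set : set G :=
  [set x | forall K : normal_subgroup G, (forall r, R r -> K r) -> K x].

Lemma nclosure1 : normal_closure_set 1.
Proof. by move=> K _; exact: nsub1. Qed.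
Lemma nclosureM x y : normal_closure_set x -> normal_closure_set y ->
  normal_closure_set (x * y).
Proof. by move=> hx hy K RK; apply: nsubM; [apply: hx | apply: hy]. Qed.
Lemma nclosureV x : normal_closure_set x -> normal_closure_set x^-1.
Proof. by move=> hx K RK; apply/nsubV/hx. Qed.
Lemma nclosureJ x y : normal_closure_set x -> normal_closure_set (x ^ y).
Proof. by move=> hx K RK; apply/nsubJ/hx. Qed.

Definition normal_closure : normal_subgroup G :=
  NormalSubgroup nclosure1 nclosureM nclosureV nclosureJ.

End NormalClosure.

Lemma mem_normal_closure (G : groupType) (R : set G) r :
  R r -> normal_closure R r.
Proof. by move=> Rr K; apply. Qed.

Section FreeGroup.
Variable I : choiceType.

(* The letter (false, i) stands for the generator i and (true, i) for its
   inverse; two words are identified when they have the same reduced form. *)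
Definition letter : Type := (bool * I)%type.
HB.instance Definition _ := Choice.on letter.
Definition word : Type := seq letter.
HB.instance Definition _ := Choice.on word.
Implicit Types (l : letter) (u v w : word).

Definition letter_inv l : letter := (~~ l.1, l.2).

Definition push l w : word :=
  if w is l' :: w' then if l' == letter_inv l then w' else l :: w else [:: l].
Definition reduce w : word := foldr push [::] w.
Definition reduced w : bool := sorted (fun l l' => l' != letter_inv l) w.

Lemma letter_invK : involutive letter_inv.
Proof. by case=> b i; rewrite /letter_inv /= negbK. Qed.

Lemma push_reduced l w : reduced w -> reduced (push l w).
Proof.
case: w => [//|l' w] /=; case: eqP => [_|/eqP nl]; first exact: path_sorted.
by move=> pw; rewrite /reduced /= nl.
Qed.

Lemma reduce_reduced w : reduced (reduce w).
Proof. by elim: w => // l w; exact: push_reduced. Qed.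

Lemma pushK l w : reduced w -> push (letter_inv l) (push l w) = w.
Proof.
case: w => [|l' w] /=; first by rewrite letter_invK eqxx.
case: (eqVneq l' (letter_inv l)) => [->|nl] /=; last by rewrite letter_invK eqxx.
by case: w => [//|l'' w] /= /andP[/negbTE-> _].
Qed.

Lemma foldr_push_reduced u w : reduced w -> reduced (foldr push w u).
Proof. by move=> rw; elim: u => // l u; exact: push_reduced. Qed.

Lemma foldr_push u w : reduced w -> foldr push w (reduce u) = foldr push w u.
Proof.
move=> rw; elim: u => //= l u <-.
case: (reduce u) => [//|l' u'] /=; case: eqP => [->|//].
set x := foldr push w u'; have rx : reduced x by exact: foldr_push_reduced.
by rewrite -[LHS](pushK (letter_inv l) rx) letter_invK.
Qed.

Lemma reduce_cat u v : reduce (u ++ v) = foldr push (reduce v) (reduce u).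
Proof.
by rewrite foldr_push ?reduce_reduced // /reduce foldr_cat.
Qed.

Definition word_inv w : word := rev (map letter_inv w).

Lemma reduce_invl w : reduce (word_inv w ++ w) = [::].
Proof.
elim: w => // l w IH; rewrite /word_inv map_cons rev_cons cat_rcons /reduce.
rewrite foldr_cat -[X in foldr _ X _]/(push (letter_inv l) (push l (reduce w))).
by rewrite pushK ?reduce_reduced // -foldr_cat; exact: IH.
Qed.

Lemma word_invK : involutive word_inv.
Proof.
by move=> w; rewrite /word_inv map_rev revK -map_comp map_id_in // => l _;
  exact: letter_invK.
Qed.

Lemma reduce_invr w : reduce (w ++ word_inv w) = [::].
Proof. by have := reduce_invl (word_inv w); rewrite word_invK. Qed.

Definition word_rel : rel word := fun u v => reduce u == reduce v.
Lemma word_rel_refl : reflexive word_rel. Proof. by move=> u; exact: eqxx. Qed.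
Lemma word_rel_sym : symmetric word_rel.
Proof. by move=> u v; exact: eq_sym. Qed.
Lemma word_rel_trans : transitive word_rel.
Proof. by move=> v u w /eqP uv; rewrite /word_rel uv. Qed.
Canonical word_equiv :=
  EquivRel word_rel word_rel_refl word_rel_sym word_rel_trans.

Definition free_group := {eq_quot word_equiv}.
HB.instance Definition _ := EqQuotient.on free_group.
HB.instance Definition _ := Choice.on free_group.

Definition to_free (w : word) : free_group := \pi_free_group w.

Lemma to_free_eq u v : (to_free u = to_free v) <-> (reduce u = reduce v).
Proof.
by split=> [/eqmodP /eqP|uv]; last by apply/eqmodP/eqP.
Qed.

Lemma to_free_surj (x : free_group) : exists w, to_free w = x.
Proof. by exists (repr x); rewrite /to_free reprK. Qed.

Lemma reduce_repr w : reduce (repr (to_free w)) = reduce w.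
Proof. by apply/to_free_eq; rewrite /to_free reprK. Qed.

Definition free_one : free_group := to_free [::].
Definition free_mul (x y : free_group) : free_group :=
  to_free (repr x ++ repr y).
Definition free_inv (x : free_group) : free_group :=
  to_free (word_inv (repr x)).

Lemma free_mulE u v : free_mul (to_free u) (to_free v) = to_free (u ++ v).
Proof. by apply/to_free_eq; rewrite !reduce_cat !reduce_repr. Qed.

Lemma free_mulA : associative free_mul.
Proof.
move=> x y z.
case: (to_free_surj x) (to_free_surj y) (to_free_surj z) => u <- [v <-] [w <-].
by rewrite !free_mulE catA.
Qed.
Lemma free_mul1g : left_id free_one free_mul.
Proof. by move=> x; case: (to_free_surj x) => u <-; rewrite free_mulE. Qed.
Lemma free_mulg1 : right_id free_one free_mul.
Proof. by move=> x; case: (to_free_surj x) => u <-; rewrite free_mulE cats0. Qed.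
Lemma free_mulVg : left_inverse free_one free_inv free_mul.
Proof.
move=> x; rewrite /free_inv -[x in X in free_mul _ X]reprK free_mulE.
by apply/to_free_eq; exact: reduce_invl.
Qed.
Lemma free_mulgV : right_inverse free_one free_inv free_mul.
Proof.
move=> x; rewrite /free_inv -[x in X in free_mul X _]reprK free_mulE.
by apply/to_free_eq; exact: reduce_invr.
Qed.

HB.instance Definition _ := isGroup.Build free_group
  free_mulA free_mul1g free_mulg1 free_mulVg free_mulgV.

Lemma to_freeM u v : to_free (u ++ v) = to_free u * to_free v.
Proof. by rewrite -free_mulE. Qed.

Definition free_gen (i : I) : free_group := to_free [:: (false, i)].

Lemma free_gen_inv i : (free_gen i)^-1 = to_free [:: (true, i)].
Proof.
apply: (mulIg (free_gen i)); rewrite mulVg -to_freeM.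
by apply/to_free_eq; rewrite /= eqxx.
Qed.

Variables (H : groupType) (h : I -> H).

Definition letter_eval l : H := if l.1 then (h l.2)^-1 else h l.2.
Definition word_eval w : H := \prod_(l <- w) letter_eval l.

Lemma letter_eval_inv l : letter_eval (letter_inv l) = (letter_eval l)^-1.
Proof. by case: l => [] [] i; rewrite /letter_eval /= ?invgK. Qed.

Lemma word_eval_reduce w : word_eval (reduce w) = word_eval w.
Proof.
elim: w => // l w IH; rewrite /= [RHS]/word_eval big_cons -/(word_eval w) -IH.
case: (reduce w) => [|l' u] /=; first by rewrite /word_eval big_seq1 big_nil mulg1.
case: eqP => [->|_]; last by rewrite /word_eval !big_cons.
by rewrite /word_eval big_cons letter_eval_inv mulKVg.
Qed.

Definition free_lift (x : free_group) : H := word_eval (repr x).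

Lemma free_liftE w : free_lift (to_free w) = word_eval w.
Proof. by rewrite /free_lift -word_eval_reduce reduce_repr word_eval_reduce. Qed.

Lemma free_liftM : {morph free_lift : x y / x * y}.
Proof.
move=> x y; case: (to_free_surj x) (to_free_surj y) => u <- [v <-].
by rewrite -to_freeM !free_liftE /word_eval big_cat.
Qed.
HB.instance Definition _ := isMultiplicative.Build free_group H free_lift
  free_liftM.

Lemma free_lift_gen i : free_lift (free_gen i) = h i.
Proof. by rewrite free_liftE /word_eval big_seq1. Qed.

Lemma free_lift_uniq (f : free_group -> H) :
  {morph f : x y / x * y} -> (forall i, f (free_gen i) = h i) -> f =1 free_lift.
Proof.
move=> fM fg; have f1 : f 1 = 1 by apply: (mulgI (f 1)); rewrite -fM !mulg1.
have fV x : f x^-1 = (f x)^-1.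
  by apply: (mulgI (f x)); rewrite -fM !mulgV f1.
move=> x; case: (to_free_surj x) => w <-; rewrite free_liftE.
elim: w => [|l w IH]; first by rewrite /word_eval big_nil -f1.
rewrite -cat1s to_freeM fM IH /word_eval big_cat big_seq1; congr (_ * _).
by case: l => [] [] i; rewrite /letter_eval /= -?fg // -fV free_gen_inv.
Qed.

End FreeGroup.

Definition presented_group (I : choiceType) (R : seq (free_group I)) :=
  quot_group (normal_closure [set x | x \in R]).
HB.instance Definition _ I (R : seq (free_group I)) :=
  Group.on (presented_group R).

Definition relators_353 (G : groupType) (a b c d : G) : seq G :=
  [:: a ^+ 2; b ^+ 2; c ^+ 2; d ^+ 2; (a * b) ^+ 3; (b * c) ^+ 5;
      (c * d) ^+ 3; (a * c) ^+ 2; (a * d) ^+ 2; (b * d) ^+ 2].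

Definition free_gen4 (k : nat) : free_group 'I_4 := free_gen (inord k).

Definition Gamma : Type := presented_group
  (relators_353 (free_gen4 0) (free_gen4 1) (free_gen4 2) (free_gen4 3)).
HB.instance Definition _ := Group.on Gamma.

Definition Gamma_proj : free_group 'I_4 -> Gamma := @to_quot _ _.
HB.instance Definition _ := UMagmaMorphism.on Gamma_proj.

(* The generators a, b, c, d are numbered 0, 1, 2, 3. *)
Definition Gamma_gen (i : 'I_4) : Gamma := Gamma_proj (free_gen i).

Lemma Gamma_relations (x : Gamma) :
  x \in relators_353 (Gamma_gen (inord 0)) (Gamma_gen (inord 1))
                     (Gamma_gen (inord 2)) (Gamma_gen (inord 3)) -> x = 1.
Proof.
set a := free_gen4 0; set b := free_gen4 1.
set c := free_gen4 2; set d := free_gen4 3.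
have -> : relators_353 (Gamma_gen (inord 0)) (Gamma_gen (inord 1))
    (Gamma_gen (inord 2)) (Gamma_gen (inord 3)) =
    map Gamma_proj (relators_353 a b c d).
  by rewrite /= !gmulfXn !gmulfM.
case/mapP => w wR ->; apply/to_quot_eq1; exact: mem_normal_closure.
Qed.

Lemma Gamma_ind (P : Gamma -> Prop) :
  P 1 -> (forall i x, P x -> P (Gamma_gen i * x)) ->
  (forall i x, P x -> P ((Gamma_gen i)^-1 * x)) -> forall x, P x.
Proof.
move=> P1 Pg PV x; case: (to_quot_surj x) => y <-.
case: (to_free_surj y) => w <-; elim: w => [|[b i] w IH]; first exact: P1.
have -> : to_free ((b, i) :: w) = to_free [:: (b, i)] * to_free w.
  by rewrite -to_freeM.
rewrite to_quotM; case: b; last exact: Pg.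
by rewrite -free_gen_inv gmulfV; exact: PV.
Qed.

Lemma Gamma_gen2 i : Gamma_gen i * Gamma_gen i = 1.
Proof.
rewrite -[i]inord_val; case: i => [[|[|[|[|k]]]] lik] //=;
  by apply: (Gamma_relations (x := _ ^+ 2)); rewrite !inE eqxx ?orbT.
Qed.

Lemma Gamma_genV i : (Gamma_gen i)^-1 = Gamma_gen i.
Proof. by apply: (mulIg (Gamma_gen i)); rewrite mulVg Gamma_gen2. Qed.

(* [rev_ord] exchanges 0 with 3 and 1 with 2, that is, a with d and b with c. *)
Definition swap_free : free_group 'I_4 -> Gamma :=
  free_lift (fun i => Gamma_gen (rev_ord i)).
HB.instance Definition _ := isMultiplicative.Build _ _ swap_free
  (@free_liftM _ _ _).

Lemma swap_free_closure x :
  normal_closure [set x | x \in relators_353 (free_gen4 0) (free_gen4 1)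
                                  (free_gen4 2) (free_gen4 3)] x ->
  swap_free x = 1.
Proof.
have s1 : swap_free 1 = 1 by rewrite /swap_free free_liftE /word_eval big_nil.
have sM : {morph swap_free : x y / x * y} by exact: gmulfM.
have sV u : swap_free u^-1 = (swap_free u)^-1.
  by apply: (mulgI (swap_free u)); rewrite -sM !mulgV s1.
have sX n : {morph swap_free : u / u ^+ n}.
  by elim: n => [|n IH] u; rewrite ?expg0 // !expgS sM IH.
pose K := @NormalSubgroup (free_group 'I_4) (fun u => swap_free u = 1) s1
  (fun u v hu hv => etrans (sM u v) (etrans (congr2 _ hu hv) (mul1g 1)))
  (fun u hu => etrans (sV u) (etrans (congr1 _ hu) (invg1 _)))
  (fun u v hu => etrans (etrans (sM _ _) (congr2 _ (sV v)
     (etrans (sM _ _) (etrans (congr2 _ hu erefl) (mul1g _)))))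
     (mulVg _)).
move=> xR; apply: (xR K) => {x xR} r rR; rewrite /K /=.
have : swap_free r \in map swap_free (relators_353 (free_gen4 0) (free_gen4 1)
                                  (free_gen4 2) (free_gen4 3)).
  exact: map_f.
rewrite /= !sX !sM /swap_free !free_lift_gen.
have [r0 r1 r2 r3] : [/\ rev_ord (inord 0 : 'I_4) = inord 3,
    rev_ord (inord 1 : 'I_4) = inord 2, rev_ord (inord 2 : 'I_4) = inord 1
    & rev_ord (inord 3 : 'I_4) = inord 0].
  by split; apply: val_inj; rewrite /= !inordK.
rewrite r0 r1 r2 r3.
set a := Gamma_gen (inord 0); set b := Gamma_gen (inord 1).
set c := Gamma_gen (inord 2); set d := Gamma_gen (inord 3).
have comm i j n : (Gamma_gen i * Gamma_gen j) ^+ n = 1 ->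
    (Gamma_gen j * Gamma_gen i) ^+ n = 1.
  by move=> h; rewrite -[_ ^+ n]invgK -expVgn invgM !Gamma_genV h invg1.
have rel := Gamma_relations; rewrite -/a -/b -/c -/d in rel.
suff /allP h1 : all (pred1 1) (relators_353 d c b a) by move=> /h1 /eqP.
rewrite /relators_353 /= andbT; repeat (apply/andP; split); apply/eqP;
  first [ by apply: rel; rewrite !inE eqxx ?orbT
        | by apply: comm; apply: rel; rewrite !inE eqxx ?orbT ].
Qed.

Definition rho : Gamma -> Gamma := quot_lift swap_free.

Lemma rhoM : {morph rho : x y / x * y}.
Proof. exact: quot_liftM (@gmulfM _ _ _) swap_free_closure. Qed.
HB.instance Definition _ := isMultiplicative.Build Gamma Gamma rho rhoM.

Lemma rho1 : rho 1 = 1.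
Proof. by apply: (mulgI (rho 1)); rewrite -rhoM !mulg1. Qed.
HB.instance Definition _ :=
  Multiplicative_isUMagmaMorphism.Build Gamma Gamma rho rho1.

Lemma rho_gen i : rho (Gamma_gen i) = Gamma_gen (rev_ord i).
Proof.
by rewrite [LHS](quot_liftE (@gmulfM _ _ _) swap_free_closure) [LHS]free_lift_gen.
Qed.

Lemma rhoK : involutive rho.
Proof.
apply: Gamma_ind => [|i x IH|i x IH]; first by rewrite !rho1.
  by rewrite !rhoM IH !rho_gen rev_ordK.
by rewrite Gamma_genV !rhoM IH !rho_gen rev_ordK.
Qed.

(* The pair (x, e) stands for x * r ^ e in the semidirect product of Gamma with
   the group of order 2 generated by r, where r acts on Gamma as [rho]; this is
   the normaliser of Gamma in the isometry group of hyperbolic 3-space. *)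
Definition Omega : Type := (Gamma * bool)%type.
HB.instance Definition _ := Choice.on Omega.

Definition rho_pow (e : bool) (x : Gamma) : Gamma := if e then rho x else x.
Definition Omega_one : Omega := (1, false).
Definition Omega_mul (x y : Omega) : Omega :=
  (x.1 * rho_pow x.2 y.1, x.2 (+) y.2).
Definition Omega_inv (x : Omega) : Omega := (rho_pow x.2 x.1^-1, x.2).

Lemma Omega_mulA : associative Omega_mul.
Proof.
case=> x [] [] y [] [] z [];
  by rewrite /Omega_mul /= ?rhoM ?rhoK ?mulgA.
Qed.
Lemma Omega_mul1g : left_id Omega_one Omega_mul.
Proof. by case=> x e; rewrite /Omega_mul /= mul1g. Qed.
Lemma Omega_mulg1 : right_id Omega_one Omega_mul.
Proof. by case=> x []; rewrite /Omega_mul /= ?rho1 mulg1. Qed.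
Lemma Omega_mulVg : left_inverse Omega_one Omega_inv Omega_mul.
Proof. by case=> x []; rewrite /Omega_mul /= -?rhoM mulVg ?rho1. Qed.
Lemma Omega_mulgV : right_inverse Omega_one Omega_inv Omega_mul.
Proof. by case=> x []; rewrite /Omega_mul /= ?rhoK mulgV. Qed.

HB.instance Definition _ := isGroup.Build Omega
  Omega_mulA Omega_mul1g Omega_mulg1 Omega_mulVg Omega_mulgV.

Definition even_in_Gamma : {pred Gamma} := fun x =>
  `[< exists s : seq 'I_4, ~~ odd (size s) /\ x = \prod_(i <- s) Gamma_gen i >].

Lemma even_in_Gamma_closed : group_closed even_in_Gamma.
Proof.
split=> [|x y /asboolP[s [es ->]] /asboolP[t [et ->]]].
  by apply/asboolP; exists [::]; rewrite big_nil.
apply/asboolP; exists (s ++ rev t); split.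
  by rewrite size_cat size_rev oddD (negbTE es).
rewrite big_cat /=; congr (_ * _); rewrite -[t in LHS]revK -prodgV.
by apply: eq_bigr => i _; rewrite Gamma_genV.
Qed.

Record Delta : Type :=
  MkDelta { Delta_val :> Gamma; Delta_valP : Delta_val \in even_in_Gamma }.
HB.instance Definition _ := [isSub for Delta_val].
HB.instance Definition _ := [Choice of Delta by <:].
HB.instance Definition _ :=
  SubChoice_isSubGroup.Build Gamma even_in_Gamma Delta even_in_Gamma_closed.

Definition Delta_in_Omega (x : Delta) : Omega := (Delta_val x, false).

Definition torsion_free (G : groupType) (N : normal_subgroup G) : Prop :=
  forall (x : G) (n : nat), N x -> (0 < n)%N -> x ^+ n = 1 -> x = 1.

Definition has_index (G : groupType) (N : normal_subgroup G) (n : nat) : Prop :=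
  ([set: quot_group N] #= `I_n)%card.

(* N is the unique torsion-free normal subgroup of least index. *)
Definition least_torsion_free (G : groupType) (N : normal_subgroup G) : Prop :=
  torsion_free N /\
  exists n : nat, has_index N n /\
    forall M : normal_subgroup G, torsion_free M ->
      (forall m : nat, has_index M m -> (n <= m)%N) /\
      (has_index M n -> M = N).

(* K, as a subgroup of Delta <= Gamma <= Omega, is the unique torsion-free
   normal subgroup of least index in Omega. *)
Definition is_K0 (K : normal_subgroup Delta) : Prop :=
  exists N : normal_subgroup Omega, least_torsion_free N /\
    nsub_set N = [set Delta_in_Omega x | x in nsub_set K]%classic.

Section L2.
Variable F : finFieldType.

Definition SL2 : {set {'GL_2[F]}} := [set g : {'GL_2[F]} | (\det (GLval g) == 1)%R].

Lemma SL2_group_set : group_set SL2.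
Proof.
apply/group_setP; split=> [|x y]; rewrite !inE ?GL_1E ?det1 //.
by rewrite GL_MxE det_mulmx => /eqP-> /eqP->; rewrite mul1r.
Qed.
Canonical SL2_group := Group SL2_group_set.

Definition minus_one : {'GL_2[F]} := FinRing.unit 'M[F]_2 (unitrN1 _).

(* [<[minus_one]>] is the group of scalar matrices 1 and -1. *)
Definition L2 := (SL2_group / <[minus_one]>)%G.

End L2.

Definition L2_quotients (F : finFieldType) : set (normal_subgroup Delta) :=
  [set K | group_iso (quot_group K) ([subg L2 F])%type]%classic.

(* For every q = p ^ n >= 4, there are exactly [count n] normal subgroups of
   Delta with quotient isomorphic to L_2(q). *)
Definition L2_census (p : nat) (count : nat -> nat) : Prop :=
  forall (n : nat) (F : finFieldType),
    (0 < n)%N -> (4 <= p ^ n)%N -> #|F| = (p ^ n)%N ->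
    (L2_quotients F #= `I_(count n))%card.

Definition is_square (F : fieldType) (x : F) : Prop := exists y : F, x = (y ^+ 2)%R.

(* For both predicates the choice of the square root s of 5 is immaterial. *)
Definition both_squares (F : fieldType) : Prop :=
  exists s : F, [/\ s ^+ 2 = 5%:R, is_square (3%:R + 2%:R * s)
                  & is_square (3%:R - 2%:R * s)]%R.

Definition both_nonsquares (F : fieldType) : Prop :=
  exists s : F, [/\ s ^+ 2 = 5%:R, ~ is_square (3%:R + 2%:R * s)
                  & ~ is_square (3%:R - 2%:R * s)]%R.

(* Main.v *)
(** A normal subgroup of Delta with quotient L_2(q) is the kernel of a
    homomorphism sending alpha, beta, gamma to matrices X, Y, Z of SL_2 with
    prescribed traces. Up to conjugation such triples are parametrised by
    c = tr (XZ), a root of the quartic phi^2 = phi + 1 with phi = 1 + c - c^2,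
    and two roots give the same kernel exactly when they are Galois conjugate.
    So the census counts the Galois orbits of roots in characteristic p, an
    orbit of length n giving one quotient L_2(p^n).

    For p = 11 the kernel of the L_2(11) quotient is torsion-free because Delta
    acts on the reflection representation reduced modulo 11, and Minkowski's
    argument applies. It is of least index: let M be torsion-free and normal in
    Omega, A = <a,b,c> of order 120 with centre <z>. Then A embeds in Omega/M.
    If z does not commute with d there, the 23 cosets xA with x = 1, r, ar or
    x = gd for g in A/<a,b>, are distinct, and the index is at least 2760.
    Otherwise z is central, every element of Gamma is congruent to g or g d g'
    with g, g' in A, which gives index at most 2640, and determines M. *)

From HB Require Import structures.
Require Import Defs.
From mathcomp Require Import all_boot all_order all_fingroup all_algebra all_solvable all_field.
From mathcomp Require Import zify ring.
Set Implicit Arguments.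
Unset Strict Implicit.
Unset Printing Implicit Defensive.
Import GRing.Theory.
Local Open Scope ring_scope.

(** The weight lies on surjectivity: when c generates F, the image has to be all of L_2(F). Over a
    finite extension where every element has an eigenvalue, each element of the image fixes a point
    of the projective line. Counting fixed points orbit by orbit (Dickson) leaves only PSL_2 of a
    subfield, up to conjugacy, or a group of order 60, which the traces c and 1 - c exclude.
    Conversely, equal kernels give an injective endomorphism of PSL_2(F), and Hua's theorem on
    additive maps compatible with inversion makes it semilinear, so that the two roots are Galois
    conjugate. Residues modulo 11 enter because (3 - 2 sqrt 5)(3 + 2 sqrt 5) = -11; quadratic Gauss
    sums turn Euler's criterion for 5 and -11 into congruences. For K_0 the group is infinite, so
    relations between words are decided by computing in the reflection representation over Z[phi],
    shown to be faithful. Minkowski's argument at 11 says nothing about elements of order 11; these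
    are excluded by reducing modulo 19 instead. *)

(** * Two-by-two matrices and their trace identities *)

Section Matrix2.
Variable R : comNzRingType.
Implicit Types (a b c d : R) (M N X Y Z D : 'M[R]_2).

Lemma mx2P M N :
  M 0 0 = N 0 0 -> M 0 1 = N 0 1 -> M 1 0 = N 1 0 -> M 1 1 = N 1 1 -> M = N.
Proof.
move=> h1 h2 h3 h4; apply/matrixP=> i j.
have E (k : 'I_2) : k = 0 \/ k = 1.
  by case: k => [[|[|k]] lk] //; [left|right]; exact: val_inj.
by case: (E i) => ->; case: (E j) => ->.
Qed.

Lemma sum2 (F : 'I_2 -> R) : \sum_i F i = F 0 + F 1.
Proof.
rewrite !big_ord_recl big_ord0 addr0; congr (_ + F _); exact: val_inj.
Qed.

Lemma mul2E M N i j : (M *m N) i j = M i 0 * N 0 j + M i 1 * N 1 j.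
Proof. by rewrite mxE sum2. Qed.

Lemma tr2E M : \tr M = M 0 0 + M 1 1.
Proof. by rewrite /mxtrace sum2. Qed.

Lemma det2E M : \det M = M 0 0 * M 1 1 - M 0 1 * M 1 0.
Proof.
have l00 : lift (0 : 'I_2) (0 : 'I_1) = 1 by apply/val_inj.
have l10 : lift (1 : 'I_2) (0 : 'I_1) = 0 by apply/val_inj.
rewrite (expand_det_row _ 0) sum2 /cofactor !det_mx11 !mxE /= l00 l10.
ring.
Qed.

Definition mx2 a b c d : 'M[R]_2 :=
  \matrix_(i, j) if i == 0 then (if j == 0 then a else b)
                 else (if j == 0 then c else d).

Lemma mx2E a b c d :
  (mx2 a b c d 0 0 = a) * (mx2 a b c d 0 1 = b) *
  (mx2 a b c d 1 0 = c) * (mx2 a b c d 1 1 = d).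
Proof. by rewrite !mxE. Qed.

Lemma mx2_eta M : M = mx2 (M 0 0) (M 0 1) (M 1 0) (M 1 1).
Proof. by apply: mx2P; rewrite mx2E. Qed.

Lemma mx2_1 : 1%:M = mx2 1 0 0 1.
Proof. by apply: mx2P; rewrite mx2E !mxE. Qed.

Lemma scalar2E a : ((a%:M : 'M[R]_2) 0 0 = a) * ((a%:M : 'M[R]_2) 0 1 = 0) *
  ((a%:M : 'M[R]_2) 1 0 = 0) * ((a%:M : 'M[R]_2) 1 1 = a).
Proof. by rewrite !mxE /= ?mulr1n ?mulr0n. Qed.

Lemma det_mx2 a b c d : \det (mx2 a b c d) = a * d - b * c.
Proof. by rewrite det2E !mx2E. Qed.

Lemma mul_mx2 a b c d a' b' c' d' :
  mx2 a b c d *m mx2 a' b' c' d' =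
  mx2 (a * a' + b * c') (a * b' + b * d') (c * a' + d * c') (c * b' + d * d').
Proof. by apply: mx2P; rewrite mul2E !mx2E. Qed.

Lemma scale_mx2 k a b c d : k *: mx2 a b c d = mx2 (k * a) (k * b) (k * c) (k * d).
Proof. by apply: mx2P; rewrite !mxE. Qed.

(* Cayley-Hamilton, polarised. *)
Lemma mx2_swap M N :
  N *m M = - (M *m N) + \tr M *: N + \tr N *: M
           + (\tr (M *m N) - \tr M * \tr N)%:M.
Proof.
apply: mx2P; rewrite !tr2E !(mul2E, mxE) /= ?mulr1n ?mulr0n; ring.
Qed.

Lemma mx2_sqr M : M *m M = \tr M *: M - (\det M)%:M.
Proof.
apply: mx2P; rewrite !tr2E !det2E !(mul2E, mxE) /= ?mulr1n ?mulr0n; ring.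
Qed.

(* Fricke's relation between the seven traces of a triple of matrices. *)
Lemma fricke X Y Z :
  let x := \tr X in let y := \tr Y in let z := \tr Z in
  let a := \tr (X *m Y) in let b := \tr (Y *m Z) in let c := \tr (X *m Z) in
  let d := \tr (X *m Y *m Z) in
  let p := \det X in let q := \det Y in let r := \det Z in
  d ^+ 2 - (x * b + y * c + z * a - x * y * z) * d
  + (x ^+ 2 * q * r + y ^+ 2 * p * r + z ^+ 2 * p * q + a ^+ 2 * r + b ^+ 2 * p
     + c ^+ 2 * q - x * y * a * r - y * z * b * p - x * z * c * q + a * b * c
     - 4%:R * p * q * r) = 0.
Proof.
rewrite /= !tr2E !det2E !mul2E.
move: (X 0 0) (X 0 1) (X 1 0) (X 1 1) (Y 0 0) (Y 0 1) (Y 1 0) (Y 1 1) (Z 0 0)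
  (Z 0 1) (Z 1 0) (Z 1 1) => *; ring.
Qed.

(* The trace form pairs a traceless matrix with X, Y and XY, and the resulting
   3 x 3 determinant is the determinant of the commutator XY - YX. *)
Lemma trace_form_nondegenerate X Y D :
    \tr D = 0 -> \tr (D *m X) = 0 -> \tr (D *m Y) = 0 ->
    \tr (D *m (X *m Y)) = 0 ->
  (4%:R * \det X * \det Y - \tr X ^+ 2 * \det Y - \tr Y ^+ 2 * \det X
   - \tr (X *m Y) ^+ 2 + \tr X * \tr Y * \tr (X *m Y)) *: D = 0.
Proof.
rewrite !tr2E !det2E => D0; have {}D0 : D 1 1 = - D 0 0.
  by apply/eqP; rewrite -addr_eq0 addrC D0.
rewrite !mul2E D0.
move: (X 0 0) (X 0 1) (X 1 0) (X 1 1) (Y 0 0) (Y 0 1) (Y 1 0) (Y 1 1)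
  => x1 x2 x3 x4 y1 y2 y3 y4.
(* The entries of XY. Each of the four goals below is Cramer's rule: the multipliers are cofactors
   of the matrix of the three trace equations in the unknowns D00, D01, D10. *)
set u1 := x1 * y1 + _; set u2 := x1 * y2 + _.
set u3 := x3 * y1 + _; set u4 := x3 * y2 + _.
move=> h1 h2 h3; apply: mx2P; rewrite !mxE ?D0.
- transitivity ((y3 * u2 - y2 * u3) * (D 0 0 * x1 + D 0 1 * x3 + (D 1 0 * x2 + - D 0 0 * x4))
   + (u3 * x2 - u2 * x3) * (D 0 0 * y1 + D 0 1 * y3 + (D 1 0 * y2 + - D 0 0 * y4))
   + (x3 * y2 - x2 * y3) * (D 0 0 * u1 + D 0 1 * u3 + (D 1 0 * u2 + - D 0 0 * u4)));
   last by rewrite h1 h2 h3 !mulr0 !addr0.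
  rewrite /u1 /u2 /u3 /u4; ring.
- transitivity ((y2 * (u1 - u4) - (y1 - y4) * u2) * (D 0 0 * x1 + D 0 1 * x3 + (D 1 0 * x2 + - D 0 0 * x4))
   + (u2 * (x1 - x4) - (u1 - u4) * x2) * (D 0 0 * y1 + D 0 1 * y3 + (D 1 0 * y2 + - D 0 0 * y4))
   + (x2 * (y1 - y4) - (x1 - x4) * y2) * (D 0 0 * u1 + D 0 1 * u3 + (D 1 0 * u2 + - D 0 0 * u4)));
   last by rewrite h1 h2 h3 !mulr0 !addr0.
  rewrite /u1 /u2 /u3 /u4; ring.
- transitivity (((y1 - y4) * u3 - y3 * (u1 - u4)) * (D 0 0 * x1 + D 0 1 * x3 + (D 1 0 * x2 + - D 0 0 * x4))
   + ((u1 - u4) * x3 - u3 * (x1 - x4)) * (D 0 0 * y1 + D 0 1 * y3 + (D 1 0 * y2 + - D 0 0 * y4))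
   + ((x1 - x4) * y3 - x3 * (y1 - y4)) * (D 0 0 * u1 + D 0 1 * u3 + (D 1 0 * u2 + - D 0 0 * u4)));
   last by rewrite h1 h2 h3 !mulr0 !addr0.
  rewrite /u1 /u2 /u3 /u4; ring.
- transitivity (- ((y3 * u2 - y2 * u3) * (D 0 0 * x1 + D 0 1 * x3 + (D 1 0 * x2 + - D 0 0 * x4))
   + (u3 * x2 - u2 * x3) * (D 0 0 * y1 + D 0 1 * y3 + (D 1 0 * y2 + - D 0 0 * y4))
   + (x3 * y2 - x2 * y3) * (D 0 0 * u1 + D 0 1 * u3 + (D 1 0 * u2 + - D 0 0 * u4))));
   last by rewrite h1 h2 h3 !mulr0 !addr0 oppr0.
  rewrite /u1 /u2 /u3 /u4; ring.
Qed.

Definition comb (X Y : 'M[R]_2) (p q r s : R) : 'M[R]_2 :=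
  p%:M + q *: X + r *: Y + s *: (X *m Y).

End Matrix2.

Ltac mx_ring :=
  apply/matrixP=> ? ?; rewrite !mxE; case: eqP => _; rewrite ?mulr1n ?mulr0n; ring.

(** * Triples X, Y, Z in the basis 1, X, Y, XY *)

Section Coefficients.
Variables (R : comNzRingType) (c : R).

(** The trace y of Y: with tr X = tr Z = 1, tr (XZ) = c and trace 0 for XY, YZ, XYZ, Fricke's
    relation reads y^2 + c^2 - c - 2 = 0, and order 5 gives y^2 = y + 1. *)
Definition phi : R := 1 + c - c ^+ 2.
Definition quartic : R := phi ^+ 2 - phi - 1.

(** Coordinates on 1, X, Y, XY. The steps below are left multiplication by X, Y, Z, and [stepV] that
    by k - M, the inverse of M when det M = 1 and tr M = k. Any commutative ring is allowed so that
    they can be run on integer polynomials in c. *)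
Definition quad : Type := R * R * R * R.

Definition stepX (t : quad) : quad :=
  let: (p, q, r, s) := t in (- q, p + q, - s, r + s).
Definition stepY (t : quad) : quad :=
  let: (p, q, r, s) := t in
  (- (q * phi + r + s), q * phi + s, p + q + r * phi, - q).
(** The solution of the linear system given by the traces of Z, ZX, ZY and ZXY, simplified with f^2
    = f + 1 and c^2 = 1 + c - f. *)
Definition coefZ : quad :=
  (c * (1 + phi) - (1 + phi + phi), (1 + phi) * (1 - c - c), 1 + phi + phi,
   (1 + phi + phi) * (c - 1)).
Definition qadd (t u : quad) : quad :=
  let: (p, q, r, s) := t in let: (p', q', r', s') := u in
  (p + p', q + q', r + r', s + s').
Definition qscale (k : R) (t : quad) : quad :=
  let: (p, q, r, s) := t in (k * p, k * q, k * r, k * s).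
Definition stepZ (t : quad) : quad :=
  let: (z1, z2, z3, z4) := coefZ in
  qadd (qadd (qscale z1 t) (qscale z2 (stepX t)))
       (qadd (qscale z3 (stepY t)) (qscale z4 (stepX (stepY t)))).
Definition stepV (k : R) (f : quad -> quad) (t : quad) : quad :=
  qadd (qscale k t) (qscale (-1) (f t)).

End Coefficients.

Definition quad_map (R S : comNzRingType) (f : R -> S) (t : quad R) : quad S :=
  let: (p, q, r, s) := t in (f p, f q, f r, f s).

Section CoefficientMorphism.
Variables (R S : comNzRingType) (f : {rmorphism R -> S}) (c : R).

Lemma phi_morph : f (phi c) = phi (f c).
Proof. by rewrite /phi !(rmorphD, rmorphN, rmorphXn, rmorph1) . Qed.

Lemma stepX_morph t : quad_map f (stepX t) = stepX (quad_map f t).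
Proof. by case: t => [[[p q] r] s]; rewrite /= !(rmorphD, rmorphN). Qed.

Lemma stepY_morph t : quad_map f (stepY c t) = stepY (f c) (quad_map f t).
Proof.
by case: t => [[[p q] r] s]; rewrite /= -phi_morph !(rmorphD, rmorphN, rmorphM).
Qed.

Lemma qadd_morph t u : quad_map f (qadd t u) = qadd (quad_map f t) (quad_map f u).
Proof. by case: t u => [[[? ?] ?] ?] [[[? ?] ?] ?]; rewrite /= !rmorphD. Qed.

Lemma qscale_morph k t : quad_map f (qscale k t) = qscale (f k) (quad_map f t).
Proof. by case: t => [[[? ?] ?] ?]; rewrite /= !rmorphM. Qed.

Lemma stepZ_morph t : quad_map f (stepZ c t) = stepZ (f c) (quad_map f t).
Proof.
have : quad_map f (coefZ c) = coefZ (f c).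
  by rewrite /coefZ /= -phi_morph !(rmorphD, rmorphN, rmorphM, rmorph1).
rewrite /stepZ; case: (coefZ c) => [[[? ?] ?] ?]; case: (coefZ _) => [[[? ?] ?] ?].
by case=> <- <- <- <-; rewrite !(qadd_morph, qscale_morph) stepX_morph stepY_morph stepX_morph stepY_morph.
Qed.

Lemma stepV_morph k g h t : (forall t, quad_map f (g t) = h (quad_map f t)) ->
  quad_map f (stepV k g t) = stepV (f k) h (quad_map f t).
Proof. by move=> gh; rewrite qadd_morph !qscale_morph gh rmorphN rmorph1. Qed.

End CoefficientMorphism.

Definition combq (R : comNzRingType) (X Y : 'M[R]_2) (t : quad R) : 'M[R]_2 :=
  let: (p, q, r, s) := t in comb X Y p q r s.

Lemma combq_add (R : comNzRingType) (X Y : 'M[R]_2) t u :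
  combq X Y (qadd t u) = combq X Y t + combq X Y u.
Proof.
case: t u => [[[p q] r] s] [[[p' q'] r'] s'] /=; rewrite /comb.
move: (X *m Y) => U; mx_ring.
Qed.

Lemma combq_scale (R : comNzRingType) (X Y : 'M[R]_2) k t :
  combq X Y (qscale k t) = k *: combq X Y t.
Proof.
case: t => [[[p q] r] s] /=; rewrite /comb.
move: (X *m Y) => U; mx_ring.
Qed.

Section Pair.
Variables (F : fieldType) (c : F) (X Y : 'M[F]_2).

Record xy_pair : Prop := XYPair {
  tr_root : quartic c = 0;
  tr_detX : \det X = 1; tr_detY : \det Y = 1;
  tr_X : \tr X = 1; tr_Y : \tr Y = phi c; tr_XY : \tr (X *m Y) = 0 }.

Hypothesis P : xy_pair.
Let f := phi c.

Lemma phi_sqr : f ^+ 2 = f + 1.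
Proof. by apply/eqP; rewrite -subr_eq0 opprD addrA; exact/eqP/(tr_root P). Qed.

Lemma tripleXX : X *m X = X - 1%:M.
Proof. by rewrite mx2_sqr tr_X // tr_detX // scale1r. Qed.
Lemma tripleYY : Y *m Y = f *: Y - 1%:M.
Proof. by rewrite mx2_sqr tr_Y // tr_detY. Qed.
Lemma tripleYX : Y *m X = - (X *m Y) + Y + f *: X - f%:M.
Proof.
rewrite mx2_swap tr_X // tr_Y // tr_XY // scale1r mul1r sub0r.
by rewrite -/f; move: (X *m Y) => U; mx_ring.
Qed.

Lemma stepX_comb t : X *m combq X Y t = combq X Y (stepX t).
Proof.
case: t => [[[p q] r] s]; rewrite /= /comb !mulmxDr -!scalemxAr !mulmxA tripleXX.
rewrite mulmxBl mul1mx mul_mx_scalar; move: (X *m Y) => U.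
by mx_ring.
Qed.

Lemma stepY_comb t : Y *m combq X Y t = combq X Y (stepY c t).
Proof.
case: t => [[[p q] r] s]; rewrite /= /comb !mulmxDr -!scalemxAr !mulmxA.
rewrite tripleYX mulmxBl !mulmxDl mulNmx -!mulmxA tripleYY mulmxBr mulmx1.
rewrite -scalemxAr -scalemxAl mul_mx_scalar mul_scalar_mx.
move: (X *m Y) => U; rewrite -/f.
by mx_ring.
Qed.

Lemma comb_traces p q r s : let C := comb X Y p q r s in
  [/\ \tr C = 2%:R * p + q + f * r,
      \tr (C *m X) = p - q - f * s,
      \tr (C *m Y) = f * p + (f - 1) * r - s &
      \tr (C *m (X *m Y)) = - f * q - r - 2%:R * s].
Proof.
have [trXX trYY] : \tr (X *m X) = -1 /\ \tr (Y *m Y) = f - 1.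
  rewrite tripleXX tripleYY !linearB /= linearZ /= mxtrace_scalar tr_X // tr_Y //.
  by split; [ring | rewrite -/f -expr2 phi_sqr; ring].
have trXYY : \tr (X *m (Y *m Y)) = -1.
  by rewrite tripleYY mulmxBr -scalemxAr mulmx1 linearB linearZ /= tr_XY // tr_X // mulr0 sub0r.
have trYXY : \tr (Y *m (X *m Y)) = -1 by rewrite mxtrace_mulC -mulmxA.
have trXXY : \tr (X *m (X *m Y)) = - f.
  by rewrite mulmxA tripleXX mulmxBl mul1mx linearB /= tr_XY // tr_Y // sub0r.
have trXYX : \tr (X *m (Y *m X)) = - f by rewrite mulmxA mxtrace_mulC.
have trXYXY : \tr (X *m (Y *m (X *m Y))) = -2%:R.
  rewrite mulmxA mx2_sqr linearB linearZ /= tr_XY // mulr0 sub0r mxtrace_scalar.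
  by rewrite det_mulmx tr_detX // tr_detY // mulr1.
have trYX : \tr (Y *m X) = 0 by rewrite mxtrace_mulC tr_XY.
rewrite /comb /= !mulmxDl !mul_scalar_mx -!scalemxAl.
rewrite !(linearD, linearZ) /= mxtrace_scalar -!mulmxA.
rewrite trXYXY trYXY trXXY trXYX trXYY trXX trYY trYX.
rewrite !(tr_X, tr_Y, tr_XY) // -/f -mulr_natr.
by split; ring.
Qed.

(** The trace form on 1, X, Y, XY is nondegenerate in every characteristic, because 2 - f is a unit
    with inverse f + 1. The multipliers below are the rows of the inverse Gram matrix. *)
Lemma combq_scalar p q r s k :
  combq X Y (p, q, r, s) = k%:M -> [/\ p = k, q = 0, r = 0 & s = 0].
Proof.
move=> E; have : comb X Y (p - k) q r s = 0.
  have -> : comb X Y (p - k) q r s = combq X Y (p, q, r, s) - k%:M.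
    by rewrite /= /comb; move: (X *m Y) => U; mx_ring.
  by rewrite E subrr.
have := comb_traces (p - k) q r s.
move=> /= [] + + + + C0; rewrite C0 !mul0mx !linear0 => h1 h2 h3 h4.
have {}E := phi_sqr; move: h1 h2 h3 h4; move: (p - k) (subrK k p) => p' <-.
move=> h1 h2 h3 h4.
have Hp : p' = 0.
  transitivity (- (1 + 2%:R * f) * (2%:R * p' + q + f * r) + (1 + f) * (p' - q - f * s)
    + (1 + 2%:R * f) * (f * p' + (f - 1) * r - s)
    - (1 + 2%:R * f) * (- f * q - r - 2%:R * s)); first by ring: E.
  by rewrite -h1 -h2 -h3 -h4; ring.
rewrite {}Hp in h1 h2 h3 h4 *; rewrite add0r; split => //.
- transitivity ((1 + f) * (2%:R * 0 + q + f * r) - (2%:R + 2%:R * f) * (0 - q - f * s)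
    + (1 + 2%:R * f) * (- f * q - r - 2%:R * s)); first by ring: E.
  by rewrite -h1 -h2 -h4; ring.
- transitivity ((1 + 2%:R * f) * (2%:R * 0 + q + f * r)
    - (2%:R + 2%:R * f) * (f * 0 + (f - 1) * r - s)
    + (1 + f) * (- f * q - r - 2%:R * s)); first by ring: E.
  by rewrite -h1 -h3 -h4; ring.
- transitivity (- (1 + 2%:R * f) * (2%:R * 0 + q + f * r) + (1 + 2%:R * f) * (0 - q - f * s)
    + (1 + f) * (f * 0 + (f - 1) * r - s)
    - (2%:R + 2%:R * f) * (- f * q - r - 2%:R * s)); first by ring: E.
  by rewrite -h1 -h2 -h3 -h4; ring.
Qed.

Lemma stepV_comb k M g t : (forall t, M *m combq X Y t = combq X Y (g t)) ->
  (k%:M - M) *m combq X Y t = combq X Y (stepV k g t).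
Proof.
by move=> Mg; rewrite combq_add !combq_scale -Mg mulmxBl mul_scalar_mx scaleN1r.
Qed.

Lemma tripleXV : X *m (1%:M - X) = 1%:M.
Proof. by rewrite mulmxBr mulmx1 tripleXX opprB addrC subrK. Qed.
Lemma tripleYV : Y *m (f%:M - Y) = 1%:M.
Proof. by rewrite mulmxBr mul_mx_scalar tripleYY opprB addrC subrK. Qed.
Lemma phi_sub2_neq0 : f - 2%:R != 0.
Proof.
apply/eqP => f2; have E := phi_sqr; have /eqP : (1 : F) = 0.
  transitivity (- (f - 2%:R) * (f + 1)); first by ring: E.
  by rewrite f2; ring.
by rewrite oner_eq0.
Qed.

End Pair.

Section Triple.
Variables (F : fieldType) (c : F) (X Y Z : 'M[F]_2).

Record triple : Prop := Triple {
  tr_pair : xy_pair c X Y;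
  tr_detZ : \det Z = 1; tr_Z : \tr Z = 1; tr_YZ : \tr (Y *m Z) = 0;
  tr_XZ : \tr (X *m Z) = c; tr_XYZ : \tr (X *m Y *m Z) = 0 }.

Hypothesis T : triple.
Let P := tr_pair T.
Let f := phi c.

(** Z minus the combination is trace-orthogonal to 1, X, Y and XY, and the factor that annihilates
    it is 2 - f, with inverse f + 1. *)
Lemma tripleZ : Z = combq X Y (coefZ c).
Proof.
have E : f ^+ 2 = f + 1 := phi_sqr P; have c2 : c ^+ 2 = 1 + c - f by rewrite /f /phi; ring.
apply/eqP; rewrite -subr_eq0; set D := _ - _.
have [D0 DX DY DXY] : [/\ \tr D = 0, \tr (D *m X) = 0, \tr (D *m Y) = 0 &
    \tr (D *m (X *m Y)) = 0].
  rewrite /D /combq /coefZ; set C := comb _ _ _ _ _ _.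
  rewrite !mulmxBl !linearB /=.
  have [-> -> -> ->] 
    := comb_traces P (c * (1 + phi c) - (1 + phi c + phi c))
    ((1 + phi c) * (1 - c - c)) (1 + phi c + phi c) ((1 + phi c + phi c) * (c - 1)).
  rewrite [\tr (Z *m X)]mxtrace_mulC [\tr (Z *m Y)]mxtrace_mulC.
  rewrite [\tr (Z *m (X *m Y))]mxtrace_mulC.
  rewrite !(tr_YZ, tr_XZ, tr_XYZ, tr_Z) // -/f; split.
  - by ring: E.
  - by ring: E.
  - by ring: E.
  - by ring: E.
have := trace_form_nondegenerate D0 DX DY DXY.
rewrite (tr_detX P) (tr_detY P) (tr_X P) (tr_Y P) (tr_XY P) -/f E.
move=> /eqP; rewrite scaler_eq0 => /orP[/eqP d0|//].
have : (1 : F) = 0.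
  transitivity ((4%:R * 1 * 1 - 1 ^+ 2 * 1 - (f + 1) * 1 - 0 ^+ 2 + 1 * f * 0) * (f + 1)).
    by ring: E.
  by rewrite d0 mul0r.
by move/eqP; rewrite oner_eq0.
Qed.

Lemma stepZ_comb t : Z *m combq X Y t = combq X Y (stepZ c t).
Proof.
rewrite {1}tripleZ /stepZ; case: (coefZ c) => [[[z1 z2] z3] z4].
rewrite !(combq_add, combq_scale) -!(stepX_comb P, stepY_comb P) /= /comb.
by rewrite !mulmxDl !mul_scalar_mx -!scalemxAl -!mulmxA !addrA.
Qed.

Lemma tripleZV : Z *m (1%:M - Z) = 1%:M.
Proof.
rewrite mulmxBr mulmx1 mx2_sqr tr_Z // tr_detZ // scale1r.
by rewrite opprB addrC subrK.
Qed.

End Triple.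

(** Fricke's relation is here linear in det Z and reads (f - 2)(det Z - 1) = 0, which spares
    expanding the determinant of the combination. *)
Lemma coefZ_triple (F : fieldType) (c : F) (X Y : 'M[F]_2) :
  xy_pair c X Y -> triple c X Y (combq X Y (coefZ c)).
Proof.
move=> P; have E := phi_sqr P; set f := phi c in E *.
have c2 : c ^+ 2 = 1 + c - f by rewrite /f /phi; ring.
set Z := combq _ _ _; have [] := comb_traces P (c * (1 + phi c) - (1 + phi c + phi c))
    ((1 + phi c) * (1 - c - c)) (1 + phi c + phi c) ((1 + phi c + phi c) * (c - 1)).
rewrite -/(combq X Y (coefZ c)) -/Z -/f => tZ tZX tZY tZXY.
have {}tZ : \tr Z = 1 by rewrite tZ; ring: E.
have {}tZX : \tr (X *m Z) = c by rewrite mxtrace_mulC tZX; ring: E.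
have {}tZY : \tr (Y *m Z) = 0 by rewrite mxtrace_mulC tZY; ring: E.
have {}tZXY : \tr (X *m Y *m Z) = 0 by rewrite mxtrace_mulC tZXY; ring: E.
split=> //; have := fricke X Y Z.
rewrite /= tZ tZX tZY tZXY (tr_detX P) (tr_detY P) (tr_X P) (tr_Y P) (tr_XY P) -/f.
move: (\det Z) => r h; apply: (mulfI (phi_sub2_neq0 P)); rewrite mulr1 -/f.
by apply/eqP; rewrite -subr_eq0 -[X in _ == X]h; apply/eqP; ring: E c2.
Qed.

(** * Existence of a triple over every finite field *)

Lemma card_fibres2 (T U : finType) (g : T -> U) :
  (forall x0, #|[set x | g x == g x0]| <= 2)%N -> (#|T| <= 2 * #|[set g x | x : T]|)%N.
Proof.
move=> g2; rewrite -[X in (X <= _)%N]sum1_card (partition_big g (mem [set g x | x : T])) /=; last first.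
  by move=> x _; apply: imset_f.
apply: (@leq_trans (\sum_(y in [set g x | x : T]) 2)%N); last by rewrite sum_nat_const mulnC.
by apply: leq_sum => y /imsetP[x0 _ ->]; rewrite sum1dep_card.
Qed.

(** Each image contains at least half of the elements; two disjoint images would contain exactly
    half each, which an odd set does not allow. *)
Lemma images_meet (T : finType) (g h : T -> T) : odd #|T| ->
  (forall x0, #|[set x | g x == g x0]| <= 2)%N ->
  (forall x0, #|[set x | h x == h x0]| <= 2)%N -> exists s b, g s = h b.
Proof.
move=> oT /card_fibres2 hA /card_fibres2 hB.
have /set0Pn[v] : [set g x | x : T] :&: [set h x | x : T] != set0.
  apply: contraTneq oT => S0; move: (cardsUI [set g x | x : T] [set h x | x : T]).
  have := subset_leq_card (subsetT ([set g x | x : T] :|: [set h x | x : T])).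
  rewrite S0 cards0 addn0 cardsT; move: hA hB.
  move: #|[set g x | x : T]| #|[set h x | x : T]| #|_ :|: _| => m n u hA hB hu E.
  have -> : #|T| = m.*2 by lia.
  by rewrite odd_double.
by case/setIP=> /imsetP[s _ ->] /imsetP[b _ E]; exists s, b.
Qed.

Lemma quadratic_fibres (F : finFieldType) (g : F -> F) (a b c : F) :
  (forall x, g x = a * x ^+ 2 + b * x + c) -> (a != 0) || (b != 0) ->
  forall x0, (#|[set x | g x == g x0]| <= 2)%N.
Proof.
move=> gE ab x0.
(* Two arguments with the same value sum to - b / a. For a = 0 the quotient is 0 by convention and
   the second candidate is harmless. *)
apply: (@leq_trans #|[set x0; - (b / a) - x0]|); last first.
  by rewrite cards2; case: (_ != _).
apply/subset_leq_card/subsetP=> x; rewrite !inE -subr_eq0.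
have -> : g x - g x0 = (x - x0) * (a * (x + x0) + b) by rewrite !gE; ring.
rewrite mulf_eq0 subr_eq0 => /orP[->//|].
have [az|a0] := eqVneq a 0.
  by move: ab; rewrite az eqxx mul0r add0r /= => /negbTE->.
rewrite addr_eq0 => /eqP E; apply/orP; right; apply/eqP/(mulfI a0).
have -> : a * x = a * (x + x0) - a * x0 by ring.
by rewrite E; field.
Qed.

(* The pairs (X, Y) with X = (0, -1; 1, 1) correspond to the points of the conic
   a^2 - a b + b^2 - phi b + 1 = 0, whose existence follows from counting. *)
Lemma conic_point (F : finFieldType) (f : F) : f != 0 ->
  exists a b : F, a ^+ 2 - a * b + b ^+ 2 - f * b + 1 = 0.
Proof.
move=> f0; have [p pr pF] := finPcharP F.
have [F2|F2] := eqVneq (2%:R : F) 0.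
  exists 1, 0; rewrite expr1n mulr0 subr0 expr0n addr0 mulr0 subr0; exact: F2.
have oF : odd #|F|.
  rewrite (card_pprimeChar pF) oddX; apply/orP; right.
  case: (even_prime pr) => // p2; move: F2; rewrite -p2 (pcharf0 pF) eqxx //.
(* [h b] is the discriminant of the conic as a quadratic equation in a. *)
pose g (x : F) : F := x ^+ 2; pose h (x : F) : F := (- 3%:R) * x ^+ 2 + (4%:R * f) * x - 4%:R.
have [||s [b E]] := images_meet (g := g) (h := h) oF.
- by apply: (@quadratic_fibres _ g 1 0 0) => [x|]; [rewrite /g; ring | rewrite oner_neq0].
- apply: (@quadratic_fibres _ h (- 3%:R) (4%:R * f) (- 4%:R)) => //.
  rewrite oppr_eq0 mulf_eq0 (negbTE f0) orbF; have [F3|//] := eqVneq (3%:R : F) 0.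
  by rewrite /= (_ : 4%:R = 2%:R * 2%:R :> F) ?mulf_neq0 //; ring.
rewrite /g /h in E.
exists ((b + s) / 2%:R), b; apply: (mulfI (mulf_neq0 F2 F2)); rewrite mulr0.
transitivity (s ^+ 2 + 3%:R * b ^+ 2 - 4%:R * f * b + 4%:R).
  by field.
by rewrite E; ring.
Qed.

Lemma triple_exists (F : finFieldType) (c : F) : quartic c = 0 ->
  exists X Y Z, triple c X Y Z.
Proof.
move=> Qc; have E : phi c ^+ 2 = phi c + 1.
  by apply/eqP; rewrite -subr_eq0 opprD addrA -/(quartic c) Qc.
have [|a [b ab]] := @conic_point F (phi c).
  apply: contra_eq_neq E => ->; rewrite expr0n add0r eq_sym oner_neq0 //.
pose X := mx2 0 (-1) 1 1 : 'M[F]_2.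
(* The general matrix with trace phi and tr (XY) = 0; determinant 1 is then the equation of the
   conic. *)
pose Y := mx2 (phi c - b) (a - b) a b.
exists X, Y, (combq X Y (coefZ c)); apply: coefZ_triple; split=> //.
- by rewrite det_mx2; ring.
- by rewrite det_mx2; apply/eqP; rewrite -subr_eq0 -oppr_eq0 -[X in _ == X]ab; apply/eqP; ring.
- by rewrite tr2E !mx2E add0r.
- by rewrite tr2E !mx2E subrK.
- by rewrite mul_mx2 tr2E !mx2E; ring.
Qed.

(** * Moebius transformations of the projective line over a finite field *)

Section Moebius.
Variable F : finFieldType.
Implicit Types (M N : 'M[F]_2) (x y : option F) (u v k t : F).

(* [option F] is the projective line, [None] being the point (1 : 0); matrices
   act on row vectors, so that the action is a right action. *)
Definition proj_pt (u v : F) : option F := if v == 0 then None else Some (u / v).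
Definition mob M x : option F :=
  if x is Some t then proj_pt (t * M 0 0 + M 1 0) (t * M 0 1 + M 1 1)
  else proj_pt (M 0 0) (M 0 1).

Lemma proj_ptZ k u v : k != 0 -> proj_pt (k * u) (k * v) = proj_pt u v.
Proof.
move=> k0; rewrite /proj_pt mulf_eq0 (negbTE k0) /=; case: eqP => // /eqP v0.
by congr (Some _); field; rewrite v0 k0.
Qed.

Lemma proj_ptP x : exists u v : F, [/\ x = proj_pt u v, (u != 0) || (v != 0) &
  forall M, mob M x = proj_pt (u * M 0 0 + v * M 1 0) (u * M 0 1 + v * M 1 1)].
Proof.
case: x => [t|]; [exists t, 1 | exists 1, 0].
  by rewrite /proj_pt oner_eq0 divr1 orbT; split=> // M; rewrite !mul1r.
by rewrite /proj_pt eqxx oner_eq0; split=> // M; rewrite !mul1r !mul0r !addr0.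
Qed.

Lemma proj_pt_eq u v (u' v' : F) : (u != 0) || (v != 0) -> (u' != 0) || (v' != 0) ->
  (proj_pt u v == proj_pt u' v') = (u * v' == u' * v).
Proof.
rewrite /proj_pt => h h'; have [v0|v0] := eqVneq v 0; have [v'0|v'0] := eqVneq v' 0.
- by rewrite eqxx v0 v'0 !mulr0 eqxx.
- move: h; rewrite v0 eqxx orbF mulr0 => u0.
by rewrite mulf_eq0 (negbTE u0) (negbTE v'0).
- move: h'; rewrite v'0 eqxx orbF mulr0 => u0.
  by rewrite [RHS]eq_sym mulf_eq0 (negbTE u0) (negbTE v0).
- by rewrite (inj_eq (@Some_inj _)) eqr_div.
Qed.

Lemma det_row_neq0 M u v : \det M != 0 -> (u != 0) || (v != 0) ->
  (u * M 0 0 + v * M 1 0 != 0) || (u * M 0 1 + v * M 1 1 != 0).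
Proof.
rewrite det2E => d; apply: contraLR.
rewrite !negb_or !negbK => /andP[/eqP h1 /eqP h2].
have hu : u * (M 0 0 * M 1 1 - M 0 1 * M 1 0) = 0.
  transitivity ((u * M 0 0 + v * M 1 0) * M 1 1 - (u * M 0 1 + v * M 1 1) * M 1 0).
    by ring.
  by rewrite h1 h2; ring.
have hv : v * (M 0 0 * M 1 1 - M 0 1 * M 1 0) = 0.
  transitivity ((u * M 0 1 + v * M 1 1) * M 0 0 - (u * M 0 0 + v * M 1 0) * M 0 1).
    by ring.
  by rewrite h1 h2; ring.
by move: hu hv => /eqP + /eqP; rewrite !mulf_eq0 (negbTE d) !orbF => -> ->.
Qed.

Lemma mob_proj_pt M u v : (u != 0) || (v != 0) ->
  mob M (proj_pt u v) = proj_pt (u * M 0 0 + v * M 1 0) (u * M 0 1 + v * M 1 1).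
Proof.
rewrite {1}/proj_pt; have [-> | v0 _] /= := eqVneq v 0.
  by rewrite orbF => u0; rewrite !mul0r !addr0 proj_ptZ.
by rewrite -[RHS](proj_ptZ _ _ (invr_neq0 v0)); congr proj_pt; field.
Qed.

Lemma mob_mul M N x : \det M != 0 -> mob (M *m N) x = mob N (mob M x).
Proof.
move=> dM; have [u [v [-> uv _]]] := proj_ptP x.
rewrite !mob_proj_pt ?det_row_neq0 //.
by rewrite !mul2E; congr proj_pt; ring.
Qed.

Lemma mob_scale k M x : k != 0 -> mob (k *: M) x = mob M x.
Proof.
move=> k0; case: x => [t|] /=; rewrite !mxE -[RHS](proj_ptZ _ _ k0) //.
by congr proj_pt; ring.
Qed.

Lemma mob1 x : mob 1%:M x = x.
Proof.
case: x => [t|]; rewrite /= !scalar2E ?mulr0 ?add0r ?mulr1 ?addr0 /proj_pt.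
  by rewrite oner_eq0 divr1.
by rewrite eqxx.
Qed.

Lemma mob_inj M : \det M != 0 -> injective (mob M).
Proof.
move=> dM; have uM : M \in unitmx by rewrite unitmxE unitfE.
by apply: (can_inj (g := mob (invmx M))) => x; rewrite -mob_mul // mulmxV // mob1.
Qed.

(** Total in M: when the action is not bijective the value is the identity. *)
Definition mobp M : {perm option F} :=
  odflt 1%g [pick s : {perm option F} | [forall x, s x == mob M x]].

Lemma mobpE M x : \det M != 0 -> mobp M x = mob M x.
Proof.
move=> dM; rewrite /mobp; case: pickP => [s /forallP /(_ x) /eqP //|].
move/(_ (perm (mob_inj dM))); move/negbT/forallPn => [y].
by rewrite permE eqxx.
Qed.

Lemma mobpM M N : \det M != 0 -> \det N != 0 ->
  mobp (M *m N) = (mobp M * mobp N)%g.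
Proof.
move=> dM dN; apply/permP=> x; rewrite permM !mobpE ?det_mulmx ?mulf_neq0 //.
exact: mob_mul.
Qed.

Lemma mobp1 : mobp 1%:M = 1%g.
Proof. by apply/permP=> x; rewrite mobpE ?det1 ?oner_neq0 // mob1 perm1. Qed.

Lemma det2Z k M : \det (k *: M) = k ^+ 2 * \det M.
Proof. exact: detZ. Qed.

Lemma mobpZ k M : k != 0 -> \det M != 0 -> mobp (k *: M) = mobp M.
Proof.
move=> k0 dM; apply/permP=> x; rewrite !mobpE ?mob_scale //.
by rewrite det2Z mulf_neq0 // expf_neq0.
Qed.

(** Fixing the three points [None], 0 and 1 is enough. *)
Lemma mobp_eq1 M : \det M != 0 -> mobp M = 1%g -> M = (M 0 0)%:M.
Proof.
move=> dM /permP h; have E x := h x; rewrite det2E in dM.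
have h0 : M 0 1 = 0.
  by have := E None; rewrite mobpE ?det2E // perm1 /= /proj_pt; case: eqP.
have h1 : M 1 0 = 0.
  have := E (Some 0); rewrite mobpE ?det2E // perm1 /= /proj_pt !mul0r !add0r.
  case: eqP => // /eqP d0 [] /eqP; rewrite mulf_eq0 invr_eq0 (negbTE d0) orbF.
  by move/eqP.
have h2 : M 0 0 = M 1 1.
  have := E (Some 1); rewrite mobpE ?det2E // perm1 /= /proj_pt !mul1r h0 h1.
  rewrite add0r addr0; case: eqP => // /eqP d0 [] h2.
  by rewrite -[LHS](divfK d0) h2 mul1r.
by apply: mx2P; rewrite !scalar2E.
Qed.

Lemma mobp_inj M N : \det M = 1 -> \det N = 1 -> mobp M = mobp N ->
  M = N \/ M = - N.
Proof.
move=> dM dN E; have uN : N \in unitmx by rewrite unitmxE dN unitr1.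
have dM0 : \det M != 0 by rewrite dM oner_neq0.
have dN0 : \det N != 0 by rewrite dN oner_neq0.
have dV : \det (invmx N) = 1 by rewrite det_inv dN invr1.
have dV0 : \det (invmx N) != 0 by rewrite dV oner_neq0.
have : mobp (M *m invmx N) = 1%g.
  by rewrite mobpM // E -mobpM // mulmxV // mobp1.
move/mobp_eq1; rewrite det_mulmx mulf_neq0 // => /(_ isT).
set k := (_ 0 0) => Ek; have {Ek} MN : M = k *: N.
  by rewrite -[M](mulmxKV uN) Ek mul_scalar_mx.
have := dM; rewrite MN det2Z dN mulr1 => /eqP; rewrite sqrf_eq1.
by case/orP=> /eqP->; [left|right]; rewrite ?scale1r ?scaleN1r.
Qed.

Lemma mobpN M : \det M != 0 -> mobp (- M) = mobp M.
Proof. by move=> dM; rewrite -scaleN1r mobpZ // oppr_eq0 oner_neq0. Qed.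

Lemma mobpV M : \det M != 0 -> mobp (invmx M) = (mobp M)^-1%g.
Proof.
move=> dM; have uM : M \in unitmx by rewrite unitmxE unitfE.
apply: (mulgI (mobp M)); rewrite mulgV -mobpM ?mulmxV ?mobp1 //.
by rewrite det_inv invr_neq0.
Qed.

Definition psl_set : {set {perm option F}} :=
  [set mobp M | M in [pred M : 'M[F]_2 | \det M == 1]].

Lemma psl_setP s : reflect (exists2 M, \det M = 1 & s = mobp M) (s \in psl_set).
Proof.
apply: (iffP imsetP) => [[M /eqP dM ->]|[M dM ->]]; first by exists M.
by exists M; rewrite ?inE ?dM.
Qed.

Lemma psl_group_set : group_set psl_set.
Proof.
apply/group_setP; split; first by apply/psl_setP; exists 1%:M; rewrite ?det1 ?mobp1.
move=> s t /psl_setP[M dM ->] /psl_setP[N dN ->]; apply/psl_setP.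
by exists (M *m N); rewrite ?det_mulmx ?dM ?dN ?mulr1 // mobpM ?dM ?dN ?oner_neq0.
Qed.
Canonical psl_group := Group psl_group_set.

End Moebius.

Section FixedPoints.
Variable F : finFieldType.
Implicit Types (M N H : 'M[F]_2) (x y : option F) (g h s : {perm option F}).

Lemma psl_conj s H : \det H != 0 -> s \in psl_set F -> (s ^ mobp H)%g \in psl_set F.
Proof.
move=> dH /psl_setP[M dM ->]; have uH : H \in unitmx by rewrite unitmxE unitfE.
have dV : \det (invmx H) != 0 by rewrite det_inv invr_neq0.
apply/psl_setP; exists (invmx H *m M *m H).
  by rewrite !det_mulmx det_inv dM mulr1 mulVf.
have dM0 : \det M != 0 by rewrite dM oner_neq0.
by rewrite conjgE -mobpV // !mobpM ?det_mulmx ?mulf_neq0 // mulgA.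
Qed.

Definition fixpts g : {set option F} := [set x | g x == x].

Lemma fixptsJ g h : fixpts (g ^ h) = h @: fixpts g.
Proof.
apply/setP=> x; apply/idP/imsetP.
  rewrite inE => /eqP E; exists ((h^-1)%g x); last by rewrite permKV.
  rewrite inE; apply/eqP/(@perm_inj _ h).
  by rewrite permKV -[RHS]E conjgE !permM.
by case=> y; rewrite inE => /eqP E ->; rewrite inE conjgE !permM permK E.
Qed.

Lemma card_fixptsJ g h : #|fixpts (g ^ h)| = #|fixpts g|.
Proof. by rewrite fixptsJ card_imset //; exact: perm_inj. Qed.

Lemma move_to_None x : exists2 H, \det H != 0 & mob H x = None.
Proof.
case: x => [t|]; last by exists 1%:M; rewrite ?det1 ?oner_neq0 ?mob1.
exists (mx2 0 1 1 (- t)); first by rewrite det_mx2 !(mul0r, mul1r) sub0r oppr_eq0 oner_neq0.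
by rewrite /= !mx2E /proj_pt mulr1 subrr eqxx.
Qed.

Lemma affineP s : s \in psl_set F -> s None = None ->
  exists l m : F, l != 0 /\ forall t, s (Some t) = Some (l * t + m).
Proof.
case/psl_setP=> M dM ->; have dM0 : \det M != 0 by rewrite dM oner_neq0.
rewrite mobpE // /= /proj_pt; have [b0 _|//] := eqVneq (M 0 1) 0.
have : M 0 0 * M 1 1 = 1 by rewrite -dM det2E b0; ring.
have [->|d0 ad] := eqVneq (M 1 1) 0.
  by rewrite mulr0 => /eqP; rewrite eq_sym oner_eq0.
have a0 : M 0 0 != 0.
  by apply: contra_eq_neq ad => ->; rewrite mul0r eq_sym oner_eq0.
exists (M 0 0 / M 1 1), (M 1 0 / M 1 1); rewrite mulf_neq0 ?invr_neq0 //.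
split=> // t; rewrite mobpE // /= /proj_pt b0 mulr0 add0r (negbTE d0).
by congr (Some _); field.
Qed.

(** Moving a fixed point to [None] makes the map affine, t to l t + m; it has one more fixed point
    when l differs from 1, and none when l = 1. *)
Lemma psl_fixpts_le2 s : s \in psl_set F -> s != 1%g -> (#|fixpts s| <= 2)%N.
Proof.
move=> ps s1; have [->|[x]] := set_0Vmem (fixpts s); first by rewrite cards0.
have [H dH Hx] := move_to_None x; rewrite inE => /eqP sx.
rewrite -(card_fixptsJ s (mobp H)).
have s'1 : (s ^ mobp H)%g != 1%g by rewrite conjg_eq1.
have : (s ^ mobp H)%g None = None.
  by rewrite -Hx -(mobpE _ dH) conjgE !permM permK sx.
move: (psl_conj dH ps) s'1; move: (s ^ mobp H)%g => {s1 sx ps}s ps s1 sN.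
have [l [m [l0 sE]]] := affineP ps sN.
have [l1|l1] := eqVneq l 1.
  suff -> : fixpts s = [set None] by rewrite cards1.
  apply/setP=> -[t|]; rewrite !inE ?sN // sE l1 mul1r.
  apply/negbTE; apply: contraNneq s1 => -[E].
  have {E} m0 : m = 0 by apply: (addrI t); rewrite E addr0.
  by apply/eqP/permP=> -[t'|]; rewrite perm1 ?sN // sE l1 m0 mul1r addr0.
suff /subset_leq_card /leq_trans -> // :
    fixpts s \subset [set None; Some (m / (1 - l))] by rewrite ?cards2.
apply/subsetP=> -[t|]; rewrite !inE // sE => /eqP[E].
have l1' : 1 - l != 0 by rewrite subr_eq0 eq_sym.
apply/eqP; congr (Some _); apply/(canRL (mulfK l1')).
apply/eqP; rewrite -subr_eq0; have -> : t * (1 - l) - m = t - (l * t + m) by ring.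
by rewrite E subrr.
Qed.

(** An affine map without finite fixed point is a translation, and p m = 0. *)
Lemma transl_pX s p (pF : p \in [pchar F]) : s \in psl_set F ->
  #|fixpts s| = 1%N -> (s ^+ p = 1)%g.
Proof.
move=> ps s1; have [x xs] : exists x, x \in fixpts s.
  by apply/set0Pn; rewrite -card_gt0 s1.
have [H dH Hx] := move_to_None x; apply/eqP; rewrite -(conjg_eq1 _ (mobp H)) conjXg.
have : (s ^ mobp H)%g None = None.
  by rewrite -Hx -(mobpE _ dH) conjgE !permM permK; move: xs; rewrite inE => /eqP->.
move: s1 (psl_conj dH ps); rewrite -(card_fixptsJ s (mobp H)).
move: (s ^ mobp H)%g => {xs ps}s s1 ps sN; have [l [m [l0 sE]]] := affineP ps sN.
have l1 : l = 1.
  apply: contra_eq s1 => l1; have l1' : 1 - l != 0 by rewrite subr_eq0 eq_sym.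
  rewrite neq_ltn; apply/orP; right.
  apply: (@leq_trans #|[set None; Some (m / (1 - l))]|); first by rewrite cards2.
  apply/subset_leq_card/subsetP=> y; rewrite !inE => /orP[]/eqP->; first by rewrite sN.
  by rewrite sE; apply/eqP; congr (Some _); field.
have sX k t : (s ^+ k)%g (Some t) = Some (t + m *+ k).
  elim: k t => [|k IH] t; first by rewrite perm1 mulr0n addr0.
  by rewrite expgS permM sE l1 mul1r IH mulrS addrA.
have sXN k : (s ^+ k)%g None = None.
  by elim: k => [|k IH]; rewrite ?perm1 // expgS permM sN.
apply/eqP/permP => -[t|]; rewrite perm1 ?sXN // sX -mulr_natr (pcharf0 pF).
by rewrite mulr0 addr0.
Qed.

End FixedPoints.

(** * Counting fixed points: Dickson's argument *)

Section Burnside.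
Variables (F : finFieldType) (G : {group {perm option F}}).
Implicit Types (x y : option F) (g h : {perm option F}).

(** What the image of Delta satisfies after a field extension. Generation by odd order excludes
    subgroups of index 2 and later brings the entries into a subfield, perfectness excludes a common
    fixed point, and 15 singles out the icosahedral order. *)
Record moebius_group : Prop := MoebiusGroup {
  mg_psl : G \subset psl_group F;
  mg_fix : forall g, g \in G -> exists x, g x = x;
  mg_odd : G = <<[set g in G | odd #[g]%g]>>%g :> {set {perm option F}};
  mg_perfect : G^`(1)%g = G;
  mg_15 : (15 %| #|G|)%N }.

Hypothesis hG : moebius_group.

Lemma mg_neq1 : (#|G| >= 15)%N.
Proof. by apply: dvdn_leq (mg_15 hG); exact: cardG_gt0. Qed.

Lemma mg_index2 (A : {group {perm option F}}) : A \subset G -> #|G : A|%g != 2%N.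
Proof.
move=> sAG; apply/eqP=> i2; have nA := index2_normal sAG i2.
have nGA := normal_norm nA.
have : G \subset A.
  rewrite {1}(mg_odd hG) gen_subG; apply/subsetP=> g; rewrite inE => /andP[gG og].
  have nAg : g \in 'N(A)%g by exact: (subsetP nGA).
  apply: coset_idr => //; apply/eqP; rewrite -order_eq1.
  have d1 : (#[coset A g]%g %| 2)%N.
    by rewrite -i2 -(card_quotient nGA) order_dvdG // mem_quotient.
  have := dvdn_odd (morph_order (coset_morphism A) nAg) og.
  by move: d1; case: (#[coset A g]%g) => [|[|[|n]]] // /dvdn_leq; move/(_ isT).
by move/(indexgS G) ; rewrite i2 indexgg.
Qed.

(** With a common fixed point G would consist of affine maps. Commutators have slope 1, so the
    perfect group G would consist of translations, hence be abelian and trivial. *)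
Lemma mg_no_fixpt x : exists2 g, g \in G & g x != x.
Proof.
apply/exists_inP; rewrite -[X in is_true X]negbK negb_exists_in.
apply/negP => /forall_inP fx; have {}fx g : g \in G -> g x = x.
  by move=> /fx; rewrite negbK => /eqP.
have [H dH Hx] := move_to_None x.
pose h := mobp H; have aff g : g \in G -> exists l m : F, l != 0 /\
    forall t, (g ^ h)%g (Some t) = Some (l * t + m).
  move=> gG; apply: affineP; first by apply: psl_conj => //; apply: (subsetP (mg_psl hG)).
  by rewrite -Hx -(mobpE _ dH) conjgE !permM permK fx.
have affN g : g \in G -> (g ^ h)%g None = None.
  by move=> gG; rewrite -Hx -(mobpE _ dH) conjgE !permM permK fx.
pose T := [set g in G | [exists m : F, [forall t, (g ^ h)%g (Some t) == Some (t + m)]]].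
have TP g : g \in G -> reflect (exists m : F, forall t, (g ^ h)%g (Some t) = Some (t + m)) (g \in T).
  move=> gG; rewrite inE gG; apply: (iffP existsP) => -[m /=].
    by move/forallP => E; exists m => t; apply/eqP.
  by move=> E; exists m; apply/forallP=> t; rewrite E.
have gT : group_set T.
  apply/group_setP; split.
    by apply/(TP _ (group1 G)); exists 0 => t; rewrite conj1g perm1 addr0.
  move=> g1 g2 T1 T2; have [G1 G2] : g1 \in G /\ g2 \in G.
    by move: T1 T2; rewrite !inE => /andP[-> _] /andP[-> _].
  have [m1 E1] := TP _ G1 T1; have [m2 E2] := TP _ G2 T2.
  apply/TP; first exact: groupM.
  by exists (m1 + m2) => t; rewrite conjMg permM E1 E2 addrA.
have GT : G \subset Group gT.
  rewrite -{1}(mg_perfect hG) gen_subG; apply/subsetP=> _ /imset2P[g1 g2 G1 G2 ->].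
  have Gc : [~ g1, g2]%g \in G by rewrite groupR.
  have [l1 [m1 [l10 E1]]] := aff _ G1; have [l2 [m2 [l20 E2]]] := aff _ G2.
  have [l [m [_ E]]] := aff _ Gc.
  have C : (g1 ^ h * g2 ^ h = (g2 ^ h * g1 ^ h) * [~ g1, g2] ^ h)%g.
    by rewrite -!conjMg -commgC.
  (* Comparing values at 0 and at 1 isolates the slope l of the commutator. *)
  have [C0 C1] : l2 * (l1 * 0 + m1) + m2 = l * (l1 * (l2 * 0 + m2) + m1) + m /\
                 l2 * (l1 * 1 + m1) + m2 = l * (l1 * (l2 * 1 + m2) + m1) + m.
    move: (g1 ^ h)%g (g2 ^ h)%g ([~ g1, g2] ^ h)%g C E1 E2 E => k1 k2 k3 C E1 E2 E.
    split; first by move/permP: C => /(_ (Some 0)); rewrite !permM !(E1, E2, E) => -[].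
    by move/permP: C => /(_ (Some 1)); rewrite !permM !(E1, E2, E) => -[].
  have l1' : l = 1.
    apply: (mulIf (mulf_neq0 l10 l20)); rewrite mul1r.
    have : l1 * l2 - l * (l1 * l2) = (l2 * (l1 * 1 + m1) + m2) - (l2 * (l1 * 0 + m1) + m2)
      - ((l * (l1 * (l2 * 1 + m2) + m1) + m) - (l * (l1 * (l2 * 0 + m2) + m1) + m)) by ring.
    by rewrite C0 C1 subrr => /eqP; rewrite subr_eq0 => /eqP.
  by apply/TP => //; exists m => t; rewrite E l1' mul1r.
have abG : abelian G.
  apply/centsP=> g1 G1 g2 G2; apply: (conjg_inj h); rewrite !conjMg.
  have [m1 E1] := TP _ G1 (subsetP GT _ G1); have [m2 E2] := TP _ G2 (subsetP GT _ G2).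
  move: (affN _ G1) (affN _ G2) E1 E2; move: (g1 ^ h)%g (g2 ^ h)%g => k1 k2 N1 N2 E1 E2.
  apply/permP=> -[t|]; rewrite !permM ?N1 ?N2 // !(E1, E2).
  by congr (Some _); ring.
have := mg_neq1; move/derG1P: abG; rewrite (mg_perfect hG) => G1.
by rewrite (_ : #|G| = 1%N) // G1 cards1.
Qed.

End Burnside.

Section Count.
Local Open Scope nat_scope.
Local Open Scope group_scope.
Variables (F : finFieldType) (G : {group {perm option F}}).
Implicit Types (x y : option F) (g h : {perm option F}) (A : {set option F}).
Hypothesis hG : moebius_group G.

Let st x := 'C_G[x | 'P].
Let orb x := orbit 'P G x.

Lemma stabP x g : (g \in st x) = (g \in G) && (g x == x).
Proof.
by rewrite inE; congr (_ && _); apply/astab1P/eqP.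
Qed.

Lemma orb_stab x : (#|orb x| * #|st x|)%N = #|G|.
Proof. exact: card_orbit_stab. Qed.

Lemma fixpts_card g : g \in G^# -> #|fixpts g| = 1%N \/ #|fixpts g| = 2%N.
Proof.
rewrite !inE => /andP[g1 gG].
have := psl_fixpts_le2 (subsetP (mg_psl hG) _ gG) g1.
have [x gx] := mg_fix hG gG.
have : 0 < #|fixpts g| by rewrite (cardD1 x) inE gx eqxx.
by case: #|_| => [|[|[|]]] //; [left|right].
Qed.

(* An element with a single fixed point counts twice, so that every non-trivial
   element contributes 2 to the sum of [weight]. *)
Definition weight x := (\sum_(g in G^#) (g x == x) * (3 - #|fixpts g|))%N.

Lemma sum_weight : (\sum_x weight x = 2 * (#|G| - 1))%N.
Proof.
rewrite exchange_big /= (cardsD1 1 G) group1 add1n subn1 /= mulnC -sum_nat_const.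
apply: eq_bigr => g gG; rewrite -big_distrl /=.
have -> : (\sum_x (g x == x) = #|fixpts g|)%N.
  by rewrite /fixpts -sum1dep_card [RHS]big_mkcond; apply: eq_bigr => x _; case: (_ == _).
by case: (fixpts_card gG) => ->.
Qed.

Lemma weight_orb x y : y \in orb x -> weight y = weight x.
Proof.
case/imsetP=> h hG' ->; rewrite /weight (reindex_inj (conjg_inj h)) /=.
rewrite [LHS](eq_bigl (mem G^#)); last first.
  by move=> g /=; rewrite !inE conjg_eq1 groupJr.
apply: eq_bigr => g _; rewrite card_fixptsJ; congr (nat_of_bool _ * _)%N.
by rewrite /= apermE conjgE !permM permK (inj_eq perm_inj).
Qed.

Definition invariant_set A := forall x g, x \in A -> g \in G -> g x \in A.

Lemma invariant_set_orb A x : invariant_set A -> x \in A -> orb x \subset A.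
Proof. by move=> sA xA; apply/subsetP=> _ /imsetP[g gG ->]; exact: sA. Qed.

Lemma invariant_setD A x : invariant_set A -> x \in A -> invariant_set (A :\: orb x).
Proof.
move=> sA xA y g; rewrite !inE => /andP[yx yA] gG; rewrite sA // andbT.
by rewrite -[g y]/('P%act y g) orbit_actr.
Qed.

(** The weight is constant on orbits, so a whole orbit of positive weight can be split off the
    sum. *)
Lemma peel A : invariant_set A -> (0 < \sum_(x in A) weight x)%N -> exists x,
  [/\ x \in A, (0 < weight x)%N &
   (\sum_(y in A) weight y = #|orb x| * weight x + \sum_(y in A :\: orb x) weight y)%N].
Proof.
move=> sA; rewrite lt0n sum_nat_eq0 negb_forall => /existsP[x].
rewrite negb_imply -lt0n => /andP[xA wx]; exists x; split=> //.
rewrite (bigID (mem (orb x))) /=; congr (_ + _)%N; last first.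
  by apply: eq_bigl => y; rewrite !inE andbC.
rewrite -sum_nat_const; apply: congr_big => // [y|y yx].
  by rewrite andb_idl // => /(subsetP (invariant_set_orb sA xA)).
by apply: weight_orb; case/andP: yx.
Qed.

Lemma weight_le x : (#|st x| - 1 <= weight x)%N.
Proof.
have -> : (#|st x| - 1 = \sum_(g in G^#) (g x == x))%N.
  rewrite (cardsD1 1) group1 add1n subn1 /= -sum1_card big_mkcond [RHS]big_mkcond /=.
  by apply: eq_bigr => g _; rewrite !in_setD1 stabP; case: (g == 1); case: (g \in G); case: (g x == x).
apply: leq_sum => g gG; case: (fixpts_card gG) => ->; lia.
Qed.

Lemma weight_semisimple x :
  (forall g, g \in G^# -> g x = x -> #|fixpts g| = 2%N) -> weight x = (#|st x| - 1)%N.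
Proof.
move=> ss; rewrite (cardsD1 1) group1 add1n subn1 /= -sum1_card /weight.
rewrite big_mkcond [RHS]big_mkcond /=.
apply: eq_bigr => g _; have := ss g; rewrite !in_setD1 stabP.
case: (g \in G); case: (g == 1) => //=.
by case: eqP => // gx -> //; rewrite gx.
Qed.

Lemma orb_neq1 x : (1 < #|orb x|)%N.
Proof.
have [g gG gx] := mg_no_fixpt hG x.
rewrite (cardD1 x) orbit_refl ltnS; apply/card_gt0P; exists (g x).
by rewrite !inE gx; apply/imsetP; exists g.
Qed.

Lemma orb_neq2 x : #|orb x| <> 2%N.
Proof. by rewrite card_orbit; apply/eqP/mg_index2/subsetIl. Qed.

End Count.

Section ArithmeticRegular.
Local Open Scope nat_scope.

(** The equation 1/m1 + 1/m2 + 1/m3 = 1 + 2/g of the finite rotation groups. It forces m1 = 2; the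
    dihedral case m2 = 2 would give an orbit of size 2, and of the remaining orders 12, 24, 60 only
    the last is divisible by 15. *)
Lemma three_orbits_sorted g o1 o2 o3 m1 m2 m3 :
  o1 * m1 = g -> o2 * m2 = g -> o3 * m3 = g -> 1 < m1 -> m1 <= m2 -> m2 <= m3 ->
  o1 + o2 + o3 = g + 2 -> o1 != 2 -> o2 != 2 -> o3 != 2 -> 15 %| g -> 0 < g ->
  [/\ g = 60, m1 = 2, m2 = 3 & m3 = 5].
Proof.
move=> E1 E2 E3 m1g m12 m23 S n1 n2 n3 /dvdnP[k gk] g0.
have m1E : m1 = 2.
  by have [//|m13] := leqP m1 2; [lia|exfalso; nia].
have o1E : g = 2 * o1 by lia.
have m2E : m2 = 3.
  have [m2E|//] : m2 = 2 \/ m2 = 3 by nia.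
  by exfalso; rewrite m2E in E2; lia.
have o2E : g = 3 * o2 by lia.
have h3 : m3 <= 5 by nia.
have : m3 = 3 \/ m3 = 4 \/ m3 = 5 by lia.
by case=> [|[]] m3E; split; rewrite m3E in E3; lia.
Qed.

Lemma three_orbits g o1 o2 o3 m1 m2 m3 :
  o1 * m1 = g -> o2 * m2 = g -> o3 * m3 = g -> 1 < m1 -> 1 < m2 -> 1 < m3 ->
  o1 + o2 + o3 = g + 2 -> o1 != 2 -> o2 != 2 -> o3 != 2 -> 15 %| g -> 0 < g ->
  g = 60 /\ [/\ m1 \in [:: 2; 3; 5], m2 \in [:: 2; 3; 5] & m3 \in [:: 2; 3; 5]].
Proof.
move=> E1 E2 E3 m1g m2g m3g S n1 n2 n3 d15 g0.
have [m12|m21] := leqP m1 m2; have [m23|m32] := leqP m2 m3;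
  have [m13|m31] := leqP m1 m3.
- by have [-> -> -> ->] := three_orbits_sorted E1 E2 E3 m1g m12 m23 S n1 n2 n3 d15 g0.
- by lia.
- by have [|-> -> -> ->] := three_orbits_sorted E1 E3 E2 m1g m13 (ltnW m32) _ n1 n3 n2 d15 g0; first lia.
- by have [|-> -> -> ->] := three_orbits_sorted E3 E1 E2 m3g (ltnW m31) m12 _ n3 n1 n2 d15 g0; first lia.
- by have [|-> -> -> ->] := three_orbits_sorted E2 E1 E3 m2g (ltnW m21) m13 _ n2 n1 n3 d15 g0; first lia.
- by have [|-> -> -> ->] := three_orbits_sorted E2 E3 E1 m2g m23 (ltnW m31) _ n2 n3 n1 d15 g0; first lia.
- by lia.
- by have [|-> -> -> ->] := three_orbits_sorted E3 E2 E1 m3g (ltnW m32) (ltnW m21) _ n3 n2 n1 d15 g0; first lia.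
Qed.

(* The second orbit of poles, when the first one carries the unipotent elements:
   its point stabilisers have order q n, there are N = 1 + k q of them, and o m
   is the size of the group. *)
Lemma two_orbits q n k N o m :
  1 < q -> 0 < n -> n <= q - 1 -> N = 1 + k * q -> 0 < k ->
  o + 2 * N = N * q + 2 -> o * m = q * n * N -> o != 2 ->
  k = 1 \/ [/\ q = 3, q * n = 6, m = 5 & q * n * N = 60].
Proof.
move=> q1 n0 nq NE k0 oN om o2.
have [q2|q2] := eqVneq q 2; first by subst q; lia.
have q3 : 2 < q by lia.
have [r qr] : exists r, q = r + 2 by exists (q - 2); lia.
(* Eliminating N gives o = q d and m d = n (d + 2 k). With m = n + e this is e d = 2 k n; as k is
   coprime to d, e = k f and f d = 2 n, which bounds k because n < q. *)
set d := 1 + k * r.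
have oE : o = q * d by rewrite /d; nia.
have md : m * d = n * (d + 2 * k) by nia.
have mn : n < m by nia.
have [e mE] : exists e, m = n + e by exists (m - n); lia.
have ed : e * d = 2 * k * n by nia.
have cdk : coprime k d by rewrite /d addnC mulnC /coprime gcdnMDl gcdn1.
have /dvdnP[f fE] : k %| e.
  by rewrite -(Gauss_dvdl _ cdk) ed -mulnA mulnCA dvdn_mulr.
have fd : f * d = 2 * n by nia.
have f0 : 0 < f by case: f fd {fE} => //; rewrite mul0n; lia.
have fk : f * (1 + k * r) <= 2 * r + 2 by rewrite -/d; lia.
have [k1|k1] := eqVneq k 1; first by left.
have k2 : 1 < k by lia.
have kr : 1 + k * r <= 2 * r + 2 by apply: leq_trans fk; rewrite leq_pmull.
have fr : f * 3 <= f * (1 + k * r).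
  by rewrite leq_mul2l; apply/orP; right; have := leq_mul k2 (_ : 1 <= r); lia.
right; have r1 : r = 1.
  have [//|r2] := eqVneq r 1.
  exfalso; have kE : k = 2.
    have [|k3] := leqP k 2; first by lia.
    by have := leq_mul k3 (leqnn r); lia.
  have f1 : f = 1.
    have [|f2] := leqP f 1; first by lia.
    by have := leq_mul f2 (leqnn (1 + k * r)); rewrite kE; lia.
  by move: fd; rewrite /d kE f1; lia.
have [f1 k3] : f = 1 /\ k = 3.
  move: fk fr fd; rewrite /d r1 muln1 => fk fr fd; have f1 : f = 1 by lia.
  by split=> //; rewrite f1 in fd; lia.
have nE : n = 2 by rewrite f1 mul1n /d k3 r1 in fd; lia.
by split; lia.
Qed.

End ArithmeticRegular.

Section Dickson.
Local Open Scope nat_scope.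
Local Open Scope group_scope.
Variables (F : finFieldType) (G : {group {perm option F}}).
Implicit Types (x y : option F) (g h : {perm option F}) (A : {set option F}).
Hypothesis hG : moebius_group G.

Lemma order_dvd_stab x g : g \in G -> g x = x -> #[g] %| #|'C_G[x | 'P]|.
Proof. by move=> gG gx; rewrite order_dvdG // stabP gG gx eqxx. Qed.

Lemma invariant_setT : invariant_set G [set: option F].
Proof. by move=> x g _ _; rewrite inE. Qed.

(** An orbit of positive weight contributes |G| - o, which lies between |G| / 2 and |G| - 2. The
    total 2 |G| - 2 therefore needs exactly three such orbits. *)
Lemma dickson_regular : (forall g, g \in G^# -> #|fixpts g| = 2%N) ->
  #|G| = 60%N /\ forall g, g \in G -> #[g] \in [:: 1; 2; 3; 5]%N.
Proof.
move=> ss; have W x : weight G x = (#|'C_G[x | 'P]| - 1)%N.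
  by apply: weight_semisimple => // g gG _; exact: ss.
have g15 := mg_neq1 hG; have tot := sum_weight hG.
have OS x := orb_stab G x.
have C x : (#|orbit 'P G x| * weight G x = #|G| - #|orbit 'P G x|)%N.
  by rewrite W mulnBr muln1 OS.
have tot' : (\sum_(x in [set: option F]) weight G x = 2 * (#|G| - 1))%N.
  by rewrite -tot; apply: eq_bigl => x; rewrite inE.
have S0 := invariant_setT.
have half x : (0 < weight G x)%N -> (2 * #|orbit 'P G x| <= #|G|)%N.
  by rewrite W => w; rewrite -(OS x) mulnC leq_mul2l; apply/orP; right; lia.
have [|x1 [_ w1 E1]] := peel S0; first by rewrite tot'; lia.
have S1 := invariant_setD S0 (in_setT x1).
have h1 := half _ w1; have n1 := orb_neq1 hG x1.
rewrite tot' C in E1.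
have [|x2 [x2A w2 E2]] := peel S1; first by lia.
have S2 := invariant_setD S1 x2A; have h2 := half _ w2; have n2 := orb_neq1 hG x2.
rewrite C in E2.
have [|x3 [x3A w3 E3]] := peel S2; first by lia.
have S3 := invariant_setD S2 x3A; have h3 := half _ w3; have n3 := orb_neq1 hG x3.
rewrite C in E3.
have R3 : (\sum_(y in [set: option F] :\: orbit 'P G x1 :\: orbit 'P G x2 :\: orbit 'P G x3) weight G y = 0)%N.
  apply/eqP; rewrite -leqn0 leqNgt; apply/negP => R.
  have [x4 [_ w4 E4]] := peel S3 R; have h4 := half _ w4; rewrite C in E4.
  by have := orb_neq1 hG x4; lia.
have E : (#|orbit 'P G x1| + #|orbit 'P G x2| + #|orbit 'P G x3| = #|G| + 2)%N by lia.
have M x : (0 < weight G x)%N -> (1 < #|'C_G[x | 'P]|)%N by rewrite W; lia.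
have N2 x : #|orbit 'P G x| != 2%N by apply/eqP/(orb_neq2 hG).
have [g60 [m1 m2 m3]] := three_orbits (OS x1) (OS x2) (OS x3) (M _ w1) (M _ w2)
  (M _ w3) E (N2 _) (N2 _) (N2 _) (mg_15 hG) (cardG_gt0 G).
split=> // g gG; have [->|g1] := eqVneq g 1; first by rewrite order1.
have [x gx] := mg_fix hG gG.
have wx : (0 < weight G x)%N.
  rewrite W; have := order_dvd_stab gG gx; have : (1 < #[g])%N by rewrite order_gt1.
  by move=> o1 /(dvdn_leq (cardG_gt0 _)); rewrite subn_gt0; exact: leq_trans.
have orbM y : x \in orbit 'P G y -> #|'C_G[y | 'P]| \in [:: 2; 3; 5]%N ->
    #[g] \in [:: 1; 2; 3; 5]%N.
  move=> xy; have -> : #|'C_G[y | 'P]| = #|'C_G[x | 'P]|.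
    have Exy : orbit 'P G x = orbit 'P G y by apply/esym/orbit_eqP; rewrite // orbit_sym.
    have := OS y; rewrite -(OS x) Exy => /eqP; rewrite eqn_pmul2l; first by move/eqP.
    exact: ltnW (orb_neq1 hG y).
  have := order_dvd_stab gG gx; rewrite !inE => d m; rewrite order_eq1 (negbTE g1) /=.
  have pm : prime #|'C_G[x | 'P]| by case/or3P: m => /eqP->.
  by rewrite (prime_nt_dvdP pm _ d) // order_eq1.
have [x1x|x1x] := boolP (x \in orbit 'P G x1); first exact: orbM x1x m1.
have [x2x|x2x] := boolP (x \in orbit 'P G x2); first exact: orbM x2x m2.
have [x3x|x3x] := boolP (x \in orbit 'P G x3); first exact: orbM x3x m3.
by move/eqP: R3; rewrite sum_nat_eq0 => /forallP/(_ x); rewrite !inE x1x x2x x3x -leqn0 leqNgt wx.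
Qed.

End Dickson.

Section Irregular.
Local Open Scope nat_scope.
Local Open Scope group_scope.
Variables (F : finFieldType) (G : {group {perm option F}}).
Implicit Types (x y : option F) (g h : {perm option F}) (A : {set option F}).
Hypothesis hG : moebius_group G.

Lemma transl_fixpts g (m : F) : g None = None -> (forall t, g (Some t) = Some (t + m)%R) ->
  g != 1 -> fixpts g = [set None].
Proof.
move=> gN gE g1; apply/setP=> -[t|]; rewrite !inE ?gN // gE; apply/negbTE.
apply: contraNneq g1 => -[E].
have m0 : m = 0%R by apply: (addrI t); rewrite E addr0.
by apply/eqP/permP=> -[t'|]; rewrite perm1 ?gN // gE m0 addr0.
Qed.

Lemma fixpts_transl g : g \in psl_set F -> fixpts g = [set None] ->
  exists m, forall t, g (Some t) = Some (t + m)%R.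
Proof.
move=> pg fg; have gN : g None = None.
  by apply/eqP; have := set11 (None : option F); rewrite -fg inE.
have [l [m [l0 gE]]] := affineP pg gN; exists m => t; rewrite gE.
have [->|l1] := eqVneq l 1%R; first by rewrite mul1r.
have : Some (m / (1 - l))%R \in fixpts g.
  rewrite inE gE; apply/eqP; congr Some; field.
  by rewrite subr_eq0 eq_sym.
by rewrite fg inE.
Qed.

Definition transl : {set {perm option F}} :=
  [set g in G | (g == 1) || (fixpts g == [set None])].

Lemma translP g : reflect (g \in G /\ exists m, forall t, g (Some t) = Some (t + m)%R)
  (g \in transl).
Proof.
rewrite inE; apply: (iffP andP) => -[gG].
  case/orP=> /eqP; first by move=> ->; split; [exact: group1 | exists 0%R => t; rewrite perm1 addr0].
  by move=> fg; split=> //; apply: fixpts_transl => //; apply: (subsetP (mg_psl hG)).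
case=> m gE; split=> //; have gN : g None = None.
  case E : (g None) => [t|] //; have := gE (t - m)%R; rewrite subrK -E => /perm_inj.
  by [].
by have [//|g1] := eqVneq g 1; rewrite (transl_fixpts gN gE g1) eqxx.
Qed.

Lemma transl_None g : g \in transl -> g None = None.
Proof.
rewrite inE => /andP[_ /orP[/eqP->|/eqP E]]; first by rewrite perm1.
by have := set11 (None : option F); rewrite -E inE => /eqP.
Qed.

Lemma transl_group_set : group_set transl.
Proof.
apply/group_setP; split; first by rewrite inE group1 eqxx.
move=> g h /translP[gG [m gE]] /translP[hG' [m' hE]]; apply/translP.
by split; [exact: groupM | exists (m + m')%R => t; rewrite permM gE hE addrA].
Qed.
Canonical transl_group := Group transl_group_set.

Let st := 'C_G[None | 'P].

Lemma transl_sub : transl \subset st.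
Proof.
apply/subsetP=> g gT; rewrite stabP transl_None // eqxx andbT.
by move: gT; rewrite inE => /andP[].
Qed.

(** A non-trivial translation has a single fixed point and counts twice; the other non-trivial
    elements of the stabiliser count once. *)
Lemma weight_None : weight G None = ((#|st| - 1) + (#|transl| - 1))%N.
Proof.
rewrite (cardsD1 1 st) (cardsD1 1 transl) !group1 !add1n !subn1 /= -!sum1_card /weight.
rewrite big_mkcond [in RHS]big_mkcond /= [X in _ = (_ + X)%N]big_mkcond -big_split /=.
apply: eq_bigr => g _; rewrite !in_setD1 /st stabP [g \in transl]inE.
have [//|g1] /= := eqVneq g 1; have [gG|//] := boolP (g \in G); rewrite /=.
have [gN|gN] /= := eqVneq (g None) None; last first.
  rewrite mul0n; case: eqP => // E.
  by have := set11 (None : option F); rewrite -E inE (negbTE gN).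
have fN : None \in fixpts g by rewrite inE gN.
have g' : g \in G^# by rewrite !inE g1.
rewrite mul1n; case: (fixpts_card hG g') => c; rewrite c.
  by move/eqP/cards1P: c fN => [y ->]; rewrite inE => /eqP->; rewrite eqxx.
by case: eqP => // E; rewrite E cards1 in c.
Qed.

(** The line has |F| + 1 points, so every p-subgroup fixes a point, and if it contains an element
    with a single fixed point it fixes that one. Conjugacy of Sylow subgroups moves one such point
    to another. *)
Lemma unipotent_orbit u g x : u \in G -> u != 1 -> fixpts u = [set None] ->
  g \in G -> g != 1 -> fixpts g = [set x] -> x \in orbit 'P G None.
Proof.
move=> uG u1 fu gG g1 fg; have [p pr pF] := finPcharP F.
have pfix h y (P : {group {perm option F}}) : h \in P -> fixpts h = [set y] ->
    p.-group P -> forall k, k \in P -> k y = y.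
  move=> hP fh pP.
  have aP : [acts P, on [set: option F] | 'P] by apply/actsP=> k _ z; rewrite !inE.
  have pdvd : p %| #|F|.
    have := abelem_pgroup (fin_ring_pchar_abelem pF (R := F)); rewrite /pgroup cardsT.
    case/p_natP => [[|n]] E; last by rewrite E expnS dvdn_mulr.
    by have := finNzRing_gt1 F; rewrite E.
  have := pgroup_fix_mod pP aP; rewrite cardsT card_option.
  rewrite -addn1 -modnDml (eqP pdvd) add0n => E.
  have /set0Pn[z] : 'Fix_([set: option F] | 'P)(P) != set0.
    apply: contra_eq_neq E => ->; rewrite cards0 mod0n modn_small // prime_gt1 //.
  case/setIP=> _ /afixP fz k kP.
  have zy : z = y by apply/set1P; rewrite -fh inE; apply/eqP/fz.
  by rewrite -zy; exact: fz.
have ppow h y : h \in G -> h != 1 -> fixpts h = [set y] -> p.-group <[h]>.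
  move=> hG' h1 fh; have hp : h ^+ p = 1.
    by apply: transl_pX => //; [exact: (subsetP (mg_psl hG)) | rewrite fh cards1].
  rewrite /pgroup -orderE; apply: (@pnat_dvd _ p); last exact: pnat_id.
  by rewrite order_dvdn hp.
have subG h : h \in G -> <[h]> \subset G by move=> ?; rewrite cycle_subG.
have [P sP uP] := Sylow_superset (subG _ uG) (ppow _ _ uG u1 fu).
have [Q sQ gQ] := Sylow_superset (subG _ gG) (ppow _ _ gG g1 fg).
have [h hG' QP] := Sylow_trans sP sQ.
have fP k : k \in P -> k None = None.
  apply: (pfix u); rewrite ?(pHall_pgroup sP) //; exact: subsetP uP _ (cycle_id u).
have : h None \in fixpts g.
  have : g \in P :^ h by rewrite -QP; exact: subsetP gQ _ (cycle_id g).
  by case/imsetP=> k kP ->; rewrite fixptsJ imset_f // inE fP.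
by rewrite fg inE => /eqP <-; apply/imsetP; exists h.
Qed.

(** The translations act freely on the points other than infinity. *)
Lemma dvdn_transl_orbit : #|transl| %| (#|orbit 'P G None|).-1.
Proof.
set S := orbit 'P G None :\ None.
have -> : (#|orbit 'P G None|).-1 = #|S|.
  by rewrite /S cardsDS ?sub1set ?orbit_refl // cards1 subn1.
have aS : [acts transl_group, on S | 'P].
  apply/actsP=> k kT z; have kG : k \in G by move: kT; rewrite /= inE => /andP[].
  rewrite !in_setD1 orbit_actr //; congr (~~ _ && _).
  by rewrite /= apermE -[X in _ == X](transl_None kT) (inj_eq perm_inj).
rewrite -(acts_sum_card_orbit aS); apply: dvdn_sum => _ /imsetP[z zS ->].
rewrite card_orbit; suff -> : 'C_transl_group[z | 'P] = 1 by rewrite indexg1.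
apply/trivgP/subsetP=> k; rewrite inE => /andP[kT /astab1P kz].
rewrite inE; apply: contraLR zS => k1.
move: kT; rewrite inE (negbTE k1) /= => /andP[_ /eqP fk].
by rewrite !inE -(in_set1 z) -fk inE [k z]kz eqxx.
Qed.

Variable u : {perm option F}.
Hypotheses (uG : u \in G) (u1 : u != 1) (fu : fixpts u = [set None]).

Lemma cent_transl : 'C_st[u] = transl.
Proof.
have uT : u \in transl by rewrite inE uG fu eqxx orbT.
have /translP[_ [m uE]] := uT.
apply/setP=> g; rewrite inE; apply/andP/idP => [[gs /cent1P cgu]|gT].
  have := gs; rewrite stabP => /andP[gG /eqP gN].
  have [l [m' [l0 gE]]] := affineP (subsetP (mg_psl hG) _ gG) gN.
  apply/translP; split=> //; exists m' => t; rewrite gE.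
  have m0 : (m != 0)%R.
    apply: contraNneq u1 => m0; apply/eqP/permP=> -[t'|]; rewrite perm1 ?uE ?m0 ?addr0 //.
    exact: transl_None.
  have /permP/(_ (Some 0%R)) := cgu; rewrite !permM !(gE, uE) => -[E].
  suff -> : l = 1%R by rewrite mul1r.
  apply: (mulIf m0); rewrite mul1r; apply/eqP; rewrite -subr_eq0.
  have -> : (l * m - m = (l * (0 + m) + m') - (l * 0 + m' + m))%R by ring.
  by rewrite E subrr.
split; first exact: (subsetP transl_sub).
apply/cent1P; have /translP[_ [m' gE]] := gT.
apply/permP=> -[t|]; rewrite !permM; last by rewrite !transl_None.
by rewrite !(gE, uE); congr Some; ring.
Qed.

(** The index counts the conjugates of u under the stabiliser, and these are non-trivial
    translations. *)
Lemma index_transl_le : (#|st : transl| <= #|transl| - 1)%N.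
Proof.
rewrite -{1}cent_transl index_cent1 subn1.
have -> : (#|transl|.-1 = #|transl^#|)%N by rewrite (cardsD1 1) group1.
apply/subset_leq_card/subsetP=> _ /imsetP[g gs ->].
move: gs; rewrite stabP => /andP[gG /eqP gN].
rewrite !inE conjg_eq1 u1 groupJ //= fixptsJ fu; apply/orP; right.
by rewrite imset_set1 gN.
Qed.

(** The orbit of infinity takes all the unipotent weight. What is left is positive and at most |G| -
    2, which is room for exactly one further orbit contributing at least |G| / 2; [two_orbits] then
    applies. The exception is a group of order 60 in characteristic 3. *)
Lemma dickson_irregular :
  #|orbit 'P G None| = (#|transl|).+1 \/
  [/\ #|G| = 60%N, (3%:R = 0 :> F)%R &
      forall g, g \in G -> (#[g] %| 6) || (#[g] %| 5)].
Proof.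
have g15 := mg_neq1 hG; have tot := sum_weight hG.
have OS x := orb_stab G x.
have tot' : (\sum_(x in [set: option F]) weight G x = 2 * (#|G| - 1))%N.
  by rewrite -tot; apply: eq_bigl => x; rewrite inE.
have S0 := @invariant_setT F G.
have q1 : (1 < #|transl|)%N.
  rewrite (cardsD1 1) group1 ltnS card_gt0; apply/set0Pn; exists u.
  by rewrite !inE u1 uG fu eqxx orbT.
have nq := index_transl_le; have qn : (#|transl| * #|st : transl| = #|st|)%N.
  exact: Lagrange transl_sub.
have n0 : (0 < #|st : transl|)%N by rewrite indexg_gt0.
have N1 := orb_neq1 hG None.
have /dvdnP[k kE] := dvdn_transl_orbit.
have NE : (#|orbit 'P G None| = 1 + k * #|transl|)%N.
  by rewrite -kE add1n prednK // ltnW.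
have k0 : (0 < k)%N by move: N1; rewrite NE; case: (k) => //.
have OSN := OS None; rewrite -/st -qn in OSN.
have W x : x \notin orbit 'P G None -> weight G x = (#|'C_G[x | 'P]| - 1)%N.
  move=> xN; apply: weight_semisimple => // g gG gx.
  case: (fixpts_card hG gG) => // c1; exfalso; move/negP: xN; apply.
  have xg : x \in fixpts g by rewrite inE gx.
  move/eqP/cards1P: c1 => [y fg]; move: gG; rewrite !inE => /andP[g1 gG].
  apply: (unipotent_orbit uG u1 fu gG g1).
  by rewrite fg; congr [set _]; apply/esym/set1P; rewrite -fg.
have C x : x \notin orbit 'P G None ->
    (#|orbit 'P G x| * weight G x = #|G| - #|orbit 'P G x|)%N.
  by move=> xN; rewrite W // mulnBr muln1 OS.
have half x : x \notin orbit 'P G None -> (0 < weight G x)%N ->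
    (2 * #|orbit 'P G x| <= #|G|)%N.
  by move=> xN; rewrite W // => w; rewrite -(OS x) mulnC leq_mul2l; apply/orP; right; lia.
have S1 := invariant_setD S0 (in_setT None).
have [E1 R1] : (\sum_(y in [set: option F] :\: orbit 'P G None) weight G y
    = #|G| - 2 + 2 * #|orbit 'P G None| - #|orbit 'P G None| * #|transl|)%N /\
    (#|orbit 'P G None| * #|transl| < #|G| - 2 + 2 * #|orbit 'P G None|)%N.
  have E : (\sum_(y in [set: option F]) weight G y =
      #|orbit 'P G None| * weight G None
      + \sum_(y in [set: option F] :\: orbit 'P G None) weight G y)%N.
    rewrite (bigID (mem (orbit 'P G None))) /=; congr (_ + _)%N; last first.
      by apply: eq_bigl => y; rewrite !inE andbC.
    rewrite -sum_nat_const; apply: congr_big => // [y|y yx]; first by rewrite inE.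
    by apply: weight_orb; case/andP: yx.
  move: E; rewrite tot' weight_None -/st -qn.
  move: OSN N1 q1 n0 nq g15 => /=; clear.
  move: #|orbit 'P G None| #|transl| #|st : transl| #|G| (\sum_(_ in _) _)%N.
  move=> N q n g w OSN N1 q1 n0 nq g15 E; have nN : (N * q <= N * (q * n))%N by rewrite leq_mul2l leq_pmulr ?orbT.
  have A : (N * ((q * n - 1) + (q - 1)) = N * (q * n) - N + (N * q - N))%N.
    by rewrite mulnDr !mulnBr !muln1.
  have qN : (2 * N <= N * q)%N by rewrite mulnC leq_mul2l q1 orbT.
  by rewrite A in E; split=> //; lia.
rewrite -/st in E1.
have [|x [xA w2 E2]] := peel S1; first by rewrite E1; lia.
have xN : x \notin orbit 'P G None by move: xA; rewrite inE => /andP[].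
rewrite C // in E2.
have S2 := invariant_setD S1 xA.
have h2 := half _ xN w2.
have R2 : (\sum_(y in [set: option F] :\: orbit 'P G None :\: orbit 'P G x) weight G y = 0)%N.
  apply/eqP; rewrite -leqn0 leqNgt; apply/negP => R.
  have [x3 [x3A w3 E3]] := peel S2 R.
  have x3N : x3 \notin orbit 'P G None by move: x3A; rewrite !inE => /and3P[].
  have h3 := half _ x3N w3; rewrite C // in E3.
  have := leq_mul (leqnn #|orbit 'P G None|) q1; lia.
have oE : (#|orbit 'P G x| + 2 * #|orbit 'P G None| = #|orbit 'P G None| * #|transl| + 2)%N by lia.
have om : (#|orbit 'P G x| * #|'C_G[x | 'P]| = #|transl| * #|st : transl| * #|orbit 'P G None|)%N.
  by rewrite OS mulnC.
have o2 : #|orbit 'P G x| != 2%N by apply/eqP/(orb_neq2 hG).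
have [k1|[q3 qn6 m5 g60]] := two_orbits q1 n0 nq NE k0 oE om o2.
  by left; rewrite NE k1 mul1n.
right; split; first by rewrite -OSN mulnC.
  have /translP[_ [m uE]] : u \in transl by rewrite inE uG fu eqxx orbT.
  have uT : u \in transl by rewrite inE uG fu eqxx orbT.
  have m0 : (m != 0)%R.
    apply: contraNneq u1 => m0; apply/eqP/permP=> -[t'|]; rewrite perm1 ?uE ?m0 ?addr0 //.
    exact: transl_None.
  have u3 : u ^+ 3 = 1.
    by apply/eqP; rewrite -order_dvdn -q3 order_dvdG.
  have /permP/(_ (Some 0%R)) := u3; rewrite !expgS expg0 !permM !perm1 !uE => -[E].
  by apply: (mulIf m0); rewrite mul0r -[RHS]E; ring.
move=> g gG; have [->|g1] := eqVneq g 1; first by rewrite order1.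
have [y gy] := mg_fix hG gG; have d := order_dvd_stab gG gy.
have trans z : y \in orbit 'P G z -> #|'C_G[y | 'P]| = #|'C_G[z | 'P]|.
  move=> yz; have Eyz : orbit 'P G y = orbit 'P G z by apply/esym/orbit_eqP; rewrite // orbit_sym.
  have := OS z; rewrite -(OS y) Eyz => /eqP; rewrite eqn_pmul2l; first by move/eqP.
  exact: ltnW (orb_neq1 hG z).
have [yN|yN] := boolP (y \in orbit 'P G None).
  by rewrite -qn6 qn -[#|st|](trans _ yN) d.
have [yx|yx] := boolP (y \in orbit 'P G x).
  by rewrite -m5 -(trans _ yx) d orbT.
move/eqP: R2; rewrite sum_nat_eq0 => /forallP/(_ y); rewrite !inE yN yx /= W // subn_eq0.
have o1 : (1 < #[g])%N by rewrite order_gt1.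
by have := leq_trans o1 (dvdn_leq (cardG_gt0 _) d); rewrite ltnNge => /negP.
Qed.

End Irregular.

(** * Subfields, and groups with an orbit that is a projective line over a subfield *)

Section Subfield.
Variable F : finFieldType.
Implicit Types (B : {set F}) (M : 'M[F]_2).

Record subfield B : Prop := Subfield {
  sf1 : 1 \in B;
  sfB : forall x y, x \in B -> y \in B -> x - y \in B;
  sfM : forall x y, x \in B -> y \in B -> x * y \in B;
  sfV : forall x, x \in B -> x^-1 \in B }.

Lemma sf0 B : subfield B -> 0 \in B.
Proof. by move=> sB; rewrite -(subrr 1) sfB ?sf1. Qed.
Lemma sfN B x : subfield B -> x \in B -> - x \in B.
Proof. by move=> sB xB; rewrite -sub0r sfB ?sf0. Qed.
Lemma sfD B x y : subfield B -> x \in B -> y \in B -> x + y \in B.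
Proof. by move=> sB xB yB; rewrite -[y]opprK sfB ?sfN. Qed.
Lemma sfX B x n : subfield B -> x \in B -> x ^+ n \in B.
Proof. by move=> sB xB; elim: n => [|n IH]; rewrite ?sf1 // exprS sfM. Qed.

Definition psl_over B : {set {perm option F}} :=
  [set mobp M | M in [pred M : 'M[F]_2 | (\det M == 1) && [forall i, forall j, M i j \in B]]].

Lemma psl_overP B s : reflect (exists M, [/\ \det M = 1, forall i j, M i j \in B & s = mobp M])
  (s \in psl_over B).
Proof.
apply: (iffP imsetP) => [[M]|[M [dM MB ->]]].
  rewrite inE => /andP[/eqP dM /forallP MB] ->; exists M; split=> // i j.
  exact: (forallP (MB i)).
by exists M => //; rewrite inE dM eqxx; apply/forallP=> i; apply/forallP.
Qed.

(* Every element of SL_2 is a product of elementary matrices. *)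
Lemma sl2_elementary B (P : 'M[F]_2 -> Prop) : subfield B ->
  (forall M N, \det M = 1 -> \det N = 1 -> P M -> P N -> P (M *m N)) ->
  (forall b, b \in B -> P (mx2 1 0 b 1)) -> (forall b, b \in B -> P (mx2 1 b 0 1)) ->
  forall M, \det M = 1 -> (forall i j, M i j \in B) -> P M.
Proof.
move=> sB PM Pl Pu; have dl b : \det (mx2 1 0 b 1 : 'M[F]_2) = 1.
  by rewrite det_mx2; ring.
have du b : \det (mx2 1 b 0 1 : 'M[F]_2) = 1 by rewrite det_mx2; ring.
have main M : \det M = 1 -> (forall i j, M i j \in B) -> M 0 1 != 0 -> P M.
  move=> dM MB b0.
  have -> : M = mx2 1 0 ((M 1 1 - 1) / M 0 1) 1 *m mx2 1 (M 0 1) 0 1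
                *m mx2 1 0 ((M 0 0 - 1) / M 0 1) 1.
    have cE : M 1 0 = (M 0 0 * M 1 1 - 1) / M 0 1 by rewrite -dM det2E; field.
    by rewrite !mul_mx2; apply: mx2P; rewrite !mx2E ?cE; first [ring | field].
  have HB x : x \in B -> (x - 1) / M 0 1 \in B.
    by move=> xB; apply: sfM; rewrite ?sfV ?sfB ?sf1.
  apply: (PM); rewrite ?det_mulmx ?dl ?du ?mulr1 //; last by apply: Pl; apply: HB.
  by apply: (PM); rewrite ?dl ?du //; [apply: Pl; apply: HB | apply: Pu].
move=> M dM MB; have [b0|b0] := eqVneq (M 0 1) 0; last exact: main.
have a0 : M 0 0 != 0.
  apply: contra_eq_neq dM => a0; by rewrite det2E b0 a0 !mul0r subrr eq_sym oner_neq0.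
have -> : M = (M *m mx2 1 1 0 1) *m mx2 1 (-1) 0 1.
  by rewrite -mulmxA mul_mx2; apply: mx2P; rewrite mul2E !mx2E; ring.
apply: (PM); rewrite ?det_mulmx ?du ?mulr1 //; last by apply: Pu; rewrite sfN ?sf1.
apply: main; first by rewrite det_mulmx dM du mulr1.
  move=> i j; rewrite mul2E sfD // sfM //; case: j => [[|[|j]] lj] //; rewrite !mxE /=;
  by rewrite ?sf1 ?sf0.
by rewrite mul2E !mx2E b0 mul0r addr0 mulr1.
Qed.

End Subfield.

Lemma some_injective (T : Type) : injective (@Some T).
Proof. by move=> x y []. Qed.

(* A subset containing 1 that is closed under subtraction and under the harmonic
   sum x y / (x + y) is a subfield: a (1 - a) / 1 gives squares, and
   b - b^2 / s gives b^2 / s. *)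
Lemma harmonic_subfield (F : finFieldType) (B : {set F}) : 1 \in B ->
  (forall x y, x \in B -> y \in B -> x - y \in B) ->
  (forall x y, x \in B -> y \in B -> x != 0 -> x + y != 0 -> x * y / (x + y) \in B) ->
  subfield B.
Proof.
move=> B1 BB BH; have B0 : 0 \in B by rewrite -(subrr 1) BB.
have BN x : x \in B -> - x \in B by rewrite -sub0r; exact: BB.
have BD x y : x \in B -> y \in B -> x + y \in B by move=> xB /BN; rewrite -{2}[y]opprK; apply: BB.
have Bq b s : b \in B -> s \in B -> s != 0 -> b ^+ 2 / s \in B.
  move=> bB sB s0; have [->|b0] := eqVneq b 0; first by rewrite expr0n mul0r.
  have -> : b ^+ 2 / s = b - b * (s - b) / (b + (s - b)) by field; rewrite addrC subrK.
  apply: (BB) => //; apply: BH => //; first exact: BB.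
  by have -> : b + (s - b) = s by ring.
have BV x : x \in B -> x^-1 \in B.
  move=> xB; have [->|x0] := eqVneq x 0; first by rewrite invr0.
  by have := Bq 1 x B1 xB x0; rewrite expr1n mul1r.
have B2 b s : b \in B -> s \in B -> b ^+ 2 * s \in B.
  move=> bB sB; have [->|s0] := eqVneq s 0; first by rewrite mulr0.
  by rewrite -[s]invrK; apply: Bq; rewrite ?BV ?invr_eq0.
split=> // x y xB yB.
have Bxy2 : x * y *+ 2 \in B.
  have -> : x * y *+ 2 = (x + 1) ^+ 2 * y - x ^+ 2 * y - y by ring.
  by rewrite !BB ?B2 // BD.
have [p pr pF] := finPcharP F.
have BM z n : z \in B -> z *+ n \in B.
  by move=> zB; elim: n => [|n IH]; rewrite ?mulr0n // mulrS BD.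
(* In characteristic 2 squaring permutes B, so x is the square of an element of B. *)
have [p2|p2] := eqVneq p 2%N.
  have inj : {in B &, injective (fun z => z ^+ 2)}.
    move=> a b _ _ /eqP; rewrite -subr_eq0 subr_sqr mulf_eq0 subr_eq0.
    have char2 : (2%:R : F) = 0 by rewrite -p2 pcharf0.
    case/orP=> /eqP // ab; apply/eqP; rewrite -subr_eq0.
    have -> : a - b = a + b - b * 2%:R by ring.
    by rewrite ab char2 mulr0 subrr.
  have sq : [set z ^+ 2 | z in B] = B.
    apply/eqP; rewrite eqEcard card_in_imset // leqnn andbT.
    apply/subsetP=> t /imsetP[z zB tE].
    by have := B2 z 1 zB B1; rewrite mulr1 -tE.
  by move: xB; rewrite -{1}sq => /imsetP[z zB ->]; apply: B2.
(* In odd characteristic multiplication by (p + 1) / 2 undoes the doubling. *)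
have op : odd p by case: (even_prime pr) p2 => [->|].
have : x * y *+ 2 *+ (p.+1)./2 \in B by apply: BM.
rewrite -mulrnA mul2n -[X in _ *+ X]/((p.+1)./2.*2) even_halfK ?mulrS /= ?op //.
by rewrite mulrn_pchar // addr0.
Qed.

Lemma transl0_form (F : finFieldType) (s : {perm option F}) (b : F) : b != 0 ->
  s \in psl_set F -> fixpts s = [set Some 0] -> s None = Some b -> s = mobp (mx2 1 b^-1 0 1).
Proof.
move=> b0 /psl_setP[M dM ->] fs; have dM0 : \det M != 0 by rewrite dM oner_neq0.
have E x : (mob M x == x) = (x == Some 0).
  by have := in_set1 x (Some 0); rewrite -fs inE mobpE.
have := dM; rewrite mobpE // det2E => {}dM; rewrite /= /proj_pt.
case: eqP => // /eqP m01 [bE].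
have m10 : M 1 0 = 0.
  have := E (Some 0); rewrite eqxx /= /proj_pt !mul0r !add0r => /eqP.
  case: eqP => // /eqP m11 [] /eqP; rewrite mulf_eq0 invr_eq0 (negbTE m11) orbF.
  by move/eqP.
rewrite m10 mulr0 subr0 in dM.
have m00 : M 0 0 != 0 by apply: contra_eq_neq dM => ->; rewrite mul0r eq_sym oner_neq0.
have eqd : M 0 0 = M 1 1.
  have : mob M (Some ((M 0 0 - M 1 1) / M 0 1)) == Some ((M 0 0 - M 1 1) / M 0 1).
    by rewrite /= /proj_pt m10 addr0 divfK // subrK (negbTE m00) mulfK.
  rewrite E => /eqP[] /eqP.
  by rewrite mulf_eq0 invr_eq0 (negbTE m01) orbF subr_eq0 => /eqP.
rewrite -bE invf_div; set N := mx2 _ _ _ _.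
have -> : M = M 0 0 *: N.
  by apply: mx2P; rewrite /N scale_mx2 !mx2E ?m10 -?eqd ?mulr0 ?mulr1 //; field.
by rewrite mobpZ // det_mx2 mulr0 mulr1 subr0 oner_neq0.
Qed.

Section Normalized.
Variables (F : finFieldType) (G : {group {perm option F}}).
Hypothesis hG : moebius_group G.
Local Notation O := (orbit 'P G None).
Local Notation T := (transl G).
Variables u w : {perm option F}.
Hypotheses (uG : u \in G) (uE : forall t, u (Some t) = Some (t + 1)).
Hypotheses (wG : w \in G) (wE : w None = Some 0).
Hypothesis cardO : #|O| = #|T|.+1.

Let B : {set F} := [set b | Some b \in O].

Lemma normO g x : g \in G -> (g x \in O) = (x \in O).
Proof. by move=> gG; rewrite -[g x]/('P%act x g) orbit_actr. Qed.

Lemma normO_None : None \in O. Proof. exact: orbit_refl. Qed.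

Lemma norm0 : 0 \in B.
Proof. by rewrite inE -wE normO // normO_None. Qed.

Lemma card_B : #|B| = #|T|.
Proof.
apply/eqP; rewrite -eqSS -cardO (cardsD1 None) normO_None add1n eqSS.
rewrite -(card_imset B (@some_injective F)); apply/eqP/eq_card=> -[b|].
  by rewrite mem_imset ?inE //; exact: some_injective.
by rewrite !inE; apply/imsetP=> -[].
Qed.

(** Evaluation at 0 embeds the translations into B, and both sets have the same size because the
    orbit has one point more than there are translations. *)
Lemma norm_transl b : b \in B -> exists2 g, g \in T & forall t, g (Some t) = Some (t + b).
Proof.
pose m (g : {perm option F}) : F := odflt 0 (g (Some 0)).
have mE g : g \in T -> forall t, g (Some t) = Some (t + m g).
  by move=> /translP[//|_ [m' gE]] t; rewrite /m !gE /= add0r.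
suff <- : m @: T = B by case/imsetP=> g gT ->; exists g => //; exact: mE.
apply/eqP; rewrite eqEcard card_B card_in_imset ?leqnn ?andbT.
  apply/subsetP=> _ /imsetP[g gT ->]; have gG : g \in G by move: gT; rewrite inE => /andP[].
  by rewrite inE -[m g]add0r -mE // normO //; have := norm0; rewrite inE.
move=> g h gT hT E; apply/permP=> -[t|]; first by rewrite !mE // E.
by rewrite (transl_None gT) (transl_None hT).
Qed.

Lemma normD x y : x \in B -> y \in B -> x + y \in B.
Proof.
move=> xB /norm_transl[g gT gE]; have gG : g \in G by move: gT; rewrite inE => /andP[].
by rewrite inE -gE normO //; move: xB; rewrite inE.
Qed.

Lemma normB x y : x \in B -> y \in B -> x - y \in B.
Proof.
move=> xB /norm_transl[g gT gE]; have gG : g \in G by move: gT; rewrite inE => /andP[].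
by rewrite inE -(normO _ gG) gE subrK; move: xB; rewrite inE.
Qed.

Lemma norm1 : 1 \in B.
Proof. by rewrite inE -[1]add0r -uE normO //; have := norm0; rewrite inE. Qed.

(** As w carries [None] to 0, a suitable translation conjugated by w has 0 as its only fixed point
    and sends [None] to b. *)
Lemma norm_opp b : b \in B -> b != 0 -> mobp (mx2 1 b^-1 0 1) \in G.
Proof.
move=> bB b0.
have wV : (w^-1)%g \in G by rewrite groupV.
have pre x : x != Some 0 -> x \in O -> exists2 z, z \in B & (w^-1)%g x = Some z.
  move=> x0 xO; case E : ((w^-1)%g x) => [z|].
    by exists z => //; rewrite inE -E normO.
  by case/eqP: x0; rewrite -wE -E permKV.
have [z0 z0B z0E] := pre None isT normO_None.
have [|//|z1 z1B z1E] := pre (Some b); first by rewrite (inj_eq (@some_injective F)).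
  by move: bB; rewrite inE.
have [g gT gE] := norm_transl (normB z1B z0B).
have gG : g \in G by move: gT; rewrite inE => /andP[].
have sN : (g ^ w)%g None = Some b.
  by rewrite conjgE !permM z0E gE addrC subrK -z1E permKV.
have sG : (g ^ w)%g \in G by rewrite groupJ.
suff fs : fixpts (g ^ w) = [set Some 0].
  by rewrite -(transl0_form b0 (subsetP (mg_psl hG) _ sG) fs sN).
rewrite fixptsJ; have -> : fixpts g = [set None].
  apply: (transl_fixpts (transl_None gT) gE).
  by apply: contra_eq_neq sN => ->; rewrite conj1g perm1.
by rewrite imset_set1 wE.
Qed.

(** The element of [norm_opp] attached to x sends y to x y / (x + y), so B is closed under the
    harmonic sum. *)
Lemma norm_subfield : subfield B.
Proof.
apply: harmonic_subfield; [exact: norm1 | exact: normB |].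
move=> x y xB yB x0 xy0; have sG := norm_opp xB x0.
have : mobp (mx2 1 x^-1 0 1) (Some y) \in O.
  by rewrite normO //; move: yB; rewrite inE.
rewrite mobpE ?det_mx2 ?mulr0 ?mulr1 ?subr0 ?oner_neq0 // /= !mx2E /proj_pt.
have e : y / x + 1 != 0.
  have -> : y / x + 1 = (x + y) / x by field.
  by rewrite mulf_neq0 ?invr_eq0.
rewrite (negbTE e) inE; congr (Some _ \in O); field.
by rewrite x0 xy0.
Qed.

Lemma psl_over_group_set (C : {set F}) : subfield C -> group_set (psl_over C).
Proof.
move=> sC; apply/group_setP; split.
  apply/psl_overP; exists 1%:M; rewrite det1 mobp1; split=> // i j.
  by rewrite mxE; case: (_ == _); rewrite ?sf0 ?sf1.
move=> s t /psl_overP[M [dM MB ->]] /psl_overP[N [dN NB ->]]; apply/psl_overP.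
exists (M *m N); rewrite det_mulmx dM dN mulr1 mobpM ?dM ?dN ?oner_neq0 //; split=> // i j.
by rewrite mul2E sfD // sfM.
Qed.

Lemma proj_pt_rational a b : proj_pt a b \in O -> (a != 0) || (b != 0) ->
  exists l u v : F, [/\ l != 0, u \in B, v \in B, a = l * u & b = l * v].
Proof.
have sB := norm_subfield; rewrite /proj_pt; have [-> _|b0 ab _] := eqVneq b 0.
  by rewrite orbF => a0; exists a, 1, 0; rewrite sf1 ?sf0 // mulr1 mulr0.
by exists b, (a / b), 1; rewrite sf1 // inE ab mulr1 mulrC divfK.
Qed.

(** G preserves the projective line over B, and a linear map is determined up to a scalar by the
    images of the three points [None], 0 and 1. *)
Lemma rational_multiple (M : 'M[F]_2) : \det M = 1 -> mobp M \in G ->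
  exists (l : F) (N : 'M[F]_2), [/\ forall i j, N i j \in B & M = l *: N].
Proof.
have sB := norm_subfield; move=> dM gM; have dM0 : \det M != 0 by rewrite dM oner_neq0.
have row r s : (r != 0) || (s != 0) -> proj_pt r s \in O ->
    exists l p q : F, [/\ l != 0, p \in B, q \in B, r * M 0 0 + s * M 1 0 = l * p
      & r * M 0 1 + s * M 1 1 = l * q].
  move=> uv; rewrite -(normO _ gM) mobpE // mob_proj_pt // => O1.
  by apply: proj_pt_rational => //; apply: det_row_neq0.
have [||l1 [u1 [v1 [l10 u1B v1B]]]] := row 1 0; rewrite ?oner_neq0 //.
  by rewrite /proj_pt eqxx normO_None.
have [||l2 [u2 [v2 [l20 u2B v2B]]]] := row 0 1; rewrite ?oner_neq0 ?orbT //.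
  by rewrite /proj_pt oner_eq0 mul0r; have := norm0; rewrite inE.
have [||l3 [u3 [v3 [l30 u3B v3B]]]] := row 1 1; rewrite ?oner_neq0 ?orbT //.
  by rewrite /proj_pt oner_eq0 divr1; have := norm1; rewrite inE.
rewrite !mul1r !mul0r !add0r !addr0 => e3 e3' e2 e2' e1 e1'.
move: dM; rewrite det2E e1 e1' e2 e2' => dM.
have D0 : u1 * v2 - u2 * v1 != 0.
  apply: contra_eq_neq dM => D.
  have -> : l1 * u1 * (l2 * v2) - l1 * v1 * (l2 * u2) = l1 * l2 * (u1 * v2 - u2 * v1) by ring.
  by rewrite D mulr0 eq_sym oner_neq0.
rewrite e1 e2 in e3; rewrite e1' e2' in e3'.
have E1 : l1 = l3 * ((u3 * v2 - v3 * u2) / (u1 * v2 - u2 * v1)).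
  apply: (mulIf D0); rewrite mulrA divfK //.
  have -> : l1 * (u1 * v2 - u2 * v1) = (l1 * u1 + l2 * u2) * v2 - (l1 * v1 + l2 * v2) * u2 by ring.
  by rewrite e3 e3'; ring.
have E2 : l2 = l3 * ((u1 * v3 - v1 * u3) / (u1 * v2 - u2 * v1)).
  apply: (mulIf D0); rewrite mulrA divfK //.
  have -> : l2 * (u1 * v2 - u2 * v1) = u1 * (l1 * v1 + l2 * v2) - v1 * (l1 * u1 + l2 * u2) by ring.
  by rewrite e3 e3'; ring.
move: E1 E2; set f1 := _ / _; set f2 := _ / _ => E1 E2.
have [f1B f2B] : f1 \in B /\ f2 \in B.
  by rewrite /f1 /f2; split; apply: sfM; rewrite ?sfV //; apply: sfB; rewrite ?sfM.
exists l3, (mx2 (f1 * u1) (f1 * v1) (f2 * u2) (f2 * v2)); split.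
  by move=> i j; rewrite mxE; case: eqP => _; case: eqP => _; apply: sfM.
by apply: mx2P; rewrite scale_mx2 !mx2E mulrA -?E1 -?E2.
Qed.

(** The sign is chosen so that N^k = 1 for the odd order k, and N = l N0 with N0 over B. The
    determinant puts l^2 in B and the power puts l^k in B, hence l itself. *)
Lemma odd_rational g : g \in G -> odd #[g]%g -> g \in psl_over B.
Proof.
have sB := norm_subfield; move=> gG og.
have /psl_setP[M dM gE] := subsetP (mg_psl hG) _ gG.
have dX (N : 'M[F]_2) n : \det N = 1 -> \det (N ^+ n : 'M[F]_2) = 1 by move=> dN; elim: n => [|n IH]; rewrite ?expr0 ?det1 // exprS -mulmxE det_mulmx dN IH mulr1.
have mX (N : 'M[F]_2) n : \det N = 1 -> mobp (N ^+ n) = (mobp N ^+ n)%g.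
  move=> dN; elim: n => [|n IH]; first by rewrite expr0 mobp1.
  have h : \det (N ^+ n) != 0 by rewrite dX // oner_neq0.
  have h' : \det N != 0 by rewrite dN oner_neq0.
  by rewrite exprS expgS -IH; exact: mobpM h' h.
have [N [dN NE NX]] : exists N : 'M[F]_2, [/\ \det N = 1, g = mobp N & N ^+ #[g]%g = 1%:M].
  have := mX M #[g]%g dM; rewrite -gE expg_order -mobp1 => /mobp_inj.
  rewrite det1 dX // => /(_ erefl erefl)[E|E]; first by exists M.
  exists (- M); rewrite -scaleN1r det2Z sqrrN expr1n mul1r dM scaleN1r mobpN ?dM ?oner_neq0 //.
  by split=> //; rewrite exprNn -signr_odd og expr1 mulN1r E opprK.
have [l [N0 [N0B NE0]]] : exists (l : F) (N0 : 'M[F]_2), [/\ forall i j, N0 i j \in B & N = l *: N0].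
  by apply: rational_multiple; rewrite -?NE.
have N0X n : forall i j, (N0 ^+ n) i j \in B.
  elim: n => [|n IH] i j; first by rewrite expr0 mxE; case: (_ == _); rewrite ?sf0 ?sf1.
  by rewrite exprS -mulmxE mul2E sfD // sfM.
have l2 : l ^+ 2 \in B.
  have : l ^+ 2 * \det N0 = 1 by rewrite -det2Z -NE0.
  have dB : \det N0 \in B by rewrite det2E sfB // sfM.
  have [d0|d0 E] := eqVneq (\det N0) 0; first by rewrite d0 mulr0 => /eqP; rewrite eq_sym oner_eq0.
  by rewrite -[_ ^+ 2](mulfK d0) E mul1r sfV.
have lk : l ^+ #[g]%g \in B.
  have : l ^+ #[g]%g * (N0 ^+ #[g]%g) 0 0 = 1.
    by have := congr1 (fun A : 'M[F]_2 => A 0 0) NX; rewrite NE0 exprZn !mxE.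
  set e := (N0 ^+ _) 0 0 => E; have eB : e \in B by apply: N0X.
  have [e0|e0] := eqVneq e 0; first by move: E; rewrite e0 mulr0 => /eqP; rewrite eq_sym oner_eq0.
  by rewrite -[_ ^+ _](mulfK e0) E mul1r sfV.
have lB : l \in B.
  have l0 : l != 0.
    apply: contra_eq_neq dN => l0; by rewrite NE0 l0 scale0r det0 eq_sym oner_neq0.
  have -> : l = l ^+ #[g]%g / (l ^+ 2) ^+ (#[g]%g)./2.
    rewrite -[in X in X / _](odd_double_half #[g]%g) og -mul2n exprD exprM expr1 mulfK //.
    by rewrite !expf_neq0.
  by rewrite sfM // sfV // sfX.
apply/psl_overP; exists N; split=> // i j; rewrite NE0 mxE sfM //.
Qed.

Lemma normalized_psl_over : G = psl_over B :> {set _}.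
Proof.
have sB := norm_subfield; apply/eqP; rewrite eqEsubset; apply/andP; split.
  rewrite {1}(mg_odd hG) -[psl_over B]/(gval (Group (psl_over_group_set sB))) gen_subG.
  by apply/subsetP=> g; rewrite inE => /andP[gG og]; apply: odd_rational.
apply/subsetP=> g /psl_overP[M [dM MB ->]].
apply: (sl2_elementary (P := fun M => mobp M \in G) sB) dM MB.
- by move=> N N' dN dN' PN PN'; rewrite mobpM ?dN ?dN' ?oner_neq0 // groupM.
- move=> b bB; have [g' gT gE] := norm_transl bB.
  suff <- : g' = mobp (mx2 1 0 b 1) by move: gT; rewrite inE => /andP[].
  have d1 : \det (mx2 1 0 b 1) != 0 by rewrite det_mx2 mul0r mulr1 subr0 oner_neq0.
  apply/permP=> -[t|]; rewrite mobpE //= !mx2E /proj_pt ?eqxx ?(transl_None gT) //.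
  by rewrite mulr0 add0r oner_eq0 divr1 mulr1 gE.
- move=> b bB; have [->|b0] := eqVneq b 0.
    have -> : mx2 1 0 0 1 = 1%:M :> 'M[F]_2 by rewrite mx2_1.
    by rewrite mobp1 group1.
  have bV0 : b^-1 != 0 by rewrite invr_eq0.
  by have := norm_opp (sfV sB bB) bV0; rewrite invrK.
Qed.

End Normalized.

(** * The possible images up to conjugacy *)

Section DicksonTheorem.
Variable F : finFieldType.
Implicit Types (G : {group {perm option F}}) (H : 'M[F]_2).

Lemma moebius_group_conj G H : \det H != 0 -> moebius_group G ->
  moebius_group (G :^ mobp H)%G.
Proof.
move=> dH hG; split.
- apply/subsetP=> _ /imsetP[g gG ->]; apply: psl_conj => //.
  exact: (subsetP (mg_psl hG)).
- move=> _ /imsetP[g gG ->]; have [x gx] := mg_fix hG gG.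
  by exists (mobp H x); rewrite conjgE !permM permK gx.
- rewrite /= {1}(mg_odd hG) -genJ; congr <<_>>%g; apply/setP=> g.
  by rewrite mem_conjg !inE -!mem_conjgV invgK orderJ mem_conjg.
- by rewrite /= derJ (mg_perfect hG).
- by rewrite cardJg (mg_15 hG).
Qed.

Lemma dickson G : moebius_group G ->
  (exists H B, [/\ \det H != 0, subfield B & (G :^ mobp H)%g = psl_over B]) \/
  (#|G| = 60%N /\
   ((forall g, g \in G -> #[g]%g \in [:: 1; 2; 3; 5]%N) \/
    (3%:R = 0 :> F /\ forall g, g \in G -> (#[g]%g %| 6)%N || (#[g]%g %| 5)%N))).
Proof.
move=> hG; have [/exists_inP[v vG v1]|] := boolP [exists v in G^#%g, #|fixpts v| == 1%N]; last first.
  move/exists_inPn => no1; right.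
  have [g60 ord] : #|G| = 60%N /\ forall g, g \in G -> #[g]%g \in [:: 1; 2; 3; 5]%N.
    apply: dickson_regular => // g gG; case: (fixpts_card hG gG) => // /eqP g1.
    by have := no1 g gG; rewrite g1.
  by split=> //; left.
have /cards1P[x fv] := v1.
have [H1 dH1 Hx] := move_to_None x.
move: vG; rewrite !inE => /andP[vn1 vG].
have hG1 := moebius_group_conj dH1 hG.
set G1 := (G :^ mobp H1)%G in hG1.
have v1G : (v ^ mobp H1)%g \in G1 by rewrite memJ_conjg.
have v11 : (v ^ mobp H1)%g != 1%g by rewrite conjg_eq1.
have fv1 : fixpts (v ^ mobp H1) = [set None].
  by rewrite fixptsJ fv imset_set1 mobpE // Hx.
have [m v1E] := fixpts_transl (subsetP (mg_psl hG1) _ v1G) fv1.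
move: v1G v11 fv1 v1E; move: (v ^ mobp H1)%g => v' v1G v11 fv1 v1E.
have m0 : m != 0.
  apply: contraNneq v11 => m0; apply/eqP/permP=> -[t|]; rewrite perm1 ?v1E ?m0 ?addr0 //.
  by apply/eqP; have := set11 (None : option F); rewrite -fv1 inE.
have [g gG1 gN] := mg_no_fixpt hG1 None.
case E : (g None) gN => [y|] // _.
(* The map t to (t - y) / m turns the translation by m into the translation by 1 and moves y, the
   image of infinity under g, to 0. *)
pose H2 := mx2 m^-1 0 (- y / m) 1 : 'M[F]_2.
have dH2 : \det H2 != 0 by rewrite det_mx2 mulr1 mul0r subr0 invr_eq0.
have H2E t : mobp H2 (Some t) = Some ((t - y) / m).
  rewrite mobpE //= !mx2E /proj_pt mulr0 add0r oner_eq0 divr1; congr (Some _).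
  by rewrite mulrBl mulNr.
have H2N : mobp H2 None = None by rewrite mobpE //= !mx2E /proj_pt eqxx.
have H2V t : (mobp H2)^-1%g (Some t) = Some (t * m + y).
  by apply: (@perm_inj _ (mobp H2)); rewrite permKV H2E addrK mulfK.
have H2NV : (mobp H2)^-1%g None = None.
  by apply: (@perm_inj _ (mobp H2)); rewrite permKV H2N.
have hG2 := moebius_group_conj dH2 hG1.
set G2 := (G1 :^ mobp H2)%G in hG2.
have gJ : G2 = (G :^ mobp (H1 *m H2))%G by apply: val_inj; rewrite /= mobpM // conjsgM.
have dH : \det (H1 *m H2) != 0 by rewrite det_mulmx mulf_neq0.
pose u := (v' ^ mobp H2)%g; pose w := (g ^ mobp H2)%g.
have uG : u \in G2 by rewrite memJ_conjg.
have wG : w \in G2 by rewrite memJ_conjg.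
have uE t : u (Some t) = Some (t + 1).
  by rewrite /u conjgE !permM H2V v1E H2E; congr (Some _); field.
have wN : w None = Some 0.
  by rewrite /w conjgE !permM H2NV E H2E subrr mul0r.
have u1 : u != 1%g by rewrite conjg_eq1.
have fu : fixpts u = [set None] by rewrite fixptsJ fv1 imset_set1 H2N.
have [cO|[g60 F3 ord]] := dickson_irregular hG2 uG u1 fu; last first.
  right; have c : #|G| = #|G2| by rewrite gJ cardJg.
  rewrite c; split=> //; right; split=> // k kG.
  by rewrite -(orderJ k (mobp (H1 *m H2))); apply: ord; rewrite gJ memJ_conjg.
left; exists (H1 *m H2), [set b | Some b \in orbit 'P G2 None]; split=> //.
  exact: (norm_subfield hG2 uG uE wG wN cO).
by rewrite -(normalized_psl_over hG2 uG uE wG wN cO) gJ.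
Qed.

End DicksonTheorem.

From mathcomp Require Import boolp classical_sets functions cardinality.
From mathcomp Require Import zify ring.
Local Open Scope group_scope.

(** * Universal properties of Gamma and Delta *)

Section MorphismFacts.
Variables (G H : groupType) (f : G -> H).
Hypothesis fM : {morph f : x y / x * y}.

Lemma gmorph1 : f 1 = 1.
Proof. by apply: (mulgI (f 1)); rewrite -fM !mulg1. Qed.
Lemma gmorphV x : f x^-1 = (f x)^-1.
Proof. by apply: (mulgI (f x)); rewrite -fM !mulgV gmorph1. Qed.
Lemma gmorphX x n : f (x ^+ n) = f x ^+ n.
Proof. by elim: n => [|n IH]; rewrite ?expg0 ?gmorph1 // !expgS fM IH. Qed.

Lemma ker_J x y : f x = 1 -> f (x ^ y) = 1.
Proof. by move=> fx; rewrite conjgE !fM fx mul1g -fM mulVg gmorph1. Qed.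

Definition kernel : normal_subgroup G.
exists (fun x => f x = 1).
- exact: gmorph1.
- by move=> x y fx fy; rewrite fM fx fy mulg1.
- by move=> x fx; rewrite gmorphV fx invg1.
- exact: ker_J.
Defined.

End MorphismFacts.

Lemma Gamma_lift (H : groupType) (h : 'I_4 -> H) :
  (forall r, r \in relators_353 (h (inord 0)) (h (inord 1)) (h (inord 2)) (h (inord 3)) ->
     r = 1) ->
  exists f : Gamma -> H, {morph f : x y / x * y} /\ forall i, f (Gamma_gen i) = h i.
Proof.
move=> rel; have lM := @free_liftM _ _ h.
have lK x : normal_closure [set x | x \in relators_353 (free_gen4 0) (free_gen4 1)
                                  (free_gen4 2) (free_gen4 3)]%classic x -> free_lift h x = 1.
  move/(_ (kernel lM)); apply => r rR.
  suff : free_lift h r \in relators_353 (h (inord 0)) (h (inord 1)) (h (inord 2)) (h (inord 3)).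
    exact: rel.
  have -> : relators_353 (h (inord 0)) (h (inord 1)) (h (inord 2)) (h (inord 3)) =
    map (free_lift h) (relators_353 (free_gen4 0) (free_gen4 1) (free_gen4 2) (free_gen4 3)).
    by rewrite /= !(gmorphX lM) !lM !free_lift_gen.
  exact: map_f.
exists (quot_lift (free_lift h)); split; first exact: quot_liftM lM lK.
by move=> i; rewrite [LHS](quot_liftE lM lK) free_lift_gen.
Qed.

Lemma even_pair i j : Gamma_gen i * Gamma_gen j \in even_in_Gamma.
Proof.
by apply/asboolP; exists [:: i; j]; rewrite big_cons big_seq1.
Qed.
Definition Delta_pair i j : Delta := MkDelta (even_pair i j).
Definition alpha := Delta_pair (inord 0) (inord 1).
Definition beta := Delta_pair (inord 1) (inord 2).
Definition gamma := Delta_pair (inord 2) (inord 3).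

Lemma Delta_valM (x y : Delta) : Delta_val (x * y) = Delta_val x * Delta_val y.
Proof. exact: erefl. Qed.
Lemma Delta_val1 : Delta_val 1 = 1.
Proof. by apply: (mulgI (Delta_val 1)); rewrite -Delta_valM !mulg1. Qed.
Lemma Delta_val_inj : injective Delta_val. Proof. exact: val_inj. Qed.

Lemma Gamma_genK i x : Gamma_gen i * (Gamma_gen i * x) = x.
Proof. by rewrite mulgA Gamma_gen2 mul1g. Qed.

Lemma Delta_pairM i j k : Delta_pair i j * Delta_pair j k = Delta_pair i k.
Proof.
by apply: Delta_val_inj; rewrite Delta_valM /= -mulgA Gamma_genK.
Qed.

Lemma Delta_pair_id i : Delta_pair i i = 1.
Proof. by apply: Delta_val_inj; rewrite Delta_val1 [LHS]Gamma_gen2. Qed.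

Lemma Delta_pairV i j : (Delta_pair i j)^-1 = Delta_pair j i.
Proof. by apply: (mulgI (Delta_pair i j)); rewrite mulgV Delta_pairM Delta_pair_id. Qed.

(** An even word is a product of pairs, a pair ij is (i0)(0j), and the pairs with 0 are products of
    alpha, beta, gamma or of their inverses. *)
Lemma Delta_ind (P : Delta -> Prop) : P 1 ->
  (forall x, P x -> [/\ P (alpha * x), P (beta * x) & P (gamma * x)]) ->
  (forall x, P x -> [/\ P (alpha^-1 * x), P (beta^-1 * x) & P (gamma^-1 * x)]) ->
  forall x, P x.
Proof.
move=> P1 Pg PV.
have P0 (j : 'I_4) x : P x -> P (Delta_pair (inord 0) j * x) /\ P (Delta_pair j (inord 0) * x).
  rewrite -[j]inord_val; case: j => [[|[|[|[|k]]]] lk] //= Px.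
  - by rewrite Delta_pair_id mul1g.
  - by rewrite -(Delta_pairV (inord 0)); split; [case: (Pg x Px) | case: (PV x Px)].
  - rewrite -(Delta_pairV (inord 0)) -(Delta_pairM (inord 0) (inord 1)) invgM -!mulgA; split.
      by have [_ /Pg[]] := Pg x Px.
    by have [/PV[]] := PV x Px.
  - rewrite -(Delta_pairV (inord 0)) -(Delta_pairM (inord 0) (inord 1)).
    rewrite -(Delta_pairM (inord 1) (inord 2)) !invgM -!mulgA; split.
      by have [_ _ /Pg[_ /Pg[]]] := Pg x Px.
    by have [/PV[_ + _] _ _] := PV x Px; case/PV.
have Pp i j x : P x -> P (Delta_pair i j * x).
  by move=> /(P0 j)[/(P0 i)[_]]; rewrite mulgA Delta_pairM.
move=> [x xe]; have /asboolP[s [es xE]] := xe.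
suff main n s' : (size s' <= n)%N -> ~~ odd (size s') -> forall y : Delta,
    Delta_val y = \prod_(i <- s') Gamma_gen i -> P y.
  exact: (main (size s) s).
elim: n s' {x xe s es xE} => [|n IH] [|i [|j s]] //= sz es y yE.
- by rewrite big_nil in yE; rewrite (_ : y = 1) //; apply: Delta_val_inj; rewrite yE Delta_val1.
- by rewrite big_nil in yE; rewrite (_ : y = 1) //; apply: Delta_val_inj; rewrite yE Delta_val1.
have -> : y = Delta_pair i j * (Delta_pair j i * y).
  by rewrite mulgA Delta_pairM Delta_pair_id mul1g.
rewrite negbK in es; apply/Pp/(IH s) => //; first exact: ltnW.
by rewrite Delta_valM yE !big_cons /= -mulgA !Gamma_genK.
Qed.

Section Wreath.
Variable H : groupType.

(* The pair ((x, y), e) stands for (x, y) s ^ e, where s swaps the two factors. *)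
Definition wreath2 : Type := (H * H * bool)%type.
HB.instance Definition _ := Choice.on wreath2.
Definition wr_one : wreath2 := (1, 1, false).
Definition wr_mul (u v : wreath2) : wreath2 :=
  (u.1.1 * (if u.2 then v.1.2 else v.1.1), u.1.2 * (if u.2 then v.1.1 else v.1.2), u.2 (+) v.2).
Definition wr_inv (u : wreath2) : wreath2 :=
  if u.2 then ((u.1.2)^-1, (u.1.1)^-1, true) else ((u.1.1)^-1, (u.1.2)^-1, false).

Lemma wr_mulA : associative wr_mul.
Proof. by move=> [[x y] []] [[x' y'] []] [[x'' y''] []]; rewrite /wr_mul /= !mulgA. Qed.
Lemma wr_mul1g : left_id wr_one wr_mul.
Proof. by move=> [[x y] e]; rewrite /wr_mul /= !mul1g. Qed.
Lemma wr_mulg1 : right_id wr_one wr_mul.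
Proof. by move=> [[x y] []]; rewrite /wr_mul /= !mulg1. Qed.
Lemma wr_mulVg : left_inverse wr_one wr_inv wr_mul.
Proof. by move=> [[x y] []]; rewrite /wr_mul /wr_inv /= !mulVg. Qed.
Lemma wr_mulgV : right_inverse wr_one wr_inv wr_mul.
Proof. by move=> [[x y] []]; rewrite /wr_mul /wr_inv /= !mulgV. Qed.
HB.instance Definition _ := isGroup.Build wreath2
  wr_mulA wr_mul1g wr_mulg1 wr_mulVg wr_mulgV.

Lemma wr_base_X (x y : H) n : ((x, y, false) : wreath2) ^+ n = (x ^+ n, y ^+ n, false).
Proof. by elim: n => [|n IH] //; rewrite !expgS IH. Qed.

Definition relators_Delta (x y z : H) : seq H :=
  [:: x ^+ 3; y ^+ 5; z ^+ 3; (x * y) ^+ 2; (y * z) ^+ 2; (x * y * z) ^+ 2].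

(* Gamma is sent into the wreath product of H by the group of order 2, in such a
   way that Delta lands in the base group, where we project on the first factor. *)
Lemma Delta_lift (x y z : H) : (forall r, r \in relators_Delta x y z -> r = 1) ->
  exists f : Delta -> H, {morph f : u v / u * v} /\
    [/\ f alpha = x, f beta = y & f gamma = z].
Proof.
move=> rel.
have rX : x ^+ 3 = 1 by apply: rel; rewrite !inE eqxx.
have rY : y ^+ 5 = 1 by apply: rel; rewrite !inE eqxx ?orbT.
have rZ : z ^+ 3 = 1 by apply: rel; rewrite !inE eqxx ?orbT.
have rXY : (x * y) ^+ 2 = 1 by apply: rel; rewrite !inE eqxx ?orbT.
have rYZ : (y * z) ^+ 2 = 1 by apply: rel; rewrite !inE eqxx ?orbT.
have rXYZ : (x * y * z) ^+ 2 = 1 by apply: rel; rewrite !inE eqxx ?orbT.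
have J2 (u v : H) n : (u * v) ^+ n = 1 -> (v * u) ^+ n = 1.
  move=> h; have -> : v * u = (u * v) ^ u by rewrite conjgE -mulgA mulKg.
  by rewrite -conjXg h conj1g.
have V2 (u : H) n : u ^+ n = 1 -> (u^-1) ^+ n = 1 by move=> h; rewrite expVgn h invg1.
(* The generator b goes to the bare swap; the other images are forced by asking for x, y, z as first
   coordinates of ab, bc, cd. *)
pose a : wreath2 := (x, x^-1, true).
pose b : wreath2 := (1, 1, true).
pose c : wreath2 := (y^-1, y, true).
pose d : wreath2 := ((y * z)^-1, y * z, true).
pose h (i : 'I_4) : wreath2 := nth 1 [:: a; b; c; d] i.
have wrE (u v : wreath2) : u * v = wr_mul u v by [].
have invs (u v : H) (w : wreath2) n : u ^+ n = 1 -> v ^+ n = 1 -> w = (u, v, false) -> w ^+ n = 1.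
  by move=> un vn ->; rewrite wr_base_X un vn.
have sq (u : H) : ((u^-1, u, true) : wreath2) ^+ 2 = 1.
  by rewrite expgS expg1 wrE /wr_mul /= mulVg mulgV.
have sq' (u : H) : ((u, u^-1, true) : wreath2) ^+ 2 = 1.
  by rewrite expgS expg1 wrE /wr_mul /= mulVg mulgV.
have [|f [fM fg]] := @Gamma_lift wreath2 h.
  rewrite /h !inordK //= => r; rewrite !inE.
  case/or4P=> [/eqP->|/eqP->|/eqP->|]; [exact: sq' | | exact: sq|].
    by rewrite expgS expg1 wrE /wr_mul /= mulg1.
  case/or4P=> [/eqP->|/eqP->|/eqP->|]; first exact: sq.
  - by apply: (invs x x^-1) => //; [exact: V2 | rewrite wrE /wr_mul /= !mulg1].
  - by apply: (invs y y^-1) => //; [exact: V2 | rewrite wrE /wr_mul /= !mul1g].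
  case/or4P=> /eqP->.
  - apply: (invs z (z^-1 ^ y^-1)) => //; first by rewrite -conjXg V2 // conj1g.
    by rewrite wrE /wr_mul /= mulKg conjgE invgK invgM mulgA.
  - apply: (invs (x * y) (x^-1 * y^-1)) => //; by rewrite -invgM V2 // J2.
  - apply: (invs (x * y * z) (x^-1 * (y * z)^-1)) => //; last by rewrite wrE /wr_mul /= mulgA.
    by rewrite -invgM V2 // J2 // mulgA.
  - by apply: (invs (y * z) (y * z)^-1) => //; [exact: V2 | rewrite wrE /wr_mul /= !mul1g].
have fg' k : (k < 4)%N -> f (Gamma_gen (inord k)) = nth 1 [:: a; b; c; d] k.
  by move=> k4; rewrite fg /h inordK.
have fpair i j : (i < 4)%N -> (j < 4)%N -> f (Delta_pair (inord i) (inord j)) =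
    nth 1 [:: a; b; c; d] i * nth 1 [:: a; b; c; d] j.
  by move=> i4 j4; rewrite [LHS]fM !fg'.
have fa : f alpha = (x, x^-1, false) by rewrite fpair // wrE /wr_mul /= !mulg1.
have fb : f beta = (y, y^-1, false) by rewrite fpair // wrE /wr_mul /= !mul1g.
have fc : f gamma = (z, y * (y * z)^-1, false) by rewrite fpair // wrE /wr_mul /= mulKg.
have fV (u : wreath2) : u.2 = false -> (u^-1).2 = false.
  by case: u => [[? ?] []].
have base (u : Delta) : (f u).2 = false.
  move: u; apply: Delta_ind.
  - by rewrite Delta_val1 (gmorph1 fM); exact: erefl.
  - by move=> u uf; split; rewrite Delta_valM fM ?fa ?fb ?fc wrE /wr_mul /= uf.
  - move=> u uf.
    have E (v : Delta) : f (Delta_val v^-1) = (f v)^-1.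
      by apply: (mulgI (f v)); rewrite -fM -Delta_valM !mulgV Delta_val1 (gmorph1 fM).
    by split; rewrite Delta_valM fM E ?fa ?fb ?fc wrE /wr_mul /= uf.
exists (fun u : Delta => (f u).1.1); split; last by split; [rewrite fa|rewrite fb|rewrite fc].
by move=> u v; rewrite -[LHS]/((f (Delta_val (u * v))).1.1) Delta_valM fM wrE /wr_mul /= base.
Qed.

End Wreath.

Lemma Delta_relations r : r \in relators_Delta alpha beta gamma -> r = 1.
Proof.
have E (x : Delta) n : Delta_val x ^+ n = 1 -> x ^+ n = 1.
  move=> h; apply: Delta_val_inj; rewrite Delta_val1 -[RHS]h.
  by elim: n {h} => [|n IH]; rewrite ?expg0 ?Delta_val1 // !expgS Delta_valM IH.
have rel w : w \in relators_353 (Gamma_gen (inord 0)) (Gamma_gen (inord 1))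
  (Gamma_gen (inord 2)) (Gamma_gen (inord 3)) -> w = 1 by exact: Gamma_relations.
rewrite /alpha /beta /gamma /relators_Delta !Delta_pairM !inE.
case/or4P=> [/eqP->|/eqP->|/eqP->|/or3P[]/eqP->]; apply: E; apply: rel;
  by rewrite !inE eqxx ?orbT.
Qed.

Local Close Scope group_scope.

(** * Words of Delta as polynomials in the parameter *)

Section Words.

Definition ev (R : comNzRingType) (c : R) : {poly int} -> R :=
  horner_eval c \o map_poly intr.
HB.instance Definition _ (R : comNzRingType) (c : R) := GRing.RMorphism.on (ev c).

Lemma evX (R : comNzRingType) (c : R) : ev c 'X = c.
Proof. by rewrite /ev /= map_polyX /horner_eval hornerX. Qed.

Lemma ev_morph (R S : comNzRingType) (f : {rmorphism R -> S}) (c : R) P :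
  f (ev c P) = ev (f c) P.
Proof.
rewrite /ev /= /horner_eval -horner_map /= -map_poly_comp; congr (_.[_]).
by apply: eq_map_poly => z /=; rewrite rmorph_int.
Qed.

Record param_hom (F : finFieldType) (c : F) (X Y Z : 'M[F]_2)
    (e : Delta -> {perm option F}) : Prop := ParamHom {
  ph_triple : triple c X Y Z;
  ph_morph : {morph e : u v / (u * v)%g};
  ph_alpha : e alpha = mobp X;
  ph_beta : e beta = mobp Y;
  ph_gamma : e gamma = mobp Z }.

(* The coefficients of a word in X, Y, Z with respect to 1, X, Y, XY are integer
   polynomials in c that depend on the word only. *)
Lemma word_coefficients (w : Delta) : exists P : quad {poly int},
  forall (F : finFieldType) (c : F) X Y Z e, param_hom c X Y Z e ->
    let M := combq X Y (quad_map (ev c) P) in \det M = 1 /\ e w = mobp M.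
Proof.
have cancelM (F : finFieldType) (M N : 'M[F]_2) :
    \det M = 1 -> M *m N = 1%:M -> (mobp M)^-1%g = mobp N /\ \det N = 1.
  move=> dM MN; have dN : \det N = 1 by have := det_mulmx M N; rewrite MN det1 dM mul1r.
  split=> //; apply: (mulgI (mobp M)); rewrite mulgV -mobpM ?dM ?dN ?oner_neq0 //.
  by rewrite MN mobp1.
have step (g : Delta) (s : quad {poly int} -> quad {poly int}) :
    (forall (F : finFieldType) (c : F) X Y Z e, param_hom c X Y Z e -> exists M,
      [/\ \det M = 1, e g = mobp M & forall t, M *m combq X Y (quad_map (ev c) t)
          = combq X Y (quad_map (ev c) (s t))]) ->
    forall w, (exists P : quad {poly int}, forall (F : finFieldType) (c : F) X Y Z e,
      param_hom c X Y Z e -> let M := combq X Y (quad_map (ev c) P) in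
      \det M = 1 /\ e w = mobp M) ->
    exists P : quad {poly int}, forall (F : finFieldType) (c : F) X Y Z e,
      param_hom c X Y Z e -> let M := combq X Y (quad_map (ev c) P) in
      \det M = 1 /\ e (g * w)%g = mobp M.
  move=> hs u [P hP]; exists (s P) => F c X Y Z e hph.
  have [M [dM gE sE]] := hs _ _ _ _ _ _ hph; have [dW uE] := hP _ _ _ _ _ _ hph.
  rewrite /= -sE; split; first by rewrite det_mulmx dM dW mulr1.
  by rewrite (ph_morph hph) gE uE mobpM ?dM ?dW ?oner_neq0.
have evX' (F : finFieldType) (c : F) : (ev c : {rmorphism {poly int} -> F}) 'X = c := evX c.
have mX (F : finFieldType) (c : F) t : quad_map (ev c) (stepX t) = stepX (quad_map (ev c) t).
  exact: stepX_morph.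
have mY (F : finFieldType) (c : F) t : quad_map (ev c) (stepY 'X t) = stepY c (quad_map (ev c) t).
  by rewrite (stepY_morph (ev c)) evX'.
have mZ (F : finFieldType) (c : F) t : quad_map (ev c) (stepZ 'X t) = stepZ c (quad_map (ev c) t).
  by rewrite (stepZ_morph (ev c)) evX'.
have mphi (F : finFieldType) (c : F) : (ev c : {rmorphism {poly int} -> F}) (phi 'X) = phi c by rewrite (phi_morph (ev c)) evX'.
move: w; apply: Delta_ind.
- exists (1, 0, 0, 0) => F c X Y Z e hph /=; rewrite !rmorph1 !rmorph0 /comb !scale0r !addr0.
  by rewrite det1 mobp1 (gmorph1 (ph_morph hph)).
- move=> u hu; split; apply: step hu.
  + move=> F c X Y Z e hph; have T := ph_triple hph; exists X.
    rewrite (tr_detX (tr_pair T)) (ph_alpha hph); split=> // t.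
    by rewrite (stepX_comb (tr_pair T)) -mX.
  + move=> F c X Y Z e hph; have T := ph_triple hph; exists Y.
    rewrite (tr_detY (tr_pair T)) (ph_beta hph); split=> // t.
    by rewrite (stepY_comb (tr_pair T)) -mY.
  + move=> F c X Y Z e hph; have T := ph_triple hph; exists Z.
    rewrite (tr_detZ T) (ph_gamma hph); split=> // t.
    by rewrite (stepZ_comb T) -mZ.
- move=> u hu; split.
  + apply: (step _ (stepV 1 (@stepX _))) hu => F c X Y Z e hph; have T := ph_triple hph.
    have [E d] := cancelM _ _ _ (tr_detX (tr_pair T)) (tripleXV (tr_pair T)).
    exists (1%:M - X); rewrite (gmorphV (ph_morph hph)) (ph_alpha hph); split=> // t.
    rewrite (stepV_comb 1 _ (stepX_comb (tr_pair T))).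
    by rewrite (stepV_morph (f := ev c) 1 _ (mX _ c)) rmorph1.
  + apply: (step _ (stepV (phi 'X) (stepY 'X))) hu => F c X Y Z e hph; have T := ph_triple hph.
    have [E d] := cancelM _ _ _ (tr_detY (tr_pair T)) (tripleYV (tr_pair T)).
    exists ((phi c)%:M - Y); rewrite (gmorphV (ph_morph hph)) (ph_beta hph); split=> // t.
    rewrite (stepV_comb (phi c) _ (stepY_comb (tr_pair T))).
    by rewrite (stepV_morph (f := ev c) (phi 'X) _ (mY _ c)) mphi.
  + apply: (step _ (stepV 1 (stepZ 'X))) hu => F c X Y Z e hph; have T := ph_triple hph.
    have [E d] := cancelM _ _ _ (tr_detZ T) (tripleZV T).
    exists (1%:M - Z); rewrite (gmorphV (ph_morph hph)) (ph_gamma hph); split=> // t.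
    rewrite (stepV_comb 1 _ (stepZ_comb T)).
    by rewrite (stepV_morph (f := ev c) 1 _ (mZ _ c)) rmorph1.
Qed.

End Words.

(** * Epimorphisms onto L_2(F) and the traces of torsion elements *)

Section Epimorphisms.

Definition epi_kernel (gT : finGroupType) (G : {group gT}) (e : Delta -> gT)
    (K : normal_subgroup Delta) : Prop :=
  [/\ {morph e : u v / (u * v)%g}, forall w, e w \in G,
      forall g, g \in G -> exists w, e w = g & forall w, K w <-> e w = 1%g].

Lemma group_iso_subg (gT : finGroupType) (G : {group gT}) K :
  group_iso (quot_group K) [subg G] <-> exists e, epi_kernel G e K.
Proof.
split=> [[f [f' fK f'K]]|[e [eM eG eonto eK]]].
  have f1 : f 1%g = 1%g by apply: (mulgI (f 1%g)); rewrite -gmulfM !mulg1.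
  exists (fun w => sgval (f (to_quot K w))); split.
  - by move=> u v; rewrite to_quotM gmulfM.
  - by move=> w; exact: subgP.
  - move=> g gG; have [w wE] := to_quot_surj (f' (subg G g)).
    by exists w; rewrite wE f'K subgK.
  - move=> w; rewrite -to_quot_eq1; split=> [->|E]; first by rewrite f1.
    apply: (can_inj fK); apply: val_inj; rewrite f1; exact: E.
have eK' x : K x -> e x = 1%g by move/eK.
pose f (u : quot_group K) : [subg G] := subg G (quot_lift e u).
have fG u : quot_lift e u \in G by exact: eG.
have fM : {morph f : u v / (u * v)%g >-> (u * v)%g}.
  move=> u v; apply: val_inj; rewrite /f /= !subgK ?groupM //.
  exact: quot_liftM eM eK' u v.
have finj : injective f.
  move=> u v; have [x <-] := to_quot_surj u; have [y <-] := to_quot_surj v.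
  move=> /(congr1 val); rewrite /f /= !subgK // !(quot_liftE eM eK') => E.
  by apply/to_quot_eq/eK; rewrite eM (gmorphV eM) E mulVg.
have fsurj y : exists u, f u = y.
  have [w wE] := eonto _ (subgP y); exists (to_quot K w); apply: val_inj.
  by rewrite /f /= subgK // (quot_liftE eM eK').
pose fm := isMultiplicative.Build _ _ f fM.
pose F : {multiplicative (quot_group K) -> [subg G]} := HB.pack f fm.
exists F; exists (fun y => projT1 (cid (fsurj y))).
  by move=> u; apply: finj; case: cid.
by move=> y; case: cid.
Qed.

Lemma epi_kernel_isog (gT hT : finGroupType) (G : {group gT}) (H : {group hT}) K :
  G \isog H -> (exists e, epi_kernel G e K) -> exists e, epi_kernel H e K.
Proof.
case/isogP=> f injf fG [e [eM eG eonto eK]]; exists (fun w => f (e w)); split.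
- by move=> u v; rewrite eM morphM.
- by move=> w; rewrite -fG mem_morphim.
- by move=> h; rewrite -fG => /morphimP[g gG _ ->]; have [w <-] := eonto _ gG; exists w.
- move=> w; rewrite eK; split=> [->|/eqP]; first by rewrite morph1.
  by rewrite morph_injm_eq1 // => /eqP.
Qed.

Variable F : finFieldType.

Lemma L2_psl : L2 F \isog psl_group F.
Proof.
have GLn0 (g : {'GL_2[F]}) : \det (GLval g) != 0.
  by rewrite -unitfE -unitmxE; exact: (valP g).
pose f (g : {'GL_2[F]}) := mobp (GLval g).
have fM : {in SL2_group F &, {morph f : x y / (x * y)%g}}.
  by move=> x y _ _; rewrite /f GL_MxE mobpM.
pose fm := Morphism fM.
have kerE : ('ker fm)%g = <[minus_one F]>%g.
  apply/eqP; rewrite finset.eqEsubset; apply/andP; split; last first.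
    have dN1 : \det (- 1%:M : 'M[F]_2) = 1.
      by rewrite -scaleN1r det2Z det1 mulr1 sqrrN expr1n.
    rewrite cycle_subG; apply/kerP; first by rewrite inE; apply/eqP.
    have d1 : \det (1%:M : 'M[F]_2) != 0 by rewrite det1 oner_neq0.
    exact: etrans (mobpN d1) (mobp1 F).
  apply/fintype.subsetP=> g gk; have [gS fg] : g \in SL2_group F /\ mobp (GLval g) = 1%g.
    by have gS := dom_ker gk; split=> //; have := mker gk.
  have dg : \det (GLval g) = 1 by move: gS; rewrite inE => /eqP.
  have := mobp_inj dg (det1 _ _); rewrite mobp1 => /(_ fg)[E|E].
    by rewrite (_ : g = 1%g) ?group1 //; apply: val_inj.
  by rewrite (_ : g = minus_one F) ?cycle_id //; apply: val_inj.
have im : (fm @* SL2_group F)%g = psl_set F.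
  apply/setP=> s; apply/morphimP/psl_setP.
    by case=> g _ gS ->; exists (GLval g) => //; move: gS; rewrite inE => /eqP.
  case=> M dM ->; have uM : M \is a GRing.unit by rewrite unitmxE dM unitr1.
  by exists (FinRing.unit _ uM); rewrite ?inE /= ?dM.
have gen (A : {set {'GL_2[F]}}) : ('ker fm)%g = A -> (SL2_group F / A)%g \isog (fm @* SL2_group F)%g.
  by move=> <-; exact: first_isog.
by have := gen _ kerE; rewrite im.
Qed.

Lemma L2_quotientsP K : L2_quotients F K <-> exists e, epi_kernel (psl_group F) e K.
Proof.
rewrite /L2_quotients /= group_iso_subg; split; apply: epi_kernel_isog.
  exact: L2_psl.
by rewrite isog_sym; exact: L2_psl.
Qed.

End Epimorphisms.

Section Collapse.
Local Open Scope group_scope.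
Variable H : groupType.

Lemma order23_eq1 (u : H) : u ^+ 2 = 1 -> u ^+ 3 = 1 -> u = 1.
Proof. by move=> u2; rewrite expgS u2 mulg1. Qed.
Lemma order25_eq1 (u : H) : u ^+ 2 = 1 -> u ^+ 5 = 1 -> u = 1.
Proof. by move=> u2; rewrite (expgS u 4) (expgM u 2 2) u2 expg1n mulg1. Qed.
Lemma order35_eq1 (u : H) : u ^+ 3 = 1 -> u ^+ 5 = 1 -> u = 1.
Proof.
move=> u3 u5; have : u ^+ 6 = 1 by rewrite (expgM u 3 2) u3 expg1n.
by rewrite expgS u5 mulg1.
Qed.

(* If one of the torsion elements x, y, z, xy, yz, xyz is killed, so are all. *)
Lemma relators_Delta_collapse (x y z : H) :
  (forall r, r \in relators_Delta x y z -> r = 1) ->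
  1 \in [:: x; y; z; x * y; y * z; x * y * z] -> [/\ x = 1, y = 1 & z = 1].
Proof.
move=> rel.
have rX : x ^+ 3 = 1 by apply: rel; rewrite !inE eqxx.
have rY : y ^+ 5 = 1 by apply: rel; rewrite !inE eqxx ?orbT.
have rZ : z ^+ 3 = 1 by apply: rel; rewrite !inE eqxx ?orbT.
have rXY : (x * y) ^+ 2 = 1 by apply: rel; rewrite !inE eqxx ?orbT.
have rYZ : (y * z) ^+ 2 = 1 by apply: rel; rewrite !inE eqxx ?orbT.
have rXYZ : (x * y * z) ^+ 2 = 1 by apply: rel; rewrite !inE eqxx ?orbT.
have y1 : y = 1 -> [/\ x = 1, y = 1 & z = 1].
  move=> yE; split=> //; apply: order23_eq1 => //.
    by move: rXY; rewrite yE mulg1.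
  by move: rYZ; rewrite yE mul1g.
rewrite !inE ![1 == _]eq_sym.
case/or4P=> [/eqP E|/eqP//|/eqP E|/or3P[]/eqP E].
- by apply/y1/order25_eq1 => //; move: rXY; rewrite E mul1g.
- by apply/y1/order25_eq1 => //; move: rYZ; rewrite E mulg1.
- apply/y1/order35_eq1 => //; have -> : y = x^-1 by apply: (mulgI x); rewrite E mulgV.
  by rewrite expVgn rX invg1.
- apply/y1/order35_eq1 => //; have -> : y = z^-1 by apply: (mulIg z); rewrite E mulVg.
  by rewrite expVgn rZ invg1.
- have z1 : z = 1.
    apply: order23_eq1 => //; move: rXY; have -> : x * y = z^-1.
      by apply: (mulIg z); rewrite E mulVg.
    by rewrite expVgn => /(congr1 (fun v => v^-1)); rewrite invgK invg1.
  by apply/y1/order25_eq1 => //; move: rYZ; rewrite z1 mulg1.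
Qed.

End Collapse.

Section Traces.
Variable F : finFieldType.
Implicit Types (M N : 'M[F]_2).

Lemma mobp_scalar (k : F) : k != 0 -> mobp k%:M = 1%g.
Proof. by move=> k0; rewrite -[k%:M]scalemx1 mobpZ ?mobp1 // det1 oner_neq0. Qed.

(** By Cayley-Hamilton a power of M has the form a M + b; if the power is scalar and M is not, a
    vanishes. This turns the order of M in the projective group into a polynomial equation for its
    trace. *)
Lemma scalar_comb M (a b s : F) : \det M = 1 -> mobp M <> 1%g ->
  a *: M + b%:M = s%:M -> a = 0.
Proof.
move=> dM M1 E; have [//|a0] := eqVneq a 0; case: M1.
have ME : M = (a^-1 * (s - b))%:M.
  apply: (scalerI a0); move/matrixP: E => E; apply/matrixP=> i j; have := E i j.
  rewrite !mxE; case: eqP => _; rewrite ?mulr1n ?mulr0n => E'.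
    by rewrite mulrA mulfV // mul1r -E' addrK.
  by rewrite mulr0 -E' addr0.
rewrite ME mobp_scalar //; apply: contra_eq_neq dM => k0; rewrite ME k0.
by rewrite raddf0 det0 eq_sym oner_neq0.
Qed.

Lemma mobp_pow_scalar M n : \det M = 1 -> (mobp M ^+ n = 1)%g -> exists s, M ^+ n = s%:M.
Proof.
have dX (N : 'M[F]_2) k : \det N = 1 -> \det (N ^+ k) = 1.
  by move=> dN; elim: k => [|k IH]; rewrite ?expr0 ?det1 // exprS -mulmxE det_mulmx dN IH mulr1.
have mX (N : 'M[F]_2) k : \det N = 1 -> mobp (N ^+ k) = (mobp N ^+ k)%g.
  move=> dN; elim: k => [|k IH]; first by rewrite expr0 mobp1.
  by rewrite exprS expgS -mulmxE mobpM ?dN ?oner_neq0 ?IH // (dX N k dN) oner_neq0.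
move=> dM; rewrite -mX // => /mobp_eq1 E; exists ((M ^+ n) 0 0); apply: E.
by rewrite dX // oner_neq0.
Qed.

Lemma trace_order2 M : \det M = 1 -> mobp M <> 1%g -> (mobp M ^+ 2 = 1)%g -> \tr M = 0.
Proof.
move=> dM M1 /(mobp_pow_scalar dM)[s]; rewrite expr2 -mulmxE mx2_sqr dM => E.
apply: (@scalar_comb M _ (-1) s) => //; rewrite -E; congr (_ + _).
by apply/matrixP=> i j; rewrite !mxE mulNrn.
Qed.

Lemma trace_order3 M : \det M = 1 -> mobp M <> 1%g -> (mobp M ^+ 3 = 1)%g ->
  \tr M ^+ 2 = 1.
Proof.
move=> dM M1 /(mobp_pow_scalar dM)[s] E; apply/eqP; rewrite -subr_eq0; apply/eqP.
apply: (@scalar_comb M _ (- \tr M) s) => //; rewrite -E.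
rewrite [M ^+ 3]exprS [M ^+ 2]expr2 -!mulmxE mx2_sqr dM mulmxBr -scalemxAr mulmx1 mx2_sqr dM.
by move: (\tr M) => t; mx_ring.
Qed.

Lemma trace_order5 M : \det M = 1 -> mobp M <> 1%g -> (mobp M ^+ 5 = 1)%g ->
  \tr M ^+ 4 - 3%:R * \tr M ^+ 2 + 1 = 0.
Proof.
move=> dM M1 /(mobp_pow_scalar dM)[s] E.
apply: (@scalar_comb M _ (2%:R * \tr M - \tr M ^+ 3) s) => //; rewrite -E.
have sq : M *m M = \tr M *: M - 1%:M by rewrite mx2_sqr dM.
have mul a b : M *m (a *: M + b%:M) = (a * \tr M + b) *: M + (- a)%:M.
  by rewrite mulmxDr -scalemxAr sq mul_mx_scalar; move: (\tr M) => t; mx_ring.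
have -> : M ^+ 5 = M *m (M *m (M *m (M *m (1 *: M + 0%:M)))).
  by rewrite scale1r raddf0 addr0 !exprS expr0 -!mulmxE mulmx1.
by rewrite !mul; move: (\tr M) => t; mx_ring.
Qed.

Definition param (c : F) (K : normal_subgroup Delta) : Prop :=
  exists X Y Z e, param_hom c X Y Z e /\ forall w, K w <-> e w = 1%g.

(** None of the six torsion elements dies, since otherwise the epimorphism would be trivial. Orders
    then give the traces up to sign, and the signs of the lifts are free. *)
Lemma epi_param e K : epi_kernel (psl_group F) e K ->
  exists c X Y Z, param_hom c X Y Z e.
Proof.
case=> eM ein eonto eK.
have rel r : r \in relators_Delta (e alpha) (e beta) (e gamma) -> r = 1%g.
  have -> : relators_Delta (e alpha) (e beta) (e gamma) = map e (relators_Delta alpha beta gamma).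
    by rewrite /= !(gmorphX eM) !eM.
  by case/mapP=> w /Delta_relations -> ->; exact: gmorph1 eM.
have nt : ~ (1%g \in [:: e alpha; e beta; e gamma; e alpha * e beta; e beta * e gamma;
     e alpha * e beta * e gamma]%g).
  move=> h; have [ea eb ec] := relators_Delta_collapse rel h.
  have triv w : e w = 1%g.
    move: w; apply: Delta_ind; first exact: gmorph1 eM.
      by move=> x xE; rewrite !eM ea eb ec xE mulg1.
    by move=> x xE; rewrite !eM !(gmorphV eM) ea eb ec xE invg1 mulg1.
  have d1 : \det (mx2 1 0 1 1 : 'M[F]_2) = 1 by rewrite det_mx2 mul0r mulr1 subr0.
  have [|w] := eonto (mobp (mx2 1 0 1 1)); first by apply/psl_setP; exists (mx2 1 0 1 1).
  rewrite triv => /esym/mobp_eq1; rewrite d1 oner_neq0 => /(_ isT).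
  move/(congr1 (fun M : 'M[F]_2 => M 1 0)); rewrite mx2E !mxE /= => /eqP.
  by rewrite oner_eq0.
have n1 x : x \in [:: e alpha; e beta; e gamma; e alpha * e beta; e beta * e gamma;
     e alpha * e beta * e gamma]%g -> x <> 1%g by move=> h x1; apply: nt; rewrite -x1.
have rX k : k \in relators_Delta (e alpha) (e beta) (e gamma) -> k = 1%g by exact: rel.
have lift3 g : g <> 1%g -> (g ^+ 3 = 1)%g -> g \in psl_set F ->
    exists M, [/\ \det M = 1, g = mobp M & \tr M = 1].
  move=> g1 g3 /psl_setP[M dM gE]; rewrite gE in g1 g3 *.
  have := trace_order3 dM g1 g3 => /eqP; rewrite sqrf_eq1 => /orP[]/eqP t; first by exists M.
  exists (- M); rewrite mobpN ?dM ?oner_neq0 // -scaleN1r det2Z sqrrN expr1n mul1r dM.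
  by rewrite mxtraceZ t mulrNN mulr1.
have [X [dX aX tX]] : exists M, [/\ \det M = 1, e alpha = mobp M & \tr M = 1].
  by apply: lift3; rewrite ?ein //; [apply: n1 | apply: rel]; rewrite !inE eqxx ?orbT.
have [Z [dZ cZ tZ]] : exists M, [/\ \det M = 1, e gamma = mobp M & \tr M = 1].
  by apply: lift3; rewrite ?ein //; [apply: n1 | apply: rel]; rewrite !inE eqxx ?orbT.
have [Y [dY bY tY]] : exists M, [/\ \det M = 1, e beta = mobp M & \tr M ^+ 2 = \tr M + 1].
  have /psl_setP[M dM gE] := ein beta.
  have : \tr M ^+ 4 - 3%:R * \tr M ^+ 2 + 1 = 0.
    by apply: trace_order5; rewrite -?gE //; [apply: n1 | apply: rel]; rewrite !inE eqxx ?orbT.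
  (* The two factors are exchanged when M changes sign, so one of the two lifts satisfies t^2 = t +
     1. *)
  have -> : \tr M ^+ 4 - 3%:R * \tr M ^+ 2 + 1 =
    (\tr M ^+ 2 - (\tr M + 1)) * (\tr M ^+ 2 - (- \tr M + 1)) by ring.
  move/eqP; rewrite mulf_eq0 !subr_eq0 => /orP[]/eqP t; first by exists M.
  exists (- M); rewrite mobpN ?dM ?oner_neq0 // -scaleN1r det2Z sqrrN expr1n mul1r dM.
  by rewrite mxtraceZ mulN1r sqrrN t.
have M2 M N : \det M = 1 -> \det N = 1 -> mobp (M *m N) = (mobp M * mobp N)%g.
  by move=> dM dN; rewrite mobpM ?dM ?dN ?oner_neq0.
have tXY : \tr (X *m Y) = 0.
  apply: trace_order2; rewrite ?det_mulmx ?dX ?dY ?mulr1 ?M2 -?aX -?bY //;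
    by [apply: n1; rewrite !inE eqxx ?orbT | apply: rel; rewrite !inE eqxx ?orbT].
have tYZ : \tr (Y *m Z) = 0.
  apply: trace_order2; rewrite ?det_mulmx ?dZ ?dY ?mulr1 ?M2 -?bY -?cZ //;
    by [apply: n1; rewrite !inE eqxx ?orbT | apply: rel; rewrite !inE eqxx ?orbT].
have dXY : \det (X *m Y) = 1 by rewrite det_mulmx dX dY mulr1.
have tXYZ : \tr (X *m Y *m Z) = 0.
  apply: trace_order2; rewrite ?det_mulmx ?dX ?dZ ?dY ?mulr1 ?(M2 _ _ dXY dZ) ?M2 -?aX -?bY -?cZ //;
    by [apply: n1; rewrite !inE eqxx ?orbT | apply: rel; rewrite !inE eqxx ?orbT].
have := fricke X Y Z; rewrite /= dX dY dZ tX tZ tXY tYZ tXYZ.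
set c := \tr (X *m Z) => fr.
have pE : \tr Y = phi c.
  apply/eqP; rewrite -subr_eq0 /phi -[X in _ == X]fr; apply/eqP; ring: tY.
exists c, X, Y, Z; split=> //; split=> //; split=> //.
by rewrite /quartic -pE tY; ring.
Qed.

(** Traces 0, 1 and phi make the powers 2, 3 and 5 of the matrices equal to - 1, so the relators
    hold projectively. *)
Lemma triple_hom (c : F) X Y Z : triple c X Y Z -> exists e, param_hom c X Y Z e.
Proof.
move=> T; have P := tr_pair T.
have M1 M k : (- 1%:M : 'M[F]_2) = M ^+ k -> \det M = 1 -> (mobp M ^+ k = 1)%g.
  move=> E dM; have -> : (mobp M ^+ k)%g = mobp (M ^+ k).
    elim: k {E} => [|k IH]; first by rewrite expr0 mobp1.
    rewrite exprS expgS IH -mulmxE mobpM ?dM ?oner_neq0 //.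
    suff -> : \det (M ^+ k) = 1 by rewrite oner_neq0.
    by elim: k {IH} => [|k IH]; rewrite ?expr0 ?det1 // exprS -mulmxE det_mulmx dM IH mulr1.
  by rewrite -E mobpN ?mobp1 // det1 oner_neq0.
have t0 M : \det M = 1 -> \tr M = 0 -> (mobp M ^+ 2 = 1)%g.
  move=> dM tM; apply: (M1) => //.
  by rewrite expr2 -mulmxE mx2_sqr dM tM scale0r sub0r.
have t1 M : \det M = 1 -> \tr M = 1 -> (mobp M ^+ 3 = 1)%g.
  move=> dM tM; apply: (M1) => //.
  have sq : M *m M = M - 1%:M by rewrite mx2_sqr dM tM scale1r.
  by rewrite exprS expr2 -!mulmxE sq mulmxBr sq mulmx1; move: M {dM tM sq} => M; mx_ring.
have Y5 : (mobp Y ^+ 5 = 1)%g.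
  apply: M1; last exact: tr_detY P.
  have sq := tripleYY P; have E := phi_sqr P; set f := phi c in sq E.
  have mul a b : Y *m (a *: Y + b%:M) = (a * f + b) *: Y + (- a)%:M.
    by rewrite mulmxDr -scalemxAr sq mul_mx_scalar; move: (f) => t; mx_ring.
  have -> : Y ^+ 5 = Y *m (Y *m (Y *m (Y *m (1 *: Y + 0%:M)))).
    by rewrite scale1r raddf0 addr0 !exprS expr0 -!mulmxE mulmx1.
  rewrite !mul; apply/matrixP=> i j; rewrite !mxE; case: eqP => _;
  by rewrite ?mulr1n ?mulr0n; ring: E.
have dn (M : 'M[F]_2) : \det M = 1 -> \det M != 0 by move=> ->; exact: oner_neq0.
have dX := tr_detX P; have dY := tr_detY P; have dZ := tr_detZ T.
have dXY : \det (X *m Y) = 1 by rewrite det_mulmx dX dY mulr1.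
have [|e [eM [ea eb ec]]] := @Delta_lift _ (mobp X) (mobp Y) (mobp Z).
  move=> r; rewrite !inE -!mobpM ?dn //.
  case/or4P=> [/eqP->|/eqP->|/eqP->|/or3P[]/eqP->].
  - exact: t1 dX (tr_X P).
  - exact: Y5.
  - exact: t1 dZ (tr_Z T).
  - exact: t0 dXY (tr_XY P).
  - by apply: t0 (tr_YZ T); rewrite det_mulmx dY dZ mulr1.
  - by apply: t0 (tr_XYZ T); rewrite det_mulmx dXY dZ mulr1.
by exists e.
Qed.

Lemma param_exists (c : F) : quartic c = 0 -> exists K, param c K.
Proof.
move=> /triple_exists[X [Y [Z /triple_hom[e he]]]].
by exists (kernel (ph_morph he)), X, Y, Z, e.
Qed.

End Traces.

(** * Surjectivity onto L_2(F) *)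

Section SplittingExtension.

Lemma split_extension (F : finFieldType) (p : {poly F}) : p != 0 ->
  exists (L : finFieldType) (f : {rmorphism F -> L}) (rs : seq L),
    map_poly f p %= \prod_(z <- rs) ('X - z%:P).
Proof.
move=> /FinSplittingFieldFor[L [rs Dp _]].
by exists (FinFieldExtType L : finFieldType), (in_alg L), rs.
Qed.

Lemma split_root (F : fieldType) (p q : {poly F}) (rs : seq F) :
  p %= \prod_(z <- rs) ('X - z%:P) -> q %| p -> (1 < size q)%N -> exists z, root q z.
Proof.
move=> Dp qp sq; have /dvdp_prod_XsubC[m Dq] : q %| \prod_(z <- rs) ('X - z%:P).
  by rewrite -(eqp_dvdr _ Dp).
case E : (mask m rs) Dq => [|z s] Dq.
  by move: sq; rewrite (eqp_size Dq) big_nil size_poly1.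
by exists z; rewrite (eqp_root Dq) root_prod_XsubC inE eqxx.
Qed.

(** Splits at once the characteristic polynomials of all matrices of determinant 1 over F; over L
    their Moebius maps have fixed points. *)
Lemma eigenvalue_extension (F : finFieldType) :
  exists (L : finFieldType) (f : {rmorphism F -> L}),
    forall t : F, exists z : L, z ^+ 2 - f t * z + 1 = 0.
Proof.
pose q (R : comNzRingType) (t : R) : {poly R} := 'X^2 - t *: 'X + 1.
have qE (R : comNzRingType) (t x : R) : (q R t).[x] = x ^+ 2 - t * x + 1.
  by rewrite /q !hornerE.
have sq (R : comNzRingType) (t : R) : size (q R t) = 3%N.
  rewrite /q -addrA size_polyDl ?size_polyXn //.
  rewrite (leq_ltn_trans (size_polyD _ _)) // size_polyN size_poly1 gtn_max /=.
  by rewrite (leq_ltn_trans (size_scale_leq _ _)) // size_polyX.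
have [|L [f [rs Dp]]] := @split_extension F (\prod_t q F t).
  by apply/prodf_neq0 => t _; rewrite -size_poly_eq0 sq.
exists L, f => t; have mq : map_poly f (q F t) = q L (f t).
  by rewrite /q rmorphD rmorphB /= map_polyXn map_polyZ /= map_polyX rmorph1.
have [||z] := split_root (q := q L (f t)) Dp.
- by rewrite -mq dvdp_map (bigD1 t) //= dvdp_mulr.
- by rewrite sq.
by rewrite /root qE => /eqP; exists z.
Qed.

End SplittingExtension.

Lemma quartic_morph (R S : comNzRingType) (f : {rmorphism R -> S}) (c : R) :
  f (quartic c) = quartic (f c).
Proof. by rewrite /quartic -phi_morph rmorphB rmorphB rmorphXn rmorph1. Qed.

Lemma eigenvector_slope (F : fieldType) (a b c d l : F) : b != 0 ->
  a * d - b * c = 1 -> l ^+ 2 - (a + d) * l + 1 = 0 ->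
  (l - d) / b * a + c = (l - d) / b * l.
Proof.
move=> b0 abcd hl; apply: (mulIf b0); rewrite mulrDl.
have -> : (l - d) / b * a * b = (l - d) * a by field.
have -> : (l - d) / b * l * b = (l - d) * l by field.
by apply/eqP; rewrite -subr_eq0 -oppr_eq0 -hl -abcd; apply/eqP; ring.
Qed.

Section Surjectivity.
Variables (F : finFieldType) (c : F).

(** A subring of a finite field is a subfield, so this says that c generates F over its prime
    field. *)
Definition generates : Prop := forall B : {set F}, 1 \in B ->
  (forall x y, x \in B -> y \in B -> x - y \in B) ->
  (forall x y, x \in B -> y \in B -> x * y \in B) -> c \in B -> forall x, x \in B.

Variables (X Y Z : 'M[F]_2).
Hypothesis T : triple c X Y Z.
Let P := tr_pair T.

Lemma map_triple (L : finFieldType) (f : {rmorphism F -> L}) :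
  triple (f c) (map_mx f X) (map_mx f Y) (map_mx f Z).
Proof.
split; rewrite -?map_mxM ?det_map_mx ?trace_map_mx;
  rewrite ?(tr_detZ T) ?(tr_Z T) ?(tr_YZ T) ?(tr_XZ T) ?(tr_XYZ T) ?rmorph1 ?rmorph0 //.
split; rewrite -?map_mxM ?det_map_mx ?trace_map_mx;
  rewrite ?(tr_detX P) ?(tr_detY P) ?(tr_X P) ?(tr_Y P) ?(tr_XY P) ?rmorph1 ?rmorph0 //.
  by rewrite -quartic_morph (tr_root P) rmorph0.
by rewrite phi_morph.
Qed.

Lemma map_combq (L : finFieldType) (f : {rmorphism F -> L}) t :
  combq (map_mx f X) (map_mx f Y) (quad_map f t) = map_mx f (combq X Y t).
Proof.
case: t => [[[p q] r] s]; rewrite /= /comb -map_mxM.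
by rewrite !map_mxD !map_mxZ map_scalar_mx.
Qed.

(** Meant for t = c and t = 1 - c, the traces of alpha gamma and alpha gamma^-1. Orders 2, 3, 5
    would make t a root of t, t^2 - 1 or t^4 - 3 t^2 + 1; the relation f^2 = f + 1 excludes the
    first two, and the last outside characteristic 3. *)
Lemma triple_char_ne (t : F) : phi t = phi c ->
  [/\ t != 0, t ^+ 2 != 1 & t ^+ 4 - 3%:R * t ^+ 2 + 1 = 0 -> 3%:R = 0 :> F /\ (1 - t) ^+ 2 = -1].
Proof.
move=> tE; have E := phi_sqr P; rewrite -tE in E.
have n1 : phi t != 1.
  by apply: contra_eq_neq E => ->; rewrite expr1n -subr_eq0 opprD addrA subrr sub0r oppr_eq0 oner_neq0.
have n0 : phi t != 0.
  by apply: contra_eq_neq E => ->; rewrite expr0n add0r eq_sym oner_neq0.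
split.
- by apply: contraNneq n1 => ->; rewrite /phi expr0n addr0 subr0.
- apply: contraNneq n1 => t2; have pt : phi t = t by rewrite /phi t2; ring.
  move: E; rewrite pt t2 => E; have : t = 0 by apply: (addIr 1); rewrite -E add0r.
  by rewrite -pt => p0; rewrite p0 eqxx in n0.
have -> : t ^+ 4 - 3%:R * t ^+ 2 + 1 = (t ^+ 2 - (t + 1)) * (t ^+ 2 - (1 - t)) by ring.
move/eqP; rewrite mulf_eq0 !subr_eq0 => /orP[]/eqP t2.
  by have : phi t = 0; [rewrite /phi t2; ring | move=> p0; rewrite p0 eqxx in n0].
have pt : phi t = t + t by rewrite /phi t2; ring.
have t6 : 3%:R * (t + t - 1) = 0.
  have -> : 3%:R * (t + t - 1) = - ((t + t) ^+ 2 - (t + t + 1)) + 4%:R * (t ^+ 2 - (1 - t)) by ring.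
  by rewrite t2 -pt E; ring.
move/eqP: t6; rewrite mulf_eq0 subr_eq0 -pt (negbTE n1) orbF => /eqP F3; split=> //.
have -> : (1 - t) ^+ 2 = (t ^+ 2 - (1 - t)) - 3%:R * t + 3%:R - 1 by ring.
by rewrite t2 F3; ring.
Qed.

Variable e : Delta -> {perm option F}.
Hypothesis he : param_hom c X Y Z e.

Lemma image_group_set : group_set [set s | `[< exists w, e w = s >]].
Proof.
apply/group_setP; split; first by rewrite inE; apply/asboolP; exists 1%g; apply: (gmorph1 (ph_morph he)).
move=> s t; rewrite !inE => -[u <-] [v <-].
by exists (u * v)%g; rewrite (ph_morph he).
Qed.
Canonical image_group := Group image_group_set.

Lemma image_groupP s : reflect (exists w, e w = s) (s \in image_group).
Proof. by rewrite inE; apply: asboolP. Qed.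

Lemma image_gen (A : {group {perm option F}}) :
  e alpha \in A -> e beta \in A -> e gamma \in A -> image_group \subset A.
Proof.
move=> ea eb ec; apply/fintype.subsetP=> s /image_groupP[w <-] {s}; move: w; apply: Delta_ind.
- by rewrite (gmorph1 (ph_morph he)) group1.
- by move=> w wA; rewrite !(ph_morph he) !groupM.
- by move=> w wA; rewrite !(ph_morph he) !(gmorphV (ph_morph he)) !groupM ?groupV.
Qed.

Lemma image_relators r : r \in relators_Delta (e alpha) (e beta) (e gamma) -> r = 1%g.
Proof.
have eM := ph_morph he.
have -> : relators_Delta (e alpha) (e beta) (e gamma) = map e (relators_Delta alpha beta gamma).
  by rewrite /= !(gmorphX eM) !eM.
by case/mapP=> w /Delta_relations -> ->; exact: gmorph1 eM.
Qed.

Lemma word_comb w : exists t, [/\ e w = mobp (combq X Y t), \det (combq X Y t) = 1 &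
  exists Pw, t = quad_map (ev c) Pw].
Proof.
have [Q hQ] := word_coefficients w; have [d E] := hQ _ _ _ _ _ _ he.
by exists (quad_map (ev c) Q); split=> //; exists Q.
Qed.

Lemma comb_eq1 p q r s : \det (combq X Y (p, q, r, s)) = 1 ->
  mobp (combq X Y (p, q, r, s)) = 1%g -> [/\ q = 0, r = 0 & s = 0].
Proof.
move=> d /mobp_eq1; rewrite d oner_neq0 => /(_ isT) E.
by have [_ -> -> ->] := combq_scalar P E.
Qed.

Lemma alpha_neq1 : e alpha <> 1%g.
Proof.
rewrite (ph_alpha he); have XE : X = combq X Y (0, 1, 0, 0).
  by rewrite /= /comb scale1r !scale0r raddf0 add0r !addr0.
rewrite {1}XE => /comb_eq1[]; first by rewrite -XE (tr_detX P).
by move/eqP; rewrite oner_eq0.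
Qed.

Lemma beta_neq1 : e beta <> 1%g.
Proof.
rewrite (ph_beta he); have YE : Y = combq X Y (0, 0, 1, 0).
  by rewrite /= /comb scale1r !scale0r raddf0 add0r !addr0 add0r.
rewrite {1}YE => /comb_eq1[]; first by rewrite -YE (tr_detY P).
by move=> _ /eqP; rewrite oner_eq0.
Qed.

Lemma image_moebius : (forall w, exists x, e w x = x) -> moebius_group image_group.
Proof.
move=> fx; have rel := image_relators; have eM := ph_morph he.
have rX : (e alpha ^+ 3 = 1)%g by apply: rel; rewrite !inE eqxx.
have rY : (e beta ^+ 5 = 1)%g by apply: rel; rewrite !inE eqxx ?orbT.
have rZ : (e gamma ^+ 3 = 1)%g by apply: rel; rewrite !inE eqxx ?orbT.
have inG w : e w \in image_group by apply/image_groupP; exists w.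
have odd_of (s : {perm option F}) n : (s ^+ n = 1)%g -> odd n -> odd #[s]%g.
  by move=> /eqP; rewrite -order_dvdn => /dvdn_odd h /h.
split.
- apply/fintype.subsetP=> s /image_groupP[w <-]; have [t [-> d _]] := word_comb w.
  by apply/psl_setP; exists (combq X Y t).
- by move=> s /image_groupP[w <-]; exact: fx.
- apply/eqP; rewrite finset.eqEsubset gen_subG; apply/andP; split.
    by apply: image_gen; apply: mem_gen; rewrite inE inG /=;
      [apply: odd_of rX _ | apply: odd_of rY _ | apply: odd_of rZ _].
  by apply/fintype.subsetP=> s; rewrite inE => /andP[].
- apply/eqP; rewrite finset.eqEsubset der_sub /=.
  pose D := (image_group^`(1))%G; have nD : image_group \subset 'N(D)%g by apply: normal_norm; exact: der_normal.
  have inN w : e w \in 'N(D)%g by apply: (fintype.subsetP nD).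
  pose f (w : Delta) := coset D (e w).
  have fM : {morph f : u v / (u * v)%g} by move=> u v; rewrite /f eM morphM.
  have frel r : r \in relators_Delta (f alpha) (f beta) (f gamma) -> r = 1%g.
    have -> : relators_Delta (f alpha) (f beta) (f gamma) = map f (relators_Delta alpha beta gamma).
      by rewrite /= !(gmorphX fM) !fM.
    by case/mapP=> w /Delta_relations -> ->; exact: gmorph1 fM.
  (* The abelianisation is trivial: for commuting x and y the relations give 1 = (xy)^6 = y^6 =
     y. *)
  have com : commute (f alpha) (f beta).
    apply: (centsP (der_abelian 0 image_group)); rewrite /f mem_quotient //.
  have b1 : f beta = 1%g.
    have xy : ((f alpha * f beta) ^+ 2 = 1)%g by apply: frel; rewrite !inE eqxx ?orbT.
    have x3 : (f alpha ^+ 3 = 1)%g by apply: frel; rewrite !inE eqxx ?orbT.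
    have y5 : (f beta ^+ 5 = 1)%g by apply: frel; rewrite !inE eqxx ?orbT.
    have : ((f alpha * f beta) ^+ 6 = 1)%g by rewrite (expgM _ 2 3) xy expg1n.
    by rewrite expgMn // (expgM (f alpha) 3 2) x3 expg1n mul1g expgS y5 mulg1.
  have [a1 _ c1] : [/\ f alpha = 1%g, f beta = 1%g & f gamma = 1%g].
    by apply: relators_Delta_collapse frel _; rewrite b1 !inE eqxx ?orbT.
  by apply: image_gen; apply: coset_idr.
- rewrite (@Gauss_dvd 3 5) //; apply/andP; split.
    have <- : #[e alpha]%g = 3%N.
      by apply: nt_prime_order => //; apply/eqP; exact: alpha_neq1.
    by rewrite order_dvdG.
  have <- : #[e beta]%g = 5%N.
    by apply: nt_prime_order => //; apply/eqP; exact: beta_neq1.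
  by rewrite order_dvdG.
Qed.

(* alpha gamma and alpha gamma^-1 have traces c and 1 - c; neither can have
   order 1, 2, 3 (or 6 in characteristic 3), nor can both have order 5. *)
Lemma image_not_exceptional :
  ~ ((forall g, g \in image_group -> #[g]%g \in [:: 1; 2; 3; 5]%N) \/
    (3%:R = 0 :> F /\ forall g, g \in image_group -> (#[g]%g %| 6)%N || (#[g]%g %| 5)%N)).
Proof.
have eM := ph_morph he; have E := phi_sqr P.
have phi0 : phi c != 0.
  by apply: contra_eq_neq E => ->; rewrite expr0n add0r eq_sym oner_neq0.
have dX := tr_detX P; have dZ := tr_detZ T.
have dZ' : \det (1%:M - Z) = 1.
  by have := det_mulmx Z (1%:M - Z); rewrite (tripleZV T) det1 dZ mul1r.
have two (t : F) g (M : 'M[F]_2) : \det M = 1 -> e g = mobp M -> \tr M = t -> phi t = phi c -> e g <> 1%g ->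
    ((forall g, g \in image_group -> #[g]%g \in [:: 1; 2; 3; 5]%N) \/
    (3%:R = 0 :> F /\ forall g, g \in image_group -> (#[g]%g %| 6)%N || (#[g]%g %| 5)%N)) ->
    t ^+ 4 - 3%:R * t ^+ 2 + 1 = 0.
  move=> dM gM tM pt g1 h; have [t0 t2 _] := triple_char_ne pt.
  have inG : e g \in image_group by apply/image_groupP; exists g.
  have no2 : (e g ^+ 2)%g <> 1%g.
    by move=> o2; move/eqP: t0; apply; rewrite -tM; apply: trace_order2; rewrite -?gM.
  have no3 : (e g ^+ 3)%g <> 1%g.
    by move=> o3; move/eqP: t2; apply; rewrite -tM; apply: trace_order3; rewrite -?gM.
  have o5 : (e g ^+ 5)%g = 1%g -> t ^+ 4 - 3%:R * t ^+ 2 + 1 = 0.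
    by move=> o5; rewrite -tM; apply: trace_order5; rewrite -?gM.
  case: h => [h|[F3 h]].
    have := h _ inG; rewrite !inE => /or4P[]/eqP o; have := expg_order (e g); rewrite o //.
  have := h _ inG; rewrite !order_dvdn => /orP[/eqP o6|/eqP]; last exact: o5.
  have dMM : \det (M *m M) = 1 by rewrite det_mulmx dM mulr1.
  have gMM : (e g ^+ 2)%g = mobp (M *m M).
    by rewrite expgS expg1 gM mobpM ?dM ?oner_neq0.
  have : \tr (M *m M) ^+ 2 = 1.
    by apply: trace_order3; rewrite -?gMM // -expgM.
  rewrite mx2_sqr dM linearB linearZ /= mxtrace_scalar tM => tt.
  have : t * t * (t ^+ 2 - 1) = 0.
    have -> : t * t * (t ^+ 2 - 1) = ((t * t - 1 *+ 2) ^+ 2 - 1) + 3%:R * (t * t - 1) by ring.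
    by rewrite tt F3; ring.
  by move/eqP; rewrite !mulf_eq0 subr_eq0 (negbTE t0) (negbTE t2).
move=> h.
have XE : X *m (1%:M - X) = 1%:M := tripleXV P.
have dXV : \det (1%:M - X) = 1.
  by have := det_mulmx X (1%:M - X); rewrite XE det1 dX mul1r.
have tY := tr_Y P; have tYX : \tr (Y *m X) = 0 by rewrite mxtrace_mulC (tr_XY P).
have phi1 : phi (1 - c) = phi c by rewrite /phi; ring.
have q1 : c ^+ 4 - 3%:R * c ^+ 2 + 1 = 0.
  apply: (two c (alpha * gamma)%g (X *m Z)) => //.
  - by rewrite det_mulmx dX dZ mulr1.
  - by rewrite eM (ph_alpha he) (ph_gamma he) mobpM ?dX ?dZ ?oner_neq0.
  - exact: tr_XZ T.
  rewrite eM (ph_alpha he) (ph_gamma he) => ag.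
  have : mobp (1%:M - X) = mobp Z.
    apply: (mulgI (mobp X)); rewrite ag -mobpM ?dX ?dXV ?oner_neq0 //.
    by rewrite XE mobp1.
  case/(mobp_inj dXV dZ) => ZE.
    move: (tr_YZ T); rewrite -ZE mulmxBr mulmx1 linearB /= tY tYX subr0 => p0.
    by rewrite p0 eqxx in phi0.
  move: (tr_YZ T); rewrite -[Z]opprK -ZE mulmxN mulmxBr mulmx1 linearN linearB /= tY tYX subr0.
  by move/eqP; rewrite oppr_eq0 (negbTE phi0).
have q2 : (1 - c) ^+ 4 - 3%:R * (1 - c) ^+ 2 + 1 = 0.
  apply: (two (1 - c) (alpha * gamma^-1)%g (X *m (1%:M - Z))) => //.
  - by rewrite det_mulmx dX dZ' mulr1.
  - rewrite eM (gmorphV eM) (ph_alpha he) (ph_gamma he) mobpM ?dX ?dZ' ?oner_neq0 //.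
    congr (_ * _)%g; apply: (mulgI (mobp Z)); rewrite mulgV -mobpM ?dZ ?dZ' ?oner_neq0 //.
    by rewrite (tripleZV T) mobp1.
  - by rewrite mulmxBr mulmx1 linearB /= (tr_XZ T) (tr_X P).
  rewrite eM (gmorphV eM) (ph_alpha he) (ph_gamma he) => ag.
  have : mobp Z = mobp X by apply: (mulIg (mobp Z)^-1%g); rewrite mulgV ag.
  have tXYX : \tr (X *m Y *m X) = - phi c.
    by rewrite mxtrace_mulC mulmxA (tripleXX P) mulmxBl mul1mx linearB /= (tr_XY P) tY sub0r.
  case/(mobp_inj dZ dX) => ZE; move: (tr_XYZ T); rewrite ZE ?mulmxN ?[\tr (- _)]linearN /= ?mulmxA tXYX ?opprK.
    by move/eqP; rewrite oppr_eq0 (negbTE phi0).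
  by move=> p0; rewrite p0 eqxx in phi0.
have [_ _ /(_ q1)[F3 c2]] := triple_char_ne (erefl (phi c)).
have two0 : 2%:R = 0 :> F.
  rewrite -[RHS]q2; have -> : (1 - c) ^+ 4 - 3%:R * (1 - c) ^+ 2 + 1 =
    ((1 - c) ^+ 2) ^+ 2 - 3%:R * (1 - c) ^+ 2 + 1 by ring.
  by rewrite c2 F3; ring.
have : (1 : F) = 3%:R - 2%:R by ring.
rewrite F3 two0 subr0.
by move/eqP; rewrite oner_eq0.
Qed.

End Surjectivity.

(* Over an extension where every Moebius map of F has a fixed point, Dickson's
   theorem identifies the image, whose field of definition contains c. *)
Theorem param_onto (F : finFieldType) (c : F) X Y Z e : generates c ->
  param_hom c X Y Z e -> forall M, \det M = 1 -> exists w, e w = mobp M.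
Proof.
move=> gen he M dM; have [L [f hf]] := eigenvalue_extension F.
have T := ph_triple he; have TL := map_triple T f; have [eL heL] := triple_hom TL.
have mf1 (N : 'M[F]_2) : \det N = 1 -> \det (map_mx f N) = 1.
  by move=> dN; rewrite det_map_mx dN rmorph1.
have pair w : exists N, [/\ \det N = 1, e w = mobp N & eL w = mobp (map_mx f N)].
  have [Q hQ] := word_coefficients w; have [d E] := hQ _ _ _ _ _ _ he.
  have [_ EL] := hQ _ _ _ _ _ _ heL; exists (combq X Y (quad_map (ev c) Q)); split=> //.
  rewrite EL -map_combq; congr (mobp (combq _ _ _)).
  by case: Q {hQ d E EL} => [[[q1 q2] q3] q4] /=; rewrite !(ev_morph f).
have fixL w : exists x, eL w x = x.
  have [N [dN _ ->]] := pair w; have dN0 : \det (map_mx f N) != 0 by rewrite mf1 ?oner_neq0.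
  have [b0|b0] := eqVneq (N 0 1) 0.
    by exists None; rewrite mobpE //= !mxE b0 rmorph0 /proj_pt eqxx.
  have [l hl] := hf (\tr N); have fb0 : f (N 0 1) != 0 by rewrite fmorph_eq0.
  exists (Some ((l - f (N 1 1)) / f (N 0 1))); rewrite mobpE //= !mxE.
  have l0 : l != 0.
    by apply: contra_eq_neq hl => ->; rewrite expr0n /= mulr0 subr0 add0r oner_neq0.
  rewrite divfK // subrK /proj_pt (negbTE l0); congr Some.
  have dNf : f (N 0 0) * f (N 1 1) - f (N 0 1) * f (N 1 0) = 1.
    by rewrite -!rmorphM -rmorphB -det2E dN rmorph1.
  rewrite tr2E rmorphD /= in hl.
  by rewrite (eigenvector_slope fb0 dNf hl) mulfK.
pose G := image_group heL; have mG : moebius_group G by exact: image_moebius.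
have [|[_ /(image_not_exceptional TL)//]] := dickson mG.
case=> H [B [dH sB GB]].
have uH : H \in unitmx by rewrite unitmxE unitfE.
have dV : \det (invmx H) != 0 by rewrite det_inv invr_neq0.
have GP s : reflect (exists w, eL w = s) (s \in G) by exact: image_groupP.
have conjE w (N : 'M[F]_2) : \det N = 1 -> eL w = mobp (map_mx f N) ->
    (eL w ^ mobp H)%g = mobp (invmx H *m map_mx f N *m H).
  by move=> dN ->; rewrite conjgE -mobpV // -mulmxA !mobpM ?det_mulmx ?mulf_neq0 ?mf1 ?oner_neq0 //.
have trE (N : 'M[F]_2) (N' : 'M[L]_2) : \det N = 1 -> \det N' = 1 ->
    mobp (invmx H *m map_mx f N *m H) = mobp N' -> f (\tr N) = \tr N' \/ f (\tr N) = - \tr N'.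
  move=> dN dN' E; have <- : \tr (invmx H *m map_mx f N *m H) = f (\tr N).
    by rewrite mxtrace_mulC mulmxA mulmxV // mul1mx trace_map_mx.
  case: (mobp_inj _ dN' E) => [|->|->]; first by rewrite !det_mulmx det_inv mf1 // mulr1 mulVf.
    by left.
  by right; rewrite linearN.
have fcB : f c \in B.
  have dXZ : \det (X *m Z) = 1 by rewrite det_mulmx (tr_detX (tr_pair T)) (tr_detZ T) mulr1.
  have aE : eL (alpha * gamma)%g = mobp (map_mx f (X *m Z)).
    rewrite (ph_morph heL) (ph_alpha heL) (ph_gamma heL) map_mxM mobpM ?mf1 ?oner_neq0 //.
      exact: (tr_detX (tr_pair T)).
    exact: (tr_detZ T).
  have : (eL (alpha * gamma) ^ mobp H)%g \in psl_over B.
    by rewrite -GB memJ_conjg; apply/GP; exists (alpha * gamma)%g.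
  rewrite (conjE _ _ dXZ aE) => /psl_overP[N' [dN' BN' /(trE _ _ dXZ dN')]].
  by rewrite (tr_XZ T) tr2E => -[] ->; rewrite ?sfN ?sfD.
have fB x : f x \in B.
  suff: x \in [set y | f y \in B] by rewrite inE.
  apply: gen => [|y z|y z|]; rewrite !inE ?rmorph1 ?(sf1 sB) //.
    by rewrite rmorphB; apply: sfB.
  by rewrite rmorphM; apply: sfM.
(* Every b in B is, up to sign, the trace of an element of G, and such traces come from F. *)
have BE : B = [set f x | x in F].
  apply/setP=> b; apply/idP/imsetP => [bB|[x _ ->]]; last exact: fB.
  have : mobp (mx2 b (-1) 1 0) \in psl_over B.
    apply/psl_overP; exists (mx2 b (-1) 1 0); split=> //; first by rewrite det_mx2; ring.
    by move=> i j; rewrite !mxE; case: ifP => _; case: ifP => _ //; rewrite ?sfN ?sf1 ?sf0.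
  rewrite -GB => /imsetP[g /GP[w <-] wE]; have [N [dN _ wN]] := pair w.
  have := conjE _ _ dN wN; rewrite -wE => /esym/(trE _ _ dN)[|hb|hb]; first by rewrite det_mx2; ring.
    by exists (\tr N) => //; rewrite hb tr2E !mx2E addr0.
  by exists (- \tr N) => //; rewrite rmorphN hb tr2E !mx2E addr0 opprK.
(* G has entries in the image of F and has the same size as its conjugate, so inclusion is
   enough. *)
have GE : G = psl_over B :> {set _}.
  apply/eqP; rewrite eqEcard -GB cardJg leqnn andbT GB; apply/fintype.subsetP=> _ /GP[w <-].
  have [N [dN _ ->]] := pair w; apply/psl_overP; exists (map_mx f N); split=> //; first exact: mf1.
  by move=> i j; rewrite mxE.
have : mobp (map_mx f M) \in G.
  by rewrite GE; apply/psl_overP; exists (map_mx f M); split=> [|i j|//]; rewrite ?mf1 ?mxE.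
case/GP=> w; have [N [dN ewN ->]] := pair w => E; exists w; rewrite ewN.
case: (mobp_inj (mf1 _ dN) (mf1 _ dM) E) => [/map_mx_inj ->//|].
by rewrite -map_mxN => /map_mx_inj ->; rewrite mobpN // dM oner_neq0.
Qed.

(** * Injective endomorphisms of PSL_2(F) are semilinear *)

(* Hua: an additive map commuting with inversion is multiplicative. *)
Lemma additive_inverse_morphism (F : finFieldType) (t : F -> F) :
  {morph t : x y / x - y} -> t 1 = 1 -> (forall x, x != 0 -> t x != 0) ->
  (forall x, x != 0 -> t x^-1 = (t x)^-1) -> exists s : {rmorphism F -> F}, s =1 t.
Proof.
move=> tB t1 tn tV; have t0 : t 0 = 0 by have := tB 0 0; rewrite !subrr.
have tN x : t (- x) = - t x by rewrite -sub0r tB t0 sub0r.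
have tD x y : t (x + y) = t x + t y by rewrite -{1}[y]opprK tB tN opprK.
have inj x y : x != y -> t x - t y != 0 by rewrite -tB -subr_eq0 => /tn.
have sq x y : t (x ^+ 2 / y) = t x ^+ 2 / t y.
  have [->|x0] := eqVneq x 0; first by rewrite t0 !expr0n /= !mul0r.
  have [->|y0] := eqVneq y 0; first by rewrite invr0 t0 invr0 !mulr0 t0.
  have [<-|xy] := eqVneq x y; first by rewrite !expr2 !mulfK ?tn.
  have yx : y - x != 0 by rewrite subr_eq0 eq_sym.
  have tyx : t y - t x != 0 by apply: inj; rewrite eq_sym.
  (* Hua's identity: x^2 / y is expressed by differences, sums and inverses only. *)
  have E : x - x ^+ 2 / y = (x^-1 + (y - x)^-1)^-1.
    by field; rewrite ?x0 ?y0 ?yx ?addrNK ?subrK.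
  have Et : t x - t x ^+ 2 / t y = ((t x)^-1 + (t y - t x)^-1)^-1.
    by field; rewrite ?tn ?tyx ?subrK ?tn.
  have nz : x^-1 + (y - x)^-1 != 0.
    have -> : x^-1 + (y - x)^-1 = y / (x * (y - x)) by field; rewrite x0 yx.
    by rewrite !mulf_neq0 ?invr_neq0 ?mulf_neq0.
  have : t (x - x ^+ 2 / y) = t x - t x ^+ 2 / t y.
    by rewrite E Et tV // tD !tV // tB.
  by rewrite tB => /addrI/oppr_inj.
have sqM x y : t (x ^+ 2 * y) = t x ^+ 2 * t y.
  have [->|y0] := eqVneq y 0; first by rewrite mulr0 t0 mulr0.
  by have := sq x y^-1; rewrite tV // !invrK.
have sq1 x : t (x ^+ 2) = t x ^+ 2 by have := sqM x 1; rewrite !mulr1 t1 mulr1.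
have tM x y : t (x * y) = t x * t y.
  (* A product is a difference of two squares times a factor in odd characteristic; in
     characteristic 2 every element is a square. *)
  have [two0|two1] := eqVneq (2%:R : F) 0; last first.
    have -> : x = ((x + 1) / 2%:R) ^+ 2 - ((x - 1) / 2%:R) ^+ 2 by field.
    move: (_ / _) (_ / _) => a b.
    by rewrite mulrBl !tB !sqM !sq1 mulrBl.
  have p2 : 2%N \in [pchar F] by rewrite inE two0 eqxx.
  have /injF_bij[g _ gK] : injective (fun z : F => z ^+ 2) by exact: (fmorph_inj (pFrobenius_aut p2)).
  by rewrite -[x]gK sqM sq1.
pose m := GRing.isZmodMorphism.Build F F t tB.
pose m' := GRing.isMonoidMorphism.Build F F t (conj t1 tM).
pose s : {rmorphism F -> F} := HB.pack t m m'.
by exists s.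
Qed.

(** After scaling by k = t 1, the identity (1/x - 1)^-1 = (1 - x)^-1 - 1 allows s' to be evaluated
    in two ways, so that s itself commutes with inversion and Hua's theorem applies. *)
Lemma hua_pair (F : finFieldType) (t t' : F -> F) :
  {morph t : x y / x - y} -> {morph t' : x y / x - y} -> (forall x, x != 0 -> t x != 0) ->
  (forall x, x != 0 -> t' x^-1 = (t x)^-1) ->
  exists (s : {rmorphism F -> F}) (k : F), [/\ k != 0, forall x, t x = k * s x & forall x, t' x = k^-1 * s x].
Proof.
move=> tB t'B tn tV; pose k := t 1; have k0 : k != 0 by rewrite tn ?oner_neq0.
pose s x := t x / k; pose s' x := k * t' x.
have sB : {morph s : x y / x - y} by move=> x y; rewrite /s tB mulrBl.
have s'B : {morph s' : x y / x - y} by move=> x y; rewrite /s' t'B mulrBr.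
have s1 : s 1 = 1 by rewrite /s mulfV.
have sn x : x != 0 -> s x != 0 by move=> x0; apply: mulf_neq0; [exact: tn | rewrite invr_neq0].
have s'V x : x != 0 -> s' x^-1 = (s x)^-1 by move=> x0; rewrite /s' /s tV // invfM invrK mulrC.
have s'1 : s' 1 = 1 by have := s'V 1 (oner_neq0 _); rewrite invr1 s1 invr1.
have sV x : x != 0 -> s x^-1 = (s x)^-1.
  move=> x0; have [->|x1] := eqVneq x 1; first by rewrite invr1 s1 invr1.
  have b0 : 1 - x != 0 by rewrite subr_eq0 eq_sym.
  have z0 : x^-1 - 1 != 0 by rewrite subr_eq0 invr_eq1.
  have zE : (x^-1 - 1)^-1 = (1 - x)^-1 - 1 by field; rewrite x0 b0.
  have := s'V _ z0; rewrite zE s'B s'V // s'1 !sB s1 => /(congr1 (@GRing.inv F)).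
  have sx0 := sn _ x0; have sb0 : 1 - s x != 0 by rewrite -s1 -sB sn.
  rewrite invrK; have -> : ((1 - s x)^-1 - 1)^-1 = (s x)^-1 - 1.
    have -> : (1 - s x)^-1 - 1 = s x / (1 - s x) by field.
    by field; rewrite sx0 sb0.
  by move/addIr.
have [f fE] := additive_inverse_morphism sB s1 sn sV.
exists f, k; split=> // x; rewrite fE /s; first by rewrite mulrC divfK.
have -> : t x / k = s' x.
  have [->|x0] := eqVneq x 0; last first.
    by rewrite -[x in RHS]invrK s'V ?invr_neq0 // sV // invrK.
  by have := tB 0 0; have := s'B 0 0; rewrite !subrr => -> ->; rewrite mul0r.
by rewrite /s' mulKf.
Qed.

Section AutomorphismsOfPSL.
Variable F : finFieldType.
Implicit Types (s : {perm option F}) (M N : 'M[F]_2).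

(** Matrices act on row vectors: this is the translation by b, fixing [None], while [lower b] fixes
    0. *)
Definition upper (b : F) := mobp (mx2 1 0 b 1).
Definition lower (b : F) := mobp (mx2 1 b 0 1).
Arguments upper b%_R.
Arguments lower b%_R.

Lemma det_upper (b : F) : \det (mx2 1 0 b 1) = 1. Proof. by rewrite det_mx2; ring. Qed.
Lemma det_lower (b : F) : \det (mx2 1 b 0 1) = 1. Proof. by rewrite det_mx2; ring. Qed.

Lemma mobpM1 M N : \det M = 1 -> \det N = 1 -> mobp (M *m N) = (mobp M * mobp N)%g.
Proof. by move=> dM dN; rewrite mobpM ?dM ?dN ?oner_neq0. Qed.

Lemma mobp_psl M : \det M = 1 -> mobp M \in psl_group F.
Proof. by move=> dM; apply/psl_setP; exists M. Qed.

Lemma upperD a b : upper (a + b) = (upper a * upper b)%g.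
Proof.
rewrite -(mobpM1 (det_upper a) (det_upper b)) mul_mx2; congr mobp.
by congr mx2; ring.
Qed.
Lemma lowerD a b : lower (a + b) = (lower a * lower b)%g.
Proof.
rewrite -(mobpM1 (det_lower a) (det_lower b)) mul_mx2; congr mobp.
by congr mx2; ring.
Qed.

Lemma upper_psl b : upper b \in psl_group F. Proof. exact/mobp_psl/det_upper. Qed.
Lemma lower_psl b : lower b \in psl_group F. Proof. exact/mobp_psl/det_lower. Qed.

Lemma upper_Some b t : upper b (Some t) = Some (t + b).
Proof.
rewrite /upper mobpE ?det_upper ?oner_neq0 //= !mx2E /proj_pt mulr0 add0r oner_eq0.
by rewrite mulr1 divr1.
Qed.

Lemma upper_None b : upper b None = None.
Proof. by rewrite /upper mobpE ?det_upper ?oner_neq0 //= !mx2E /proj_pt eqxx. Qed.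

Lemma upper_inj : injective upper.
Proof. by move=> a b /permP/(_ (Some 0)); rewrite !upper_Some !add0r => -[]. Qed.

Definition weyl : 'M[F]_2 := mx2 0 1 (-1) 0.
Lemma det_weyl : \det weyl = 1. Proof. by rewrite det_mx2; ring. Qed.

Lemma lower_weyl b : (lower b ^ mobp weyl)%g = upper (- b).
Proof.
rewrite conjgE; apply: (mulgI (mobp weyl)); rewrite mulKVg.
rewrite -(mobpM1 (det_lower b) det_weyl) -(mobpM1 det_weyl (det_upper (- b))) !mul_mx2.
by congr mobp; congr mx2; ring.
Qed.

Lemma lower_inj : injective lower.
Proof.
move=> a b E; apply: oppr_inj; apply: upper_inj.
by rewrite -!lower_weyl E.
Qed.

Lemma upper0 : upper 0 = 1%g. Proof. by rewrite /upper -mx2_1 mobp1. Qed.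
Lemma lower0 : lower 0 = 1%g. Proof. by rewrite /lower -mx2_1 mobp1. Qed.

Lemma translationP s : s \in psl_group F -> fixpts s = [set None] -> exists b, s = upper b.
Proof.
move=> ps fs; have sN : s None = None by apply/eqP; have := set11 (None : option F); rewrite -fs inE.
have [l [m [l0 sE]]] := affineP ps sN; have [l1|l1] := eqVneq l 1; last first.
  have : Some (m / (1 - l)) \in fixpts s.
    rewrite inE sE; apply/eqP; congr Some; field.
    by rewrite subr_eq0 eq_sym.
  by rewrite fs inE.
exists m; apply/permP=> -[t|]; last by rewrite upper_None.
by rewrite sE upper_Some l1 mul1r.
Qed.

Lemma lower_translationP s : s \in psl_group F -> fixpts s = [set Some 0] -> exists b, s = lower b.
Proof.
move=> ps fs; have dw : \det weyl != 0 by rewrite det_weyl oner_neq0.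
have [||b sb] := @translationP (s ^ mobp weyl)%g.
- exact: psl_conj.
- rewrite fixptsJ fs imset_set1; congr [set _].
  by rewrite mobpE //= !mx2E /proj_pt mul0r add0r eqxx.
by exists (- b); apply: (conjg_inj (mobp weyl)); rewrite lower_weyl opprK.
Qed.

(** The number of fixed points is 1 modulo p and at most 2. *)
Lemma porder_fixpt s (p : nat) (pF : p \in [pchar F]) : s \in psl_group F ->
  s != 1%g -> (s ^+ p = 1)%g -> exists x, fixpts s = [set x].
Proof.
move=> ps s1 sp; apply/cards1P; have pr := pcharf_prime pF.
have pg : (p.-group <[s]>)%g.
  by rewrite /pgroup -orderE (nt_prime_order pr sp s1) pnat_id.
have pdvd : (p %| #|F|)%N.
  have := abelem_pgroup (fin_ring_pchar_abelem pF (R := F)); rewrite /pgroup cardsT.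
  case/p_natP => [[|n]] E; last by rewrite E expnS dvdn_mulr.
  by have := finNzRing_gt1 F; rewrite E.
have aP : [acts <[s]>, on [set: option F] | 'P]%g by apply/actsP=> k _ z; rewrite !inE.
have := pgroup_fix_mod pg aP; rewrite cardsT card_option.
rewrite afix_cycle ?inE // -addn1 -modnDml (eqP pdvd) add0n.
have -> : 'Fix_([set: option F] | 'P)[s]%g = fixpts s.
  by apply/setP=> x; rewrite !inE finset.sub1set inE /= apermE.
have := psl_fixpts_le2 ps s1; case: #|_| => [|[|[|//]]] //.
  by rewrite mod0n modn_small ?prime_gt1.
by move=> _ /eqP; rewrite (eqn_modDl 1 0 1) mod0n modn_small ?prime_gt1.
Qed.

Lemma upperX b n : (upper b ^+ n)%g = upper (b *+ n).
Proof. by elim: n => [|n IH]; rewrite ?upper0 // mulrS upperD expgS IH. Qed.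
Lemma lowerX b n : (lower b ^+ n)%g = lower (b *+ n).
Proof. by elim: n => [|n IH]; rewrite ?lower0 // mulrS lowerD expgS IH. Qed.

Lemma lower_None b : lower b None = proj_pt 1 b.
Proof. by rewrite /lower mobpE ?det_lower ?oner_neq0 //= !mx2E. Qed.

Lemma lower_Some0 b : lower b (Some 0) = Some 0.
Proof.
by rewrite /lower mobpE ?det_lower ?oner_neq0 //= !mx2E !mul0r !add0r /proj_pt oner_eq0 mul0r.
Qed.

Lemma upper_lower_ncomm : (upper 1%R * lower 1%R <> lower 1%R * upper 1%R)%g.
Proof.
have lN : lower 1%R None = Some 1 by rewrite lower_None /proj_pt oner_eq0 divr1.
move/permP/(_ None); rewrite !permM (upper_None 1%R) lN (upper_Some 1%R 1).
case=> E; have : (1 : F) = 1 + 1 - 1 by ring.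
by rewrite -E subrr => /eqP; rewrite oner_eq0.
Qed.

Record psl_mono (th : {perm option F} -> {perm option F}) : Prop := PslMono {
  pm_morph : {in psl_group F &, {morph th : s t / (s * t)%g}};
  pm_psl : forall s, s \in psl_group F -> th s \in psl_group F;
  pm_inj : forall s, s \in psl_group F -> th s = 1%g -> s = 1%g }.

Lemma psl_mono_conj th (H : 'M[F]_2) : \det H != 0 -> psl_mono th ->
  psl_mono (fun s => (th s ^ mobp H)%g).
Proof.
move=> dH [hM hp hi]; split=> [s t ps pt|s ps|s ps].
- by rewrite hM // conjMg.
- by apply: psl_conj => //; exact: hp.
- by move/eqP; rewrite conjg_eq1 => /eqP; exact: hi.
Qed.

Section Mono.
Variable th : {perm option F} -> {perm option F}.
Hypothesis hth : psl_mono th.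

Lemma pm1 : th 1%g = 1%g.
Proof. by apply: (mulgI (th 1%g)); rewrite -(pm_morph hth) ?group1 // !mulg1. Qed.

Lemma pmX s n : s \in psl_group F -> th (s ^+ n)%g = (th s ^+ n)%g.
Proof.
move=> ps; elim: n => [|n IH]; first exact: pm1.
by rewrite !expgS (pm_morph hth) ?groupX // IH.
Qed.

Lemma pm_injective : {in psl_group F &, injective th}.
Proof.
move=> s t ps pt E; apply/eqP; rewrite eq_mulgV1; apply/eqP/(pm_inj hth).
  by rewrite groupM ?groupV.
apply: (mulIg (th t)); rewrite -(pm_morph hth) ?groupM ?groupV //.
by rewrite mulgKV mul1g.
Qed.

(** The images commute, so each of them preserves the single fixed point of the others. *)
Lemma unipotent_family (g : F -> {perm option F}) : (forall b, g b \in psl_group F) ->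
  injective g -> {morph g : a b / a + b >-> (a * b)%g} ->
  exists x, forall b, b != 0 -> fixpts (th (g b)) = [set x].
Proof.
move=> gp gi gD; have [p pr pF] := finPcharP F.
have g0 : g 0 = 1%g by apply: (mulgI (g 0)); rewrite -gD !addr0 mulg1.
have gX b n : g (b *+ n) = (g b ^+ n)%g.
  by elim: n => [|n IH]; rewrite ?g0 // mulrS gD expgS IH.
have fx b : b != 0 -> exists x, fixpts (th (g b)) = [set x].
  move=> b0; apply: (porder_fixpt pF); first exact: pm_psl.
    by apply: contra_neq b0 => /(pm_inj hth (gp b)); rewrite -g0 => /gi.
  by rewrite -pmX // -gX -mulr_natr (pcharf0 pF) mulr0 g0 pm1.
have [x fx1] := fx 1 (oner_neq0 _); exists x => b b0; have [y fy] := fx b b0.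
rewrite fy; congr [set _]; apply/set1P; rewrite -fx1.
have : fixpts (th (g b) ^ th (g 1%R)) = [set y].
  have com : (th (g b) * th (g 1%R) = th (g 1%R) * th (g b))%g.
    by rewrite -!(pm_morph hth) // -!gD addrC.
  by rewrite conjgE com mulKg.
by rewrite fixptsJ fy imset_set1 => /set1_inj E; rewrite inE E.
Qed.

End Mono.

(** The middle factor is chosen so that n exchanges 0 and infinity. The relation is what ties the
    images of [lower] to those of [upper]. *)
Lemma upper_lower_braid (b : F) : b != 0 -> let n := (upper b * lower (- b^-1) * upper b)%g in
  (upper (- b ^+ 2) * n = n * lower 1%R)%g.
Proof.
move=> b0 /=; set A := mx2 1 0 b 1 *m mx2 1 (- b^-1) 0 1 *m mx2 1 0 b 1.
have dA : \det A = 1 by rewrite !det_mulmx !det_upper det_lower !mulr1.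
have -> : (upper b * lower (- b^-1) * upper b)%g = mobp A.
  by rewrite /A !mobpM1 ?det_mulmx ?det_upper ?det_lower ?mulr1.
rewrite -(mobpM1 (det_upper _) dA) -(mobpM1 dA (det_lower 1)); congr mobp.
by rewrite /A !mul_mx2; congr mx2; field.
Qed.

Lemma diag_conj (k : F) : k != 0 -> let D := mx2 k^-1 0 0 1 in
  [/\ \det D != 0, forall b, (upper (k * b) ^ mobp D)%g = upper b
    & forall b, (lower (k^-1 * b) ^ mobp D)%g = lower b].
Proof.
move=> k0 D; have dD : \det D != 0 by rewrite det_mx2 mulr1 mulr0 subr0 invr_neq0.
have d1 (M : 'M[F]_2) : \det M = 1 -> \det M != 0 by move=> ->; exact: oner_neq0.
split=> // b; rewrite conjgE; apply: (mulgI (mobp D)); rewrite mulKVg.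
  rewrite -(mobpM (d1 _ (det_upper _)) dD) -(mobpM dD (d1 _ (det_upper _))); congr mobp.
  by rewrite /D !mul_mx2; congr mx2; field.
rewrite -(mobpM (d1 _ (det_lower _)) dD) -(mobpM dD (d1 _ (det_lower _))); congr mobp.
by rewrite /D !mul_mx2; congr mx2; field.
Qed.

Opaque upper lower.

Section Normalization.
Variables (th : {perm option F} -> {perm option F}).
Hypotheses (hth : psl_mono th)
  (fu : forall b, b != 0 -> fixpts (th (upper b)) = [set None])
  (fl : forall b, b != 0 -> fixpts (th (lower b)) = [set Some 0]).

Lemma normalized_images : exists t t' : F -> F,
  [/\ forall b, th (upper b) = upper (t b), forall b, th (lower b) = lower (t' b),
      {morph t : x y / x - y}, {morph t' : x y / x - y} & forall x, x != 0 -> t x != 0 /\ t' x != 0].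
Proof.
have /choice[t tE] (b : F) : exists m, th (upper b) = upper m.
  have [->|b0] := eqVneq b 0; first by exists 0; rewrite upper0 (pm1 hth).
  by apply: translationP; [exact: (pm_psl hth (upper_psl b)) | exact: fu].
have /choice[t' t'E] (b : F) : exists m, th (lower b) = lower m.
  have [->|b0] := eqVneq b 0; first by exists 0; rewrite lower0 (pm1 hth).
  by apply: lower_translationP; [exact: (pm_psl hth (lower_psl b)) | exact: fl].
have add (f : F -> F) : {morph f : x y / x + y} -> {morph f : x y / x - y}.
  by move=> fD x y; apply: (addIr (f y)); rewrite -fD !subrK.
exists t, t'; split=> // [||x x0].
- apply: add => x y; apply: upper_inj.
  by rewrite -tE !upperD (pm_morph hth) ?upper_psl // !tE.
- apply: add => x y; apply: lower_inj.
  by rewrite -t'E !lowerD (pm_morph hth) ?lower_psl // !t'E.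
split; apply: contra_neq x0 => E.
  by apply: upper_inj; apply: (pm_injective hth); rewrite ?upper_psl // !tE E -tE !upper0 (pm1 hth).
by apply: lower_inj; apply: (pm_injective hth); rewrite ?lower_psl // !t'E E -t'E !lower0 (pm1 hth).
Qed.

Lemma normalized_semilinear : exists (s : {rmorphism F -> F}) (D : 'M[F]_2), \det D != 0 /\
  forall M, \det M = 1 -> (th (mobp M) ^ mobp D)%g = mobp (map_mx s M).
Proof.
have [t [t' [tE t'E tB t'B tn]]] := normalized_images.
have t'V b : b != 0 -> t' b^-1 = (t b)^-1.
  move=> b0; have [tb0 _] := tn _ b0.
  have [_ t'b0] := tn _ (invr_neq0 b0).
  pose n := (upper b * lower (- b^-1) * upper b)%g.
  have nE : (upper (- b ^+ 2) * n = n * lower 1%R)%g by exact: upper_lower_braid.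
  have pul := groupM (upper_psl b) (lower_psl (- b^-1)).
  have pn : n \in psl_group F := groupM pul (upper_psl b).
  have {nE} := congr1 th nE; rewrite (pm_morph hth (upper_psl _) pn) (pm_morph hth pn (lower_psl _)).
  move/permP/(_ None); rewrite !permM tE upper_None => nN.
  (* The image of n sends infinity to the fixed point 0 of the image of [lower 1]; written out, t'
     (1/b) = 1 / t b. *)
  have : th n None \in fixpts (th (lower 1)) by rewrite inE -nN.
  rewrite fl ?oner_neq0 // inE (pm_morph hth pul (upper_psl b)).
  rewrite (pm_morph hth (upper_psl b) (lower_psl _)) (tE b) (t'E (- b^-1)) !permM.
  have -> : t' (- b^-1) = - t' b^-1.
    by have := t'B 0 b^-1; have := t'B 0 0; rewrite !subrr !sub0r => ->; rewrite sub0r.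
  rewrite upper_None lower_None /proj_pt oppr_eq0 (negbTE t'b0) upper_Some => /eqP[] E.
  apply: invr_inj; rewrite invrK; apply/eqP; rewrite eq_sym -subr_eq0 -E; apply/eqP.
  by field; rewrite ?oppr_eq0 ?t'b0.
have [s [k [k0 tk t'k]]] := hua_pair tB t'B (fun x x0 => proj1 (tn x x0)) t'V.
have [dD Du Dl] := diag_conj k0; set D := mx2 k^-1 0 0 1 in dD Du Dl.
exists s, D; split=> // M dM; have hD := psl_mono_conj dD hth.
have sB : subfield [set: F] by split=> *; rewrite !inE.
have := @sl2_elementary F [set: F] (fun M => (th (mobp M) ^ mobp D)%g = mobp (map_mx s M)) sB.
have map2 (x y z w : F) : map_mx s (mx2 x y z w) = mx2 (s x) (s y) (s z) (s w).
  by apply: mx2P; rewrite !mx2E !mxE.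
apply=> // [A B dA dB EA EB|b _|b _].
- rewrite mobpM1 // (pm_morph hD) ?mobp_psl // EA EB map_mxM mobpM1 // det_map_mx ?dA ?dB rmorph1 //.
- by rewrite -/(upper b) tE tk Du map2 rmorph1 rmorph0.
- by rewrite -/(lower b) t'E t'k Dl map2 rmorph1 rmorph0.
Qed.

End Normalization.

(* A monomorphism of the group of Moebius maps sends the translations, up to
   conjugacy, to translations. *)
Theorem psl_mono_semilinear th : psl_mono th -> exists (s : {rmorphism F -> F}) (H : 'M[F]_2),
  \det H != 0 /\ forall M, \det M = 1 -> (th (mobp M) ^ mobp H)%g = mobp (map_mx s M).
Proof.
move=> hth; have [x fx] := unipotent_family hth upper_psl upper_inj upperD.
have [y fy] := unipotent_family hth lower_psl lower_inj lowerD.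
have [H1 dH1 H1x] := move_to_None x.
have fxJ (H : 'M[F]_2) g z : \det H != 0 -> fixpts g = [set z] -> fixpts (g ^ mobp H)%g = [set mob H z].
  by move=> dH fg; rewrite fixptsJ fg imset_set1 mobpE.
case yE : (mob H1 y) => [t|]; last first.
  (* If both families had the same fixed point, the images of [upper 1] and [lower 1] would be
     commuting translations. *)
  have hth1 := psl_mono_conj dH1 hth.
  have [|a aE] := translationP (s := (th (upper 1%R) ^ mobp H1)%g) (pm_psl hth1 (upper_psl _)).
    by rewrite (fxJ _ _ _ dH1 (fx _ (oner_neq0 _))) H1x.
  have [|b bE] := translationP (s := (th (lower 1%R) ^ mobp H1)%g) (pm_psl hth1 (lower_psl _)).
    by rewrite (fxJ _ _ _ dH1 (fy _ (oner_neq0 _))) yE.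
  case: upper_lower_ncomm; have pu := upper_psl 1; have pl := lower_psl 1.
  apply: (pm_injective hth1 (groupM pu pl) (groupM pl pu)).
  by rewrite (pm_morph hth1 pu pl) (pm_morph hth1 pl pu) aE bE -!upperD addrC.
pose H2 := mx2 1 0 (- t) 1; have dH2 : \det H2 != 0 by rewrite det_upper oner_neq0.
have mH2 z : mob H2 z = upper (- t) z by rewrite -mobpE.
have dH : \det (H1 *m H2) != 0 by rewrite det_mulmx mulf_neq0.
have hth1 := psl_mono_conj dH hth.
have [b b0|b b0|s [D [dD sE]]] := normalized_semilinear hth1.
- by rewrite (fxJ _ _ _ dH (fx _ b0)) mob_mul // H1x mH2 upper_None.
- by rewrite (fxJ _ _ _ dH (fy _ b0)) mob_mul // yE mH2 upper_Some subrr.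
exists s, (H1 *m H2 *m D); split; first by rewrite det_mulmx mulf_neq0.
by move=> M dM; rewrite mobpM // conjgM sE.
Qed.

End AutomorphismsOfPSL.

(** * Kernels and Galois conjugate roots *)

Section Classification.
Variable F : finFieldType.
Implicit Types (c : F) (K : normal_subgroup Delta).

Lemma ev_closed (B : {set F}) c : 1 \in B ->
  (forall x y, x \in B -> y \in B -> x - y \in B) ->
  (forall x y, x \in B -> y \in B -> x * y \in B) -> c \in B -> forall P, ev c P \in B.
Proof.
move=> B1 BB BM Bc P; have B0 : 0 \in B by rewrite -(subrr 1) BB.
have BD x y : x \in B -> y \in B -> x + y \in B.
  by move=> xB yB; rewrite -[y]opprK -[- y]sub0r BB // BB.
have Bz (z : int) : z%:~R \in B.
  have Bn (n : nat) : n%:R \in B by elim: n => [|n IH] //; rewrite mulrS BD.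
  by case: z => n; rewrite ?NegzE ?rmorphN /= ?mulrzN -?pmulrn // -sub0r BB.
elim/poly_ind: P => [|P z IH]; first by rewrite rmorph0.
have evC : ev c z%:P = z%:~R by rewrite /ev /= map_polyC /horner_eval hornerC.
by rewrite rmorphD rmorphM /= evX evC BD ?BM.
Qed.

(** Traces of words are integer polynomials in c, and every x is the trace of a matrix of
    determinant 1. *)
Lemma onto_generates c X Y Z e : param_hom c X Y Z e ->
  (forall g, g \in psl_group F -> exists w, e w = g) -> generates c.
Proof.
move=> he onto B B1 BB BM Bc x; have P := tr_pair (ph_triple he).
have B0 : 0 \in B by rewrite -(subrr 1) BB.
have BD u v : u \in B -> v \in B -> u + v \in B.
  by move=> uB vB; rewrite -[v]opprK -[- v]sub0r BB // BB.
have BN u : u \in B -> - u \in B by move=> uB; rewrite -sub0r BB.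
have dx : \det (mx2 x (-1) 1 0) = 1 by rewrite det_mx2; ring.
have [w wE] := onto _ (mobp_psl dx); have [Q hQ] := word_coefficients w.
have [d E] := hQ _ _ _ _ _ _ he; move: d E; rewrite wE.
case: Q {hQ} => [[[q1 q2] q3] q4] /=; set N := comb _ _ _ _ _ _ => dN E.
have tN : \tr N \in B.
  have [-> _ _ _] := comb_traces P (ev c q1) (ev c q2) (ev c q3) (ev c q4).
  have B2 : 2%:R \in B by rewrite mulr2n BD.
  have Bp : phi c \in B by rewrite /phi BB ?BD // expr2 BM.
  by rewrite !BD ?BM ?ev_closed.
have [/(congr1 mxtrace)|/(congr1 mxtrace)] := mobp_inj dx dN E.
  by rewrite tr2E !mx2E addr0 => ->.
by rewrite linearN /= tr2E !mx2E addr0 => ->; apply: BN.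
Qed.

Lemma L2_quotients_param K : L2_quotients F K <-> exists c, generates c /\ param c K.
Proof.
rewrite L2_quotientsP; split=> [[e he]|[c [gc [X [Y [Z [e [he eK]]]]]]]].
  have [c [X [Y [Z ph]]]] := epi_param he; case: he => _ _ onto eK.
  by exists c; split; [exact: onto_generates ph onto | exists X, Y, Z, e].
exists e; split=> //; first exact: (ph_morph he).
- move=> w; have [Q hQ] := word_coefficients w; have [d ->] := hQ _ _ _ _ _ _ he.
  exact: mobp_psl.
- by move=> g /psl_setP[M dM ->]; exact: param_onto gc he _ dM.
Qed.

(** Membership in the kernel is the vanishing of three integer polynomials at c, a condition that
    field morphisms preserve and reflect. *)
Lemma param_kernel c X Y Z e w (Q : quad {poly int}) : param_hom c X Y Z e ->
  let M := combq X Y (quad_map (ev c) Q) in \det M = 1 -> e w = mobp M ->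
  e w = 1%g <-> [/\ ev c Q.1.1.2 = 0, ev c Q.1.2 = 0 & ev c Q.2 = 0].
Proof.
move=> he; case: Q => [[[q1 q2] q3] q4] /= d ->; split.
  move=> /mobp_eq1; rewrite d oner_neq0 => /(_ isT) E.
  by have [_ -> -> ->] := combq_scalar (tr_pair (ph_triple he)) E.
case=> q20 q30 q40; move: d; rewrite q20 q30 q40 /comb !scale0r !addr0 => d.
by apply: mobp_scalar; apply: contra_eq_neq d => ->; rewrite det_scalar expr0n eq_sym oner_neq0.
Qed.

End Classification.

Lemma param_morph (F L : finFieldType) (f : {rmorphism F -> L}) (c : F) K K' :
  param c K -> param (f c) K' -> K = K'.
Proof.
case=> X [Y [Z [e [he eK]]]] [X' [Y' [Z' [e' [he' eK']]]]].
apply: nsub_inj; apply/funext=> w; apply/propext; rewrite eK eK'.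
have [Q hQ] := word_coefficients w.
have [d E] := hQ _ _ _ _ _ _ he; have [d' E'] := hQ _ _ _ _ _ _ he'.
rewrite (param_kernel he d E) (param_kernel he' d' E') -!(ev_morph f).
have f0 x : (f x = 0) = (x = 0).
  by apply/propext; split=> [/eqP|->]; rewrite ?fmorph_eq0 ?rmorph0 // => /eqP.
by rewrite !f0.
Qed.

(** Equal kernels let e' factor through e and give an injective endomorphism of PSL_2(F); its
    semilinear form carries tr (XZ) to tr (X'Z'). *)
Lemma param_conj (F : finFieldType) (c c' : F) K : generates c ->
  param c K -> param c' K -> exists s : {rmorphism F -> F}, s c = c'.
Proof.
move=> gc [X [Y [Z [e [he eK]]]]] [X' [Y' [Z' [e' [he' eK']]]]].
have eM := ph_morph he; have e'M := ph_morph he'.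
have /choice[wd wdE] (g : {perm option F}) : exists w, g \in psl_group F -> e w = g.
  have [/psl_setP[M dM ->]|] := boolP (g \in psl_group F); last by exists 1%g.
  by have [w <-] := param_onto gc he dM; exists w.
have ee' u v : e u = e v -> e' u = e' v.
  move=> E; have : K (u * v^-1)%g by rewrite eK eM (gmorphV eM) E mulgV.
  by rewrite eK' e'M (gmorphV e'M) => /(congr1 (fun g => g * e' v)%g); rewrite mulgKV mul1g.
have e'p w : e' w \in psl_group F.
  have [Q hQ] := word_coefficients w; have [d ->] := hQ _ _ _ _ _ _ he'.
  exact: mobp_psl.
have ep w : e w \in psl_group F.
  have [Q hQ] := word_coefficients w; have [d ->] := hQ _ _ _ _ _ _ he.
  exact: mobp_psl.
pose th g := e' (wd g); have thE w : th (e w) = e' w by apply: ee'; exact: wdE.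
have mono : psl_mono th.
  split=> [g h pg ph|g _|g pg].
  - by rewrite -(wdE g pg) -(wdE h ph) -eM !thE e'M.
  - exact: e'p.
  - by rewrite -(wdE g pg) thE -eK' eK.
have [s [H [dH sE]]] := psl_mono_semilinear mono.
have uH : H \in unitmx by rewrite unitmxE unitfE.
have dV : \det (invmx H) != 0 by rewrite det_inv invr_neq0.
have T := ph_triple he; have T' := ph_triple he'; have P := tr_pair T; have P' := tr_pair T'.
have lift1 w (M M' : 'M[F]_2) : \det M = 1 -> \det M' = 1 -> \tr M = 1 -> \tr M' = 1 ->
    e w = mobp M -> e' w = mobp M' -> H^-1 *m M' *m H = map_mx s M.
  move=> dM dM' tM tM' eM1 eM1'.
  have dJ : \det (H^-1 *m M' *m H) = 1 by rewrite !det_mulmx det_inv dM' mulr1 mulVf.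
  have tJ : \tr (H^-1 *m M' *m H) = 1 by rewrite mxtrace_mulC mulmxA mulmxV // mul1mx.
  have E : mobp (H^-1 *m M' *m H) = mobp (map_mx s M).
    rewrite -sE // -eM1 thE eM1' conjgE -mobpV // -mulmxA !mobpM ?det_mulmx ?mulf_neq0 ?dM' ?oner_neq0 //.
  have dsM : \det (map_mx s M) = 1 by rewrite det_map_mx dM rmorph1.
  (* With the wrong sign the traces give 1 = - 1, and then the sign is immaterial. *)
  case: (mobp_inj dJ dsM E) => // EN; have := congr1 mxtrace EN.
  rewrite linearN /= trace_map_mx tM tJ rmorph1 => m1; rewrite EN.
  by rewrite -scaleN1r -m1 scale1r.
have EX := lift1 _ _ _ (tr_detX P) (tr_detX P') (tr_X P) (tr_X P') (ph_alpha he) (ph_alpha he').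
have EZ := lift1 _ _ _ (tr_detZ T) (tr_detZ T') (tr_Z T) (tr_Z T') (ph_gamma he) (ph_gamma he').
exists s; rewrite -(tr_XZ T) -trace_map_mx map_mxM -EX -EZ -(tr_XZ T').
rewrite !mulmxA mulmxK // mxtrace_mulC !mulmxA mulmxV // mul1mx //.
Qed.

(** * Fixed fields of Frobenius powers, degrees and squares *)

Section FrobeniusPowers.
Variables (F : finFieldType) (p : nat).
Hypothesis pF : p \in [pchar F].
Let p_pr : prime p := pcharf_prime pF.

Lemma frobB k (x y : F) : (x - y) ^+ (p ^ k) = x ^+ (p ^ k) - y ^+ (p ^ k).
Proof.
elim: k => [|k IH]; first by rewrite !expr1.
by rewrite expnSr !exprM IH -!(pFrobenius_autE pF) rmorphB.
Qed.

Lemma frobD k (x y : F) : (x + y) ^+ (p ^ k) = x ^+ (p ^ k) + y ^+ (p ^ k).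
Proof.
elim: k => [|k IH]; first by rewrite !expr1.
by rewrite expnSr !exprM IH -!(pFrobenius_autE pF) rmorphD.
Qed.

Lemma frob_nat k n : (n%:R : F) ^+ (p ^ k) = n%:R.
Proof.
elim: k => [|k IH]; first by rewrite expr1.
by rewrite expnSr exprM IH -(pFrobenius_autE pF) rmorph_nat.
Qed.

Lemma fixed_powers_bound m : (1 < m)%N -> (forall x : F, x ^+ m = x) -> (#|F| <= m)%N.
Proof.
move=> m1 h; have sz : size ('X^m - 'X : {poly F}) = m.+1.
  by rewrite size_polyDl ?size_polyXn // size_polyN size_polyX.
have := @max_poly_roots _ ('X^m - 'X : {poly F}) (enum F).
rewrite sz -cardE ltnS; apply; last exact: enum_uniq.
  by rewrite -size_poly_eq0 sz.
by apply/allP=> x _; rewrite /root !hornerE h subrr.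
Qed.

(** The fixed points of the m-th power of Frobenius form a subring containing c. *)
Lemma generates_degree (c : F) n m : generates c -> #|F| = (p ^ n)%N -> (0 < m)%N ->
  c ^+ (p ^ m) = c -> (n <= m)%N.
Proof.
move=> gc cF m0 hc; rewrite -(leq_exp2l _ _ (prime_gt1 p_pr)) -cF.
apply: fixed_powers_bound; first by rewrite -[1%N](exp1n m) ltn_exp2r ?prime_gt1.
move=> x; apply/eqP; have : x \in [set y : F | y ^+ (p ^ m) == y]; last by rewrite inE.
apply: gc => [|y z|y z|]; rewrite !inE.
- by rewrite expr1n.
- by rewrite frobB => /eqP-> /eqP->.
- by rewrite exprMn => /eqP-> /eqP->.
- exact/eqP.
Qed.

(** The k-th power of Frobenius fixes E but not c, so 1 and c are independent over E. *)
Lemma card_span2 (E : {set F}) k (c : F) : (forall x, x \in E -> x ^+ (p ^ k) = x) ->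
  c ^+ (p ^ k) <> c -> #|[set x.1 + x.2 * c | x in finset.setX E E]| = (#|E| * #|E|)%N.
Proof.
move=> hE hc; rewrite card_in_imset ?cardsX // => -[a b] [a' b'] /=.
rewrite !inE /= => /andP[aE bE] /andP[a'E b'E] E1.
have [bb|bb] := eqVneq b b'; first by move: E1; rewrite bb => /addIr->.
have b0 : b' - b != 0 by rewrite subr_eq0 eq_sym.
case: hc; have -> : c = (a - a') / (b' - b).
  apply: (mulIf b0); rewrite divfK // mulrBr ![c * _]mulrC.
  by apply/eqP; rewrite subr_eq addrAC eq_sym subr_eq E1 addrC.
by rewrite exprMn exprVn !frobB !hE.
Qed.

Definition prime_field : {set F} := [set (i : nat)%:R | i : 'I_p].

Lemma prime_field_nat x : x \in prime_field -> exists i : nat, x = i%:R.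
Proof. by case/imsetP=> i _ ->; exists i. Qed.

Lemma nat_inj_char i j : (i < p)%N -> (j < p)%N -> i%:R = j%:R :> F -> i = j.
Proof.
move=> ip jp; wlog ij : i j ip jp / (i <= j)%N.
  by move=> W E; case/orP: (leq_total i j) => ij; [|apply/esym]; apply: W.
move=> /esym/eqP; rewrite -subr_eq0 -natrB // -(dvdn_pcharf pF) => h.
have [|] := posnP (j - i); last by move/dvdn_leq=> /(_ _ h); lia.
by lia.
Qed.

Lemma card_prime_field : #|prime_field| = p.
Proof.
rewrite card_imset ?card_ord // => i j /nat_inj_char h.
by apply/val_inj/h; apply: ltn_ord.
Qed.

Lemma fixed_natP (x : F) : x ^+ p = x -> exists i : nat, x = i%:R.
Proof.
move=> xp; apply: prime_field_nat; apply: contraT => xN.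
have := @max_poly_roots _ ('X^p - 'X : {poly F}) (enum (x |: prime_field)).
have sz : size ('X^p - 'X : {poly F}) = p.+1.
  by rewrite size_polyDl ?size_polyXn // size_polyN size_polyX ltnS prime_gt1.
rewrite sz -cardE cardsU1 xN card_prime_field ltnn => ->//; last exact: enum_uniq.
  by rewrite -size_poly_eq0 sz.
apply/allP=> y; rewrite mem_enum => /setU1P[->|/prime_field_nat[i ->]].
  by rewrite /root !hornerE xp subrr.
by rewrite /root !hornerE -{1}(expn1 p) frob_nat subrr.
Qed.

Lemma generates1 (c : F) : #|F| = p -> generates c.
Proof.
move=> cF B B1 BB BM _ x; have [i ->] : exists i : nat, x = i%:R.
  by apply: fixed_natP; rewrite -cF expf_card.
have B0 : 0 \in B by rewrite -(subrr 1) BB.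
elim: i => [//|i IH]; rewrite -addn1 natrD -[1%:R]opprK -[- 1%:R]sub0r BB // BB //.
Qed.

Lemma prime_field_sub (B : {set F}) x : 1 \in B -> (forall x y, x \in B -> y \in B -> x - y \in B) ->
  x \in prime_field -> x \in B.
Proof.
move=> B1 BB /prime_field_nat[i ->]; have B0 : 0 \in B by rewrite -(subrr 1) BB.
by elim: i => [//|i IH]; rewrite -addn1 natrD -[1%:R]opprK -[- 1%:R]sub0r BB // BB.
Qed.

Definition span1 (c : F) : {set F} := [set x.1 + x.2 * c | x in finset.setX prime_field prime_field].

Lemma span1_sub (B : {set F}) c x : 1 \in B -> (forall x y, x \in B -> y \in B -> x - y \in B) ->
  (forall x y, x \in B -> y \in B -> x * y \in B) -> c \in B -> x \in span1 c -> x \in B.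
Proof.
move=> B1 BB BM Bc /imsetP[[a b] /=]; rewrite inE /= => /andP[aP bP] ->.
have B0 : 0 \in B by rewrite -(subrr 1) BB.
rewrite -[b * c]opprK -[- (b * c)]sub0r BB ?BB ?BM //; exact: prime_field_sub.
Qed.

Lemma full_set (A : {set F}) : #|A| = #|F| -> forall x, x \in A.
Proof.
move=> cA x; suff -> : A = [set: F] by rewrite inE.
by apply/eqP; rewrite finset.eqEcard finset.subsetT cardsT cA leqnn.
Qed.

Lemma prime_field_fixed x k : x \in prime_field -> x ^+ (p ^ k) = x.
Proof. by case/prime_field_nat=> i ->; exact: frob_nat. Qed.

Lemma card_span1 c : c ^+ p <> c -> #|span1 c| = (p * p)%N.
Proof.
move=> hc; rewrite (@card_span2 _ 1) ?card_prime_field ?expn1 // => x xP.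
by rewrite -[p]expn1 prime_field_fixed.
Qed.

Lemma generates2 (c : F) : #|F| = (p ^ 2)%N -> c ^+ p <> c -> generates c.
Proof.
move=> cF hc B B1 BB BM Bc x; apply: (span1_sub B1 BB BM Bc); apply: full_set.
by rewrite card_span1 // cF expn2.
Qed.

(** Two quadratic steps: 1 and f span p^2 elements over the prime field, and 1 and c span p^4 over
    these. *)
Lemma generates4 (c f : F) : #|F| = (p ^ 4)%N -> (forall B : {set F}, 1 \in B ->
  (forall x y, x \in B -> y \in B -> x - y \in B) ->
  (forall x y, x \in B -> y \in B -> x * y \in B) -> c \in B -> f \in B) ->
  f ^+ (p ^ 2) = f -> f ^+ p <> f -> c ^+ (p ^ 2) <> c -> generates c.
Proof.
move=> cF hf f2 f1 c2 B B1 BB BM Bc x; have Bf := hf B B1 BB BM Bc.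
have B0 : 0 \in B by rewrite -(subrr 1) BB.
have fixE y : y \in span1 f -> y ^+ (p ^ 2) = y.
  case/imsetP=> -[a b]; rewrite inE /= => /andP[aP bP] ->.
  by rewrite frobD exprMn f2 !prime_field_fixed.
have := full_set (A := [set x.1 + x.2 * c | x in finset.setX (span1 f) (span1 f)]).
rewrite (card_span2 fixE c2) card_span1 // cF => /(_ _ x)/imsetP[|[a b]].
  by rewrite !expnS expn0; lia.
rewrite inE /= => /andP[aS bS] ->; rewrite -[b * c]opprK -[- (b * c)]sub0r BB ?BB ?BM //;
  exact: (span1_sub B1 BB BM Bf).
Qed.

End FrobeniusPowers.

(** The m + 1 squares already are roots of T^(m+1) - T; a non-square would be one root too many. *)
Lemma euler_square (F : finFieldType) m (x : F) : #|F| = m.*2.+1 -> x ^+ m.+1 = x -> is_square x.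
Proof.
move=> cF xm; apply: contrapT => nsq; have q3 : (1 < m.+1)%N.
  by have := finNzRing_gt1 F; rewrite cF; case: (m).
pose S := [set y ^+ 2 | y : F].
have S2 : (#|F| <= 2 * #|S|)%N.
  apply: card_fibres2; apply: (@quadratic_fibres _ _ 1 0 0) => [y|]; last by rewrite oner_neq0.
  by rewrite mul1r mul0r !addr0.
have xS : x \notin S by apply/imsetP=> -[y _ xE]; apply: nsq; exists y.
have := @max_poly_roots _ ('X^(m.+1) - 'X : {poly F}) (enum (x |: S)).
have sz : size ('X^(m.+1) - 'X : {poly F}) = m.+2.
  by rewrite size_polyDl ?size_polyXn // size_polyN size_polyX ltnS.
rewrite sz -cardE cardsU1 xS ltnS => h; suff: (1 + #|S| <= m.+1)%N by move: S2; rewrite cF; lia.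
apply: h; last exact: enum_uniq; first by rewrite -size_poly_eq0 sz.
apply/allP=> y; rewrite mem_enum => /setU1P[->|/imsetP[z _ ->]].
  by rewrite /root !hornerE xm subrr.
rewrite /root !hornerE -exprM; have -> : (2 * m.+1 = m.*2.+1.+1)%N by lia.
by rewrite exprS -cF expf_card -expr2 subrr.
Qed.

(* An element of the fixed field of x |-> x ^+ e is a square one quadratic
   extension up. *)
Lemma quadratic_square (F : finFieldType) e (x : F) : odd e -> #|F| = (e * e)%N ->
  x ^+ e = x -> is_square x.
Proof.
move=> oe cF xe; have [k ek] : exists k, e = k.*2.+1.
  by exists e./2; rewrite -[LHS]odd_double_half oe.
apply: (@euler_square _ (k * e.+1)); first by rewrite cF ek; lia.
rewrite exprS; have -> : (k * e.+1 = e * k + k)%N by lia.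
rewrite exprD exprM xe -exprD addnn -exprS -[(k.*2).+1]ek xe //.
Qed.

(** * Quadratic Gauss sums for 5 and - 11 *)

Section GaussSums.

Lemma int_char_transfer (F L : finFieldType) p (pF : p \in [pchar F]) (pL : p \in [pchar L]) (z : int) :
  z%:~R = 0 :> L -> z%:~R = 0 :> F.
Proof. by move/eqP; rewrite -(dvdz_pcharf pL) (dvdz_pcharf pF) => /eqP. Qed.

Lemma cyclotomic_root (F : finFieldType) q : (1 < q)%N -> exists (L : finFieldType) (f : {rmorphism F -> L}) (z : L),
  \sum_(i < q) z ^+ i = 0.
Proof.
move=> q1; pose P (R : comNzRingType) : {poly R} := \poly_(i < q) 1.
have sP (R : comNzRingType) : size (P R) = q by rewrite size_poly_eq // oner_neq0.
have [|L [f [rs Dp]]] := @split_extension F (P F).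
  by rewrite -size_poly_eq0 sP; case: (q) q1.
exists L, f; have mP : map_poly f (P F) = P L.
  by apply/polyP=> i; rewrite coef_map /P !coef_poly /=; case: (i < q)%N; rewrite ?rmorph1 ?rmorph0.
have [||z] := split_root (q := P L) Dp; [by rewrite mP | by rewrite sP|].
rewrite /root horner_poly => /eqP zE; exists z; rewrite -[RHS]zE.
by apply: eq_bigr => i _; rewrite mul1r.
Qed.

Lemma frobenius_sign (L : finFieldType) p (pL : p \in [pchar L]) (a g e : L) : odd p -> a != 0 ->
  g ^+ 2 = a -> g ^+ p = e * g -> a ^+ (p.-1)./2 = e.
Proof.
move=> op a0 g2 gp; have g0 : g != 0 by apply: contra_neq a0 => g0; rewrite -g2 g0 expr0n.
apply: (mulIf g0); rewrite -gp -g2 -exprM -exprSr; congr (_ ^+ _).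
by move: op; case: (p) => // n /=; lia.
Qed.

Variables (F : finFieldType) (p : nat).
Hypotheses (pF : p \in [pchar F]) (op : odd p).

Lemma rmorph_pchar (L : finFieldType) (f : {rmorphism F -> L}) : p \in [pchar L].
Proof.
rewrite inE (pcharf_prime pF) -(rmorph_nat f) (pcharf0 pF) rmorph0 eqxx //.
Qed.

(** An equation between integers depends on the characteristic only, so it may be proved in the
    cyclotomic extension. *)
Lemma legendre_transfer (L : finFieldType) (pL : p \in [pchar L]) (a b : int) n :
  (a%:~R : L) ^+ n = b%:~R -> (a%:~R : F) ^+ n = b%:~R.
Proof.
move=> E; apply/eqP; rewrite -subr_eq0 -rmorphXn -rmorphB; apply/eqP.
by apply: (int_char_transfer pF pL); rewrite rmorphB rmorphXn /= E subrr.
Qed.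

Lemma legendre5 : 5%:R != 0 :> F ->
  (p %% 5 \in [:: 1; 4])%N /\ (5%:R : F) ^+ (p.-1)./2 = 1 \/
  (p %% 5 \in [:: 2; 3])%N /\ (5%:R : F) ^+ (p.-1)./2 = -1.
Proof.
move=> n5; have [L [f [z]]] := @cyclotomic_root F 5 isT; have pL := rmorph_pchar f.
rewrite !big_ord_recr big_ord0 /= add0r expr0 expr1 => E.
have z5 : z ^+ 5 = 1.
  apply/eqP; rewrite -subr_eq0; apply/eqP.
  have -> : z ^+ 5 - 1 = (z - 1) * (1 + z + z ^+ 2 + z ^+ 3 + z ^+ 4) by ring.
  by rewrite E mulr0.
(* The quadratic Gauss sum. Frobenius replaces z by z^p, which depends on p modulo 5 only. *)
pose g := z + z ^+ 4 - z ^+ 2 - z ^+ 3.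
have g2 : g ^+ 2 = 5%:R.
  (* The factor is the quotient of g^2 - 5 by the fifth cyclotomic polynomial. *)
  have -> : g ^+ 2 = 5%:R + (- 5%:R + 5%:R * z + z ^+ 2 - 3%:R * z ^+ 3 + z ^+ 4) *
    (1 + z + z ^+ 2 + z ^+ 3 + z ^+ 4) by rewrite /g; ring.
  by rewrite E mulr0 addr0.
have gp r : (p %% 5)%N = r -> g ^+ p = z ^+ r + (z ^+ r) ^+ 4 - (z ^+ r) ^+ 2 - (z ^+ r) ^+ 3.
  move=> pr; rewrite -pr (expr_mod _ z5) -!(pFrobenius_autE pL) /g.
  by rewrite rmorphB rmorphB rmorphD !rmorphXn.
have n5L : 5%:R != 0 :> L by rewrite -(rmorph_nat f) fmorph_eq0.
have p5 : (p %% 5 != 0)%N.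
  apply: contra_neq n5 => /eqP; rewrite -/(dvdn 5 p) dvdn_prime2 ?(pcharf_prime pF) // => /eqP p5.
  by rewrite p5 (pcharf0 pF).
have fin (b : int) : g ^+ p = b%:~R * g -> (5%:R : F) ^+ (p.-1)./2 = b%:~R.
  move=> h; apply: (legendre_transfer pL (a := 5)).
  exact: (frobenius_sign pL op n5L g2).
have : (p %% 5 < 5)%N by rewrite ltn_mod.
case: (p %% 5)%N p5 gp => [|[|[|[|[|//]]]]] // _ gp _; [left|right|right|left]; split=> //.
- by apply: (fin 1); rewrite (gp 1%N) // /g; ring.
- by apply: (fin (-1)); rewrite (gp 2%N) // /g; ring: z5.
- by apply: (fin (-1)); rewrite (gp 3%N) // /g; ring: z5.
- by apply: (fin 1); rewrite (gp 4%N) // /g; ring: z5.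
Qed.

Lemma legendre11 : 11%:R != 0 :> F ->
  (p %% 11 \in [:: 1; 3; 4; 5; 9])%N /\ (- 11%:R : F) ^+ (p.-1)./2 = 1 \/
  (p %% 11 \in [:: 2; 6; 7; 8; 10])%N /\ (- 11%:R : F) ^+ (p.-1)./2 = -1.
Proof.
move=> n5; have [L [f [z]]] := @cyclotomic_root F 11 isT; have pL := rmorph_pchar f.
rewrite !big_ord_recr big_ord0 /= add0r expr0 expr1 => E.
have z11 : z ^+ 11 = 1.
  apply/eqP; rewrite -subr_eq0; apply/eqP; rewrite -[RHS](mulr0 (z - 1)) -E; ring.
(* The sum over the residues modulo 11 minus the sum over the non-residues, rewritten with the
   vanishing of the sum of all powers of z. *)
pose g := 1 + 2%:R * (z + z ^+ 3 + z ^+ 4 + z ^+ 5 + z ^+ 9).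
have g2 : g ^+ 2 = - 11%:R.
  rewrite -[RHS]addr0 -[X in _ = _ + X](mulr0 (12%:R - 8%:R * z + 8%:R * z ^+ 4 - 4%:R * z ^+ 7 + 4%:R * z ^+ 8)) -E /g.
  ring.
have gp r : (p %% 11)%N = r -> g ^+ p = 1 + 2%:R * (z ^+ r + (z ^+ r) ^+ 3 + (z ^+ r) ^+ 4 + (z ^+ r) ^+ 5 + (z ^+ r) ^+ 9).
  move=> pr; rewrite -pr (expr_mod _ z11) -!(pFrobenius_autE pL) /g.
  by rewrite rmorphD rmorphM rmorph_nat rmorph1 !rmorphD !rmorphXn.
have n5L : - 11%:R != 0 :> L by rewrite oppr_eq0 -(rmorph_nat f) fmorph_eq0.
have p5 : (p %% 11 != 0)%N.
  apply: contra_neq n5 => /eqP; rewrite -/(dvdn 11 p) dvdn_prime2 ?(pcharf_prime pF) // => /eqP p5.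
  by rewrite p5 (pcharf0 pF).
have fin (b : int) : g ^+ p = b%:~R * g -> (- 11%:R : F) ^+ (p.-1)./2 = b%:~R.
  move=> h; have h1 := @legendre_transfer _ pL (- 11%:Z) b (p.-1)./2; rewrite !mulrNz in h1.
  by apply: h1; exact: (frobenius_sign pL op n5L g2).
have : (p %% 11 < 11)%N by rewrite ltn_mod.
have E' : z ^+ 10 = - (1 + z + z ^+ 2 + z ^+ 3 + z ^+ 4 + z ^+ 5 + z ^+ 6 + z ^+ 7 + z ^+ 8 + z ^+ 9).
  by apply/eqP; rewrite -addr_eq0 addrC E.
case: (p %% 11)%N p5 gp => [|[|[|[|[|[|[|[|[|[|[|//]]]]]]]]]]] // _ gp _;
  [left|right|left|left|left|right|right|right|left|right]; split=> //.
- by apply: (fin 1); rewrite (gp 1%N) // /g; ring.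
- by apply: (fin (-1)); rewrite (gp 2%N) // /g; ring: z11 E'.
- by apply: (fin 1); rewrite (gp 3%N) // /g; ring: z11.
- by apply: (fin 1); rewrite (gp 4%N) // /g; ring: z11.
- by apply: (fin 1); rewrite (gp 5%N) // /g; ring: z11.
- by apply: (fin (-1)); rewrite (gp 6%N) // /g; ring: z11 E'.
- by apply: (fin (-1)); rewrite (gp 7%N) // /g; ring: z11 E'.
- by apply: (fin (-1)); rewrite (gp 8%N) // /g; ring: z11 E'.
- by apply: (fin 1); rewrite (gp 9%N) // /g; ring: z11.
- by apply: (fin (-1)); rewrite (gp 10%N) // /g; ring: z11 E'.
Qed.

End GaussSums.

(** [rs] holds one root per Galois orbit; endomorphisms of the finite field play the Galois group.
    Conjugate roots have equal kernels by [param_morph], and equal kernels come from conjugate roots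
    by [param_conj]. *)
Lemma L2_quotients_card (F : finFieldType) (rs : seq F) :
  (forall c, c \in rs -> quartic c = 0 /\ generates c) ->
  (forall i j (s : {rmorphism F -> F}), (i < size rs)%N -> (j < size rs)%N ->
     s rs`_i = rs`_j -> i = j) ->
  (forall c, generates c -> quartic c = 0 -> exists c' (s : {rmorphism F -> F}), c' \in rs /\ s c' = c) ->
  (L2_quotients F #= `I_(size rs))%card.
Proof.
move=> hrs inj cov.
have /choice[K hK] (c : F) : exists K, quartic c = 0 -> param c K.
  have [/param_exists[K hK]|] := EM (quartic c = 0); first by exists K.
  (* A dummy value for parameters that are not roots. *)
  by exists (kernel (f := fun _ : Delta => 1%g : {perm bool}) (fun _ _ => esym (mulg1 _))).
have inK : {in `I_(size rs) &, injective (fun i => K rs`_i)}.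
  move=> i j; rewrite !inE /= => li lj E.
  have [qi gi] := hrs _ (mem_nth 0 li); have [qj _] := hrs _ (mem_nth 0 lj).
  have pj := hK _ qj; rewrite -E in pj.
  by have [s sE] := param_conj gi (hK _ qi) pj; apply: inj sE.
suff -> : L2_quotients F = [set K rs`_i | i in `I_(size rs)]%classic by exact: inj_card_eq.
apply/seteqP; split=> [L|_ [i li <-]].
  move/L2_quotients_param=> [c [gc pc]]; have qc : quartic c = 0.
    by case: pc => X [Y [Z [e [he _]]]]; exact: tr_root (tr_pair (ph_triple he)).
  have [c' [s [c'rs sc]]] := cov _ gc qc; exists (index c' rs); first by rewrite /= index_mem.
  rewrite nth_index //; have [q' _] := hrs _ c'rs; rewrite -sc in pc.
  exact: param_morph (hK _ q') pc.
have [qi gi] := hrs _ (mem_nth 0 li); apply/L2_quotients_param; exists rs`_i; split=> //.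
exact: hK.
Qed.

Lemma L2_quotients_card0 (F : finFieldType) : (forall c : F, quartic c = 0 -> ~ generates c) ->
  (L2_quotients F #= `I_0)%card.
Proof.
move=> h; apply: (@L2_quotients_card F [::]) => // c gc /h; by case.
Qed.

(** * Roots of the quartic and their Galois orbits *)

Section Roots.
Variable F : fieldType.
Implicit Types c d s t : F.

Lemma quartic_phi c : quartic c = 0 <-> phi c ^+ 2 = phi c + 1.
Proof.
rewrite /quartic; split=> [E|->]; last by ring.
by apply/eqP; rewrite -subr_eq0 opprD addrA E.
Qed.

Lemma phi_1B c : phi (1 - c) = phi c. Proof. by rewrite /phi; ring. Qed.

Lemma quartic_1B c : quartic (1 - c) = quartic c. Proof. by rewrite /quartic phi_1B. Qed.

Lemma phi_eq c d : phi d = phi c -> d = c \/ d = 1 - c.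
Proof.
move=> E; have /eqP : (d - c) * (d - (1 - c)) = 0.
  have -> : (d - c) * (d - (1 - c)) = phi c - phi d by rewrite /phi; ring.
  by rewrite E subrr.
by rewrite mulf_eq0 !subr_eq0 => /orP[]/eqP; [left|right].
Qed.

Lemma quartic_phi_eq c d : quartic c = 0 -> quartic d = 0 -> phi d = phi c \/ phi d = 1 - phi c.
Proof.
move=> /quartic_phi hc /quartic_phi hd; have /eqP : (phi d - phi c) * (phi d - (1 - phi c)) = 0.
  have -> : (phi d - phi c) * (phi d - (1 - phi c)) = (phi d ^+ 2 - phi d) - (phi c ^+ 2 - phi c) by ring.
  by rewrite hc hd; ring.
by rewrite mulf_eq0 !subr_eq0 => /orP[]/eqP; [left|right].
Qed.

(* s = 2 phi - 1 is a square root of 5 and t = 2 c - 1 one of 3 - 2 s. *)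
Lemma quartic_sqrt c : quartic c = 0 -> let s := 2%:R * phi c - 1 in
  s ^+ 2 = 5%:R /\ (2%:R * c - 1) ^+ 2 = 3%:R - 2%:R * s.
Proof.
move=> /quartic_phi E /=; split; last by rewrite /phi; ring.
have -> : (2%:R * phi c - 1) ^+ 2 = 4%:R * phi c ^+ 2 - 4%:R * phi c + 1 by ring.
by rewrite E; ring.
Qed.

Hypothesis two0 : 2%:R != 0 :> F.

Lemma sqrt_quartic s t : s ^+ 2 = 5%:R -> t ^+ 2 = 3%:R - 2%:R * s ->
  let c := (1 + t) / 2%:R in [/\ quartic c = 0, 2%:R * phi c - 1 = s & 2%:R * c - 1 = t].
Proof.
move=> hs ht c; have cE : 2%:R * c - 1 = t by rewrite /c mulrC divfK // addrC addKr.
have pE : 2%:R * phi c - 1 = s.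
  apply: (mulfI two0); apply: (addrI (- 3%:R)); rewrite -cE in ht.
  have -> : - 3%:R + 2%:R * (2%:R * phi c - 1) = - (2%:R * c - 1) ^+ 2 by rewrite /phi; ring.
  by rewrite ht; ring.
split=> //; apply/quartic_phi; have n4 : 4%:R != 0 :> F.
  have -> : 4%:R = 2%:R * 2%:R :> F by ring.
  by rewrite mulf_neq0.
apply: (mulfI n4).
have -> : 4%:R * phi c ^+ 2 = (2%:R * phi c - 1) ^+ 2 + 4%:R * phi c - 1 by ring.
by rewrite pE hs; ring.
Qed.

End Roots.

Section CharacteristicRoots.
Variables (F : finFieldType) (p n : nat).
Hypotheses (p_pr : prime p) (cF : #|F| = (p ^ n)%N) (n0 : (0 < n)%N).
Implicit Types c d s t : F.

Let pF : p \in [pchar F]. Proof. exact: card_finPcharP cF p_pr. Qed.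

Definition Fr : {rmorphism F -> F} := pFrobenius_aut pF.
Lemma FrE x : Fr x = x ^+ p. Proof. exact: pFrobenius_autE. Qed.

Lemma natr_neq0 k : ~~ (p %| k)%N -> k%:R != 0 :> F.
Proof. by rewrite -(dvdn_pcharf pF). Qed.

Lemma quartic_Fr c : quartic c = 0 -> quartic (c ^+ p) = 0.
Proof. by rewrite -FrE -quartic_morph => ->; rewrite rmorph0. Qed.

Lemma phi_Fr c : phi (c ^+ p) = phi c ^+ p. Proof. by rewrite -!FrE phi_morph. Qed.

Lemma generates_nat_eq1 c (k : nat) : generates c -> c = k%:R -> n = 1%N.
Proof.
move=> gc ck; have := @generates_degree _ _ pF c n 1 gc cF isT; rewrite ck frob_nat // => /(_ erefl).
by lia.
Qed.

Lemma fixed_nat_of_n1 : n = 1%N -> forall x : F, exists k : nat, x = k%:R.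
Proof. by move=> n1 x; apply: (fixed_natP pF); rewrite -{1}[p]expn1 -{1}n1 -cF expf_card. Qed.

Lemma rmorph_fixed (f : {rmorphism F -> F}) x : x ^+ p = x -> f x = x.
Proof. by move/(fixed_natP pF)=> [k ->]; rewrite rmorph_nat. Qed.

(* phi fixed by Frobenius *)
Lemma split_degree c : quartic c = 0 -> generates c -> phi c ^+ p = phi c ->
  (n = 1%N /\ c ^+ p = c) \/ (n = 2%N /\ c ^+ p = 1 - c /\ c ^+ p <> c).
Proof.
move=> qc gc pc; have [cp|cp] := EM (c ^+ p = c).
  left; split=> //; have [k ck] := fixed_natP pF cp; exact: generates_nat_eq1 gc ck.
have cp' : c ^+ p = 1 - c.
  by have [] : c ^+ p = c \/ c ^+ p = 1 - c by apply: phi_eq; rewrite phi_Fr.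
right; split=> //; have n2 : (n <= 2)%N.
  apply: (generates_degree pF gc cF) => //; rewrite expnS expn1 exprM cp'.
  by rewrite -FrE rmorphB rmorph1 FrE cp' opprB addrC subrK.
suff : n <> 1%N by lia.
by move=> n1; case: cp; have := expf_card c; rewrite cF n1 expn1.
Qed.

(** Here phi c has degree 2, so the square of Frobenius fixes c or sends it to 1 - c, and its fourth
    power fixes c. Degree 3 is impossible: the second and third powers fixing phi c would make
    Frobenius fix it. *)
Lemma inert_degree c : quartic c = 0 -> generates c -> phi c ^+ p = 1 - phi c ->
  phi c ^+ p <> phi c ->
  (n = 2%N /\ c ^+ (p ^ 2) = c) \/ (n = 4%N /\ c ^+ (p ^ 2) = 1 - c /\ c ^+ (p ^ 2) <> c).
Proof.
move=> qc gc pc npc.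
have p2 : phi c ^+ (p ^ 2) = phi c.
  by rewrite expnS expn1 exprM pc -FrE rmorphB rmorph1 FrE pc opprB addrC subrK.
have n1 : n <> 1%N by move=> n1; case: npc; have := expf_card (phi c); rewrite cF n1 expn1.
have [cp|cp] := EM (c ^+ (p ^ 2) = c).
  by left; split=> //; have := generates_degree pF gc cF (m := 2) isT cp; lia.
have cp' : c ^+ (p ^ 2) = 1 - c.
  have [] // : c ^+ (p ^ 2) = c \/ c ^+ (p ^ 2) = 1 - c.
  by apply: phi_eq; rewrite -[RHS]p2 expnS expn1 !exprM !phi_Fr.
right; split=> //; have n4 : (n <= 4)%N.
  apply: (generates_degree pF gc cF) => //; rewrite (expnD p 2 2) exprM cp'.
  by rewrite (frobB pF) expr1n cp' opprB addrC subrK.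
have n2 : n <> 2%N by move=> n2; case: cp; have := expf_card c; rewrite cF n2.
have n3 : n <> 3%N.
  move=> n3; case: npc; have := expf_card (phi c).
  by rewrite cF n3 (expnD p 2 1) exprM p2 expn1.
by lia.
Qed.

End CharacteristicRoots.

Section CensusByDegree.
Variables (F : finFieldType) (p n : nat).
Hypotheses (p_pr : prime p) (cF : #|F| = (p ^ n)%N).
Implicit Types c d s t : F.

Let pF : p \in [pchar F]. Proof. exact: card_finPcharP cF p_pr. Qed.
Notation frob := (Fr p_pr cF).

Lemma census_prime (rs : seq F) : n = 1%N -> uniq rs -> (forall c, quartic c = 0 <-> c \in rs) ->
  (L2_quotients F #= `I_(size rs))%card.
Proof.
move=> n1 u rsP; have c1 : #|F| = p by rewrite cF n1 expn1.
have fixed (s : {rmorphism F -> F}) x : s x = x.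
  by apply: (rmorph_fixed p_pr cF); rewrite -c1 expf_card.
apply: L2_quotients_card.
- by move=> c /rsP; split=> //; exact: generates1 pF _ c1.
- by move=> i j s li lj; rewrite fixed => /eqP; rewrite nth_uniq // => /eqP.
- by move=> c _ /rsP crs; exists c, idfun.
Qed.

(** Frobenius exchanges c and 1 - c, so the orbits are indexed by the values of phi. *)
Lemma census_split (rs : seq F) : n = 2%N ->
  (forall c, c \in rs -> [/\ quartic c = 0, phi c ^+ p = phi c & c ^+ p <> c]) ->
  uniq [seq phi c | c <- rs] ->
  (forall d, generates d -> quartic d = 0 -> phi d \in [seq phi c | c <- rs]) ->
  (L2_quotients F #= `I_(size rs))%card.
Proof.
move=> n2 hrs u cov; have c2 : #|F| = (p ^ 2)%N by rewrite cF n2.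
apply: L2_quotients_card.
- by move=> c /hrs[qc _ cp]; split=> //; exact: generates2 pF _ c2 cp.
- move=> i j s li lj E; have [_ fi _] := hrs _ (mem_nth 0 li).
  have := rmorph_fixed p_pr cF s fi; rewrite phi_morph E => /esym/eqP.
  by rewrite -!(nth_map 0 0 (@phi F)) // nth_uniq ?size_map // => /eqP.
- move=> d gd qd; have /mapP[c crs E] := cov _ gd qd; have [qc fc cp] := hrs _ crs.
  have [->|->] := phi_eq E; first by exists c, idfun.
  exists c, frob; split=> //; rewrite FrE.
  have [] // : c ^+ p = c \/ c ^+ p = 1 - c.
  by apply: phi_eq; rewrite (phi_Fr p_pr cF).
Qed.

Lemma inert_phi c d : quartic c = 0 -> phi c ^+ p = 1 - phi c -> quartic d = 0 ->
  [\/ d = c, d = 1 - c, d = c ^+ p | d = 1 - c ^+ p].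
Proof.
move=> qc pc qd; have [/phi_eq|E] := quartic_phi_eq qc qd.
  by case=> ->; [constructor 1 | constructor 2].
have [||] := @phi_eq _ (c ^+ p) d; first by rewrite E (phi_Fr p_pr cF) pc.
  by move=> ->; constructor 3.
by move=> ->; constructor 4.
Qed.

(** The four roots form the orbits of c and of 1 - c: an automorphism exchanging these two would fix
    phi c, which generates F, and so be the identity. *)
Lemma census_inert2 c : n = 2%N -> quartic c = 0 -> phi c ^+ p = 1 - phi c ->
  phi c ^+ p <> phi c -> 2%:R * c <> 1 -> (L2_quotients F #= `I_2)%card.
Proof.
move=> n2 qc pc npc nc; have c2 : #|F| = (p ^ 2)%N by rewrite cF n2.
have gen d : quartic d = 0 -> phi d = phi c -> generates d.
  move=> qd E; apply: generates2 pF _ c2 _ => dp; apply: npc.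
  by rewrite -E -(phi_Fr p_pr cF) dp.
have gphi : generates (phi c) by apply: generates2 pF _ c2 npc.
have nc' : c <> 1 - c.
  move=> E; apply: nc; have -> : 2%:R * c = c + c by ring.
  by rewrite {2}E addrC subrK.
apply: (@L2_quotients_card F [:: c; 1 - c]).
- move=> d; rewrite !inE => /orP[]/eqP->; split=> //; rewrite ?quartic_1B //; apply: gen => //.
    by rewrite quartic_1B.
  by rewrite phi_1B.
- have key (s : {rmorphism F -> F}) : s c <> 1 - c.
    move=> sc; apply: nc'; rewrite -sc; apply/eqP; rewrite eq_sym.
    have : c \in [set x | s x == x]; last by rewrite inE.
    apply: gphi => [|x y|x y|]; rewrite !inE ?rmorph1 //.
    + by rewrite rmorphB => /eqP-> /eqP->.
    + by rewrite rmorphM => /eqP-> /eqP->.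
    + by rewrite phi_morph sc phi_1B.
  move=> [|[|//]] [|[|//]] s _ _ //=; first by move/key.
  by rewrite rmorphB rmorph1 => E; case: (key s); rewrite -[in RHS]E opprB addrC subrK.
- move=> d gd qd; case: (inert_phi qc pc qd) => ->.
  + by exists c, idfun; rewrite mem_head.
  + by exists (1 - c), idfun; rewrite !inE eqxx orbT.
  + by exists c, frob; rewrite mem_head FrE.
  + by exists (1 - c), frob; rewrite !inE eqxx orbT rmorphB rmorph1 FrE.
Qed.

(** Frobenius permutes the roots in one cycle c, c^p, 1 - c, 1 - c^p. *)
Lemma census_inert4 c : n = 4%N -> quartic c = 0 -> phi c ^+ p = 1 - phi c ->
  phi c ^+ p <> phi c -> c ^+ (p ^ 2) <> c -> (L2_quotients F #= `I_1)%card.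
Proof.
move=> n4 qc pc npc nc; have c4 : #|F| = (p ^ 4)%N by rewrite cF n4.
have p2 : phi c ^+ (p ^ 2) = phi c.
  by rewrite expnS expn1 exprM pc -(FrE p_pr cF) rmorphB rmorph1 FrE pc opprB addrC subrK.
have cp' : c ^+ (p ^ 2) = 1 - c.
  have [] // : c ^+ (p ^ 2) = c \/ c ^+ (p ^ 2) = 1 - c.
  by apply: phi_eq; rewrite -[RHS]p2 expnS expn1 !exprM !(phi_Fr p_pr cF).
have cpp : (c ^+ p) ^+ p = 1 - c by rewrite -exprM -cp' expnS expn1.
pose frob2 : {rmorphism F -> F} := GRing.RMorphism.clone _ _ (frob \o frob) _.
apply: (@L2_quotients_card F [:: c]).
- move=> d; rewrite inE => /eqP->; split=> //.
  apply: (generates4 pF c4 _ p2 npc nc) => B B1 BB BM Bc.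
  have B0 : 0 \in B by rewrite -(subrr 1) BB.
  by rewrite /phi BB ?expr2 ?BM // -[c]opprK -[- c]sub0r BB ?BB.
- by move=> [|//] [|//].
- move=> d gd qd; case: (inert_phi qc pc qd) => ->; exists c.
  + by exists idfun; rewrite mem_head.
  + by exists frob2; rewrite mem_head /= !FrE.
  + by exists frob; rewrite mem_head FrE.
  + exists (GRing.RMorphism.clone _ _ (frob \o frob2) _); rewrite mem_head /= !FrE cpp.
    by rewrite -(FrE p_pr cF) rmorphB rmorph1 FrE.
Qed.

End CensusByDegree.

Section CensusCases.
Variables (F : finFieldType) (p n : nat).
Hypotheses (p_pr : prime p) (cF : #|F| = (p ^ n)%N) (n0 : (0 < n)%N).
Implicit Types c d s t : F.

Let pF : p \in [pchar F]. Proof. exact: card_finPcharP cF p_pr. Qed.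
Notation frob := (Fr p_pr cF).

Lemma card_none : (forall c, generates c -> quartic c = 0 -> False) -> (L2_quotients F #= `I_0)%card.
Proof. by move=> h; apply: L2_quotients_card0 => c qc gc; exact: h gc qc. Qed.

(** Modulo 2 the quartic is x^4 + x + 1, and its roots have degree 4. *)
Lemma census_char2 : p = 2%N -> (L2_quotients F #= `I_(if n == 4 then 1 else 0))%card.
Proof.
move=> p2; have F2 : 2%:R = 0 :> F by rewrite -{1}p2 (pcharf0 pF).
have NN (x : F) : - x = x by apply/esym/eqP; rewrite -addr_eq0 -mulr2n -mulr_natr F2 mulr0.
have facts c : quartic c = 0 -> [/\ phi c ^+ p = 1 - phi c, phi c ^+ p <> phi c & c ^+ (p ^ 2) <> c].
  move=> qc; have E := (quartic_phi c).1 qc; have E1 : phi c ^+ p = 1 - phi c by rewrite p2 E NN addrC.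
  have nE : phi c ^+ p <> phi c.
    by rewrite E1 NN => /eqP; rewrite addrC -subr_eq0 addrAC subrr add0r oner_eq0.
  split=> // cp; have /eqP : (1 : F) = 0.
    have -> : (1 : F) = - quartic c + 2%:R * (- c ^+ 3 + c) + (c ^+ 4 - c).
      by rewrite /quartic /phi; ring.
    have c4 : c ^+ 4 = c by rewrite -[RHS]cp p2.
    by rewrite qc F2 mul0r oppr0 !add0r c4 subrr.
  by rewrite oner_eq0.
case: eqP => [n4|n4]; last first.
  apply: card_none => c gc qc; have [E nE nc] := facts c qc.
  by have [[_ ?]|[? _]] := inert_degree p_pr cF n0 qc gc E nE.
have [c qc] : exists c, quartic c = 0; last first.
  by have [E nE nc] := facts c qc; exact: (census_inert4 p_pr cF n4 qc E nE nc).
apply: contrapT => nq; pose P : {poly F} := ('X^4 + 'X + 1) ^+ 3 + 1.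
have sq : size ('X^4 + 'X + 1 : {poly F}) = 5%N.
  by rewrite -addrA size_polyDl ?size_polyXn // (leq_ltn_trans (size_polyD _ _)) // size_polyX size_poly1.
have sP : size P = 13%N.
  have s3 : size (('X^4 + 'X + 1 : {poly F}) ^+ 3) = 13%N.
    by have := size_exp ('X^4 + 'X + 1 : {poly F}) 3; rewrite sq; case: (size _) => [|k] //= ->.
  by rewrite /P size_polyDl s3 // size_poly1.
have := @max_poly_roots _ P (enum F); rewrite -cardE cF n4 p2 sP; move=> h.
suff : (2 ^ 4 < 13)%N by [].
apply: h; [by rewrite -size_poly_eq0 sP| |exact: enum_uniq].
apply/allP=> x _; rewrite /root !hornerE.
pose q := x ^+ 4 + x + 1; have q0 : q != 0.
  apply/eqP=> q0; apply: nq; exists x; rewrite -q0.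
  have -> : quartic x = q + 2%:R * (- x ^+ 3 - 1) by rewrite /quartic /phi /q; ring.
  by rewrite F2 mul0r addr0.
rewrite -/q; apply/eqP; apply: (mulfI q0); rewrite mulr0.
have -> : q * (q ^+ 3 + 1) = q ^+ 4 + q by ring.
have D (a b : F) : (a + b) ^+ 4 = a ^+ 4 + b ^+ 4 by have := frobD pF 2 a b; rewrite p2.
have x16 : x ^+ 16 = x by have := expf_card x; rewrite cF n4 p2.
have -> : q ^+ 4 = x + x ^+ 4 + 1 by rewrite /q !D -exprM x16 expr1n.
have -> : x + x ^+ 4 + 1 + q = 2%:R * q by rewrite /q; ring.
by rewrite F2 mul0r.
Qed.

Section OddCharacteristic.
Hypothesis (p2 : p <> 2%N).

Lemma p_odd : odd p. Proof. by have := even_prime p_pr; case. Qed.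

Lemma two_neq0 : 2%:R != 0 :> F.
Proof. by apply: (natr_neq0 p_pr cF); rewrite dvdn_prime2 //; apply/eqP. Qed.

Lemma half_fixed c k : (2%:R * c - 1) ^+ (p ^ k) = 2%:R * c - 1 <-> c ^+ (p ^ k) = c.
Proof.
rewrite (frobB pF) exprMn (frob_nat pF) expr1n; split=> [/addIr/(mulfI two_neq0)//|->//].
Qed.

Lemma half_fixed1 c : (2%:R * c - 1) ^+ p = 2%:R * c - 1 <-> c ^+ p = c.
Proof. by have := half_fixed c 1; rewrite expn1. Qed.

Lemma phi_fixed c : phi c ^+ p = phi c <-> (2%:R * phi c - 1) ^+ p = 2%:R * phi c - 1.
Proof. exact: iff_sym (half_fixed1 (phi c)). Qed.

Lemma sqrt_phi_eq c d : 2%:R * phi c - 1 = 2%:R * phi d - 1 -> phi c = phi d.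
Proof. by move/addIr/(mulfI two_neq0). Qed.

Lemma sqrt5_cases s c : s ^+ 2 = 5%:R -> quartic c = 0 ->
  2%:R * phi c - 1 = s \/ 2%:R * phi c - 1 = - s.
Proof.
move=> hs qc; have [E _] := quartic_sqrt qc.
have /eqP : (2%:R * phi c - 1) ^+ 2 = s ^+ 2 by rewrite E hs.
by rewrite eqf_sqr => /orP[]/eqP; [left|right].
Qed.

(** A root with 2 c = 1 would make 3 - 2 s vanish, hence also its norm 9 - 4 * 5 = - 11. *)
Lemma half_neq s t c : t ^+ 2 = 3%:R - 2%:R * s -> s ^+ 2 = 5%:R -> 11%:R != 0 :> F -> 2%:R * c - 1 = t -> 2%:R * c <> 1.
Proof.
move=> ht hs n11 cE c1; move: ht; rewrite -cE c1 subrr expr0n /= => E.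
case/eqP: n11; have -> : 11%:R = - (3%:R - 2%:R * s) * (3%:R + 2%:R * s) + 4%:R * (5%:R - s ^+ 2) by ring.
by rewrite -E hs subrr !mulr0 oppr0 mul0r addr0.
Qed.

Lemma sqrt_root s t c : t ^+ 2 = 3%:R - 2%:R * s -> quartic c = 0 -> 2%:R * phi c - 1 = s ->
  t ^+ p = t -> c ^+ p = c.
Proof.
move=> ht qc pc tp; apply/half_fixed1; have [_ E] := quartic_sqrt qc; rewrite pc -ht in E.
move/eqP: E; rewrite eqf_sqr => /orP[]/eqP-> //.
by rewrite -(FrE p_pr cF) rmorphN FrE tp.
Qed.

Lemma sign_fixed s c : s ^+ 2 = 5%:R -> s ^+ p = s -> quartic c = 0 -> phi c ^+ p = phi c.
Proof.
move=> hs sp qc; apply/phi_fixed; have [->//|->] := sqrt5_cases hs qc.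
by rewrite -(FrE p_pr cF) rmorphN FrE sp.
Qed.

Lemma sqrt5_neq s : s ^+ 2 = 5%:R -> 5%:R != 0 :> F -> s <> - s.
Proof.
move=> hs n5 E; case/eqP: n5; rewrite -hs; have /eqP : 2%:R * s = 0.
  have -> : 2%:R * s = s + s by ring.
  by rewrite {1}E addNr.
by rewrite mulf_eq0 (negbTE two_neq0) => /eqP->; rewrite expr0n.
Qed.

Section SplitCases.
Variables (s t t' : F).
Hypotheses (hs : s ^+ 2 = 5%:R) (n5 : 5%:R != 0 :> F) (n11 : 11%:R != 0 :> F) (sp : s ^+ p = s).
Hypotheses (ht : t ^+ 2 = 3%:R - 2%:R * s).

Let hsN : (- s) ^+ 2 = 5%:R. Proof. by rewrite sqrrN. Qed.

Lemma split_root_eq c d : quartic d = 0 -> 2%:R * phi c - 1 = 2%:R * phi d - 1 -> d = c \/ d = 1 - c.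
Proof. by move=> _ /sqrt_phi_eq E; apply: phi_eq. Qed.

Lemma census_squares : t' ^+ 2 = 3%:R + 2%:R * s -> t ^+ p = t -> t' ^+ p = t' ->
  (L2_quotients F #= `I_(if n == 1 then 4 else 0))%card.
Proof.
move=> E0 tp t'p; have ht' : t' ^+ 2 = 3%:R - 2%:R * - s by rewrite E0 mulrN opprK.
have fixed c : quartic c = 0 -> c ^+ p = c.
  move=> qc; have [pc|pc] := sqrt5_cases hs qc; first exact: sqrt_root ht qc pc tp.
  exact: sqrt_root ht' qc pc t'p.
case: eqP => [n1|n1]; last first.
  apply: card_none => c gc qc; have := split_degree p_pr cF n0 qc gc (sign_fixed hs sp qc).
  by have cp := fixed c qc; case=> [[]|[_ [_]]].
have [qc sc tc] := sqrt_quartic two_neq0 hs ht; have [qd sd td] := sqrt_quartic two_neq0 hsN ht'.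
set c := (1 + t) / 2%:R in qc sc tc; set d := (1 + t') / 2%:R in qd sd td.
have nc : c != 1 - c.
  apply/eqP=> E; apply: (half_neq ht hs n11 tc).
  have -> : 2%:R * c = c + c by ring.
  by rewrite {2}E addrC subrK.
have nd : d != 1 - d.
  apply/eqP=> E; apply: (half_neq ht' hsN n11 td).
  have -> : 2%:R * d = d + d by ring.
  by rewrite {2}E addrC subrK.
have ncd : phi c <> phi d.
  by move=> E; apply: (sqrt5_neq hs n5); rewrite -[in RHS]sd -E sc.
apply: (@census_prime F p n p_pr cF [:: c; 1 - c; d; 1 - d] n1).
  have ne x y : phi x <> phi y -> x != y by move=> E; apply/eqP=> xy; apply: E; rewrite xy.
  by rewrite /= !inE !negb_or nc nd !ne ?phi_1B.
move=> x; split=> [qx|]; last first.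
  by rewrite !inE => /or4P[]/eqP->; rewrite ?quartic_1B.
rewrite !inE; have [px|px] := sqrt5_cases hs qx.
  by have [|->|->] := @split_root_eq c x qx; rewrite ?sc ?px ?eqxx ?orbT.
by have [|->|->] := @split_root_eq d x qx; rewrite ?sd ?px ?eqxx ?orbT.
Qed.

(** The two roots over s lie in the prime field; those over - s are conjugate in its quadratic
    extension. *)
Lemma census_half : t ^+ p = t -> (forall c, quartic c = 0 -> 2%:R * phi c - 1 = - s -> c ^+ p <> c) ->
  (L2_quotients F #= `I_(if n == 1 then 2 else if n == 2 then 1 else 0))%card.
Proof.
move=> tp nsq; have [qc sc tc] := sqrt_quartic two_neq0 hs ht.
set c := (1 + t) / 2%:R in qc sc tc.
have pC d : quartic d = 0 -> phi d ^+ p = phi d by exact: sign_fixed hs sp.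
have nc : c != 1 - c.
  apply/eqP=> E; apply: (half_neq ht hs n11 tc).
  have -> : 2%:R * c = c + c by ring.
  by rewrite {2}E addrC subrK.
have fixed d : quartic d = 0 -> 2%:R * phi d - 1 = s -> d ^+ p = d.
  by move=> qd pd; exact: sqrt_root ht qd pd tp.
case: eqP => [n1|n1].
  apply: (@census_prime F p n p_pr cF [:: c; 1 - c] n1); first by rewrite /= !inE nc.
  move=> x; split=> [qx|]; last by rewrite !inE => /orP[]/eqP->; rewrite ?quartic_1B.
  have [px|px] := sqrt5_cases hs qx.
    by rewrite !inE; have [|->|->] := @split_root_eq c x qx; rewrite ?sc ?px ?eqxx ?orbT.
  by case: (nsq _ qx px); have := expf_card x; rewrite cF n1 expn1.
case: eqP => [n2|n2]; last first.
  by apply: card_none => d gd qd; case: (split_degree p_pr cF n0 qd gd (pC d qd)) => [[]|[]].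
have [||u hu] := @quadratic_square F p (3%:R - 2%:R * - s) p_odd.
- by rewrite cF n2.
- by rewrite mulrN opprK -(FrE p_pr cF) rmorphD rmorphM !rmorph_nat FrE sp.
have [qd sd td] := sqrt_quartic two_neq0 hsN (esym hu).
set d := (1 + u) / 2%:R in qd sd td.
apply: (@census_split F p n p_pr cF [:: d] n2).
- by move=> x; rewrite inE => /eqP->; split=> //; [exact: pC | exact: nsq].
- by [].
move=> x gx qx; rewrite /= inE; apply/eqP; apply: sqrt_phi_eq; rewrite sd.
have [px|//] := sqrt5_cases hs qx.
have [k xk] := fixed_natP pF (fixed x qx px).
by have := generates_nat_eq1 p_pr cF n0 gx xk.
Qed.

End SplitCases.

Lemma census_nonsquares s : s ^+ 2 = 5%:R -> 5%:R != 0 :> F -> s ^+ p = s ->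
  (forall c, quartic c = 0 -> c ^+ p <> c) -> (L2_quotients F #= `I_(if n == 2 then 2 else 0))%card.
Proof.
move=> hs n5 sp nsq; have hsN : (- s) ^+ 2 = 5%:R by rewrite sqrrN.
have pC d : quartic d = 0 -> phi d ^+ p = phi d by exact: sign_fixed hs sp.
case: eqP => [n2|n2]; last first.
  by apply: card_none => d gd qd; case: (split_degree p_pr cF n0 qd gd (pC d qd)) => [[_ /nsq]|[]].
have sqr (r : F) : r ^+ p = r -> exists u, 3%:R - 2%:R * r = u ^+ 2.
  move=> rp; apply: (@quadratic_square F p _ p_odd); first by rewrite cF n2.
  by rewrite -(FrE p_pr cF) rmorphB rmorphM !rmorph_nat FrE rp.
have [u hu] := sqr s sp; have [|v hv] := sqr (- s); first by rewrite -(FrE p_pr cF) rmorphN FrE sp.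
have [qc sc _] := sqrt_quartic two_neq0 hs (esym hu).
have [qd sd _] := sqrt_quartic two_neq0 hsN (esym hv).
set c := (1 + u) / 2%:R in qc sc; set d := (1 + v) / 2%:R in qd sd.
have ncd : phi c <> phi d.
  by move=> E; apply: (sqrt5_neq hs n5); rewrite -[in RHS]sd -E sc.
apply: (@census_split F p n p_pr cF [:: c; d] n2).
- by move=> x; rewrite !inE => /orP[]/eqP->; split; rewrite ?pC //; exact: nsq.
- by rewrite /= !inE andbT; apply/eqP.
move=> x gx qx; rewrite /= !inE; have [px|px] := sqrt5_cases hs qx.
  by apply/orP; left; apply/eqP/sqrt_phi_eq; rewrite sc.
by apply/orP; right; apply/eqP/sqrt_phi_eq; rewrite sd.
Qed.

End OddCharacteristic.
End CensusCases.

Lemma odd_halfE q : odd q -> q = (q.-1)./2.*2.+1.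
Proof. by case: q => [//|q] /=; lia. Qed.

(** * Primes for which 5 is a non-residue *)

Section InertCases.
Variables (F : finFieldType) (p n : nat).
Hypotheses (p_pr : prime p) (cF : #|F| = (p ^ n)%N) (n0 : (0 < n)%N) (p2 : p <> 2%N).
Implicit Types c d s t : F.

Let pF : p \in [pchar F]. Proof. exact: card_finPcharP cF p_pr. Qed.
Notation m := (p.-1)./2.

Lemma p_half : p = m.*2.+1.
Proof. exact/odd_halfE/p_odd. Qed.

Lemma pow_p_half (a x : F) : x ^+ 2 = a -> x ^+ p = x * a ^+ m.
Proof. by move=> <-; rewrite {1}p_half exprS -exprM mul2n. Qed.

Hypothesis h5 : 5%:R ^+ m = -1 :> F.

Lemma sqrt5_inert s : s ^+ 2 = 5%:R -> s ^+ p = - s.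
Proof. by move/pow_p_half->; rewrite h5 mulrN1. Qed.

(** Frobenius sends s to - s, so the (p + 1)-th power is the norm 9 - 4 * 5 = - 11. Being a square
    among p^2 elements is thus decided by the Legendre symbol of - 11. *)
Lemma inert_norm s : s ^+ 2 = 5%:R -> (3%:R - 2%:R * s) ^+ (p.+1 * m) = (- 11%:R) ^+ m.
Proof.
move=> hs; rewrite exprM exprSr -(FrE p_pr cF) rmorphB rmorphM !rmorph_nat FrE (sqrt5_inert hs).
congr (_ ^+ _); have -> : (3%:R - 2%:R * - s) * (3%:R - 2%:R * s) = 9%:R - 4%:R * s ^+ 2 by ring.
by rewrite hs; ring.
Qed.

Lemma inert_sqrt s t : s ^+ 2 = 5%:R -> t ^+ 2 = 3%:R - 2%:R * s ->
  t ^+ (p ^ 2) = t * (- 11%:R) ^+ m.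
Proof.
move=> hs ht; rewrite -(inert_norm hs) -ht -exprM -exprS; congr (_ ^+ _).
by rewrite expnS expn1 {1 2 3}p_half; lia.
Qed.

Lemma inert_phi_p c : quartic c = 0 -> phi c ^+ p = 1 - phi c.
Proof.
move=> qc; have [E _] := quartic_sqrt qc; have := sqrt5_inert E.
rewrite -(FrE p_pr cF) rmorphB rmorphM rmorph_nat rmorph1 FrE => h.
apply: (mulfI (two_neq0 p_pr cF p2)); apply: (addIr (-1)); rewrite h; ring.
Qed.

Hypotheses (n5 : 5%:R != 0 :> F) (n11 : 11%:R != 0 :> F).

Lemma inert_phi_neq c : quartic c = 0 -> phi c ^+ p <> phi c.
Proof.
move=> qc; rewrite (inert_phi_p qc) => E; have [hs _] := quartic_sqrt qc.
apply: (sqrt5_neq p_pr cF p2 hs n5); rewrite -{2}E; ring.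
Qed.

Lemma inert_sqrt5 : (2 %| n)%N -> exists s : F, s ^+ 2 = 5%:R.
Proof.
move=> /dvdnP[k nk]; have [|||s hs] := @quadratic_square F (p ^ k) 5%:R; last by exists s.
- by rewrite oddX (p_odd p_pr p2) orbT.
- by rewrite cF nk -expnD addnn muln2.
- by rewrite (frob_nat pF).
Qed.

Lemma census_inert_squares : (- 11%:R) ^+ m = 1 :> F ->
  (L2_quotients F #= `I_(if n == 2 then 2 else 0))%card.
Proof.
move=> h11; have cp c : quartic c = 0 -> c ^+ (p ^ 2) = c.
  move=> qc; have [hs ht] := quartic_sqrt qc; apply/(half_fixed p_pr cF p2).
  by rewrite (inert_sqrt hs ht) h11 mulr1.
case: eqP => [n2|n2]; last first.
  apply: card_none => c gc qc.
  by have [[//]|[_ [_]]] := inert_degree p_pr cF n0 qc gc (inert_phi_p qc) (inert_phi_neq qc); case; exact: cp.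
have [|s hs] := inert_sqrt5; first by rewrite n2.
(* The exponent (p + 1)(p - 1) / 2 is half of p^2 - 1. *)
have [||t ht] := @euler_square F (p.+1 * m) (3%:R - 2%:R * s).
- by rewrite cF n2 expnS expn1 {1 2}p_half {3}p_half; lia.
- by rewrite exprS (inert_norm hs) h11 mulr1.
have [qc sc tc] := sqrt_quartic (two_neq0 p_pr cF p2) hs (esym ht).
apply: (census_inert2 p_pr cF n2 qc (inert_phi_p qc) (inert_phi_neq qc)).
exact: half_neq (esym ht) hs n11 tc.
Qed.

Lemma census_inert_nonsquares : (- 11%:R) ^+ m = -1 :> F ->
  (L2_quotients F #= `I_(if n == 4 then 1 else 0))%card.
Proof.
move=> h11; have cp c : quartic c = 0 -> c ^+ (p ^ 2) <> c.
  move=> qc; have [hs ht] := quartic_sqrt qc; move/(half_fixed p_pr cF p2).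
  rewrite (inert_sqrt hs ht) h11 mulrN1 => E.
  have : 2%:R * (2%:R * c - 1) = 0.
    have -> : 2%:R * (2%:R * c - 1) = (2%:R * c - 1) + (2%:R * c - 1) by ring.
    by rewrite -{1}E addNr.
  move/eqP; rewrite mulf_eq0 (negbTE (two_neq0 p_pr cF p2)) subr_eq0 => /eqP.
  exact: half_neq ht hs n11 erefl.
case: eqP => [n4|n4]; last first.
  apply: card_none => c gc qc.
  have [[_]|[//]] := inert_degree p_pr cF n0 qc gc (inert_phi_p qc) (inert_phi_neq qc).
  exact: cp.
have [|s hs] := inert_sqrt5; first by rewrite n4.
have [|||t ht] := @quadratic_square F (p ^ 2) (3%:R - 2%:R * s).
- by rewrite oddX (p_odd p_pr p2) orbT.
- by rewrite cF n4 -expnD.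
- rewrite (frobB pF) exprMn !(frob_nat pF) expnS expn1 exprM (sqrt5_inert hs).
  by rewrite -(FrE p_pr cF) rmorphN FrE (sqrt5_inert hs) opprK.
have [qc sc tc] := sqrt_quartic (two_neq0 p_pr cF p2) hs (esym ht).
exact: (census_inert4 p_pr cF n4 qc (inert_phi_p qc) (inert_phi_neq qc) (cp _ qc)).
Qed.

Lemma inert_both_squares : n = 2%N -> (- 11%:R) ^+ m = 1 :> F -> both_squares F.
Proof.
move=> n2 h11; have [|s hs] := inert_sqrt5; first by rewrite n2.
have sq (r : F) : r ^+ 2 = 5%:R -> is_square (3%:R - 2%:R * r).
  move=> hr; apply: (@euler_square F (p.+1 * m) (3%:R - 2%:R * r)).
    by rewrite cF n2 expnS expn1 {1 2}p_half {3}p_half; lia.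
  by rewrite exprS (inert_norm hr) h11 mulr1.
exists s; split=> //; last exact: sq.
by have := sq (- s); rewrite sqrrN mulrN opprK; apply.
Qed.

Lemma inert_not_square s : n = 2%N -> (- 11%:R) ^+ m = -1 :> F -> s ^+ 2 = 5%:R ->
  ~ is_square (3%:R - 2%:R * s).
Proof.
move=> n2 h11 hs [t ht]; have := inert_sqrt hs (esym ht).
have -> : t ^+ (p ^ 2) = t by have := expf_card t; rewrite cF n2.
rewrite h11 mulrN1 => E.
have : 2%:R * t = 0.
  have -> : 2%:R * t = t + t by ring.
  by rewrite {1}E addNr.
move/eqP; rewrite mulf_eq0 (negbTE (two_neq0 p_pr cF p2)) => /eqP t0.
have [_ _ tc] := sqrt_quartic (two_neq0 p_pr cF p2) hs (esym ht).
apply: (half_neq (esym ht) hs n11 tc).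
by apply/eqP; rewrite -subr_eq0 tc t0.
Qed.

Lemma inert_both_nonsquares : n = 2%N -> (- 11%:R) ^+ m = -1 :> F -> both_nonsquares F.
Proof.
move=> n2 h11; have [|s hs] := inert_sqrt5; first by rewrite n2.
exists s; split=> //; last exact: inert_not_square.
by have := @inert_not_square (- s) n2 h11; rewrite sqrrN mulrN opprK; apply.
Qed.

End InertCases.

(** * The exceptional primes 5 and 11 *)

Section RamifiedCases.
Variables (F : finFieldType) (p n : nat).
Hypotheses (p_pr : prime p) (cF : #|F| = (p ^ n)%N) (n0 : (0 < n)%N).
Implicit Types c d : F.

Let pF : p \in [pchar F]. Proof. exact: card_finPcharP cF p_pr. Qed.

(** Here s = 0, so both values of phi coincide, and 3 is a non-square modulo 5, so the two roots are
    conjugate of degree 2. *)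
Lemma census_char5 : p = 5%N -> (L2_quotients F #= `I_(if n == 2 then 1 else 0))%card.
Proof.
move=> p5; have p2 : p <> 2%N by rewrite p5.
have F5 : 5%:R = 0 :> F by rewrite -{1}p5 (pcharf0 pF).
have n2F := two_neq0 p_pr cF p2.
have phi3 c : quartic c = 0 -> 2%:R * phi c - 1 = 0.
  by move=> qc; have [/eqP] := quartic_sqrt qc; rewrite F5 expf_eq0 => /eqP.
have s0 : (0 : F) ^+ 2 = 5%:R by rewrite F5 expr0n.
have pC c : quartic c = 0 -> phi c ^+ p = phi c.
  by move=> qc; apply/(phi_fixed p_pr cF p2); rewrite phi3 // p5 expr0n.
have nsq c : quartic c = 0 -> c ^+ p <> c.
  move=> qc /(half_fixed1 p_pr cF p2) E; have [_ ht] := quartic_sqrt qc.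
  rewrite (phi3 _ qc) mulr0 subr0 in ht; set t := 2%:R * c - 1 in E ht.
  have t0 : t = 0.
    have E9 : t = 3%:R ^+ 2 * t.
      by rewrite -{1}E p5 -ht; ring.
    apply: (mulfI n2F); rewrite mulr0.
    have -> : 2%:R * t = (t - 3%:R ^+ 2 * t) + 5%:R * (2%:R * t) by ring.
    by rewrite -E9 subrr F5 mul0r addr0.
  have : 3%:R != 0 :> F by apply: (natr_neq0 p_pr cF); rewrite p5.
  by rewrite -ht t0 expr0n eqxx.
case: eqP => [n2|n2]; last first.
  apply: card_none => d gd qd.
  by case: (split_degree p_pr cF n0 qd gd (pC d qd)) => [[_ /nsq]|[]]; last by [].
have [|||t ht] := @quadratic_square F p 3%:R; rewrite ?(p_odd p_pr p2) //.
- by rewrite cF n2.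
- by rewrite -{1}[p]expn1 (frob_nat pF).
have [|qc sc tc] := sqrt_quartic n2F s0 (t := t); first by rewrite -ht mulr0 subr0.
apply: (@census_split F p n p_pr cF [:: (1 + t) / 2%:R] n2).
- by move=> x; rewrite inE => /eqP->; split; rewrite ?pC //; exact: nsq.
- by [].
move=> x gx qx; rewrite /= inE; apply/eqP; apply: (sqrt_phi_eq p_pr cF p2).
by rewrite sc phi3.
Qed.

(* 5 = 4 ^ 2; 3 + 2 * 4 = 0 while 3 - 2 * 4 = 6 is not a square. *)
Lemma census_char11 : p = 11%N -> (L2_quotients F #= `I_(if (n == 1) || (n == 2) then 1 else 0))%card.
Proof.
move=> p11; have p2 : p <> 2%N by rewrite p11.
have F11 : 11%:R = 0 :> F by rewrite -{1}p11 (pcharf0 pF).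
have n2F := two_neq0 p_pr cF p2.
have s4 : (4%:R : F) ^+ 2 = 5%:R.
  have -> : (4%:R : F) ^+ 2 = 5%:R + 11%:R by ring.
  by rewrite F11 addr0.
have nat_fixed k : (k%:R : F) ^+ p = k%:R by rewrite -{1}[p]expn1 (frob_nat pF).
have pC d : quartic d = 0 -> phi d ^+ p = phi d by exact: (sign_fixed p_pr cF p2 s4 (nat_fixed 4%N)).
have s4' : (- 4%:R : F) ^+ 2 = 5%:R by rewrite sqrrN.
have z0 : (0 : F) ^+ 2 = 3%:R - 2%:R * - 4%:R.
  have -> : 3%:R - 2%:R * - 4%:R = 11%:R :> F by ring.
  by rewrite F11 expr0n.
have [q6 s6 t6] := sqrt_quartic n2F s4' z0.
set c6 := (1 + 0) / 2%:R in q6 s6 t6.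
have c6E d : quartic d = 0 -> 2%:R * phi d - 1 = - 4%:R -> d = c6.
  move=> qd pd; have [_ ht] := quartic_sqrt qd; rewrite pd -z0 expr0n /= in ht.
  move/eqP: ht; rewrite expf_eq0 /= => /eqP ht.
  by apply: (mulfI n2F); apply: (addIr (-1)); rewrite ht t6.
have nsq d : quartic d = 0 -> 2%:R * phi d - 1 = 4%:R -> d ^+ p <> d.
  move=> qd pd /(half_fixed1 p_pr cF p2) E; have [_ ht] := quartic_sqrt qd.
  rewrite pd in ht; set t := 2%:R * d - 1 in E ht.
  have n5 : 5%:R != 0 :> F by apply: (natr_neq0 p_pr cF); rewrite p11.
  have t0 : t = 0.
    (* t^11 is (t^2)^5 t, and (- 5)^5 = - 1 - 11 * 284. *)
    have E5 : t = (3%:R - 2%:R * 4%:R) ^+ 5 * t by rewrite -{1}E p11 -ht; ring.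
    apply: (mulfI n2F); rewrite mulr0.
    have -> : 2%:R * t = (t - (3%:R - 2%:R * 4%:R) ^+ 5 * t) - 11%:R * (284%:R * t) by ring.
    by rewrite -E5 subrr F11 mul0r subr0.
  move/eqP: ht; rewrite t0 expr0n /= eq_sym; have -> : 3%:R - 2%:R * 4%:R = - 5%:R :> F by ring.
  by rewrite oppr_eq0 (negbTE n5).
have [n1|n1] := eqVneq n 1%N.
  apply: (@census_prime F p n p_pr cF [:: c6] n1) => // x; rewrite inE; split=> [qx|/eqP->//].
  apply/eqP; apply: c6E => //; have [px|//] := sqrt5_cases s4 qx.
  by case: (nsq _ qx px); have := expf_card x; rewrite cF n1 expn1.
have [n2|n2] := eqVneq n 2%N; last first.
  apply: card_none => d gd qd.
  case: (split_degree p_pr cF n0 qd gd (pC d qd)) => [[E _]|[E _]]; [by case/eqP: n1 | by case/eqP: n2].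
have [|||u hu] := @quadratic_square F p (3%:R - 2%:R * 4%:R); rewrite ?(p_odd p_pr p2) //.
- by rewrite cF n2.
- by rewrite -(FrE p_pr cF) rmorphB rmorphM !rmorph_nat.
have [qc sc tc] := sqrt_quartic n2F s4 (esym hu).
apply: (@census_split F p n p_pr cF [:: (1 + u) / 2%:R] n2).
- by move=> x; rewrite inE => /eqP->; split; rewrite ?pC //; exact: nsq.
- by [].
move=> x gx qx; rewrite /= inE; apply/eqP; apply: (sqrt_phi_eq p_pr cF p2); rewrite sc.
have [//|px] := sqrt5_cases s4 qx.
have /(fixed_natP pF)[k xk] : x ^+ p = x.
  by rewrite (c6E x qx px) /c6 addr0 mul1r exprVn nat_fixed.
by have := generates_nat_eq1 p_pr cF n0 gx xk; move/eqP; rewrite (negbTE n1).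
Qed.

End RamifiedCases.

(** * From the prime field to its extensions *)

Section Transfer.
Variables (L F : finFieldType) (p n : nat).
Hypotheses (p_pr : prime p) (cL : #|L| = p) (cF : #|F| = (p ^ n)%N).

Let pF : p \in [pchar F]. Proof. exact: card_finPcharP cF p_pr. Qed.
Let pL : p \in [pchar L].
Proof. by apply: (@card_finPcharP L p 1) => //; rewrite expn1. Qed.

(** The alternatives concern the prime field but are used over F. Square roots in the prime field
    are integers, and congruences between integers transfer. *)
Lemma int_eq_transfer (a b : int) : a%:~R = b%:~R :> L <-> a%:~R = b%:~R :> F.
Proof.
by split=> E; apply/eqP; rewrite -subr_eq0 -rmorphB; apply/eqP;
  [apply: (int_char_transfer pF pL) | apply: (int_char_transfer pL pF)];
  rewrite rmorphB /= E subrr.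
Qed.

Lemma intL (x : L) : exists k : int, x = k%:~R.
Proof.
have [k ->] : exists k : nat, x = k%:R by apply: (fixed_natP pL); rewrite -{1}cL expf_card.
by exists k.
Qed.

Lemma sqrt5_transfer (k : int) : (k%:~R : L) ^+ 2 = 5%:R <-> (k%:~R : F) ^+ 2 = 5%:R.
Proof. by have := int_eq_transfer (k ^+ 2) 5; rewrite !rmorphXn. Qed.

Lemma sqrt_transfer (k j : int) : (j%:~R : L) ^+ 2 = 3%:R - 2%:R * k%:~R <->
  (j%:~R : F) ^+ 2 = 3%:R - 2%:R * k%:~R.
Proof.
have := int_eq_transfer (j ^+ 2) (3%:Z - 2%:Z * k).
by rewrite !rmorphXn !(rmorphB (intr : int -> _)) !(rmorphM (intr : int -> _)).
Qed.

Lemma int_fixed (k : int) : (k%:~R : F) ^+ p = k%:~R.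
Proof. by rewrite -(FrE p_pr cF) rmorph_int. Qed.

Lemma nonsquare_root (k : int) c : p <> 2%N -> (forall j : L, j ^+ 2 <> 3%:R - 2%:R * k%:~R) ->
  quartic c = 0 -> 2%:R * phi c - 1 = k%:~R :> F -> c ^+ p <> c.
Proof.
move=> p2 nsq qc pc /(half_fixed1 p_pr cF p2)/(fixed_natP pF)[j jE]; have [_ ht] := quartic_sqrt qc.
rewrite jE pc in ht; apply: (nsq j%:R).
exact: (sqrt_transfer k j).2 ht.
Qed.

End Transfer.

(** * The clauses of the census *)

Section Clauses.
Variable p : nat.
Hypothesis p_pr : prime p.
Notation m := (p.-1)./2.

Let ndvd k q : (p %% q)%N != 0%N -> prime k -> k = q -> ~~ (p %| k)%N.
Proof.
move=> pq pk kq; rewrite dvdn_prime2 //; apply: contra pq => /eqP->.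
by rewrite kq modnn.
Qed.

Section PrimeField.
Variable L : finFieldType.
Hypotheses (cL : #|L| = p) (p2 : p <> 2%N).

Let cL1 : #|L| = (p ^ 1)%N. Proof. by rewrite expn1. Qed.

Lemma euler_sign (x : L) : x != 0 ->
  (x ^+ m = 1 /\ is_square x) \/ (x ^+ m = -1 /\ forall j, j ^+ 2 <> x).
Proof.
move=> x0; have pE := p_half p_pr p2.
have xm1 (y : L) : y != 0 -> (y ^+ m) ^+ 2 = 1.
  move=> y0; apply: (mulfI y0); rewrite mulr1 -exprM -exprS muln2.
  by rewrite -pE -{1}cL expf_card.
have : (x ^+ m) ^+ 2 = 1 ^+ 2 by rewrite xm1 // expr1n.
move/eqP; rewrite eqf_sqr => /orP[]/eqP E; [left|right].
  split=> //; apply: (@euler_square _ m); first by rewrite cL.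
  by rewrite exprS E mulr1.
split=> // j jx; have j0 : j != 0 by apply: contra_neq x0 => j0; rewrite -jx j0 expr0n.
have : 2%:R = 0 :> L.
  have -> : 2%:R = 1 - (-1) :> L by ring.
  by rewrite -E -jx -exprM mulnC exprM xm1 ?subrr.
by apply/eqP/(two_neq0 p_pr cL1 p2).
Qed.

Lemma one_neqN1 : 1 <> -1 :> L.
Proof.
move=> E; have : 2%:R = 0 :> L.
  have -> : 2%:R = 1 - (-1) :> L by ring.
  by rewrite -E subrr.
by apply/eqP/(two_neq0 p_pr cL1 p2).
Qed.

Lemma sqrt5_split : (5%:R : L) ^+ m = 1 -> exists s : L, s ^+ 2 = 5%:R.
Proof.
move=> h; have [||s hs] := @euler_square L m 5%:R; last by exists s.
  by rewrite cL; exact: p_half p_pr p2.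
by rewrite exprS h mulr1.
Qed.

(* (3 - 2 s) (3 + 2 s) = - 11 *)
Lemma sqrt_signs (s : L) : s ^+ 2 = 5%:R -> 11%:R != 0 :> L ->
  [/\ 3%:R - 2%:R * s != 0, 3%:R + 2%:R * s != 0 &
      (3%:R - 2%:R * s) ^+ m * (3%:R + 2%:R * s) ^+ m = (- 11%:R) ^+ m].
Proof.
move=> hs n11; have E : (3%:R - 2%:R * s) * (3%:R + 2%:R * s) = - 11%:R.
  have -> : (3%:R - 2%:R * s) * (3%:R + 2%:R * s) = 9%:R - 4%:R * s ^+ 2 by ring.
  by rewrite hs; ring.
rewrite -exprMn E; have : (3%:R - 2%:R * s) * (3%:R + 2%:R * s) != 0 by rewrite E oppr_eq0.
by rewrite mulf_eq0 negb_or => /andP[-> ->].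
Qed.

(** The quadratic symbols of 3 - 2 s and 3 + 2 s multiply to that of - 11, which is 1, so they
    agree. *)
Lemma square_dichotomy : (5%:R : L) ^+ m = 1 -> 11%:R != 0 :> L -> (- 11%:R : L) ^+ m = 1 ->
  both_squares L \/ both_nonsquares L.
Proof.
move=> /sqrt5_split[s hs] n11 h11; have [u0 v0] := sqrt_signs hs n11; rewrite h11 => E.
have [[eu su]|[eu su]] := euler_sign u0; have [[ev sv]|[ev sv]] := euler_sign v0.
- by left; exists s.
- by case: one_neqN1; rewrite -[LHS]E eu ev mul1r.
- by case: one_neqN1; rewrite -[LHS]E eu ev mulr1.
by right; exists s; split=> // -[y /esym]; [exact: sv | exact: su].
Qed.

Lemma mixed_squares : (5%:R : L) ^+ m = 1 -> 11%:R != 0 :> L -> (- 11%:R : L) ^+ m = -1 ->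
  exists s : L, [/\ s ^+ 2 = 5%:R, is_square (3%:R - 2%:R * s) & forall j, j ^+ 2 <> 3%:R + 2%:R * s].
Proof.
move=> /sqrt5_split[s hs] n11 h11; have [u0 v0] := sqrt_signs hs n11; rewrite h11 => E.
have [[eu su]|[eu su]] := euler_sign u0; have [[ev sv]|[ev sv]] := euler_sign v0.
- by case: one_neqN1; rewrite -[RHS]E eu ev mul1r.
- by exists s.
- by exists (- s); rewrite sqrrN mulrN opprK.
by case: one_neqN1; rewrite -[RHS]E eu ev mulrNN mulr1.
Qed.

Variables (F : finFieldType) (n : nat).
Hypotheses (cF : #|F| = (p ^ n)%N) (n0 : (0 < n)%N).
Hypotheses (n5 : 5%:R != 0 :> F) (n11 : 11%:R != 0 :> F).

Lemma both_squares_census : both_squares L ->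
  (L2_quotients F #= `I_(if n == 1 then 4 else 0))%card.
Proof.
case=> s [+ + []]; have [k ->] := intL p_pr cL s => hs [i +] j.
have [i' ->] := intL p_pr cL i; have [j' ->] := intL p_pr cL j => hi hj.
have hsF := (sqrt5_transfer p_pr cL cF k).1 hs.
have hjF := (sqrt_transfer p_pr cL cF k j').1 (esym hj).
have hiF : (i'%:~R : F) ^+ 2 = 3%:R - 2%:R * (- k)%:~R.
  by apply/(sqrt_transfer p_pr cL cF); rewrite mulrNz mulrN opprK.
rewrite mulrNz mulrN opprK in hiF.
exact: (census_squares p_pr cF n0 p2 hsF n5 n11 (int_fixed p_pr cF k) hjF hiF
  (int_fixed p_pr cF j') (int_fixed p_pr cF i')).
Qed.

Lemma both_nonsquares_census : both_nonsquares L ->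
  (L2_quotients F #= `I_(if n == 2 then 2 else 0))%card.
Proof.
case=> s []; have [k ->] := intL p_pr cL s => hs nu nv.
have hsF := (sqrt5_transfer p_pr cL cF k).1 hs.
apply: (census_nonsquares p_pr cF n0 p2 hsF n5 (int_fixed p_pr cF k)) => c qc.
have [pc|pc] := sqrt5_cases hsF qc.
  by apply: (nonsquare_root p_pr cL cF p2 _ qc pc) => j jE; apply: nv; exists j.
rewrite -mulrNz in pc; apply: (nonsquare_root p_pr cL cF p2 _ qc pc) => j.
by rewrite mulrNz mulrN opprK => jE; apply: nu; exists j.
Qed.

Lemma mixed_census : (exists s : L, [/\ s ^+ 2 = 5%:R, is_square (3%:R - 2%:R * s) &
    forall j, j ^+ 2 <> 3%:R + 2%:R * s]) ->
  (L2_quotients F #= `I_(if n == 1 then 2 else if n == 2 then 1 else 0))%card.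
Proof.
case=> s []; have [k ->] := intL p_pr cL s => hs [j]; have [j' ->] := intL p_pr cL j => hj nv.
have hsF := (sqrt5_transfer p_pr cL cF k).1 hs.
have hjF := (sqrt_transfer p_pr cL cF k j').1 (esym hj).
apply: (census_half p_pr cF n0 p2 hsF n11 (int_fixed p_pr cF k) hjF (int_fixed p_pr cF j')).
move=> c qc; rewrite -mulrNz => pc; apply: (nonsquare_root p_pr cL cF p2 _ qc pc) => i.
by rewrite mulrNz mulrN opprK; exact: nv.
Qed.

End PrimeField.

Lemma char_neq0 k n (F : finFieldType) : prime k -> (p %% k != 0)%N -> #|F| = (p ^ n)%N ->
  k%:R != 0 :> F.
Proof. by move=> pk pm cF; apply: (natr_neq0 p_pr cF); exact: (ndvd pm). Qed.

Lemma legendre5_1 n (F : finFieldType) : #|F| = (p ^ n)%N -> (p %% 5 \in [:: 1; 4])%N ->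
  5%:R ^+ m = 1 :> F.
Proof.
move=> cF m5; have p2 : p <> 2%N by move=> E; move: m5; rewrite E.
have n5 := char_neq0 (isT : prime 5) _ cF; case: (legendre5 (card_finPcharP cF p_pr) (p_odd p_pr p2)).
- by apply: n5; move: m5; case: (p %% 5)%N.
- by case.
by case=> h; move: m5 h; rewrite !inE; case: (p %% 5)%N => [|[|[|[|[]]]]].
Qed.

Lemma legendre5_N1 n (F : finFieldType) : #|F| = (p ^ n)%N -> p <> 2%N -> (p %% 5 \in [:: 2; 3])%N ->
  5%:R ^+ m = -1 :> F.
Proof.
move=> cF p2 m5; have n5 := char_neq0 (isT : prime 5) _ cF.
case: (legendre5 (card_finPcharP cF p_pr) (p_odd p_pr p2)).
- by apply: n5; move: m5; case: (p %% 5)%N.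
- by case=> h; move: m5 h; rewrite !inE; case: (p %% 5)%N => [|[|[|[|[]]]]].
by case.
Qed.

Lemma legendre11_or n (F : finFieldType) : #|F| = (p ^ n)%N -> p <> 2%N -> p <> 11%N ->
  11%:R != 0 :> F /\
  ((p %% 11 \in [:: 1; 3; 4; 5; 9])%N /\ (- 11%:R) ^+ m = 1 :> F \/
   (p %% 11 \in [:: 2; 6; 7; 8; 10])%N /\ (- 11%:R) ^+ m = -1 :> F).
Proof.
move=> cF p2 p11; have n11 : 11%:R != 0 :> F.
  by apply: (natr_neq0 p_pr cF); rewrite dvdn_prime2 //; apply/eqP.
by split=> //; exact: legendre11 (card_finPcharP cF p_pr) (p_odd p_pr p2) n11.
Qed.

Let QN : (p %% 11 \in [:: 1; 3; 4; 5; 9])%N -> (p %% 11 \in [:: 2; 6; 7; 8; 10])%N -> False.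
Proof. by rewrite !inE; case: (p %% 11)%N => [|[|[|[|[|[|[|[|[|[|[]]]]]]]]]]]. Qed.

Lemma clause_split : (p %% 5 \in [:: 1; 4])%N -> (p %% 11 \in [:: 1; 3; 4; 5; 9])%N ->
  (both_squares 'F_p \/ both_nonsquares 'F_p) /\
  (both_squares 'F_p -> L2_census p (fun n => if n == 1 then 4 else 0)) /\
  (both_nonsquares 'F_p -> L2_census p (fun n => if n == 2 then 2 else 0)).
Proof.
move=> m5 m11; have cL := card_Fp p_pr; have cL1 : #|'F_p| = (p ^ 1)%N by rewrite expn1.
have p2 : p <> 2%N by move=> E; move: m5; rewrite E.
have p11 : p <> 11%N by move=> E; move: m11; rewrite E.
have p5 : (p %% 5 != 0)%N by move: m5; case: (p %% 5)%N.
split; last first.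
  split=> h n F n0 _ cF; have n5 := char_neq0 (isT : prime 5) p5 cF; have [n11 _] := legendre11_or cF p2 p11.
    exact: (both_squares_census cL).
  exact: (both_nonsquares_census cL).
have [n11 h11] := legendre11_or cL1 p2 p11.
have h : (- 11%:R) ^+ m = 1 :> 'F_p by case: h11 => -[// /(QN m11)].
exact: (square_dichotomy cL p2 (legendre5_1 cL1 m5) n11 h).
Qed.

Lemma clause_mixed : (p %% 5 \in [:: 1; 4])%N -> (p %% 11 \in [:: 2; 6; 7; 8; 10])%N ->
  L2_census p (fun n => if n == 1 then 2 else if n == 2 then 1 else 0).
Proof.
move=> m5 m11 n F n0 _ cF; have cL := card_Fp p_pr; have cL1 : #|'F_p| = (p ^ 1)%N by rewrite expn1.
have p2 : p <> 2%N by move=> E; move: m5; rewrite E.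
have p11 : p <> 11%N by move=> E; move: m11; rewrite E.
have [n11 h11] := legendre11_or cL1 p2 p11.
have h : (- 11%:R) ^+ m = -1 :> 'F_p by case: h11 => -[// /QN/(_ m11)].
have [n11F _] := legendre11_or cF p2 p11.
apply: (mixed_census cL p2 cF n0 n11F).
exact: (mixed_squares cL p2 (legendre5_1 cL1 m5) n11 h).
Qed.

Lemma clause_inert : p <> 2%N -> (p %% 5 \in [:: 2; 3])%N ->
  forall F : finFieldType, #|F| = (p ^ 2)%N ->
    (both_squares F \/ both_nonsquares F) /\
    (both_squares F -> L2_census p (fun n => if n == 2 then 2 else 0)) /\
    (both_nonsquares F -> L2_census p (fun n => if n == 4 then 1 else 0)).
Proof.
move=> p2 m5 F0 cF0; have p11 : p <> 11%N by move=> E; move: m5; rewrite E.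
have p5 : (p %% 5 != 0)%N by move: m5; case: (p %% 5)%N.
have [n11 h11] := legendre11_or cF0 p2 p11.
have h5 := legendre5_N1 cF0 p2 m5.
(* The residue of p modulo 11 links the field of the alternative with the field over which quotients
   are counted. *)
have dich : (p %% 11 \in [:: 1; 3; 4; 5; 9])%N /\ both_squares F0 \/
    (p %% 11 \in [:: 2; 6; 7; 8; 10])%N /\ both_nonsquares F0.
  case: h11 => -[m11 h11]; [left|right]; split=> //.
    exact: (inert_both_squares p_pr cF0 isT p2 h5 (char_neq0 (isT : prime 5) p5 cF0) n11 erefl h11).
  exact: (inert_both_nonsquares p_pr cF0 isT p2 h5 n11 erefl h11).
have excl : both_squares F0 -> both_nonsquares F0 -> False.
  case=> s [hs u v] [r [hr nu nv]].
  have : r ^+ 2 == s ^+ 2 by rewrite hs hr.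
  rewrite eqf_sqr => /orP[]/eqP E; first by apply: nu; rewrite E.
  by apply: nv; rewrite E mulrN opprK.
split; first by case: dich => -[_]; [left|right].
split=> h n F n0 _ cF; have h5F := legendre5_N1 cF p2 m5; have [n11F h11F] := legendre11_or cF p2 p11;
  have n5F := char_neq0 (isT : prime 5) p5 cF.
  apply: (census_inert_squares p_pr cF n0 p2 h5F n5F n11F).
  case: dich => -[m11 h']; last by case: excl.
  by case: h11F => -[m11' //]; case: (QN m11 m11').
apply: (census_inert_nonsquares p_pr cF n0 p2 h5F n5F n11F).
case: dich => -[m11 h']; first by case: excl.
by case: h11F => -[m11' //]; case: (QN m11' m11).
Qed.

Lemma clause_2 : p = 2%N -> L2_census p (fun n => if n == 4 then 1 else 0).
Proof. by move=> p2 n F n0 _ cF; exact: (census_char2 p_pr cF n0 p2). Qed.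

Lemma clause_5 : p = 5%N -> L2_census p (fun n => if n == 2 then 1 else 0).
Proof. by move=> p5 n F n0 _ cF; exact: (census_char5 p_pr cF n0 p5). Qed.

Lemma clause_11 : p = 11%N -> L2_census p (fun n => if (n == 1) || (n == 2) then 1 else 0).
Proof. by move=> p11 n F n0 _ cF; exact: (census_char11 p_pr cF n0 p11). Qed.

End Clauses.

(** * The reflection representation of Gamma *)

Section Bijections.
Variable T : Type.

(** The type may be infinite, so the inverse is carried as data; it is determined by the function,
    hence equality is pointwise. *)
Record bij := Bij { bij_fun :> T -> T; bij_inv : T -> T;
  bijK : cancel bij_fun bij_inv; bijVK : cancel bij_inv bij_fun }.
HB.instance Definition _ := gen_eqMixin bij.
HB.instance Definition _ := gen_choiceMixin bij.

Lemma bij_eq (f g : bij) : f =1 g -> f = g.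
Proof.
move=> /funext; case: f g => f f' fK f'K [g g' gK g'K] /= E; subst g.
have E : f' = g' by apply/funext=> x; rewrite -{1}(g'K x) fK.
by subst g'; congr Bij; apply: Prop_irrelevance.
Qed.

Definition bij_one : bij := @Bij id id (fun x => erefl) (fun x => erefl).
Definition bij_mul (f g : bij) : bij := Bij (can_comp (bijK f) (bijK g)) (can_comp (bijVK g) (bijVK f)).
Definition bij_opp (f : bij) : bij := Bij (bijVK f) (bijK f).

Lemma bij_mulA : associative bij_mul. Proof. by move=> f g h; exact: bij_eq. Qed.
Lemma bij_mul1 : left_id bij_one bij_mul. Proof. by move=> f; exact: bij_eq. Qed.
Lemma bij_mulr1 : right_id bij_one bij_mul. Proof. by move=> f; exact: bij_eq. Qed.
Lemma bij_mulV : left_inverse bij_one bij_opp bij_mul.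
Proof. by move=> f; apply: bij_eq => x; rewrite /= bijK. Qed.
Lemma bij_mulVr : right_inverse bij_one bij_opp bij_mul.
Proof. by move=> f; apply: bij_eq => x; rewrite /= bijVK. Qed.

HB.instance Definition _ := isGroup.Build bij bij_mulA bij_mul1 bij_mulr1 bij_mulV bij_mulVr.
End Bijections.

Lemma foldr_mem (T : eqType) (P : T -> Prop) (l : seq T) :
  foldr (fun x Q => P x /\ Q) True l -> forall r, r \in l -> P r.
Proof.
elim: l => [//|x l IH] /= [Px Pl] r; rewrite in_cons => /orP[/eqP->//|].
exact: IH.
Qed.

(* The pair (p, q) stands for p + q phi, where phi ^ 2 = phi + 1. *)
Definition zphi : Type := (int * int)%type.
HB.instance Definition _ := GRing.Zmodule.copy zphi (int * int)%type.
Definition zphi_mul (x y : zphi) : zphi :=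
  (x.1 * y.1 + x.2 * y.2, x.1 * y.2 + x.2 * y.1 + x.2 * y.2).
Lemma zphi_mulA : associative zphi_mul.
Proof. by move=> [a b] [c d] [e f]; rewrite /zphi_mul /=; congr (_, _); ring. Qed.
Lemma zphi_mulC : commutative zphi_mul.
Proof. by move=> [a b] [c d]; rewrite /zphi_mul /=; congr (_, _); ring. Qed.
Lemma zphi_mul1 : left_id ((1, 0) : zphi) zphi_mul.
Proof. by move=> [c d]; rewrite /zphi_mul /=; congr (_, _); ring. Qed.
Lemma zphi_mulD : left_distributive zphi_mul +%R.
Proof. by move=> [a b] [c d] [e f]; rewrite /zphi_mul /=; congr (_, _); rewrite /=; ring. Qed.
Lemma zphi_1neq0 : ((1, 0) : zphi) != 0. Proof. by []. Qed.
HB.instance Definition _ := GRing.Zmodule_isComNzRing.Build zphi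
  zphi_mulA zphi_mulC zphi_mul1 zphi_mulD zphi_1neq0.

Definition golden : zphi := (0, 1).
Lemma golden_sqr : golden ^+ 2 = golden + 1. Proof. by []. Qed.

Section Reflections.
Variables (R : comNzRingType) (f : R).
Hypothesis (ff : f ^+ 2 = f + 1).
Notation W := (R * R * R * R)%type.

(* The reflection representation, for the form with 2 B(e_i, e_j) = - 2 cos (pi / m_ij). *)
Definition refl (i : nat) (v : W) : W :=
  let: (x, y, z, w) := v in
  match i with
  | 0%N => (y - x, y, z, w) | 1%N => (x, x - y + f * z, z, w)
  | 2%N => (x, y, f * y - z + w, w) | _ => (x, y, z, z - w) end.

Lemma reflK i : involutive (refl i).
Proof. by case: i => [|[|[|i]]] [[[x y] z] w] /=; congr (_, _, _, _); ring. Qed.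

Definition refl_bij i : bij W := Bij (reflK i) (reflK i).

Lemma refl_relators r : r \in relators_353 (refl_bij 0) (refl_bij 1) (refl_bij 2) (refl_bij 3) -> r = 1%g.
Proof.
move: r; apply: (@foldr_mem _ (fun r => r = 1%g)); do !split; apply: (@bij_eq W) => -[[[x y] z] w];
  by congr (_, _, _, _); rewrite /=; ring: ff.
Qed.

Lemma rep_exists : exists g : Gamma -> bij W, {morph g : x y / (x * y)%g} /\
  forall i : 'I_4, g (Gamma_gen i) = refl_bij i.
Proof.
by apply: (@Gamma_lift _ (fun i : 'I_4 => refl_bij i)) => r; rewrite !inordK //; exact: refl_relators.
Qed.
Definition rep : Gamma -> bij W := projT1 (cid rep_exists).
Lemma repM x y v : rep (x * y)%g v = rep x (rep y v).
Proof. by rewrite /rep (projT2 (cid rep_exists)).1. Qed.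
Lemma rep_gen (i : 'I_4) v : rep (Gamma_gen i) v = refl i v.
Proof. by rewrite /rep (projT2 (cid rep_exists)).2. Qed.
Lemma rep1 v : rep 1%g v = v.
Proof. by apply: (can_inj (bijK (rep 1%g))); rewrite -repM mulg1. Qed.

Definition wscale (k : R) (v : W) : W := let: (x, y, z, w) := v in (k * x, k * y, k * z, k * w).

Lemma repD g u v : rep g (u + v) = rep g u + rep g v.
Proof.
have D i (p q : W) : refl i (p + q) = refl i p + refl i q.
  case: i p q => [|[|[|i]]] [[[x y] z] w] [[[x' y'] z'] w']; congr (_, _, _, _); rewrite /=; ring.
move: g u v; apply: Gamma_ind => [u v|i g IH u v|i g IH u v]; rewrite ?rep1 // ?Gamma_genV !repM IH !rep_gen D //.
Qed.

Lemma repZ g k v : rep g (wscale k v) = wscale k (rep g v).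
Proof.
have D i (p : W) : refl i (wscale k p) = wscale k (refl i p).
  case: i p => [|[|[|i]]] [[[x y] z] w]; congr (_, _, _, _); rewrite /=; ring.
move: g v; apply: Gamma_ind => [v|i g IH v|i g IH v]; rewrite ?rep1 // ?Gamma_genV !repM IH !rep_gen D //.
Qed.

Definition wbasis (i : nat) : W :=
  match i with 0%N => (1, 0, 0, 0) | 1%N => (0, 1, 0, 0) | 2%N => (0, 0, 1, 0) | _ => (0, 0, 0, 1) end.

Definition wcoord (i : nat) (v : W) : R :=
  let: (x, y, z, w) := v in match i with 0%N => x | 1%N => y | 2%N => z | _ => w end.

Lemma basis_sum v : v = wscale (wcoord 0 v) (wbasis 0) + wscale (wcoord 1 v) (wbasis 1) +
  wscale (wcoord 2 v) (wbasis 2) + wscale (wcoord 3 v) (wbasis 3).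
Proof. by case: v => [[[x y] z] w]; congr (_, _, _, _); rewrite /=; ring. Qed.

End Reflections.

Definition wd (s : seq nat) : Gamma := (\prod_(i <- s) Gamma_gen (inord i))%g.

Lemma wd_cons i s : wd (i :: s) = (Gamma_gen (inord i) * wd s)%g.
Proof. by rewrite /wd big_cons. Qed.
Lemma wd_nil : wd [::] = 1%g. Proof. by rewrite /wd big_nil. Qed.
Lemma wd_cat s t : wd (s ++ t) = (wd s * wd t)%g.
Proof. by rewrite /wd big_cat. Qed.
Lemma wd1 i : wd [:: i] = Gamma_gen (inord i). Proof. by rewrite wd_cons wd_nil mulg1. Qed.
Lemma wdV s : (wd s)^-1%g = wd (rev s).
Proof.
elim: s => [|i s IH]; first by rewrite (_ : rev [::] = [::]) // wd_nil invg1.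
by rewrite wd_cons invgM Gamma_genV IH rev_cons -cats1 wd_cat wd1.
Qed.

Definition letters (s : seq nat) : bool := all (fun i => i < 4)%N s.

Lemma letters_cat s t : letters (s ++ t) = letters s && letters t.
Proof. exact: all_cat. Qed.

Lemma letters_rcons s t : letters (rcons s t) = (t < 4)%N && letters s.
Proof. exact: all_rcons. Qed.

Lemma wd_exists (w : Gamma) : exists2 s, letters s & w = wd s.
Proof.
move: w; apply: Gamma_ind => [|i w [s ls ->]|i w [s ls ->]].
- by exists [::]; rewrite ?wd_nil.
- by exists ((i : nat) :: s); rewrite ?wd_cons ?inord_val //= ltn_ord.
- by exists ((i : nat) :: s); rewrite ?Gamma_genV ?wd_cons ?inord_val //= ltn_ord.
Qed.

Section WordAction.
Variables (R : comNzRingType) (f : R).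
Hypothesis (ff : f ^+ 2 = f + 1).
Definition act_word (s : seq nat) v := foldr (refl f) v s.
Lemma rep_wd s v : letters s -> rep ff (wd s) v = act_word s v.
Proof.
elim: s => [|i s IH] /=; first by rewrite wd_nil rep1.
by case/andP=> i4 ls; rewrite wd_cons repM rep_gen inordK // IH.
Qed.
End WordAction.

(** * Faithfulness, by positive roots *)

Section Faithful.
Local Open Scope nat_scope.

Definition expressible (w : Gamma) (n : nat) : bool :=
  `[< exists s, [/\ letters s, size s = n & w = wd s] >].

Lemma expressible_ex w : exists n, expressible w n.
Proof. by have [s ls ->] := wd_exists w; exists (size s); apply/asboolP; exists s. Qed.

Definition len w := ex_minn (expressible_ex w).

Lemma len_wd s : letters s -> len (wd s) <= size s.
Proof. by move=> ls; rewrite /len; case: ex_minnP => n _; apply; apply/asboolP; exists s. Qed.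

Lemma len_word w : exists s, [/\ letters s, size s = len w & w = wd s].
Proof. by rewrite /len; case: ex_minnP => n /asboolP. Qed.

Lemma len_mul x y : len (x * y)%g <= len x + len y.
Proof.
have [s [ls <- ->]] := len_word x; have [t [lt <- ->]] := len_word y.
by rewrite -wd_cat -size_cat len_wd // letters_cat ls.
Qed.

Notation g i := (wd [:: i]).

Lemma len_gen i : i < 4 -> len (g i) <= 1.
Proof. by move=> i4; apply: len_wd; rewrite /= i4. Qed.

Lemma genK x i : ((x * g i) * g i)%g = x.
Proof. by rewrite wd1 -mulgA Gamma_gen2 mulg1. Qed.

Lemma len_ge x i : i < 4 -> len x <= (len (x * g i)%g).+1.
Proof. by move=> i4; rewrite -{1}[x](genK x i) -addn1 (leq_trans (len_mul _ _)) // leq_add2l len_gen. Qed.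

(* The alternating word of length j in s and t ending with t. *)
Fixpoint alt (s t j : nat) : seq nat := if j is j'.+1 then rcons (alt t s j') t else [::].

Lemma size_alt s t j : size (alt s t j) = j.
Proof. by elim: j s t => //= j IH s t; rewrite size_rcons IH. Qed.

Lemma letters_alt s t j : s < 4 -> t < 4 -> letters (alt s t j).
Proof. by elim: j s t => // j IH s t s4 t4; rewrite [alt _ _ _]/= letters_rcons t4 IH. Qed.

Lemma wd_alt s t j : wd (alt s t j.+1) = (wd (alt t s j) * g t)%g.
Proof. by rewrite /= -cats1 wd_cat. Qed.

Lemma descend n w s t : s < 4 -> t < 4 -> len w <= n -> len w <= len (w * g s)%g ->
  exists v j, [/\ w = (v * wd (alt s t j))%g, len w = len v + j, len v <= len (v * g s)%g
    & len v <= len (v * g t)%g].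
Proof.
elim: n w s t => [|n IH] w s t s4 t4 wn ws.
  exists w, 0; split=> //; [by rewrite wd_nil mulg1 | by rewrite addn0 |].
  by move: wn; rewrite leqn0 => /eqP->.
have [wt|wt] := leqP (len w) (len (w * g t)%g).
  by exists w, 0; split=> //; [rewrite wd_nil mulg1 | rewrite addn0].
have wt1 := len_ge w t4.
have [|||//|v [j [vE lE vt vs]]] := IH (w * g t)%g t s.
- by [].
- by [].
- by rewrite -ltnS; exact: leq_trans wt wn.
- by rewrite genK ltnW.
exists v, j.+1; split=> //; first by rewrite -{1}[w](genK w t) vE -mulgA -wd_alt.
by rewrite addnS -lE; apply/eqP; rewrite eqn_leq wt1 wt.
Qed.

Definition mcox (s t : nat) : nat :=
  match s, t with
  | 0, 1 | 1, 0 | 2, 3 | 3, 2 => 3 | 1, 2 | 2, 1 => 5 | _, _ => 2 end.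

Lemma mcox_gt0 s t : 0 < mcox s t.
Proof. by case: s t => [|[|[|[|s]]]] [|[|[|[|t]]]]. Qed.

Lemma braid_rel (G : groupType) (x y : G) m : (x * x = 1)%g -> (y * y = 1)%g ->
  m \in [:: 2; 3; 5] -> ((x * y) ^+ m = 1)%g ->
  match m with 2 => (x * y = y * x)%g | 3 => (x * y * x = y * x * y)%g
  | _ => (x * y * x * y * x = y * x * y * x * y)%g end.
Proof.
move=> xx yy; have xV : (x^-1 = x)%g by apply: (mulIg x); rewrite mulVg xx.
have yV : (y^-1 = y)%g by apply: (mulIg y); rewrite mulVg yy.
have key (u v : G) : (u * v^-1 = 1 -> u = v)%g by move=> h; apply: (mulIg v^-1%g); rewrite mulgV.
rewrite !inE => /or3P[]/eqP->; rewrite !expgS expg0 mulg1 => E; apply: key;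
  by rewrite !invgM ?xV ?yV -[RHS]E !mulgA.
Qed.

Lemma wd_gg i : (g i * g i = 1)%g. Proof. by rewrite wd1 Gamma_gen2. Qed.

Lemma cox_rel s t : s < 4 -> t < 4 -> s <> t -> ((g s * g t) ^+ mcox s t = 1)%g.
Proof.
have h i j : i < j < 4 -> ((g i * g j) ^+ mcox i j = 1)%g.
  case: i j => [|[|[|[|i]]]] [|[|[|[|j]]]] //; try (by case/andP); move=> _; rewrite [mcox _ _]/= !wd1; apply: Gamma_relations;
    by rewrite /relators_353 !in_cons eqxx ?orbT.
move=> s4 t4 st; case: (ltngtP s t) => [lt|gt|//]; first by apply: h; rewrite lt t4.
have sym : mcox s t = mcox t s by case: s t {s4 t4 st gt} => [|[|[|[|s]]]] [|[|[|[|t]]]].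
rewrite sym; apply: invg_inj; rewrite invg1 -expVgn invgM !wdV.
by apply: h; rewrite gt s4.
Qed.

Lemma braid s t : s < 4 -> t < 4 -> s <> t ->
  wd (alt s t (mcox s t)) = wd (alt t s (mcox s t)).
Proof.
move=> s4 t4 st; have m3 : mcox s t \in [:: 2; 3; 5].
  by case: s t {s4 t4 st} => [|[|[|[|s]]]] [|[|[|[|t]]]].
have := braid_rel (wd_gg s) (wd_gg t) m3 (cox_rel s4 t4 st).
by move: m3; rewrite !inE => /or3P[]/eqP->; rewrite -!wd_cat => ->.
Qed.

Lemma alt_suffix i m s t : s < 4 -> t < 4 ->
  exists x, len x <= i /\ wd (alt s t (i + m)) = (x * wd (alt s t m))%g.
Proof.
elim: m s t => [|m IH] s t s4 t4.
  exists (wd (alt s t i)); rewrite addn0 wd_nil mulg1; split=> //.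
  by rewrite -{2}[i](size_alt s t) len_wd // letters_alt.
have [x [xi xE]] := IH t s t4 s4; exists x; split=> //.
by rewrite addnS !wd_alt xE mulgA.
Qed.

(** Coordinatewise in the basis 1, phi: stronger than positivity of the real number, stable under
    sums and products, and decidable. *)
Definition zpos (x : zphi) : bool := (0 <= x.1)%R && (0 <= x.2)%R.
Definition wpos (v : zphi * zphi * zphi * zphi) : bool :=
  [&& zpos (wcoord 0 v), zpos (wcoord 1 v), zpos (wcoord 2 v) & zpos (wcoord 3 v)].

Lemma zposD x y : zpos x -> zpos y -> zpos (x + y)%R.
Proof. by move=> /andP[? ?] /andP[? ?]; apply/andP; split; apply: Num.Theory.addr_ge0. Qed.
Lemma zposM x y : zpos x -> zpos y -> zpos (x * y)%R.
Proof.
by move=> /andP[? ?] /andP[? ?]; apply/andP; split; rewrite /= ?Num.Theory.addr_ge0 ?Num.Theory.mulr_ge0.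
Qed.
Lemma wposD u v : wpos u -> wpos v -> wpos (u + v)%R.
Proof.
by case: u v => [[[? ?] ?] ?] [[[? ?] ?] ?] /and4P[? ? ? ?] /and4P[? ? ? ?]; apply/and4P; split; apply: zposD.
Qed.
Lemma wposZ k v : zpos k -> wpos v -> wpos (wscale k v).
Proof.
by case: v => [[[? ?] ?] ?] ? /and4P[? ? ? ?]; apply/and4P; split; apply: zposM.
Qed.

Lemma dihedral_table s t j : s < 4 -> t < 4 -> s <> t -> j < mcox s t ->
  let v := act_word golden (alt s t j) (wbasis _ s) in
  [/\ zpos (wcoord s v), zpos (wcoord t v) & v = (wscale (wcoord s v) (wbasis _ s) + wscale (wcoord t v) (wbasis _ t))%R].
Proof.
have chk : all (fun s => all (fun t => (s == t) || all (fun j =>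
    let v := act_word golden (alt s t j) (wbasis _ s) in
    [&& zpos (wcoord s v), zpos (wcoord t v) & v == (wscale (wcoord s v) (wbasis _ s) + wscale (wcoord t v) (wbasis _ t))%R])
    (iota 0 (mcox s t))) (iota 0 4)) (iota 0 4) by vm_compute.
move=> s4 t4 st jm; have := allP chk s; rewrite mem_iota s4 => /(_ isT)/allP/(_ t).
rewrite mem_iota t4 => /(_ isT)/orP[/eqP//|/allP/(_ j)]; rewrite mem_iota jm => /(_ isT).
by case/and3P=> ? ? /eqP.
Qed.

Local Notation Rep := (rep golden_sqr).

Lemma basis_wpos s : s < 4 -> wpos (wbasis _ s).
Proof. by case: s => [|[|[|[|s]]]]. Qed.

Lemma refl_basis s : s < 4 -> refl golden s (wbasis _ s) = wscale (-1)%R (wbasis _ s).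
Proof. by case: s => [|[|[|[|s]]]]. Qed.

Lemma basis_wneg s : s < 4 -> ~~ wpos (wscale (-1)%R (wbasis _ s)).
Proof. by case: s => [|[|[|[|s]]]]. Qed.

(** Write w as v times an alternating word in s and t. This word has fewer than m letters, so it
    sends the root of s to a non-negative combination of two simple roots, and v keeps both positive
    by induction. *)
Lemma root_positive w s : s < 4 -> len w <= len (w * g s)%g -> wpos (Rep w (wbasis _ s)).
Proof.
have [n] := ubnP (len w); elim: n w s => // n IH w s wn s4 ws.
have [u [lu su wE]] := len_word w; case/lastP: u lu su wE => [|u t] lu su wE.
  by rewrite wE wd_nil rep1 basis_wpos.
move: lu; rewrite letters_rcons => /andP[t4 lu].
have wtE : (w * g t)%g = wd u by rewrite wE -cats1 wd_cat genK.
have wt : len (w * g t)%g < len w by rewrite wtE -su size_rcons ltnS len_wd.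
have st : s <> t by move=> st; move: ws; rewrite st leqNgt wt.
have [v [j [vE lE vs vt]]] := descend s4 t4 (leqnn _) ws.
have j0 : 0 < j.
  case: j vE lE => // vE _; move: vt; rewrite -[v]mulg1 -wd_nil -[[::]]/(alt s t 0) -vE.
  by rewrite leqNgt wt.
have jm : j < mcox s t.
  (* With m letters or more, the braid relation would let the word end in s, and then w s would be
     shorter than w. *)
  rewrite ltnNge; apply/negP=> mj.
  have [x [xl xE]] := alt_suffix (j - mcox s t) (mcox s t) s4 t4; rewrite subnK // in xE.
  have m0 := mcox_gt0 s t.
  move: ws; rewrite {2}vE xE braid // -(prednK m0) wd_alt -!mulgA wd_gg mulg1 leqNgt => /negP; apply.
  rewrite lE (leq_ltn_trans (len_mul _ _)) // ltn_add2l (leq_ltn_trans (len_mul _ _)) //.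
  have : len (wd (alt s t (mcox s t).-1)) <= (mcox s t).-1.
    by rewrite -{2}[(mcox s t).-1](size_alt s t) len_wd // letters_alt.
  by move: xl m0 mj; lia.
have [zs zt E] := dihedral_table s4 t4 st jm.
rewrite vE repM rep_wd ?letters_alt // E repD !repZ wposD ?wposZ //; apply: IH => //;
  by move: wn j0; rewrite lE; lia.
Qed.

(** If a shortest word of w ends in t, then w t keeps the root of t positive; but it sends this root
    to its opposite when w acts trivially. *)
Lemma rep_faithful w : (forall s, s < 4 -> Rep w (wbasis _ s) = wbasis _ s) -> w = 1%g.
Proof.
move=> h; have [u [lu su wE]] := len_word w; case/lastP: u lu su wE => [|u t] lu su wE.
  by rewrite wE wd_nil.
move: lu; rewrite letters_rcons => /andP[t4 lu].
have wtE : (w * g t)%g = wd u by rewrite wE -cats1 wd_cat genK.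
have wt : len (w * g t)%g < len w by rewrite wtE -su size_rcons ltnS len_wd.
have : len (w * g t)%g <= len (w * g t * g t)%g by rewrite genK ltnW.
move/(root_positive t4); rewrite repM wd1 rep_gen inordK //.
by rewrite (refl_basis t4) repZ h // (negbTE (basis_wneg t4)).
Qed.

(** By faithfulness a complete invariant of the group element, so that [vm_compute] on keys decides
    equality of words. *)
Definition key (s : seq nat) : seq (zphi * zphi * zphi * zphi) :=
  [seq act_word golden s (wbasis _ i) | i <- iota 0 4].

Lemma wd_key s t : letters s -> letters t -> key s = key t -> wd s = wd t.
Proof.
move=> ls lt E; suff : ((wd t)^-1 * wd s = 1)%g.
  by move=> h; rewrite -[RHS]mulg1 -h mulKVg.
apply: rep_faithful => i i4; rewrite repM rep_wd //.
have /(congr1 (fun l => nth 0%R l i)) := E.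
rewrite /key !(nth_map 0) ?size_iota // nth_iota // add0n => ->.
by rewrite -(rep_wd golden_sqr) // -repM mulVg rep1.
Qed.

Lemma key_wd s t : letters s -> letters t -> wd s = wd t -> key s = key t.
Proof. by move=> ls lt E; apply: eq_map => i; rewrite -!(rep_wd golden_sqr) // E. Qed.

End Faithful.

(** * Primes of Z[phi] and torsion in Gamma *)

Definition znorm (x : zphi) : int := x.1 ^+ 2 + x.1 * x.2 - x.2 ^+ 2.

Lemma znormM x y : znorm (x * y) = znorm x * znorm y.
Proof. by case: x y => [a b] [c d]; rewrite /znorm /=; ring. Qed.

(** Completing the square gives (2 p + r)^2 = 5 r^2, impossible for r nonzero by the parity of the
    exponent of 5. *)
Lemma znorm_eq0 x : znorm x = 0 -> x = 0.
Proof.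
case: x => p r; rewrite /znorm /= => h.
have E : (2%:R * p + r) ^+ 2 = 5%:R * r ^+ 2 :> int by apply/eqP; rewrite -subr_eq0; apply/eqP; rewrite -[RHS](mulr0 4%:R) -h; ring.
have r0 : r = 0.
  have /(congr1 absz) := E; rewrite abszM !abszX => E5.
  have [//|r0] := eqVneq r 0; have := congr1 (logn 5) E5.
  have r5 : (0 < `|r|)%N by rewrite absz_gt0.
  by rewrite lognM ?expn_gt0 ?r5 // !lognX (_ : logn 5 (absz (5%:R : int)) = 1%N) //; lia.
move: E; rewrite r0 expr0n mulr0 addr0 => /eqP; rewrite expf_eq0 /= mulf_eq0 => /orP[|/eqP->] //.
Qed.

Lemma wscaleD (R : comNzRingType) (k : R) : {morph wscale k : u v / u + v}.
Proof. by move=> [[[? ?] ?] ?] [[[? ?] ?] ?]; congr (_, _, _, _); rewrite /= mulrDr. Qed.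
Lemma wscale0 (R : comNzRingType) (k : R) : wscale k 0 = 0.
Proof. by congr (_, _, _, _); rewrite /= mulr0. Qed.

Section Prime.
Variables (q k : nat).
Hypotheses (q_pr : prime q) (qk : (k ^ 2 = q + k + 1)%N).

(** A generator phi - k of a prime ideal above q, for k a root of x^2 - x - 1 modulo q. The pairs
    (q, k) used are (11, 4) and (19, 5). *)
Definition zprime : zphi := (- k%:Z, 1).

Lemma znorm_prime : znorm zprime = q.
Proof.
have : k%:Z ^+ 2 = q%:Z + k%:Z + 1 by rewrite -rmorphXn /= -[k ^+ 2]/(k ^ 2)%N qk !PoszD.
by rewrite /znorm /= sqrrN expr1n mulr1 => ->; ring.
Qed.

Lemma zprime_regular x : zprime * x = 0 -> x = 0.
Proof.
move=> h; apply: znorm_eq0; have /eqP := congr1 znorm h.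
rewrite znormM znorm_prime (_ : znorm 0 = 0) // mulf_eq0 => /orP[|/eqP//].
by move: (prime_gt0 q_pr); case: q.
Qed.

(** The norm of x would be divisible by every power of q. *)
Lemma zprime_powers x : (forall n, exists y, x = zprime ^+ n * y) -> x = 0.
Proof.
move=> h; apply: znorm_eq0; apply/eqP; apply: contraT => N0.
have [y xE] := h `|znorm x|%N; have := congr1 (fun z => `|znorm z|%N) xE.
have -> n : znorm (zprime ^+ n * y) = q%:Z ^+ n * znorm y.
  rewrite znormM; congr (_ * _); elim: n => [|n IH]; first by [].
  by rewrite !exprS znormM IH znorm_prime.
rewrite abszM abszX /= => E; have y0 : (0 < `|znorm y|)%N.
  by move: (E) N0; rewrite -absz_eq0 -lt0n; case: `|znorm y|%N => // ->; rewrite muln0.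
have := ltn_expl `|znorm x| (prime_gt1 q_pr); move: E y0.
by case: `|znorm y|%N => // m; rewrite mulnS; lia.
Qed.

Variable F : finFieldType.
Hypothesis qF : q \in [pchar F].

Definition red (x : zphi) : F := x.1%:~R + x.2%:~R * k%:R.

Lemma k_golden : (k%:R : F) ^+ 2 = k%:R + 1.
Proof. by rewrite -natrX qk !natrD (pcharf0 qF) add0r. Qed.

Lemma redD x y : red (x + y) = red x + red y.
Proof. by case: x y => [a b] [c d]; rewrite /red /= !rmorphD; ring. Qed.
Lemma redN x : red (- x) = - red x.
Proof. by case: x => [a b]; rewrite /red /= !rmorphN; ring. Qed.
Lemma redM x y : red (x * y) = red x * red y.
Proof.
by case: x y => [a b] [c d]; rewrite /red /= !(rmorphD, rmorphM) /=; ring: k_golden.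
Qed.
Lemma red1 : red 1 = 1. Proof. by rewrite /red /= mul0r addr0. Qed.
Lemma red0 : red 0 = 0. Proof. by rewrite /red /= mul0r addr0. Qed.
Lemma red_golden : red golden = k%:R. Proof. by rewrite /red /= add0r mul1r. Qed.

Lemma red_eq0 x : red x = 0 -> exists y, x = zprime * y.
Proof.
case: x => p r; rewrite /red /= => h.
have : (p + r * k%:Z)%:~R = 0 :> F by rewrite rmorphD rmorphM /= -h.
move/eqP; rewrite -(dvdz_pcharf qF) => /dvdzP[m mE].
exists (m * (1 - k%:Z) + r, - m).
have kk : k%:Z ^+ 2 = q%:Z + k%:Z + 1 by rewrite -rmorphXn /= -[k ^+ 2]/(k ^ 2)%N qk !PoszD.
have -> : p = m * q%:Z - r * k%:Z by rewrite -mE addrK.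
have -> : q%:Z = k%:Z ^+ 2 - k%:Z - 1 by rewrite kk; ring.
by congr (_, _); rewrite /=; ring.
Qed.

Notation W R := (R * R * R * R)%type.
Definition wred (v : W zphi) : W F := let: (x, y, z, w) := v in (red x, red y, red z, red w).

Lemma wred_rep g v : wred (rep golden_sqr g v) = rep k_golden g (wred v).
Proof.
have D (i : nat) (p : W zphi) : wred (refl golden i p) = refl k%:R i (wred p).
  by case: i p => [|[|[|i]]] [[[x y] z] w]; congr (_, _, _, _); rewrite /= !(redD, redN, redM, red_golden).
by move: g v; apply: Gamma_ind => [v|i g IH v|i g IH v]; rewrite ?rep1 // ?Gamma_genV !repM !rep_gen D IH.
Qed.

Lemma wredD u v : wred (u + v) = wred u + wred v.
Proof. by case: u v => [[[? ?] ?] ?] [[[? ?] ?] ?]; congr (_, _, _, _); rewrite redD. Qed.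

(* Minkowski: torsion prime to the residue characteristic survives reduction. *)
Lemma minkowski (y : Gamma) l : (l%:R : F) != 0 -> (y ^+ l = 1)%g ->
  (forall v, rep k_golden y v = v) -> y = 1%g.
Proof.
move=> l0 yl triv; pose D v := rep golden_sqr y v - v.
have wred_eq0 v : wred v = 0 -> exists u, v = wscale zprime u.
  case: v => [[[x1 x2] x3] x4] [] /red_eq0[u1 ->] /red_eq0[u2 ->] /red_eq0[u3 ->] /red_eq0[u4 ->].
  by exists (u1, u2, u3, u4).
have tel n v : rep golden_sqr (y ^+ n)%g v = v + \sum_(i < n) rep golden_sqr (y ^+ i)%g (D v).
  elim: n => [|n IH]; first by rewrite big_ord0 addr0 rep1.
  by rewrite expgSr repM -[rep _ y v](subrK v) -/(D v) addrC repD IH big_ord_recr /= addrA.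
have trivX n v : wred (rep golden_sqr (y ^+ n)%g v) = wred v.
  by rewrite wred_rep; elim: n => [|n IH]; rewrite ?rep1 // expgS repM IH triv.
have reg n x : zprime ^+ n * x = 0 -> x = 0.
  by elim: n => [|n IH]; rewrite ?mul1r // exprS -mulrA => /zprime_regular.
have scale_inj n u : wscale (zprime ^+ n) u = 0 -> u = 0.
  case: u => [[[x1 x2] x3] x4] h; have e i := congr1 (wcoord i) h.
  rewrite (reg n _ (e 0%N : _ * x1 = 0)) (reg n _ (e 1%N : _ * x2 = 0)).
  by rewrite (reg n _ (e 2%N : _ * x3 = 0)) (reg n _ (e 3%N : _ * x4 = 0)).
(* If D v = pi^n u with pi = [zprime], the telescoped relation y^l = 1 gives that the sum of the y^i
   u is 0. Modulo pi this is l u = 0, so pi divides u and n can be raised. *)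
have div n v : exists u, D v = wscale (zprime ^+ n) u.
  elim: n v => [|n IH] v; first by exists (D v); case: (D v) => [[[? ?] ?] ?]; rewrite /= !mul1r.
  have [u uE] := IH v; have := tel l v; rewrite yl rep1 -[LHS]addr0 => /addrI/esym.
  rewrite uE; under eq_bigr do rewrite repZ.
  have -> : \sum_(i < l) wscale (zprime ^+ n) (rep golden_sqr (y ^+ i)%g u) =
      wscale (zprime ^+ n) (\sum_(i < l) rep golden_sqr (y ^+ i)%g u).
    by rewrite (big_morph (wscale (zprime ^+ n)) (wscaleD _) (wscale0 _)).
  move/scale_inj/(congr1 wred).
  have -> : wred (\sum_(i < l) rep golden_sqr (y ^+ i)%g u) = wscale l%:R (wred u).
    rewrite (big_morph wred wredD (_ : wred 0 = 0)); last by congr (_, _, _, _); rewrite red0.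
    under eq_bigr do rewrite trivX; rewrite sumr_const card_ord.
    elim: (l) => [|m IHm]; first by case: (wred u) => [[[? ?] ?] ?]; congr (_, _, _, _); rewrite /= mul0r.
    by rewrite mulrS IHm; case: (wred u) => [[[? ?] ?] ?]; congr (_, _, _, _); rewrite /= mulrS mulrDl mul1r.
  rewrite (_ : wred 0 = 0); last by congr (_, _, _, _); rewrite red0.
  move=> u0; have /wred_eq0[u' ->] : wred u = 0.
    case: (wred u) u0 => [[[a b] c] d] E; have e i := congr1 (wcoord i) E.
    have c0 (z : F) : l%:R * z = 0 -> z = 0 by move/eqP; rewrite mulf_eq0 (negbTE l0) => /eqP.
    rewrite (c0 _ (e 0%N : l%:R * a = 0)) (c0 _ (e 1%N : l%:R * b = 0)).
    by rewrite (c0 _ (e 2%N : l%:R * c = 0)) (c0 _ (e 3%N : l%:R * d = 0)).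
  by exists u'; case: u' => [[[? ?] ?] ?] /=; rewrite !exprSr !mulrA.
apply: rep_faithful => s _; apply/eqP; rewrite -subr_eq0 -/(D _); apply/eqP.
have dc i : wcoord i (D (wbasis _ s)) = 0.
  apply: zprime_powers => n; have [u ->] := div n (wbasis _ s).
  by exists (wcoord i u); case: u i => [[[? ?] ?] ?] [|[|[|i]]].
have := dc 0%N; have := dc 1%N; have := dc 2%N; have := dc 3%N.
by case: (D _) => [[[? ?] ?] ?] /= -> -> -> ->.
Qed.

End Prime.

Lemma card_const_fibres (T U : finType) (D : T -> U) k :
  (forall u, #|[set v | D v == D u]| = k) -> (k %| #|T|)%N.
Proof.
move=> Dk; rewrite -sum1_card (partition_big D (mem [set D x | x : T])) /=; last first.
  by move=> x _; apply: imset_f.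
rewrite (eq_bigr (fun=> k)) ?sum_nat_const ?dvdn_mull // => y /imsetP[x0 _ ->].
by rewrite sum1dep_card Dk.
Qed.

(** The fixed space has 19^d elements with d at most 4, and 19^d = 19^4 modulo 11 forces d = 4
    because 19 has order 10 modulo 11. *)
Lemma order11_rep (F : finFieldType) (f : F) (ff : f ^+ 2 = f + 1) (y : Gamma) : #|F| = 19%N ->
  (y ^+ 11 = 1)%g -> forall v, rep ff y v = v.
Proof.
move=> cF y11; pose W := (F * F * F * F)%type.
have inj : injective (rep ff y) := can_inj (bijK _).
pose s : {perm W} := perm inj; have sE v : s v = rep ff y v by rewrite permE.
have sX n v : (s ^+ n)%g v = rep ff (y ^+ n)%g v.
  by elim: n v => [|n IH] v; rewrite ?rep1 ?perm1 // expgSr permM IH sE -repM expgS.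
have s11 : (s ^+ 11 = 1)%g by apply/permP=> v; rewrite sX y11 rep1 perm1.
have pg : (11.-group <[s]>)%g.
  rewrite /pgroup -orderE; have : (#[s]%g %| 11)%N by rewrite order_dvdn s11.
  by rewrite dvdn_divisors // !inE => /orP[]/eqP->.
have aP : [acts <[s]>, on [set: W] | 'P]%g by apply/actsP=> g _ z; rewrite !inE.
have := pgroup_fix_mod pg aP; rewrite cardsT afix_cycle ?inE //.
pose Fx : {set W} := [set v | (rep ff y v - v == 0)%R].
have -> : 'Fix_([set: W] | 'P)[s]%g = Fx.
  by apply/setP=> v; rewrite !inE finset.sub1set inE /= apermE sE subr_eq0.
have cW : #|{: W}| = (19 ^ 4)%N by rewrite !card_prod !cF.
(* The fibres of v to y v - v are cosets of the fixed space. *)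
have : (#|Fx| %| #|{: W}|)%N.
  apply: (@card_const_fibres _ _ (fun v : W => rep ff y v - v)) => u.
  rewrite -[RHS](card_imset _ (f := fun v : W => v + u)); last by move=> v w /addIr.
  have rB (v w : W) : rep ff y (v - w) = rep ff y v - rep ff y w.
    by apply: (addIr (rep ff y w)); rewrite -repD !subrK.
  congr #|pred_of_set _|; apply/setP=> v; rewrite inE; apply/eqP/imsetP => [Dv|[w]].
    exists (v - u); last by rewrite subrK.
    by rewrite inE rB [- (v - u)]opprD addrACA -[- _ + - - u]opprD Dv subrr.
  rewrite inE => /eqP Dw ->; rewrite repD opprD addrACA.
  by rewrite Dw add0r.
rewrite cW => /(dvdn_pfactor _ _ (isT : prime 19))[d d4 dE].
have fixall : d = 4%N -> forall v, rep ff y v = v.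
  move=> d4'; have /eqP E : Fx == [set: W].
    by rewrite finset.eqEcard finset.subsetT cardsT cW dE d4'.
  by move=> v; have : v \in Fx; [rewrite E inE | rewrite inE subr_eq0 => /eqP].
rewrite dE -(modnXm 4 11 19) -(modnXm d 11 19).
by case: d d4 dE fixall => [|[|[|[|[|//]]]]] // _ _ h _; exact: h.
Qed.

Lemma torsion11 (y : Gamma) : (y ^+ 11 = 1)%g -> y = 1%g.
Proof.
move=> y11; have [F cF] : exists F : finFieldType, #|F| = 19%N.
  by exists 'F_19; rewrite card_Fp.
have pF : 19%N \in [pchar F] by apply: (@card_finPcharP F 19 1) => //; rewrite expn1.
have l0 : (11%:R : F) != 0 by rewrite -(dvdn_pcharf pF).
have k5 : (5 ^ 2 = 19 + 5 + 1)%N by [].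
apply: (@minkowski 19 5 isT k5 F pF y 11 l0 y11) => v.
exact: (order11_rep _ cF y11).
Qed.

(** Since M^2 = - 1, the map N to M N M is the reflection in M for the form tr (MN); this is how
    [refl] becomes matrix multiplication. *)
Lemma traceless_conj (R : comNzRingType) (M N : 'M[R]_2) : \tr M = 0 -> \tr N = 0 -> \det M = 1 ->
  M *m N *m M = \tr (M *m N) *: M + N.
Proof.
move=> tM tN dM; have E : N *m M = (\tr (M *m N))%:M - M *m N.
  move: tM tN; rewrite !tr2E => /eqP; rewrite addr_eq0 => /eqP hM /eqP; rewrite addr_eq0 => /eqP hN.
  by apply: mx2P; rewrite !mxE /= ?mulr1n ?mulr0n ?sum2 ?mul2E ?hM ?hN; ring.
rewrite -mulmxA E mulmxBr mul_mx_scalar mulmxA mx2_sqr tM dM scale0r sub0r mulNmx mul1mx.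
by rewrite opprK.
Qed.

(** * The kernel with quotient L_2(11) and its torsion *)

Section Reduction11.
Variable F : finFieldType.
Hypothesis (cF : #|F| = 11%N).
Let pF : 11%N \in [pchar F]. Proof. by apply: (@card_finPcharP F 11 1); rewrite ?expn1. Qed.
Let F11 : 11%:R = 0 :> F. Proof. exact: pcharf0 pF. Qed.
Let k4 : (4 ^ 2 = 11 + 4 + 1)%N. Proof. by []. Qed.
Notation W := (F * F * F * F)%type.
Let ff := k_golden k4 pF.

Let mod11 (x y z : F) : x = y + 11%:R * z -> x = y. Proof. by rewrite F11 mul0r addr0. Qed.

(* Traceless matrices of square -1 realising the reflections a, b, c, d on the
   quotient of the reflection representation by its radical. *)
Definition rmx (i : nat) : 'M[F]_2 :=
  match i with 0%N => mx2 0 (-1) 1 0 | 1%N => mx2 1 5%:R 4%:R (-1)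
  | 2%N => mx2 3%:R 1 1 (- 3%:R) | _ => mx2 7%:R 7%:R 7%:R (- 7%:R) end.

Arguments rmx i : simpl never.

Lemma rmx_facts i : \tr (rmx i) = 0 /\ \det (rmx i) = 1.
Proof.
case: i => [|[|[|i]]]; rewrite /rmx tr2E det_mx2 !mx2E; split; try ring.
- by apply: (mod11 (z := - 2%:R)); ring.
- by apply: (mod11 (z := - 1)); ring.
- by apply: (mod11 (z := - 9%:R)); ring.
Qed.

Definition gram (i j : nat) : F :=
  match i, j with
  | 0%N, 0%N | 1%N, 1%N | 2%N, 2%N | 3%N, 3%N => - 2%:R
  | 0%N, 1%N | 1%N, 0%N | 2%N, 3%N | 3%N, 2%N => 1
  | 1%N, 2%N | 2%N, 1%N => 4%:R | _, _ => 0 end.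

Lemma rmx_gram i j : (i < 4)%N -> (j < 4)%N -> \tr (rmx i *m rmx j) = gram i j.
Proof.
case: i j => [|[|[|[|//]]]] [|[|[|[|//]]]] _ _; rewrite /rmx /gram mul_mx2 tr2E !mx2E;
 first [ring | by apply: (mod11 (z := 1)); ring | by apply: (mod11 (z := -1)); ring
 | by apply: (mod11 (z := 2%:R)); ring | by apply: (mod11 (z := 3%:R)); ring
 | by apply: (mod11 (z := 4%:R)); ring| by apply: (mod11 (z := 5%:R)); ring | by apply: (mod11 (z := 7%:R)); ring
 | by apply: (mod11 (z := 14%:R)); ring | by apply: (mod11 (z := 18%:R)); ring | by apply: (mod11 (z := 8%:R)); ring
 | by apply: (mod11 (z := 6%:R)); ring | by apply: (mod11 (z := 9%:R)); ring | by apply: (mod11 (z := 10%:R)); ring ].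
Qed.

Definition psi (v : W) : 'M[F]_2 := let: (x, y, z, w) := v in
  x *: rmx 0 + y *: rmx 1 + z *: rmx 2 + w *: rmx 3.

Definition gramv i (v : W) : F := let: (x, y, z, w) := v in
  x * gram i 0 + y * gram i 1 + z * gram i 2 + w * gram i 3.

Lemma tr_psi i v : (i < 4)%N -> \tr (rmx i *m psi v) = gramv i v.
Proof.
move=> i4; case: v => [[[x y] z] w]; rewrite /psi !mulmxDr -!scalemxAr !linearD /= !linearZ /=.
by rewrite !rmx_gram.
Qed.

Lemma refl_gramv i v : (i < 4)%N -> refl 4%:R i v = v + wscale (gramv i v) (wbasis _ i).
Proof.
by case: i => [|[|[|[|//]]]] _; case: v => [[[x y] z] w]; congr (_, _, _, _); rewrite /=; ring.
Qed.

Lemma psiD u v : psi (u + v) = psi u + psi v.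
Proof.
case: u v => [[[x y] z] w] [[[x' y'] z'] w'].
rewrite /psi /= !scalerDl; move: (rmx 0) (rmx 1) (rmx 2) (rmx 3) => A B C D.
by rewrite [RHS]addrACA; congr (_ + _); rewrite [RHS]addrACA; congr (_ + _); rewrite [RHS]addrACA.
Qed.
Lemma psiZ k v : psi (wscale k v) = k *: psi v.
Proof. by case: v => [[[x y] z] w]; rewrite /psi /= !scalerDr !scalerA. Qed.

Lemma psi_basis i : (i < 4)%N -> psi (wbasis _ i) = rmx i.
Proof.
by case: i => [|[|[|[|//]]]] _; rewrite /psi /wbasis !scale0r !scale1r ?addr0 ?add0r.
Qed.

Lemma psi_refl i v : (i < 4)%N -> psi (refl 4%:R i v) = rmx i *m psi v *m rmx i.
Proof.
move=> i4; have [tr0 det1] := rmx_facts i.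
rewrite traceless_conj // ?tr_psi // ?refl_gramv // ?psiD ?psiZ ?psi_basis // 1?addrC //.
case: v => [[[x y] z] w]; rewrite /psi !linearD /= !linearZ /=.
by rewrite (rmx_facts 0).1 (rmx_facts 1).1 (rmx_facts 2).1 (rmx_facts 3).1 !mulr0 !addr0.
Qed.

(** A vector killed by [psi] is orthogonal to every simple root, that is, in the radical of the form
    modulo 11. *)
Lemma psi_kernel_fixed g r : psi r = 0 -> rep ff g r = r.
Proof.
move=> pr; have fx (i : 'I_4) : refl 4%:R i r = r.
  rewrite refl_gramv // -tr_psi // pr mulmx0 linear0.
  by case: (r) (wbasis F i) => [[[? ?] ?] ?] [[[? ?] ?] ?]; congr (_, _, _, _); rewrite /= mul0r addr0.
by move: g; apply: Gamma_ind => [|i g IH|i g IH]; rewrite ?rep1 // ?Gamma_genV !repM IH rep_gen fx.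
Qed.

Lemma rmx_sqr i : rmx i *m rmx i = - 1%:M.
Proof. by have [t d] := rmx_facts i; rewrite mx2_sqr t d scale0r sub0r. Qed.

(** The value 6 is the root with 2 c = 1 modulo 11, the only one in the prime field. *)
Lemma rmx_triple : triple 6%:R (rmx 0 *m rmx 1) (rmx 1 *m rmx 2) (rmx 2 *m rmx 3).
Proof.
have dt i j : \det (rmx i *m rmx j) = 1 by rewrite det_mulmx (rmx_facts i).2 (rmx_facts j).2 mulr1.
have comp i j k : rmx i *m rmx j *m (rmx j *m rmx k) = - (rmx i *m rmx k).
  by rewrite mulmxA -(mulmxA (rmx i)) rmx_sqr mulmxN mulmx1 mulNmx.
split; rewrite ?dt ?comp ?mulNmx ?comp ?linearN /= ?rmx_gram ?oppr0 //.
- split; rewrite ?dt ?comp ?linearN /= ?rmx_gram ?oppr0 //.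
    by apply: (mod11 (z := 79%:R)); rewrite /quartic /phi; ring.
  by apply/esym/(mod11 (z := - 3%:R)); rewrite /phi /=; ring.
- by rewrite /rmx !mul_mx2 tr2E !mx2E; apply: (mod11 (z := 2%:R)); ring.
Qed.

(* w in Delta acts on the traceless matrices by conjugation by a matrix of e w. *)
Lemma psi_conj e : param_hom 6%:R (rmx 0 *m rmx 1) (rmx 1 *m rmx 2) (rmx 2 *m rmx 3) e ->
  forall w : Delta, exists M M' : 'M[F]_2, [/\ \det M = 1, M *m M' = 1%:M, e w = mobp M &
    forall v, psi (rep ff (Delta_val w) v) = M *m psi v *m M'].
Proof.
move=> he; have eM := ph_morph he; have [dt ts] : (forall i j, \det (rmx i *m rmx j) = 1) /\
    (forall i j, rmx i *m rmx j *m (rmx j *m rmx i) = 1%:M).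
  split=> i j; first by rewrite det_mulmx (rmx_facts i).2 (rmx_facts j).2 mulr1.
  by rewrite mulmxA -(mulmxA (rmx i)) rmx_sqr mulmxN mulmx1 mulNmx rmx_sqr opprK.
pose P (w : Delta) (g : {perm option F}) := exists M M' : 'M[F]_2, [/\ \det M = 1, M *m M' = 1%:M, g = mobp M &
    forall v, psi (rep ff (Delta_val w) v) = M *m psi v *m M'].
have step i j w : (i < 4)%N -> (j < 4)%N -> P w (e w) ->
    P (Delta_pair (inord i) (inord j) * w)%g (mobp (rmx i *m rmx j) * e w)%g.
  move=> i4 j4 [M [M' [dM MM ->] hv]]; exists (rmx i *m rmx j *m M), (M' *m (rmx j *m rmx i)); split.
  - by rewrite det_mulmx dt dM mulr1.
  - by rewrite mulmxA -(mulmxA _ M) MM mulmx1 ts.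
  - by rewrite -(mobpM1 (dt i j) dM).
  move=> v; rewrite Delta_valM !repM !rep_gen !inordK // !psi_refl // hv !mulmxA //.
have inv i j g w : (i < 4)%N -> (j < 4)%N -> e (Delta_pair (inord i) (inord j)) = mobp (rmx i *m rmx j) ->
    g = Delta_pair (inord i) (inord j) -> P w (e w) -> P (g * w)%g (e (g * w)%g) /\ P (g^-1 * w)%g (e (g^-1 * w)%g).
  move=> i4 j4 eg -> Pw; rewrite !eM eg (gmorphV eM) eg; split; first exact: step.
  rewrite Delta_pairV; have -> : ((mobp (rmx i *m rmx j))^-1 = mobp (rmx j *m rmx i))%g.
    by apply: (mulgI (mobp (rmx i *m rmx j))); rewrite mulgV -(mobpM1 (dt i j) (dt j i)) ts mobp1.
  exact: step.
suff H w : P w (e w) by [].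
move: w; apply: Delta_ind => [|w Pw|w Pw].
- exists 1%:M, 1%:M; split; rewrite ?det1 ?mulmx1 ?mobp1 ?(gmorph1 eM) // => v.
  by rewrite Delta_val1 rep1 mulmx1 mul1mx.
- by split; [have [] := inv 0 1 alpha w isT isT (ph_alpha he) erefl Pw
  | have [] := inv 1 2 beta w isT isT (ph_beta he) erefl Pw
  | have [] := inv 2 3 gamma w isT isT (ph_gamma he) erefl Pw].
by split; [have [] := inv 0 1 alpha w isT isT (ph_alpha he) erefl Pw
  | have [] := inv 1 2 beta w isT isT (ph_beta he) erefl Pw
  | have [] := inv 2 3 gamma w isT isT (ph_gamma he) erefl Pw].
Qed.

(** As w acts trivially on traceless matrices, it acts on the module modulo 11 by v to v + r with r
    killed by [psi], hence fixed by w. Then w^l v = v + l r gives r = 0, and [minkowski] applies.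
    The prime 11 is treated by [torsion11]. *)
Lemma param6_prime_torsion K (w : Delta) l : param (6%:R : F) K -> K w -> prime l ->
  (Delta_val w ^+ l = 1)%g -> Delta_val w = 1%g.
Proof.
move=> pK Kw pl wl; have [l11|l11] := eqVneq l 11%N; first by apply: torsion11; rewrite -l11.
have l0 : (l%:R : F) != 0 by rewrite -(dvdn_pcharf pF) dvdn_prime2 // eq_sym.
have [e he] := triple_hom rmx_triple.
have KE : K = kernel (ph_morph he).
  apply: (param_morph (f := idfun) pK).
  by exists (rmx 0 *m rmx 1), (rmx 1 *m rmx 2), (rmx 2 *m rmx 3), e.
have ew : e w = 1%g by move: Kw; rewrite KE.
have [M [M' [dM MM eE hv]]] := psi_conj he w.
have ME : M = (M 0 0)%:M by apply: mobp_eq1; rewrite ?dM ?oner_neq0 // -eE.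
have fixpsi v : psi (rep ff (Delta_val w) v) = psi v.
  by rewrite hv {1}ME -scalar_mxC -mulmxA -ME MM mulmx1.
apply: (@minkowski 11 4 isT k4 F pF _ l l0 wl) => v.
pose r := rep ff (Delta_val w) v - v.
have pr : psi r = 0.
  have := psiD r v; rewrite subrK fixpsi => /esym/eqP.
  by rewrite -subr_eq0 addrK => /eqP.
have iter n : rep ff (Delta_val w ^+ n)%g v = v + wscale n%:R r.
  elim: n => [|n IH].
    by rewrite rep1; case: (v) r {pr} => [[[? ?] ?] ?] [[[? ?] ?] ?]; congr (_, _, _, _); rewrite /= mul0r addr0.
  rewrite expgS repM IH repD repZ (psi_kernel_fixed _ pr) -[rep _ _ v](subrK v) -/r.
  by case: (v) (r) => [[[? ?] ?] ?] [[[? ?] ?] ?]; congr (_, _, _, _); rewrite /= -addn1 natrD; ring.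
have := iter l; rewrite wl rep1 -[X in X = _]addr0 => /addrI/esym E.
suff r0 : r = 0 by rewrite -[LHS](subrK v) -/r r0 add0r.
have c0 (z : F) : l%:R * z = 0 -> z = 0 by move/eqP; rewrite mulf_eq0 (negbTE l0) => /eqP.
move: E; case: (r) => [[[a b] c] d] E; have ee i := congr1 (wcoord i) E.
rewrite (c0 _ (ee 0%N : l%:R * a = 0)) (c0 _ (ee 1%N : l%:R * b = 0)).
by rewrite (c0 _ (ee 2%N : l%:R * c = 0)) (c0 _ (ee 3%N : l%:R * d = 0)).
Qed.

Lemma param6_torsion_free K (w : Delta) n : param (6%:R : F) K -> K w -> (0 < n)%N ->
  (Delta_val w ^+ n = 1)%g -> Delta_val w = 1%g.
Proof.
move=> pK; have [m] := ubnP n; elim: m n w => // m IH n w nm Kw n0 wn.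
have [n1|n1] := leqP n 1; first by rewrite -wn (_ : n = 1%N) ?expg1 //; lia.
have pp := pdiv_prime n1; have dp := pdiv_dvd n.
have q0 : (0 < n %/ pdiv n)%N by rewrite divn_gt0 ?pdiv_gt0 // dvdn_leq.
have KX k : K (w ^+ k)%g by elim: k => [|k IHk]; rewrite ?expgS; [exact: nsub1 | exact: nsubM].
have vX k : Delta_val (w ^+ k)%g = (Delta_val w ^+ k)%g.
  by elim: k => [|k IHk]; rewrite ?expg0 ?Delta_val1 // !expgS Delta_valM IHk.
have E : (Delta_val w ^+ (n %/ pdiv n))%g = 1%g.
  rewrite -vX; apply: (param6_prime_torsion pK (KX _) pp).
  by rewrite vX -expgM divnK.
apply: (IH _ _ _ Kw q0 E); apply: leq_trans (ltn_Pdiv _ n0) _; rewrite ?prime_gt1 //.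
Qed.

Lemma L2_11_unique K K' : L2_quotients F K -> L2_quotients F K' -> K = K'.
Proof.
have : (L2_quotients F #= `I_1)%card.
  exact: (clause_11 (isT : prime 11) erefl (n := 1) isT isT (F := F)).
move/card_set_bijP=> [f [fI fJ _]] hK hK'; apply: fJ; rewrite ?inE //.
have := fI K hK; have := fI K' hK'; rewrite /=; case: (f K) (f K') => [|?] [|?] //.
Qed.

(** The census leaves a single such kernel, so it is the one attached to c = 6. *)
Lemma L2_11_param6 K : L2_quotients F K -> param (6%:R : F) K.
Proof.
move=> hK; have [K' pK'] : exists K', param (6%:R : F) K'.
  by apply: param_exists; exact: (tr_root (tr_pair rmx_triple)).
have hK' : L2_quotients F K'.
  by apply/L2_quotients_param; exists 6%:R; split=> //; exact: generates1 pF _ cF.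
by rewrite (L2_11_unique hK hK').
Qed.

End Reduction11.

(** * Computations in the vertex group of order 120 *)

Section Vertex.
Local Open Scope nat_scope.

(* The stabiliser <a, b, c> of a vertex, of order 120, as the product of twenty
   coset representatives and the six elements of <a, b>. *)
Definition dih : seq (seq nat) := [:: [::]; [:: 0]; [:: 1]; [:: 0; 1]; [:: 1; 0]; [:: 0; 1; 0]].
Definition reps : seq (seq nat) := [:: [::]; [:: 2]; [:: 1;2]; [:: 0;1;2]; [:: 2;1;2]; [:: 0;2;1;2];
  [:: 1;2;1;2]; [:: 0;1;2;1;2]; [:: 1;0;2;1;2]; [:: 0;1;0;2;1;2]; [:: 2;1;0;2;1;2];
  [:: 0;2;1;0;2;1;2]; [:: 1;2;1;0;2;1;2]; [:: 0;1;2;1;0;2;1;2]; [:: 1;0;2;1;0;2;1;2];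
  [:: 0;1;0;2;1;0;2;1;2]; [:: 2;1;0;2;1;0;2;1;2]; [:: 0;2;1;0;2;1;0;2;1;2];
  [:: 1;0;2;1;0;2;1;0;2;1;2]; [:: 2;1;0;2;1;0;2;1;0;2;1;2]].
Definition vertex : seq (seq nat) := [seq r ++ h | r <- reps, h <- dih].
(** (abc)^5, the central involution of the vertex group; [zw'] is its image (dcb)^5 under r. *)
Definition zw : seq nat := flatten (nseq 5 [:: 0; 1; 2]).
Definition zw' : seq nat := flatten (nseq 5 [:: 3; 2; 1]).
Definition abc (s : seq nat) : bool := all (fun i => i < 3) s.

Lemma abc_letters s : abc s -> letters s.
Proof. by apply: sub_all => i /ltnW. Qed.
Lemma abc_cat s t : abc (s ++ t) = abc s && abc t. Proof. exact: all_cat. Qed.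
Lemma abc_rev s : abc (rev s) = abc s. Proof. exact: all_rev. Qed.

Lemma vertex_abc s : s \in vertex -> abc s.
Proof.
have /allP h : all abc vertex by vm_compute.
exact: h.
Qed.

Definition vkeys := [seq key s | s <- vertex].

Lemma vkeys_uniq : uniq vkeys.
Proof. by vm_compute. Qed.

Lemma vertex_size : size vertex = 120. Proof. by vm_compute. Qed.

Lemma vertex_closed i s : i < 3 -> s \in vertex -> key (i :: s) \in vkeys.
Proof.
have /allP h : all (fun s => all (fun i => key (i :: s) \in vkeys) [:: 0; 1; 2]) vertex.
  by vm_compute.
by move=> i3 /h/allP/(_ i); apply; case: i i3 => [|[|[|i]]].
Qed.

Lemma abc_vertex s : abc s -> exists2 t, t \in vertex & wd s = wd t.
Proof.
elim: s => [|i s IH]; first by exists [::].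
case/andP=> i3 /IH[t tv E]; have /mapP[u uv kE] := vertex_closed i3 tv.
exists u => //; rewrite wd_cons E -wd_cons; apply: wd_key kE.
  by rewrite /letters /= ltnW // -/(letters t) abc_letters ?vertex_abc.
by rewrite abc_letters ?vertex_abc.
Qed.

Lemma vertex_torsion s : abc s -> (wd s ^+ 30 = 1)%g.
Proof.
case/abc_vertex=> t tv ->; have -> : (wd t ^+ 30)%g = wd (flatten (nseq 30 t)).
  by elim: 30 => [|n IH]; rewrite ?expg0 ?wd_nil //= expgS IH wd_cat.
have /allP h : all (fun t => key (flatten (nseq 30 t)) == key [::]) vertex by vm_compute.
rewrite (wd_key _ _ (eqP (h t tv))) ?wd_nil //.
by apply: abc_letters; elim: 30 => //= n IH; rewrite abc_cat vertex_abc.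
Qed.

Lemma central_check s : abc s -> key (0 :: s) = key (rcons s 0) -> key (1 :: s) = key (rcons s 1) ->
  wd s = 1%g \/ wd s = wd zw.
Proof.
move=> as_; case: (abc_vertex as_) => t tv E.
have /allP h : all (fun t => (key (0 :: t) == key (rcons t 0)) && (key (1 :: t) == key (rcons t 1)) ==>
  (key t == key [::]) || (key t == key zw)) vertex by vm_compute.
have lt := abc_letters (vertex_abc tv); have ls := abc_letters as_.
move=> k0 k1; have e i : i < 4 -> key (i :: s) = key (rcons s i) -> key (i :: t) = key (rcons t i).
  move=> i4 k; apply: key_wd; rewrite ?letters_rcons ?i4 //= ?i4 //.
  rewrite wd_cons -cats1 wd_cat -E -wd_cons -wd_cat cats1.
  by apply: wd_key => //; rewrite ?letters_rcons /= ?i4.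
have := h t tv; rewrite (e 0 isT k0) (e 1 isT k1) !eqxx /= => /orP[]/eqP k; rewrite E.
  by left; rewrite (wd_key lt _ k) ?wd_nil.
by right; apply: wd_key k.
Qed.

Definition subst (s w : seq nat) : seq nat :=
  flatten [seq (match l with 0 => [:: 0] | 1 => [:: 1] | _ => s end) | l <- w].

(* Words in a, b, g expressing c, for the elements g of the vertex stabiliser
   outside <a, b, z>. *)
Definition c_words : seq (seq nat) := [:: [:: 2; 2; 0; 2]; [:: 2; 0; 2; 2]; [:: 0; 2; 0; 2; 2]; [:: 0; 2; 2; 0; 2]; [:: 1; 2; 1; 2; 1]; [:: 1; 0; 2; 1; 0; 2; 1]; [:: 2; 2; 1]; [:: 1; 2; 0; 1; 2; 0; 1]; [:: 1; 2; 2]; [:: 1; 0; 2; 0; 2]; [:: 2; 0; 2; 0; 1]; [:: 2; 1; 2]; [:: 0; 2; 2; 0; 1]; [:: 0; 2; 1; 0; 2]; [:: 0; 1; 0; 2; 2]; [:: 0; 2; 0; 1; 2]; [:: 1; 2; 0; 2; 1]; [:: 2; 0; 1; 0; 2]; [:: 1; 0; 2; 2; 1]; [:: 1; 0; 2; 0; 2; 0; 1]; [:: 1; 2; 2; 0; 1]; [:: 2]; [:: 0; 2]; [:: 1; 2]; [:: 2; 1]; [:: 1; 0; 2]; [:: 0; 2; 1]; [:: 0; 1; 2]; [:: 1; 2; 1]; [:: 2; 0; 1]; [:: 0; 1; 0; 2]; [:: 1; 0; 2; 1]; [:: 0; 2; 0; 1]; [:: 0; 1; 2; 1]; [:: 1;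 2; 0; 1]; [:: 0; 1; 0; 2; 1]; [:: 1; 0; 2; 0; 1]; [:: 0; 2; 0; 2; 1]; [:: 1; 0; 2; 0; 1; 0; 2; 0; 1]; [:: 0; 1; 2; 0; 1]; [:: 0; 2; 0; 1; 0; 2; 2]; [:: 0; 2; 0; 2; 1; 2; 2]; [:: 0; 1; 2; 0; 2]; [:: 0; 1; 0; 2; 0; 1]; [:: 2; 0; 1; 2; 0; 2]; [:: 2; 0; 2; 0; 1; 2]; [:: 2; 1; 0; 2; 0; 2]; [:: 2; 0; 2; 1; 0; 2]; [:: 0; 2; 1; 2; 2]; [:: 0; 2; 2; 1; 2]; [:: 0; 1; 0; 2; 1; 2; 1]; [:: 0; 1; 2; 1; 2; 0; 1]; [:: 2; 1; 2; 2; 1]; [:: 0; 1; 2; 2; 2]; [:: 0; 2; 2; 2; 1]; [:: 1; 0; 2; 2; 2]; [:: 2; 0; 1; 2; 0; 1; 2; 0; 2]; [:: 1; 2; 0; 2; 2; 1]; [:: 2; 2; 1; 2]; [:: 1; 2; 0; 2; 0; 2]; [:: 2; 2; 2; 1; 2; 2]; [:: 0; 2; 1; 2; 1; 2]; [:: 2; 1; 2; 2]; [:: 1; 2; 0; 2; 0; 2; 0; 1; 2]; [:: 2; 2; 1; 2; 2; 2]; [:: 0; 2; 1; 2; 2; 2; 1]; [:: 2; 0; 2; 1; 2; 0; 2]; [:: 0; 1; 0; 2; 2; 2; 2]; [:: 0; 1; 2; 2; 2; 1; 2]; [:: 0; 2; 2; 2; 1; 2; 1]; [:: 1; 2; 2;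 0; 2; 2; 0; 2]; [:: 2; 1; 2; 1; 2; 1; 2]; [:: 2; 2; 0; 2; 2; 0; 2; 1]; [:: 1; 2; 0; 2; 2; 0; 2; 2]; [:: 1; 2; 2; 1; 2; 2; 2; 1]; [:: 1; 2; 2; 2; 2]; [:: 2; 2; 2; 2; 1]; [:: 1; 0; 2; 1; 0; 2; 1; 0; 2; 1; 0; 2; 1]; [:: 1; 2; 1; 2; 1; 2; 1; 2; 1]].

Lemma subst_abc s w : abc s -> abc (subst s w).
Proof.
move=> hs; elim: w => [|l w IH] //; rewrite /subst /= abc_cat -/(subst s w) IH andbT.
by case: l => [|[|l]].
Qed.

(** An element outside the maximal subgroup <a, b, z> generates the vertex group together with a and
    b, so c is a word in the three. *)
Lemma outside_check s : abc s -> (exists h, [/\ h \in dih, abc h & wd s = wd h \/ wd s = wd (h ++ zw)]) \/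
  exists w, wd (subst s w) = wd [:: 2].
Proof.
move=> as_; case: (abc_vertex as_) => t tv E.
have /allP/(_ t tv) : all (fun t => has (fun h => (key t == key h) || (key t == key (h ++ zw))) dih ||
  has (fun w => key (subst t w) == key [:: 2]) c_words) vertex by vm_compute.
have lt := abc_letters (vertex_abc tv).
case/orP=> /hasP[h hh hk]; [left; exists h | right; exists h].
  have /allP/(_ h hh) ah : all abc dih by [].
  split=> //; have lh := abc_letters ah; rewrite E; case/orP: hk => /eqP k; [left|right]; apply: wd_key k => //.
  by apply: abc_letters; rewrite abc_cat ah.
have -> : wd (subst s h) = wd (subst t h).
  elim: h {hh hk} => [|l h IH] //; rewrite /subst /= !wd_cat -!/(subst _ _) IH.
  by case: l => [|[|l]] //; rewrite E.
by apply: wd_key (eqP hk); rewrite ?abc_letters ?subst_abc ?vertex_abc.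
Qed.

Lemma reps_check i j h : i < 20 -> j < 20 -> i <> j -> h \in dih ->
  wd (rev (nth [::] reps i) ++ nth [::] reps j) <> wd h.
Proof.
have chk : all (fun i => all (fun j => (i == j) ||
  all (fun h => key (rev (nth [::] reps i) ++ nth [::] reps j) != key h) dih) (iota 0 20)) (iota 0 20) by vm_compute.
have ar : all abc reps by [].
move=> i20 j20 ij hh E; have := allP chk i; rewrite mem_iota => /(_ i20)/allP/(_ j).
rewrite mem_iota => /(_ j20)/orP[/eqP//|/allP/(_ h hh)/eqP]; apply; apply: key_wd E.
  by apply: abc_letters; rewrite abc_cat abc_rev !(allP ar) ?mem_nth.
by apply: abc_letters; move: h hh {i j i20 j20 ij}; apply/allP.
Qed.

(** A conjugate of bc has order 5, whereas <a, b> has order 6. *)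
Lemma order5_check u h : abc u -> h \in dih -> wd (rev u ++ [:: 1; 2] ++ u) <> wd h.
Proof.
have chk : all (fun u => all (fun h => key (rev u ++ [:: 1; 2] ++ u) != key h) dih) vertex by vm_compute.
case/abc_vertex=> t tv E hh; rewrite wd_cat wd_cat -wdV E wdV -!wd_cat => E'.
have := allP (allP chk t tv) h hh; apply/negP/negPn/eqP; apply: key_wd E'.
  by apply: abc_letters; rewrite !abc_cat abc_rev vertex_abc.
by apply: abc_letters; move: h hh; apply/allP.
Qed.

End Vertex.

(** * The kernel as a normal subgroup of Omega *)

Section Conjugation.
Local Open Scope group_scope.

Lemma even_conj i (w : Delta) : Gamma_gen i * Delta_val w * Gamma_gen i \in even_in_Gamma.
Proof.
have /asboolP[s [es ->]] := Delta_valP w; apply/asboolP; exists (i :: s ++ [:: i]).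
split; first by rewrite /= size_cat addn1 /= negbK.
by rewrite big_cons big_cat big_seq1 -mulgA.
Qed.
Lemma even_rho (w : Delta) : rho (Delta_val w) \in even_in_Gamma.
Proof.
have /asboolP[s [es ->]] := Delta_valP w; apply/asboolP; exists (map (@rev_ord 4) s).
rewrite size_map es; split=> //; rewrite big_map.
by rewrite (big_morph rho rhoM rho1); apply: eq_bigr => i _; rewrite rho_gen.
Qed.

(** Composing an epimorphism with f gives another kernel with quotient L_2(11), and there is only
    one. *)
Lemma K_invariant (F : finFieldType) (K : normal_subgroup Delta) (f : Delta -> Delta) : #|F| = 11%N ->
  L2_quotients F K -> {morph f : u v / (u * v)%g} -> involutive f -> forall w, K (f w) <-> K w.
Proof.
move=> cF hK fM ff; have [e [eM ein eonto eK]] := (L2_quotientsP F K).1 hK.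
have efM : {morph e \o f : u v / (u * v)%g} by move=> u v; rewrite /= fM eM.
have hK' : L2_quotients F (kernel efM).
  apply/L2_quotientsP; exists (e \o f); split=> //= g /eonto[w <-]; exists (f w).
  by rewrite ff.
move=> w; rewrite [in X in _ <-> X](L2_11_unique cF hK hK'); exact: eK.
Qed.

Variables (F : finFieldType) (K : normal_subgroup Delta).
Hypotheses (cF : #|F| = 11%N) (hK : L2_quotients F K).

Definition Kval (g : Gamma) : Prop := exists2 w, K w & Delta_val w = g.

Lemma Kval_conj_gen i g : Kval g -> Kval (Gamma_gen i * g * Gamma_gen i).
Proof.
case=> w Kw <-; pose f (w : Delta) := MkDelta (even_conj i w).
have fM : {morph f : u v / (u * v)%g}.
  move=> u v; apply: Delta_val_inj; suff E : Gamma_gen i * (Delta_val u * Delta_val v) * Gamma_gen i =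
    Gamma_gen i * Delta_val u * Gamma_gen i * (Gamma_gen i * Delta_val v * Gamma_gen i) by exact: E.
  by rewrite -!mulgA Gamma_genK.
have ff : involutive f.
  by move=> u; apply: Delta_val_inj; rewrite /= !mulgA Gamma_gen2 mul1g -mulgA Gamma_gen2 mulg1.
by exists (f w) => //; apply/(K_invariant cF hK fM ff).
Qed.

Lemma Kval_rho g : Kval g -> Kval (rho g).
Proof.
case=> w Kw <-; pose f (w : Delta) := MkDelta (even_rho w).
have fM : {morph f : u v / (u * v)%g} by move=> u v; apply: Delta_val_inj; exact: rhoM.
have ff : involutive f by move=> u; apply: Delta_val_inj; rewrite /= rhoK.
by exists (f w) => //; apply/(K_invariant cF hK fM ff).
Qed.

Lemma Kval_conj g h : Kval g -> Kval (h^-1 * g * h).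
Proof.
move=> Kg; move: h g Kg; apply: Gamma_ind => [g|i h IH g|i h IH g] Kg; first by rewrite invg1 mul1g mulg1.
  by have := IH _ (Kval_conj_gen i Kg); rewrite invgM Gamma_genV !mulgA.
by have := IH _ (Kval_conj_gen i Kg); rewrite invgM !Gamma_genV !mulgA.
Qed.

Definition Nset (x : Omega) : Prop := Kval x.1 /\ x.2 = false.

Lemma Omega_mulE (x y : Omega) : x * y = (x.1 * rho_pow x.2 y.1, x.2 (+) y.2). Proof. by []. Qed.
Lemma Omega_invE (x : Omega) : x^-1 = (rho_pow x.2 x.1^-1, x.2). Proof. by []. Qed.

Lemma Nset1 : Nset 1. Proof. by split=> //; exists 1; [exact: nsub1 | exact: Delta_val1]. Qed.
Lemma NsetM x y : Nset x -> Nset y -> Nset (x * y).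
Proof.
case: x y => x1 x2 [y1 y2] [/= [u Ku <-] ->] [/= [v Kv <-] ->]; split=> //.
by exists (u * v); [exact: nsubM | exact: Delta_valM].
Qed.
Lemma NsetV x : Nset x -> Nset x^-1.
Proof.
case: x => x1 x2 [/= [u Ku <-] ->]; split=> //; exists u^-1; first exact: nsubV.
by apply: (mulgI (Delta_val u)); rewrite -Delta_valM !mulgV Delta_val1.
Qed.
Lemma NsetJ x y : Nset x -> Nset (x ^ y).
Proof.
case: x y => x1 x2 [y1 y2] [/= Kx ->]; rewrite conjgE Omega_mulE Omega_mulE Omega_invE /=.
split=> /=; last by case: y2.
case: y2 => /=; last by rewrite mulgA; exact: Kval_conj.
by rewrite -rhoM mulgA; apply/Kval_rho; exact: Kval_conj.
Qed.
Definition Nsub : normal_subgroup Omega := NormalSubgroup Nset1 NsetM NsetV NsetJ.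

Lemma Nsub_set : nsub_set Nsub = [set Delta_in_Omega x | x in nsub_set K]%classic.
Proof.
apply/funext=> -[g b]; apply/propext; split=> [[/= [w Kw <-] ->]|[w Kw <-]]; first by exists w.
by split=> //; exists w.
Qed.

Lemma Omega_valX (g : Gamma) n : ((g, false) : Omega) ^+ n = (g ^+ n, false).
Proof. by elim: n => [|n IH]; rewrite ?expg0 // !expgS IH. Qed.

Lemma Nsub_torsion_free : torsion_free Nsub.
Proof.
move=> [g b] n [/= [w Kw wg] ->] n0; rewrite -wg Omega_valX => -[wn].
by rewrite (param6_torsion_free cF (L2_11_param6 cF hK) Kw n0 wn).
Qed.

End Conjugation.

(** The commutator of z and d: it lies in M exactly when z and d commute modulo M. *)
Definition zd_word : seq nat := rev (3 :: zw)%N ++ rcons zw 3%N.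

(** * The commutator of z and d lies in the kernel *)

Section CentralInKernel.
Variable F : finFieldType.
Hypothesis (cF : #|F| = 11%N).
Let pF : 11%N \in [pchar F]. Proof. by apply: (@card_finPcharP F 11 1); rewrite ?expn1. Qed.
Let F11 : 11%:R = 0 :> F. Proof. exact: pcharf0 pF. Qed.
Let mod11 (x y z : F) : x = y + 11%:R * z -> x = y. Proof. by rewrite F11 mul0r addr0. Qed.

Definition zval (z : zphi) : F := (z.1 + 4%:Z * z.2)%:~R.
Definition wval (v : zphi * zphi * zphi * zphi) : F * F * F * F :=
  let: (x, y, z, w) := v in (zval x, zval y, zval z, zval w).

Lemma zvalD x y : zval (x + y) = zval x + zval y.
Proof.
case: x y => [a a'] [b b']; transitivity ((a + b + 4%:Z * (a' + b'))%:~R : F) => //.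
by rewrite /zval -rmorphD; congr (_%:~R); rewrite /=; ring.
Qed.
Lemma zvalN x : zval (- x) = - zval x.
Proof.
case: x => [a a']; transitivity ((- a + 4%:Z * (- a'))%:~R : F) => //.
by rewrite /zval -rmorphN; congr (_%:~R); rewrite /=; ring.
Qed.
Lemma zval_golden x : zval (golden * x) = 4%:R * zval x.
Proof.
case: x => [a b]; transitivity ((0 * a + 1 * b + 4%:Z * (0 * b + 1 * a + 1 * b))%:~R : F) => //.
have -> : 4%:R = (4%:Z)%:~R :> F by [].
apply: (mod11 (z := - b%:~R)); rewrite /zval /=.
have -> : 11%:R = (11%:Z)%:~R :> F by [].
by rewrite -rmorphN -!rmorphM -rmorphD; congr (_%:~R); ring.
Qed.

Lemma wval_refl i v : (i < 4)%N -> refl (4%:R : F) i (wval v) = wval (refl golden i v).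
Proof.
by case: i => [|[|[|[|//]]]] _; case: v => [[[x y] z] w]; rewrite /refl /wval !(zvalD, zvalN, zval_golden).
Qed.

Lemma act_wval s v : letters s -> act_word (4%:R : F) s (wval v) = wval (act_word golden s v).
Proof. by elim: s => [|i s IH] //= /andP[i4 ls]; rewrite IH // wval_refl. Qed.

(** Values computed over Z[phi]. The last two rows become trivial only modulo 11 and after applying
    [psi]. *)
Definition zd_row (i : nat) : zphi * zphi * zphi * zphi :=
  match i with 0%N => wbasis _ 0 | 1%N => wbasis _ 1
  | 2%N => ((6%:Z, 9%:Z), (12%:Z, 18%:Z), (10%:Z, 18%:Z), (1%:Z, 3%:Z))
  | _ => ((- 7%:Z, - 11%:Z), (- 14%:Z, - 22%:Z), (- 12%:Z, - 21%:Z), (- 2%:Z, - 3%:Z)) end.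

Lemma zd_word_rows i : (i < 4)%N -> act_word golden zd_word (wbasis _ i) = zd_row i.
Proof. by case: i => [|[|[|[|//]]]] _; vm_compute. Qed.

Lemma addmx_entry (A B : 'M[F]_2) i j : (A + B) i j = A i j + B i j.
Proof. by rewrite mxE. Qed.
Lemma scalemx_entry k (A : 'M[F]_2) i j : (k *: A) i j = k * A i j.
Proof. by rewrite mxE. Qed.

Lemma zd_word_psi i : (i < 4)%N -> psi (act_word (4%:R : F) zd_word (wbasis _ i)) = rmx F i.
Proof.
move=> i4; have -> : wbasis F i = wval (wbasis _ i) by case: i i4 => [|[|[|[|//]]]].
rewrite act_wval // zd_word_rows //; case: i i4 => [|[|[|[|//]]]] _.
- exact: (psi_basis F (i := 0)).
- exact: (psi_basis F (i := 1)).
- have -> : wval (zd_row 2) = ((42%:R, 84%:R, 82%:R, 13%:R) : F * F * F * F) by exact: erefl.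
  rewrite /psi /rmx; apply: mx2P; rewrite !addmx_entry !scalemx_entry !mx2E;
  first [by apply: (mod11 (z := 38%:R)); ring | by apply: (mod11 (z := 50%:R)); ring
    | by apply: (mod11 (z := - 38%:R)); ring].
have -> : wval (zd_row 3) = ((- 51%:R, - 102%:R, - 96%:R, - 14%:R) : F * F * F * F) by exact: erefl.
rewrite /psi /rmx; apply: mx2P; rewrite !addmx_entry !scalemx_entry !mx2E;
first [by apply: (mod11 (z := 45%:R)); ring | by apply: (mod11 (z := - 60%:R)); ring
  | by apply: (mod11 (z := - 45%:R)); ring].
Qed.

Lemma rmx_centraliser (M : 'M[F]_2) : M *m rmx F 0 = rmx F 0 *m M -> M *m rmx F 1 = rmx F 1 *m M ->
  M = (M 0 0)%:M.
Proof.
move=> /matrixP h0 /matrixP h1; have := h0 0 0; have := h0 0 1; have := h1 0 0.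
rewrite !mul2E /rmx !mx2E => e1 e2 e3.
have e4 : M 1 0 = 0.
  apply: (mod11 (z := - (4%:R * M 1 0))).
  have e5 : M 0 1 = - M 1 0 by move: e3; rewrite !(mulr0, mulr1, mul0r, add0r, addr0, mulN1r).
  have : M 0 0 + M 0 1 * 4%:R - (M 0 0 + 5%:R * M 1 0) = 0.
    by apply/eqP; rewrite subr_eq0; apply/eqP; move: e1; rewrite !(mulr1, mul1r).
  rewrite e5 => e6; have : 9%:R * M 1 0 = 0 by rewrite -[RHS]oppr0 -e6; ring.
  move=> e7; transitivity (5%:R * (9%:R * M 1 0) + 11%:R * - (4%:R * M 1 0)); first by ring.
  by rewrite e7 mulr0.
have e5 : M 0 1 = 0.
  by move: e3; rewrite e4 !(mulr0, mulr1, mul0r, add0r, addr0).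
have e6 : M 1 1 = M 0 0.
  by move: e2; rewrite !(mulr0, mulrN1, mul0r, add0r, addr0, mulN1r) => /oppr_inj.
by apply: mx2P; rewrite !mxE ?e4 ?e5 ?e6 /= ?mulr1n ?mulr0n.
Qed.

Lemma zd_word_kernel K : param (6%:R : F) K -> exists2 w, K w & Delta_val w = wd zd_word.
Proof.
move=> pK; have ev : wd zd_word \in even_in_Gamma.
  by apply/asboolP; exists (map inord zd_word); rewrite size_map big_map.
exists (MkDelta ev) => //; set w := MkDelta ev.
have [e he] := triple_hom (rmx_triple cF).
have -> : K = kernel (ph_morph he).
  apply: (param_morph (f := idfun) pK).
  by exists (rmx F 0 *m rmx F 1), (rmx F 1 *m rmx F 2), (rmx F 2 *m rmx F 3), e.
have [M [M' [dM MM eE hv]]] := psi_conj cF he w.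
have M'M : M' *m M = 1%:M by apply: mulmx1C.
have cm i : (i < 4)%N -> M *m rmx F i = rmx F i *m M.
  move=> i4; have := hv (wbasis F i); rewrite /= rep_wd // zd_word_psi // psi_basis // => E.
  by rewrite [in RHS]E -!mulmxA M'M mulmx1.
have ME := rmx_centraliser (cm 0%N isT) (cm 1%N isT).
suff : e w = 1%g by [].
rewrite eE ME mobp_scalar //; apply/eqP => m0; move: dM; rewrite ME m0 det_scalar expr0n /= => /eqP.
by rewrite eq_sym oner_eq0.
Qed.

End CentralInKernel.

(** * Cosets and double cosets in the vertex group *)

Section Cosets.
Local Open Scope nat_scope.

Lemma order5z_check u h : abc u -> h \in dih -> wd (rev u ++ [:: 1; 2] ++ u) <> wd (h ++ zw).
Proof.
have chk : all (fun u => all (fun h => key (rev u ++ [:: 1; 2] ++ u) != key (h ++ zw)) dih) vertex by vm_compute.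
case/abc_vertex=> t tv E hh; rewrite wd_cat wd_cat -wdV E wdV -!wd_cat => E'.
have := allP (allP chk t tv) h hh; apply/negP/negPn/eqP; apply: key_wd E'.
  by apply: abc_letters; rewrite !abc_cat abc_rev vertex_abc.
by apply: abc_letters; rewrite abc_cat andbT; move: h hh; apply/allP.
Qed.

Lemma zw_neq1 : key zw <> key [::].
Proof. by apply/eqP; vm_compute. Qed.

Lemma abc_dih h : h \in dih -> abc h.
Proof. by have /allP : all abc dih by []; apply. Qed.

(** The outer factors are taken from <a, b>, which commutes with d, and from the powers of z, so
    that d g d reduces to the three words d x d. *)
Lemma double_coset g : abc g -> exists h x h' e, [/\ h \in dih, x \in [:: [::]; [:: 2]; [:: 2; 1; 2]],
  h' \in dih, e \in [:: [::]; zw] & wd g = wd (h ++ x ++ h' ++ e)].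
Proof.
pose cs := [seq h ++ x | h <- dih, x <- [:: [::]; [:: 2]; [:: 2; 1; 2]]].
pose ds := [seq h ++ e | h <- dih, e <- [:: [::]; zw]].
have chk : let l := [seq key (c ++ d) | c <- cs, d <- ds] in all (fun t => key t \in l) vertex by vm_compute.
case/abc_vertex=> t tv E; have /allpairsP[[c d] [hc hd kt]] := allP chk t tv.
have {}kt : key t = key (c ++ d) := kt.
have /allpairsP[[h x] [hh hx Ec]] : c \in cs := hc; have /allpairsP[[h' e] [hh' he Ed]] : d \in ds := hd.
have {}hh : h \in dih := hh; have {}hh' : h' \in dih := hh'.
have {}Ec : c = h ++ x := Ec; have {}Ed : d = h' ++ e := Ed.
have {}hx : x \in [:: [::]; [:: 2]; [:: 2; 1; 2]] := hx; have {}he : e \in [:: [::]; zw] := he.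
exists h, x, h', e; split; [exact: hh|exact: hx|exact: hh'|exact: he|].
rewrite E; rewrite Ec Ed -catA in kt; apply: wd_key kt.
  by rewrite abc_letters ?vertex_abc.
have ax : abc x by move: x hx {Ec}; apply/allP.
have ae : abc e by move: e he {Ed}; apply/allP.
by apply: abc_letters; rewrite !abc_cat (abc_dih hh) (abc_dih hh') ax ae; exact: isT.
Qed.

Lemma central_coset g : abc g -> exists r h e, [/\ r \in take 10 reps, h \in dih, e \in [:: [::]; zw]
  & wd g = wd (r ++ h ++ e)].
Proof.
pose ds := [seq h ++ e | h <- dih, e <- [:: [::]; zw]].
have chk : let l := [seq key (c ++ d) | c <- take 10 reps, d <- ds] in all (fun t => key t \in l) vertex by vm_compute.
case/abc_vertex=> t tv E; have /allpairsP[[r d] [hr hd kt]] := allP chk t tv.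
have {}kt : key t = key (r ++ d) := kt.
have /allpairsP[[h e] [hh he Ed]] : d \in ds := hd.
have {}hr : r \in take 10 reps := hr; have {}hh : h \in dih := hh.
have {}Ed : d = h ++ e := Ed; have {}he : e \in [:: [::]; zw] := he.
exists r, h, e; split; [exact: hr|exact: hh|exact: he|].
rewrite E; rewrite Ed in kt; apply: wd_key kt.
  by rewrite abc_letters ?vertex_abc.
have /allP ar' : all abc (take 10 reps) by [].
have ar := ar' r hr.
have ae : abc e by move: e he {Ed}; apply/allP.
by apply: abc_letters; rewrite !abc_cat (abc_dih hh) ar ae; exact: isT.
Qed.

End Cosets.

(** * Quotients of Omega by torsion-free normal subgroups *)

Section Quotient.
Local Open Scope group_scope.
Variable M : normal_subgroup Omega.

Definition pq (g : Gamma) : quot_group M := @to_quot _ M (g, false).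
Definition pw (s : seq nat) : quot_group M := pq (wd s).
Definition rr : quot_group M := @to_quot _ M (1, true).
Definition in_abc (x : quot_group M) : Prop := exists2 t, abc t & x = pw t.

Lemma pqM x y : pq (x * y) = pq x * pq y.
Proof. by rewrite /pq -to_quotM. Qed.
Lemma pw_cat s t : pw (s ++ t) = pw s * pw t.
Proof. by rewrite /pw wd_cat pqM. Qed.
Lemma pw_cons i s : pw (i :: s) = pw [:: i] * pw s.
Proof. by rewrite -pw_cat. Qed.
Lemma pw_nil : pw [::] = 1.
Proof. by rewrite /pw wd_nil. Qed.
Lemma pwV s : (pw s)^-1 = pw (rev s).
Proof. by apply: (mulgI (pw s)); rewrite mulgV -pw_cat /pw wd_cat -wdV mulgV. Qed.
Lemma pw_eq s t : [&& letters s, letters t & key s == key t] -> pw s = pw t.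
Proof. by case/and3P=> ls lt /eqP k; rewrite /pw (wd_key ls lt k). Qed.
Lemma pw_wd s t : wd s = wd t -> pw s = pw t.
Proof. by rewrite /pw => ->. Qed.

Lemma rr2 : rr * rr = 1.
Proof. by rewrite /rr -to_quotM Omega_mulE /= rho1 mulg1. Qed.
Lemma rrJ g : rr * pq g * rr = pq (rho g).
Proof. by rewrite /rr /pq -!to_quotM !Omega_mulE /= mul1g rho1 mulg1. Qed.
Lemma rho_wd s : letters s -> rho (wd s) = wd (map (subn 3) s).
Proof.
elim: s => [|i s IH]; first by rewrite /= wd_nil rho1.
case/andP=> i4 ls; rewrite /= !wd_cons rhoM rho_gen IH //; congr (Gamma_gen _ * _).
by apply: val_inj; rewrite /= !inordK ?subSS // ltnS leq_subr.
Qed.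
Lemma pw_swap s : letters s -> rr * pw s * rr = pw (map (subn 3) s).
Proof. by move=> ls; rewrite rrJ rho_wd. Qed.

Lemma in_abcM x y : in_abc x -> in_abc y -> in_abc (x * y).
Proof. by case=> s s1 -> [t t1 ->]; exists (s ++ t); rewrite ?abc_cat ?s1 ?pw_cat. Qed.
Lemma in_abcV x : in_abc x -> in_abc x^-1.
Proof. by case=> s s1 ->; exists (rev s); rewrite ?abc_rev ?pwV. Qed.
Lemma in_abc_pw s : abc s -> in_abc (pw s).
Proof. by exists s. Qed.

Lemma dih_comm h : h \in dih -> pw (3%N :: h) = pw (rcons h 3%N).
Proof.
have /allP chk : all (fun h => [&& letters (3%N :: h), letters (rcons h 3%N) &
  key (3%N :: h) == key (rcons h 3%N)]) dih by vm_compute.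
by move/chk/pw_eq.
Qed.

Definition central : Prop := pw (3%N :: zw) = pw (rcons zw 3%N).

Lemma d_sqr : pw [:: 3%N] * pw [:: 3%N] = 1.
Proof. by rewrite -pw_cat -pw_nil; apply: pw_eq; vm_compute. Qed.

Section TorsionFree.
Hypothesis tM : torsion_free M.

(** The elements of the vertex group have order dividing 30, so only 1 lies in M. *)
Lemma pw_inj s t : abc s -> abc t -> pw s = pw t -> wd s = wd t.
Proof.
move=> as_ at_ E; have Mx : M (wd (rev s ++ t), false).
  by apply/to_quot_eq1; have : pw (rev s ++ t) = 1 by rewrite pw_cat -pwV E mulVg.
have X : ((wd (rev s ++ t), false) : Omega) ^+ 30 = 1.
  by rewrite Omega_valX vertex_torsion // abc_cat abc_rev as_.
have /(congr1 fst) := tM Mx (isT : (0 < 30)%N) X; rewrite /= wd_cat -wdV.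
by move/(congr1 (mulg (wd s))); rewrite mulKVg mulg1.
Qed.

Lemma pw_key_inj s t : abc s -> abc t -> pw s = pw t -> key s = key t.
Proof. by move=> as_ at_ E; apply: key_wd; rewrite ?abc_letters //; exact: pw_inj. Qed.

Lemma central_pw s : abc s -> (forall i, (i < 2)%N -> pw (i :: s) = pw (rcons s i)) ->
  pw s = pw [::] \/ pw s = pw zw.
Proof.
move=> as_ c; have k i : (i < 2)%N -> key (i :: s) = key (rcons s i).
  move=> i2; have i3 : (i < 3)%N := ltnW i2.
  by apply: pw_key_inj (c i i2); rewrite /abc ?all_rcons /= i3.
have [h|h] := central_check as_ (k 0%N isT) (k 1%N isT); [left|right]; apply: pw_wd => //.
by rewrite h wd_nil.
Qed.

(** As d commutes with a and b it would be 1 or z. If d = 1, then (cd)^3 = 1 reads c^3 = 1; if d =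
    z, then c and d commute and the same relation gives c = d = z. Both contradict the embedding of
    the vertex group. *)
Lemma d_notin : ~ in_abc (pw [:: 3%N]).
Proof.
case=> s as_ E; have [|E'] : pw s = pw [::] \/ pw s = pw zw.
- apply: central_pw => // i i2; rewrite -cats1 pw_cat pw_cons -E -!pw_cat.
  by case: i i2 => [|[|//]] _; apply: pw_eq; vm_compute.
- move=> E'; have d1 : pw [:: 3%N] = 1 by rewrite E E' pw_nil.
  have : pw [:: 2; 3; 2; 3; 2; 3]%N = pw [::] by apply: pw_eq; vm_compute.
  rewrite !(pw_cons _ (_ :: _)) d1 !mulg1 !mul1g -!pw_cat => h.
  by have /eqP := pw_key_inj (isT : abc [:: 2; 2; 2]%N) (isT : abc [::]) h; apply/negP; vm_compute.
have E32 : pw [:: 3; 2]%N = pw [:: 2; 3]%N.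
  by rewrite pw_cons [RHS]pw_cons E E' -!pw_cat; apply: pw_eq; vm_compute.
have h : pw [:: 2]%N = pw zw.
  rewrite -E' -E; transitivity (pw ([:: 2; 3] ++ [:: 3])%N); first by apply: pw_eq; vm_compute.
  rewrite pw_cat -E32 -pw_cat; transitivity (pw ([:: 2] ++ [:: 3; 2])%N); first by apply: pw_eq; vm_compute.
  by rewrite pw_cat E32 -pw_cat; apply: pw_eq; vm_compute.
by have /eqP := pw_key_inj (isT : abc [:: 2]%N) (isT : abc zw) h; apply/negP; vm_compute.
Qed.

(** If s were outside <a, b, z>, writing c as a word in a, b, s would put dcd in the vertex group,
    hence also d = c (dcd) c. If s = h z, then dzd lies in the vertex group and commutes with a and
    b, so it is z. *)
Lemma d_conj s : abc s -> in_abc (pw ([:: 3%N] ++ s ++ [:: 3%N])) ->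
  exists2 h, h \in dih & wd s = wd h \/ (wd s = wd (h ++ zw) /\ central).
Proof.
move=> as_ hs; case: (outside_check as_) => [[h [hd ah E]]|[w E]].
  exists h => //; case: E => E; [by left|right; split=> //].
  have hc := dih_comm hd; rewrite pw_cons -cats1 pw_cat in hc.
  have [u au Eu] : in_abc (pw ([:: 3%N] ++ zw ++ [:: 3%N])).
    have -> : pw ([:: 3%N] ++ zw ++ [:: 3%N]) = (pw h)^-1 * pw ([:: 3%N] ++ s ++ [:: 3%N]).
      rewrite (pw_cat [:: 3%N]) (pw_cat zw [:: 3%N]) (pw_cat [:: 3%N] (s ++ _)) (pw_cat s) (pw_wd E) (pw_cat h zw).
      by rewrite -!mulgA (mulgA (pw [:: 3%N]) (pw h)) hc -!mulgA mulKg.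
    by apply: in_abcM hs; apply/in_abcV/in_abc_pw.
  have [|E'] : pw u = pw [::] \/ pw u = pw zw.
  - apply: central_pw => // i i2; rewrite -cats1 pw_cat pw_cons -Eu -!pw_cat.
    by case: i i2 => [|[|//]] _; apply: pw_eq; vm_compute.
  - move=> E'; have h1 : pw zw = pw [::].
      transitivity (pw ([:: 3%N] ++ ([:: 3%N] ++ zw ++ [:: 3%N]) ++ [:: 3%N])); first by apply: pw_eq; vm_compute.
      by rewrite pw_cat (pw_cat (_ ++ _)) Eu E' -!pw_cat; apply: pw_eq; vm_compute.
    by case: (zw_neq1 (pw_key_inj (isT : abc zw) (isT : abc [::]) h1)).
  rewrite /central -cats1 pw_cat -E' -Eu -pw_cat; by apply: pw_eq; vm_compute.
have cc p q : pw ([:: 3%N] ++ (p ++ q) ++ [:: 3%N]) =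
    pw ([:: 3%N] ++ p ++ [:: 3%N]) * pw ([:: 3%N] ++ q ++ [:: 3%N]).
  by rewrite !pw_cat !mulgA -[_ * pw [:: 3%N] * pw [:: 3%N]]mulgA d_sqr mulg1.
have base t : in_abc (pw t) -> pw ([:: 3%N] ++ t ++ [:: 3%N]) = pw t -> in_abc (pw ([:: 3%N] ++ t ++ [:: 3%N])).
  by move=> ? ->.
have S : in_abc (pw ([:: 3%N] ++ subst s w ++ [:: 3%N])).
  elim: w {E} => [|l w IH].
    by apply: base; [exact: in_abc_pw | apply: pw_eq; vm_compute].
  rewrite /subst /= -/(subst s w) cc; apply: in_abcM IH.
  by case: l => [|[|l]] //; apply: base; [exact: in_abc_pw | apply: pw_eq; vm_compute
    | exact: in_abc_pw | apply: pw_eq; vm_compute].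
exfalso; apply: d_notin.
have -> : pw [:: 3%N] = pw [:: 2%N] * pw ([:: 3%N] ++ subst s w ++ [:: 3%N]) * pw [:: 2%N].
  by rewrite !pw_cat (pw_wd E) -!pw_cat; apply: pw_eq; vm_compute.
by apply: in_abcM (in_abc_pw _) => //; apply: in_abcM S; exact: in_abc_pw.
Qed.

Lemma r_notin : ~ in_abc rr.
Proof.
case=> t at_ E; apply: d_notin; have <- := pw_swap (isT : letters [:: 0%N]); rewrite E -!pw_cat.
by apply: in_abc_pw; rewrite !abc_cat at_.
Qed.

(** Conjugation by r sends bc to cb. If r = g d g', then d s d lies in the vertex group for a
    conjugate s of bc, and [d_conj] contradicts its order 5. *)
Lemma r_notdouble g g' : abc g -> abc g' -> rr <> pw g * pw [:: 3%N] * pw g'.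
Proof.
move=> ag ag' E; pose s := rev (rev g') ++ [:: 1; 2]%N ++ rev g'.
have as_ : abc s by rewrite /s revK !abc_cat abc_rev ag'.
have rV : rr = pw (rev g') * pw [:: 3%N] * pw (rev g).
  have -> : rr = rr^-1 by apply: (mulgI rr); rewrite mulgV rr2.
  by rewrite E !invgM !pwV mulgA.
have S : in_abc (pw ([:: 3%N] ++ s ++ [:: 3%N])).
  exists (rev g ++ [:: 2; 1]%N ++ g); first by rewrite !abc_cat abc_rev ag.
  have h : pw g * pw [:: 3%N] * pw g' * pw [:: 1; 2]%N * (pw (rev g') * pw [:: 3%N] * pw (rev g)) = pw [:: 2; 1]%N.
    by rewrite -rV -E; exact: pw_swap.
  rewrite /s revK (pw_cat (rev g)) (pw_cat [:: 2; 1]%N) -h (pw_cat [:: 3%N]) (pw_cat (g' ++ _)) (pw_cat g').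
  rewrite (pw_cat [:: 1; 2]%N) -(pwV g).
  by rewrite !mulgA mulVg mul1g -[RHS]mulgA mulVg mulg1.
have [h hd [E'|[E' _]]] := d_conj as_ S.
  by apply: order5_check hd E'; rewrite abc_rev.
by apply: order5z_check hd E'; rewrite abc_rev.
Qed.

Definition cell (i : nat) : quot_group M :=
  if (i < 20)%N then pw (nth [::] reps i) * pw [:: 3%N] else
  if i == 20%N then 1 else if i == 21%N then rr else pw [:: 0%N] * rr.

Lemma abc_reps i : abc (nth [::] reps i).
Proof.
have [i20|i20] := ltnP i 20; last by rewrite nth_default.
by have /allP : all abc reps by []; apply; rewrite mem_nth.
Qed.

Lemma cell_neq i j : ~ central -> (i < j < 23)%N -> ~ in_abc ((cell i)^-1 * cell j).
Proof.
move=> nc /andP[ij j23] hin; have [i20|i20] := ltnP i 20; last first.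
  have cs : (i = 20 /\ j = 21 \/ i = 20 /\ j = 22 \/ i = 21 /\ j = 22)%N by lia.
  case: cs hin => [[-> ->]|[[-> ->]|[-> ->]]]; rewrite /cell /= ?invg1 ?mul1g.
  - exact: r_notin.
  - move=> h; apply: r_notin; have -> : rr = pw [:: 0%N] * (pw [:: 0%N] * rr).
      by rewrite mulgA -pw_cat (pw_eq (t := [::])) ?pw_nil ?mul1g //; vm_compute.
    by apply: in_abcM h; exact: in_abc_pw.
  (* The identity r a r = d separates the cosets of r and ar. *)
  have -> : rr^-1 = rr by apply: (mulgI rr); rewrite mulgV rr2.
  by rewrite mulgA pw_swap //; exact: d_notin.
have ar := abc_reps i; have dV : (pw [:: 3%N])^-1 = pw [:: 3%N] by rewrite pwV.
move: hin; rewrite {1}/cell i20 invgM dV pwV; have [j20|j20] := ltnP j 20.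
  rewrite /cell j20 => hin.
  have ax : abc (rev (nth [::] reps i) ++ nth [::] reps j) by rewrite abc_cat abc_rev !abc_reps.
  have hx : in_abc (pw ([:: 3%N] ++ (rev (nth [::] reps i) ++ nth [::] reps j) ++ [:: 3%N])).
    by move: hin; rewrite !pw_cat !mulgA.
  have [h hd [E|[E ce]]] := d_conj ax hx; last by case: nc.
  by apply: (reps_check i20 j20 _ hd E); lia.
have cs : (j = 20 \/ j = 21 \/ j = 22)%N by lia.
case: cs => [->|[->|->]]; rewrite /cell /= ?mulg1 => -[t at_ E].
- apply: d_notin; have -> : pw [:: 3%N] = pw t * pw (nth [::] reps i).
    by rewrite -E -mulgA -pwV mulVg mulg1.
  by apply: in_abcM; exact: in_abc_pw.
- apply: (r_notdouble ar at_); rewrite -E -pwV.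
  by rewrite !mulgA -[_ * pw [:: 3%N] * pw [:: 3%N]]mulgA d_sqr mulg1 mulgV mul1g.
apply: (@r_notdouble (0%N :: nth [::] reps i) t) => //; rewrite -E pw_cons -pwV.
rewrite !mulgA -[_ * pw [:: 3%N] * pw [:: 3%N]]mulgA d_sqr mulg1 -[_ * pw (nth _ _ _) * _]mulgA mulgV mulg1.
by rewrite -pw_cat (pw_eq (t := [::])) ?pw_nil ?mul1g //; vm_compute.
Qed.

Lemma size_le_index m (l : seq (quot_group M)) : has_index M m -> uniq l -> (size l <= m)%N.
Proof.
move/card_set_bijP=> [f [fI fJ _]] ul; rewrite -(size_map f) -(size_iota 0 m).
apply: uniq_leq_size => [|y /mapP[x xl ->]]; last by rewrite mem_iota; have := fI x; apply.
by rewrite map_inj_in_uniq // => x y _ _; apply: fJ; rewrite ?inE.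
Qed.

Lemma noncentral_index m : ~ central -> has_index M m -> (2760 <= m)%N.
Proof.
move=> nc hm; pose l := [seq cell i * pw v | i <- iota 0 23, v <- vertex].
suff ul : uniq l by have := size_le_index hm ul; rewrite size_allpairs size_iota vertex_size.
apply: allpairs_uniq; [exact: iota_uniq|exact: (@map_uniq _ _ key vertex vkeys_uniq)|].
move=> [i v] [j w] hiv hjw E.
have /allpairsP[[i' v'] [hi hv [ei ev]]] := hiv; have /allpairsP[[j' w'] [hj hw [ej ew]]] := hjw.
subst i v j w; have {}E : cell i' * pw v' = cell j' * pw w' := E.
have {hiv hv} hv : v' \in vertex := hv; have {hjw hw} hw : w' \in vertex := hw.
have {}hi : (i' < 23)%N by move: hi; rewrite mem_iota.
have {}hj : (j' < 23)%N by move: hj; rewrite mem_iota.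
have X : in_abc ((cell i')^-1 * cell j').
  exists (v' ++ rev w'); first by rewrite abc_cat abc_rev !vertex_abc.
  apply: (mulIg (pw w')); rewrite pw_cat -!mulgA -[pw (rev w')]pwV mulVg mulg1 -E mulKg //.
have ij : i' = j'.
  case: (ltngtP i' j') => // lt; exfalso; first by apply: (cell_neq nc _ X); rewrite lt.
  by apply: (@cell_neq j' i' nc); rewrite ?lt //; have := in_abcV X; rewrite invgM invgK.
congr (_, _) => //; move: E; rewrite ij => /mulgI/pw_key_inj; rewrite !vertex_abc // => /(_ isT isT) k.
have iv := nth_index [::] hv; have iw := nth_index [::] hw.
rewrite -iv -iw; congr nth; apply/eqP; rewrite -(nth_uniq [::] _ _ vkeys_uniq) ?size_map ?index_mem //.
by rewrite !(nth_map [::]) ?index_mem // iv iw k.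
Qed.

End TorsionFree.

Section Central.
Hypothesis cI : central.

Lemma z_central s : letters s -> pw zw * pw s = pw s * pw zw.
Proof.
elim: s => [|i s IH]; first by rewrite pw_nil mulg1 mul1g.
case/andP=> i4 ls; rewrite pw_cons mulgA.
have -> : pw zw * pw [:: i] = pw [:: i] * pw zw.
  rewrite -!pw_cat cats1; case: i i4 => [|[|[|[|//]]]] _;
    [by apply: pw_eq; vm_compute | by apply: pw_eq; vm_compute | by apply: pw_eq; vm_compute | exact/esym/cI].
by rewrite -!mulgA IH.
Qed.

(** z' is central in <b, c, d> already in Gamma, and its commuting with a is the image under r of z
    commuting with d. *)
Lemma z'_central s : letters s -> pw zw' * pw s = pw s * pw zw'.
Proof.
elim: s => [|i s IH]; first by rewrite pw_nil mulg1 mul1g.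
case/andP=> i4 ls; rewrite pw_cons mulgA.
have -> : pw zw' * pw [:: i] = pw [:: i] * pw zw'.
  rewrite -!pw_cat cats1; case: i i4 => [|[|[|[|//]]]] _;
    [|by apply: pw_eq; vm_compute | by apply: pw_eq; vm_compute | by apply: pw_eq; vm_compute].
  have e1 := pw_swap (isT : letters (3%N :: zw)); have e2 := pw_swap (isT : letters (rcons zw 3%N)).
  by move: e1 e2; rewrite cI => -> e; exact: (esym e).
by rewrite -!mulgA IH.
Qed.

(** Rewrites a factor inside a word and carries the resulting commuting factor c to the front. *)
Lemma pw_ins c a x y b : c * pw a = pw a * c -> pw x = c * pw y -> pw (a ++ x ++ b) = c * pw (a ++ y ++ b).
Proof. by move=> h E; rewrite !pw_cat E !mulgA h. Qed.

Lemma dcbcd : pw [:: 3; 2; 1; 2; 3]%N = pw zw' * pw [:: 1; 2; 1; 2; 1; 3; 2; 1; 2; 1]%N.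
Proof. by rewrite -pw_cat; apply: pw_eq; vm_compute. Qed.

(* The word dcbcd abc d is evaluated in two ways, with dcbcd = z' bcbcb d cbcb. *)
Lemma z'z : pw zw' = pw zw.
Proof.
have e2 : pw [:: 2; 1; 2; 1; 0; 1; 2]%N = pw zw * pw [:: 0; 1; 0; 2; 1; 2; 0; 1]%N.
  by rewrite -pw_cat; apply: pw_eq; vm_compute.
have e3 : pw [:: 2; 1; 2; 0; 1; 2]%N = pw zw * pw [:: 0; 1; 0; 2; 1; 2; 0; 1; 0]%N.
  by rewrite -pw_cat; apply: pw_eq; vm_compute.
pose u1 : seq nat := [:: 1; 2; 1; 2; 1; 0; 1; 0; 1; 2; 1; 2; 1; 3; 2; 1; 2; 1; 0; 1]%N.
pose u2 : seq nat := [:: 0; 1; 0; 1; 2; 1; 2; 1; 3; 2; 1; 2; 1; 0; 1; 0; 2]%N.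
have w1 : pw [:: 3; 2; 1; 2; 3; 0; 1; 2; 3]%N = pw zw' * (pw zw * (pw zw' * pw u1)).
  rewrite (@pw_ins _ [::] _ _ [:: 0; 1; 2; 3]%N (z'_central (isT : letters [::])) dcbcd); congr (_ * _).
  rewrite (@pw_ins _ [:: 1; 2; 1; 2; 1; 3]%N _ _ [:: 3]%N (z_central (isT : letters [:: 1; 2; 1; 2; 1; 3]%N)) e2); congr (_ * _).
  rewrite -(@pw_ins _ [:: 1; 2; 1; 2; 1; 0; 1; 0]%N _ _ [:: 0; 1]%N (z'_central (isT : letters [:: 1; 2; 1; 2; 1; 0; 1; 0]%N)) dcbcd).
  by apply: pw_eq; vm_compute.
have w2 : pw [:: 3; 2; 1; 2; 3; 0; 1; 2; 3]%N = pw zw * (pw zw' * pw u2).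
  transitivity (pw [:: 3; 2; 1; 2; 0; 1; 2; 3; 2]%N); first by apply: pw_eq; vm_compute.
  rewrite (@pw_ins _ [:: 3]%N _ _ [:: 3; 2]%N (z_central (isT : letters [:: 3]%N)) e3); congr (_ * _).
  rewrite -(@pw_ins _ [:: 0; 1; 0]%N _ _ [:: 0; 1; 0; 2]%N (z'_central (isT : letters [:: 0; 1; 0]%N)) dcbcd).
  by apply: pw_eq; vm_compute.
have w3 : pw zw' * pw u1 = pw u2.
  have : pw zw * (pw zw' * (pw zw' * pw u1)) = pw zw * (pw zw' * pw u2).
    by rewrite -w2 w1 mulgA (z_central (isT : letters zw')) -mulgA.
  by move/mulgI/mulgI.
have w4 : pw u1 = pw zw' * pw u2.
  rewrite -w3 mulgA -pw_cat (pw_eq (s := zw' ++ zw') (t := [::])) ?pw_nil ?mul1g //; vm_compute => //.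
have e5 : pw [:: 2; 1; 2; 1; 0; 1; 2; 0; 1; 0; 1; 2; 1; 2]%N = pw zw * pw [:: 0; 1; 0]%N.
  by rewrite -pw_cat; apply: pw_eq; vm_compute.
transitivity (pw (u1 ++ rev u2)); first by rewrite pw_cat w4 -pwV -mulgA mulgV mulg1.
rewrite (@pw_ins _ [:: 1; 2; 1; 2; 1; 0; 1; 0; 1; 2; 1; 2; 1; 3]%N _ _ [:: 3; 1; 2; 1; 2; 1; 0; 1; 0]%N (z_central (isT : letters [:: 1; 2; 1; 2; 1; 0; 1; 0; 1; 2; 1; 2; 1; 3]%N)) e5).
by rewrite -pw_cat; apply: pw_eq; vm_compute.
Qed.

(** Only d g d g' needs care. With g = h x h' e the factors h, h' and e commute with d, and d x d is
    1, c d c or, by [dcbcd] and [z'z], again of the form k d k'. *)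
Lemma normal_form s : letters s -> in_abc (pw s) \/
  exists g g', [/\ abc g, abc g' & pw s = pw g * pw [:: 3%N] * pw g'].
Proof.
elim: s => [|i s IH]; first by left; exact: in_abc_pw.
case/andP=> i4 /IH{IH}; have [i3 IH|i3] := ltnP i 3.
  case: IH => [[t at_ E]|[g [g' [ag ag' E]]]].
    by left; rewrite pw_cons E -pw_cat; apply: in_abc_pw; rewrite /abc /= i3.
  right; exists (i :: g), g'; split=> //; first by rewrite /abc /= i3.
  by rewrite pw_cons (pw_cons i g) E !mulgA.
have -> : i = 3%N by lia.
case=> [[t at_ E]|[g [g' [ag ag' E]]]].
  by right; exists [::], t; split=> //; rewrite pw_cons E pw_nil mul1g.
have [h [x [h' [e [hh hx hh' he Eg]]]]] := double_coset ag.
have ae : abc e by move: e he {Eg}; apply/allP.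
have ec : pw e * pw [:: 3%N] = pw [:: 3%N] * pw e.
  by move: he; rewrite !inE => /orP[]/eqP->; [rewrite pw_nil mulg1 mul1g | exact: z_central].
have hc k : k \in dih -> pw k * pw [:: 3%N] = pw [:: 3%N] * pw k.
  by move/dih_comm; rewrite pw_cons -cats1 pw_cat => ->.
have -> : pw (3%N :: s) = pw h * pw ([:: 3%N] ++ x ++ [:: 3%N]) * pw (h' ++ e ++ g').
  rewrite pw_cons E (pw_wd Eg) !pw_cat -!mulgA (mulgA (pw [:: 3%N]) (pw h)) -(hc h hh) -!mulgA.
  by congr (_ * (_ * (_ * _))); rewrite (mulgA (pw e)) ec -mulgA (mulgA (pw h')) (hc h' hh') -!mulgA.
have a1 : abc (h' ++ e ++ g') by rewrite !abc_cat abc_dih // ae.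
have [[t at_ ->]|[k [k' [ak ak' ->]]]] : in_abc (pw ([:: 3%N] ++ x ++ [:: 3%N])) \/ exists k k',
  [/\ abc k, abc k' & pw ([:: 3%N] ++ x ++ [:: 3%N]) = pw k * pw [:: 3%N] * pw k'].
- move: hx; rewrite !inE => /or3P[]/eqP->.
  + by left; exists [::] => //; apply: pw_eq; vm_compute.
  + by right; exists [:: 2%N], [:: 2%N]; split=> //; rewrite -!pw_cat; apply: pw_eq; vm_compute.
  right; exists (zw ++ [:: 1; 2; 1; 2; 1]%N), [:: 2; 1; 2; 1]%N; split=> //.
  by rewrite [LHS]dcbcd z'z -!pw_cat.
- by left; rewrite -!pw_cat; apply: in_abc_pw; rewrite abc_cat abc_cat (abc_dih hh) at_ a1.
right; exists (h ++ k), (k' ++ h' ++ e ++ g'); split.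
- by rewrite abc_cat abc_dih.
- by rewrite abc_cat ak' a1.
by rewrite (pw_cat h k) (pw_cat k') !mulgA.
Qed.

Lemma central_index : exists2 n, (n <= 2640)%N & has_index M n.
Proof.
(* The vertex group gives 120 elements. In g d g' the factor g matters modulo <a, b, z> only, which
   commutes with d: ten representatives, hence 1200 further elements. The factor r doubles the
   list. *)
pose l1 := [seq pw v | v <- vertex] ++ [seq pw r * pw [:: 3%N] * pw v | r <- take 10 reps, v <- vertex].
pose l := undup [seq x * y | x <- l1, y <- [:: 1; rr]].
exists (size l).
  apply: leq_trans (size_undup _) _.
  by rewrite size_allpairs /l1 size_cat size_map !size_allpairs.
have l1P g : pq g \in l1.
  have [s ls ->] := wd_exists g; rewrite -/(pw s) mem_cat; apply/orP.
  case: (normal_form ls) => [[t /abc_vertex[v vv /pw_wd E] ->]|[k [k' [ak ak' ->]]]].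
    by left; rewrite E map_f.
  right; have [r [h [e [hr hh he /pw_wd ->]]]] := central_coset ak.
  have ae : abc e by move: e he; apply/allP.
  have [|v vv /pw_wd E] := @abc_vertex (h ++ e ++ k') _; first by rewrite !abc_cat abc_dih // ae.
  apply/allpairsP; exists (r, v); split=> //=; rewrite -E !pw_cat.
  have ec : pw e * pw [:: 3%N] = pw [:: 3%N] * pw e.
    by move: he; rewrite !inE => /orP[]/eqP->; [rewrite pw_nil mulg1 mul1g | exact: z_central].
  have hc := dih_comm hh; rewrite pw_cons -cats1 pw_cat in hc.
  by rewrite -!mulgA; congr (_ * _); rewrite (mulgA (pw e)) ec -!mulgA (mulgA (pw [:: 3%N]) (pw h)) hc -!mulgA.
have lP u : u \in l.
  rewrite mem_undup; have [[g b] <-] := to_quot_surj u; apply/allpairsP.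
  exists (pq g, if b then rr else 1); split=> //=; first by case: b; rewrite !inE eqxx ?orbT.
  by case: b; rewrite ?mulg1 // /pq /rr -to_quotM Omega_mulE /= mulg1.
apply/card_set_bijP; exists (index^~ l); split=> [u _|u v _ _ E|k /= kl].
- by rewrite /= index_mem.
- by rewrite -[u](nth_index 1 (lP u)) -[v](nth_index 1 (lP v)) E.
by exists (nth 1 l k) => //; rewrite index_uniq // undup_uniq.
Qed.

(** Otherwise r would be congruent to an element of Gamma, and the normal form contradicts [r_notin]
    or [r_notdouble]. *)
Lemma central_noflip g : torsion_free M -> ~ M (g, true).
Proof.
move=> tM /to_quot_eq1 E; have [s ls gs] := wd_exists g^-1.
have E' : rr = pw s.
  have h : pq g * rr = 1 by rewrite /pq /rr -to_quotM Omega_mulE /= mulg1.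
  by rewrite /pw -gs; apply: (mulgI (pq g)); rewrite h -pqM mulgV.
case: (normal_form ls) => [hin|[k [k' [ak ak' Es]]]].
  by apply: (r_notin tM); rewrite E'.
by apply: (r_notdouble tM ak ak'); rewrite E'.
Qed.

End Central.
End Quotient.

(** * Minimality and uniqueness of the kernel *)

Section LeastIndex.
Local Open Scope group_scope.

Lemma centralE (M : normal_subgroup Omega) : central M <-> M (wd zd_word, false).
Proof.
rewrite /central /pw /pq to_quot_eq /zd_word wd_cat -wdV; split=> h; move: h;
 by rewrite Omega_invE Omega_mulE.
Qed.

Definition nsubI (M M' : normal_subgroup Omega) : normal_subgroup Omega.
exists (fun x => M x /\ M' x).
- by split; exact: nsub1.
- by move=> x y [? ?] [? ?]; split; exact: nsubM.
- by move=> x [? ?]; split; exact: nsubV.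
- by move=> x y [? ?]; split; exact: nsubJ.
Defined.

(** The intersection of M and M' is again central, so an element of M has a normal form modulo it. A
    form g d g' would put d in the vertex group modulo M, and a form g is trivial because the vertex
    group embeds; so the element lies in the intersection. *)
Lemma central_sub M M' : torsion_free M -> central M -> central M' ->
  forall g, M (g, false) -> M' (g, false).
Proof.
move=> tM cM cM' g Mg; have cL : central (nsubI M M').
  by apply/centralE; split; apply/centralE.
have [s ls gs] := wd_exists g; rewrite gs in Mg *; have Ms : pw M s = 1 by apply/to_quot_eq1.
have down t : pw (nsubI M M') s = pw (nsubI M M') t -> pw M s = pw M t.
  by move/to_quot_eq=> [h _]; apply/to_quot_eq.
case: (normal_form cL ls) => [[t at_ E]|[k [k' [ak ak' E]]]].
  have t1 : wd t = wd [::] by apply: (pw_inj tM at_) => //; rewrite -(down _ E) Ms pw_nil.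
  by have /to_quot_eq1[] : pw (nsubI M M') s = 1 by rewrite E (pw_wd _ t1) pw_nil.
exfalso; apply: (d_notin tM); move: E; rewrite -!pw_cat => /down; rewrite Ms !pw_cat => E.
exists (rev k ++ rev k'); first by rewrite abc_cat !abc_rev ak.
rewrite pw_cat -!pwV; apply: (mulgI (pw M k)); apply: (mulIg (pw M k')).
by rewrite -E -!mulgA mulVg mulg1 mulgV.
Qed.

Lemma central_unique M M' : torsion_free M -> torsion_free M' -> central M -> central M' -> M = M'.
Proof.
move=> tM tM' cM cM'; apply: nsub_inj; apply/funext=> -[g []]; apply/propext; split=> h.
- by case: (central_noflip cM tM h).
- by case: (central_noflip cM' tM' h).
- exact: central_sub h.
exact: central_sub h.
Qed.

Lemma has_index_uniq (M : normal_subgroup Omega) m n : has_index M m -> has_index M n -> m = n.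
Proof. by move=> hm hn; apply/card_eq_II; apply: card_eq_trans (card_esym hm) hn. Qed.

Lemma L2_11_is_K0 (F : finFieldType) K : #|F| = 11%N -> L2_quotients F K -> is_K0 K.
Proof.
move=> cF hK; exists (Nsub cF hK); split; last exact: Nsub_set.
have tN := @Nsub_torsion_free F K cF hK; split; first exact: tN.
have cN : central (Nsub cF hK).
  apply/centralE; split=> //=.
  by have [w Kw E] := zd_word_kernel cF (L2_11_param6 cF hK); exists w.
have [n n2 hn] := central_index cN; exists n; split=> // M tM.
have [cM|nM] := pselect (central M).
  have MN := central_unique tM tN cM cN; split=> // m; rewrite MN => hm.
  by rewrite (has_index_uniq hm hn).
split=> [m /(noncentral_index tM nM) m2|/(noncentral_index tM nM) m2]; first exact: leq_trans n2 (leq_trans _ m2).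
by have := leq_trans m2 n2.
Qed.

End LeastIndex.

Local Close Scope ring_scope.

Theorem theorem1p1 (p : nat) (p_prime : prime p) :
  (p = 2 -> L2_census p (fun n => if n == 4 then 1 else 0)) /\
  (p = 5 -> L2_census p (fun n => if n == 2 then 1 else 0)) /\
  (p = 11 ->
     L2_census p (fun n => if (n == 1) || (n == 2) then 1 else 0) /\
     forall F : finFieldType, #|F| = 11 ->
       forall K : normal_subgroup Delta, L2_quotients F K -> is_K0 K) /\
  (p %% 5 \in [:: 1; 4] -> p %% 11 \in [:: 1; 3; 4; 5; 9] ->
     (both_squares 'F_p \/ both_nonsquares 'F_p) /\
     (both_squares 'F_p -> L2_census p (fun n => if n == 1 then 4 else 0)) /\
     (both_nonsquares 'F_p -> L2_census p (fun n => if n == 2 then 2 else 0))) /\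
  (p %% 5 \in [:: 1; 4] -> p %% 11 \in [:: 2; 6; 7; 8; 10] ->
     L2_census p (fun n => if n == 1 then 2 else if n == 2 then 1 else 0)) /\
  (p <> 2 -> p %% 5 \in [:: 2; 3] ->
     forall F : finFieldType, #|F| = p ^ 2 ->
       (both_squares F \/ both_nonsquares F) /\
       (both_squares F -> L2_census p (fun n => if n == 2 then 2 else 0)) /\
       (both_nonsquares F -> L2_census p (fun n => if n == 4 then 1 else 0))).
Proof.
split; [exact: clause_2 | split; [exact: clause_5 | split]].
  move=> p11; split=> [|F cF K hK]; first exact: clause_11.
  exact: L2_11_is_K0 cF hK.
split; [exact: clause_split | split; [exact: clause_mixed | exact: clause_inert]].
Qed.
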